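(* Suppose that the observation density $h$ has as support the triangle with vertices $(0,\epsilon)$, $(0,1)$ and $(1-\epsilon,1)$ (for some $\epsilon>0$) and stays away from zero on its support. Let $t_0\in(0,1)$ be an interior point, and let $F_0$ have a continuous derivative $f_0$ on $(0,1)$, satisfying $f_0(t_0)>0$. Define $$\widetilde W(t_0)=\int_{\epsilon}^{t_0-\epsilon}\frac{\sqrt{h(t,t_0)\wedge g_2(t)}}{t_0-t}\,dt+\int_{t_0+\epsilon}^{1-\epsilon}\frac{\sqrt{h(t_0,u)\wedge g_1(u)}}{u-t_0}\,du$$ and assume $\widetilde W(t_0)<\infty$. Let $c>0$ be a fixed constant and let the number $K=K_n$ used in the construction of Birg\'e's estimator $\widetilde F_n$ satisfy $K_n\sim n^{1/3}/c$ as $n\to\infty$. For each $n$ let $I_j^{(n)}$ (with $j=j_n$) be an interval of the partition of $[0,1]$ used in the construction of Birg\'e's estimator for a sample of size $n$, with left boundary point $t_j^{(n)}$, and assume that $t_j^{(n)}\to t_0$ as $n\to\infty$. Then, as $n\to\infty$, $$n^{1/3}\{\widetilde F_n(t_j^{(n)})-F_0(t_j^{(n)})\}\ \stackrel{\mathcal D}{\longrightarrow}\ N\left(\tfrac12 c f_0(t_0),\sigma^2\right),$$ a normal random variable with expectation $\tfrac12cf_0(t_0)$ and variance $$\sigma^2=\frac{1}{c\widetilde W(t_0)^2}\int_{t_0+\epsilon}^{1-\epsilon}\frac{g_1(u)\wedge h(t_0,u)}{h(t_0,u)(u-t_0)^2}\{F_0(u)-F_0(t_0)\}\{1-(F_0(u)-F_0(t_0))\}\,du$$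 $$\qquad+\frac{1}{c\widetilde W(t_0)^2}\int_{\epsilon}^{t_0-\epsilon}\frac{g_2(t)\wedge h(t,t_0)}{h(t,t_0)(t_0-t)^2}\{F_0(t_0)-F_0(t)\}\{1-(F_0(t_0)-F_0(t))\}\,dt.$$
   Context: Interval censoring, case 2 (separated case). $X_1,\dots,X_n$ are i.i.d. with distribution function $F_0$ on $[0,1]$ (unobserved). $(T_1,U_1),\dots,(T_n,U_n)$ are i.i.d., independent of the $X_i$, with joint density $h$ (w.r.t. Lebesgue measure) on the upper triangle of the unit square; $g_1(t)=\int_t^1h(t,u)\,du$ and $g_2(t)=\int_0^th(t',t)\,dt'$ are its marginal densities, whose sum is assumed to be bounded away from zero. One observes $(T_i,U_i)$ and $\Delta_{i,1}=1_{\{X_i\le T_i\}}$, $\Delta_{i,2}=1_{\{T_i<X_i\le U_i\}}$, $\Delta_{i,3}=1-\Delta_{i,1}-\Delta_{i,2}$. We write $x\wedge y=\min(x,y)$. Partition. Given $t_0\in(0,1)$ and an integer $K\ge1$: (i) if $Kt_0\in\mathbb N$, $[0,1]$ is partitioned into $K$ intervals of equal length $1/K$, $I_k=[t_k,t_{k+1})$ for $1\le k<K$ and $I_K=[t_K,t_{K+1}]$, with $t_1=0$, $t_{K+1}=1$; (ii) if $Kt_0\notin\mathbb N$, $[0,1]$ is partitioned into $K+1$ intervals $I_k=[t_k,t_{k+1})$ for $1\le k\le K$ and $I_{K+1}=[t_{K+1},t_{K+2}]$, where $t_1=0$, $t_{K+2}=1$ and $t_k=t_0-(\lfloor t_0K\rfloor-k+2)/K$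 for $2\le k\le K+1$, so $I_2,\dots,I_K$ have length $1/K$, the first and last intervals are shorter, and $t_0$ is the left boundary point of one of the intervals. Indices $j,k$ below range over all intervals of the partition. Counts. $N_k=\#\{i:T_i\in I_k\}$, $M_k=\#\{i:U_i\in I_k\}$, $Q_{j,k}=\#\{i:T_i\in I_j,U_i\in I_k\}$, $N_k'=\sum_{i:T_i\in I_k}\Delta_{i,1}$, $M_k'=\sum_{i:U_i\in I_k}\Delta_{i,3}$, $Q_{j,k}'=\sum_{i:T_i\in I_j,U_i\in I_k}\Delta_{i,2}$. Birg\'e's estimator. Ratios with denominator zero are defined to be $0$. Put $$\hat F^{(j,k)}=\frac{N_k'}{N_k}-\frac{Q_{j,k}'}{Q_{j,k}}\ (j<k),\qquad \hat F^{(j,k)}=1-\frac{M_k'}{M_k}+\frac{Q_{k,j}'}{Q_{k,j}}\ (j>k),$$ $$W_j=\sum_{k<j}\frac{\sqrt{M_k\wedge(KQ_{k,j})}}{j-k+1}+\sum_{k>j}\frac{\sqrt{N_k\wedge(KQ_{j,k})}}{k-j+1},$$ $$w_{j,k}=\frac{\sqrt{N_k\wedge(KQ_{j,k})}}{(k-j+1)W_j}\ (j<k),\qquad w_{j,k}=\frac{\sqrt{M_k\wedge(KQ_{k,j})}}{(j-k+1)W_j}\ (j>k).$$ For $t\in I_j$, $\widetilde F_n(t)=\sum_{k\ne j}w_{j,k}\hat F^{(j,k)}$.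
   Formalization: Added: h is continuous, relative to its support, at the points (t,t_0), ε≤t≤t_0-ε, and (t_0,u), t_0+ε≤u≤1-ε, where W̃(t_0) and σ² evaluate it (otherwise changing h on a null line alters σ² but not the data); also W̃(t_0)≠0, since σ² divides by W̃(t_0)². *)

(* Defs.v *)
From HB Require Import structures.
From mathcomp Require Import all_boot all_order all_algebra archimedean.
From mathcomp Require Import all_classical all_reals all_analysis.

Set Implicit Arguments.
Unset Strict Implicit.
Unset Printing Implicit Defensive.

Import Order.TTheory GRing.Theory Num.Theory.
Import numFieldNormedType.Exports.

Local Open Scope classical_set_scope.
Local Open Scope ring_scope.

(* Taking A i = setT for the unwanted indices gives the product rule over an
   arbitrary finite subfamily. *)
Definition mutually_independent {d d' : measure_display}
    {Omega : measurableType d} {E : measurableType d'} {R : realType}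
    (P : probability Omega R) (Y : nat -> Omega -> E) : Prop :=
  forall (n : nat) (A : nat -> set E), (forall i, measurable (A i)) ->
    P (\bigcap_(i in `I_n) (Y i @^-1` A i)) =
    (\prod_(i < n) P (Y i @^-1` A i))%E.

(* Independence of the sequences Y and Z (as wholes), tested on the
   pi-systems of finite-dimensional rectangles. *)
Definition independent_sequences {d d1 d2 : measure_display}
    {Omega : measurableType d} {E1 : measurableType d1}
    {E2 : measurableType d2} {R : realType} (P : probability Omega R)
    (Y : nat -> Omega -> E1) (Z : nat -> Omega -> E2) : Prop :=
  forall (n : nat) (A : nat -> set E1) (B : nat -> set E2),
    (forall i, measurable (A i)) -> (forall i, measurable (B i)) ->
    P (\bigcap_(i in `I_n) (Y i @^-1` A i) `&`
       \bigcap_(i in `I_n) (Z i @^-1` B i)) =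
    (P (\bigcap_(i in `I_n) (Y i @^-1` A i)) *
     P (\bigcap_(i in `I_n) (Z i @^-1` B i)))%E.

Definition has_joint_density {d : measure_display} {Omega : measurableType d}
    {R : realType} (P : probability Omega R) (Y : Omega -> R * R)
    (h : R * R -> R) : Prop :=
  [/\ measurable_fun setT h, (forall z, 0 <= h z) &
      forall A : set (R * R), measurable A ->
        P (Y @^-1` A) =
        (\int[(@lebesgue_measure R \x @lebesgue_measure R)%E]_(z in A)
           (h z)%:E)%E].

(* Convergence in law of real random variables: convergence of the
   distribution functions at the continuity points of the limit.  The first
   conjunct says that the Z n are random variables. *)
Definition cvg_in_distribution {d : measure_display}
    {Omega : measurableType d} {R : realType} (P : probability Omega R)
    (Z : nat -> Omega -> R) (nu : set R -> \bar R) : Prop :=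
  (forall n, measurable_fun setT (Z n)) /\
  forall x : R, {for x, continuous (fun y : R => fine (nu [set` `]-oo, y]]))} ->
    P (Z n @^-1` [set` `]-oo, x]]) @[n --> \oo] --> nu [set` `]-oo, x]].

Section model.
Context {R : realType}.

(* The closed triangle with vertices (0, eps), (0, 1) and (1 - eps, 1). *)
Definition sep_triangle (eps : R) : set (R * R) :=
  [set z | [/\ 0 <= z.1, z.1 + eps <= z.2 & z.2 <= 1]].

(* The marginal densities are extended-real valued: the integrals may be
   infinite on a Lebesgue-null set. *)
Definition g1 (h : R * R -> R) (t : R) : \bar R :=
  (\int[@lebesgue_measure R]_(u in `[t, 1%R]) (h (t, u))%:E)%E.

Definition g2 (h : R * R -> R) (t : R) : \bar R :=
  (\int[@lebesgue_measure R]_(t' in `[0%R, t]) (h (t', t))%:E)%E.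

(* These minima are finite for h >= 0, so that fine loses nothing. *)
Definition min_g1h (h : R * R -> R) (t0 u : R) : R := fine (mine (g1 h u) (h (t0, u))%:E).

Definition min_g2h (h : R * R -> R) (t0 t : R) : R := fine (mine (g2 h t) (h (t, t0))%:E).

(* When eps > t0 - eps (or t0 + eps > 1 - eps) the range of integration is the
   empty set; the oriented integral is zero too, since the integrand vanishes
   between the two bounds when h is supported by [sep_triangle eps]. *)
Definition Wtilde (h : R * R -> R) (eps t0 : R) : \bar R :=
  (\int[@lebesgue_measure R]_(t in `[eps, (t0 - eps)%R])
     (Num.sqrt (min_g2h h t0 t) / (t0 - t))%:E +
   \int[@lebesgue_measure R]_(u in `[(t0 + eps)%R, (1 - eps)%R])
     (Num.sqrt (min_g1h h t0 u) / (u - t0))%:E)%E.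

Definition limit_variance (h : R * R -> R) (F0 : R -> R) (eps t0 c : R) : R :=
  (c * fine (Wtilde h eps t0) ^+ 2)^-1 *
    (\int[@lebesgue_measure R]_(u in `[(t0 + eps)%R, (1 - eps)%R])
       (min_g1h h t0 u / (h (t0, u) * (u - t0) ^+ 2) *
        (F0 u - F0 t0) * (1 - (F0 u - F0 t0)))) +
  (c * fine (Wtilde h eps t0) ^+ 2)^-1 *
    (\int[@lebesgue_measure R]_(t in `[eps, (t0 - eps)%R])
       (min_g2h h t0 t / (h (t, t0) * (t0 - t) ^+ 2) *
        (F0 t0 - F0 t) * (1 - (F0 t0 - F0 t)))).

End model.

(* The intervals of the partition are numbered from 1, as j and k below. *)

Section partition.
Context {R : realType}.
Variables (t0 : R) (K : nat).

Definition nbins : nat := if K%:R * t0 \is a Num.nat then K else K.+1.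

Definition knot (k : nat) : R :=
  if K%:R * t0 \is a Num.nat then (k%:R - 1) / K%:R
  else if (k <= 1)%N then 0
  else if (k <= K.+1)%N then
    t0 - ((Num.floor (t0 * K%:R))%:~R - k%:R + 2) / K%:R
  else 1.

Definition bin (k : nat) : interval R :=
  if k == nbins then `[knot k, knot k.+1] else `[knot k, knot k.+1[.

End partition.

(* tu i is the pair (T_i, U_i), and the sample is indexed by i < n.  Division
   by zero yields 0 in the library, as the construction requires. *)

Section birge.
Context {R : realType}.
Variables (t0 : R) (K n : nat) (x : nat -> R) (tu : nat -> R * R).

Local Notation T i := (tu i).1.
Local Notation U i := (tu i).2.
Local Notation I := (bin t0 K).
Local Notation L := (nbins t0 K).

Definition Delta1 (i : nat) : R := (x i <= T i)%R%:R.
Definition Delta2 (i : nat) : R := (T i < x i <= U i)%R%:R.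
Definition Delta3 (i : nat) : R := 1 - Delta1 i - Delta2 i.

Definition countN (k : nat) : nat := (\sum_(i < n | T i \in I k) 1)%N.
Definition countM (k : nat) : nat := (\sum_(i < n | U i \in I k) 1)%N.
Definition countQ (j k : nat) : nat :=
  (\sum_(i < n | (T i \in I j) && (U i \in I k)) 1)%N.

Definition sumN' (k : nat) : R := \sum_(i < n | T i \in I k) Delta1 i.
Definition sumM' (k : nat) : R := \sum_(i < n | U i \in I k) Delta3 i.
Definition sumQ' (j k : nat) : R :=
  \sum_(i < n | (T i \in I j) && (U i \in I k)) Delta2 i.

(* meaningful for j != k *)
Definition Fhat (j k : nat) : R :=
  if (j < k)%N then
    sumN' k / (countN k)%:R - sumQ' j k / (countQ j k)%:R
  else
    1 - sumM' k / (countM k)%:R + sumQ' k j / (countQ k j)%:R.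

Definition rootNQ (j k : nat) : R :=
  Num.sqrt (minn (countN k) (K * countQ j k))%:R.
Definition rootMQ (j k : nat) : R :=
  Num.sqrt (minn (countM k) (K * countQ k j))%:R.

Definition totalW (j : nat) : R :=
  \sum_(1 <= k < j) rootMQ j k / (j - k + 1)%:R +
  \sum_(j.+1 <= k < L.+1) rootNQ j k / (k - j + 1)%:R.

Definition weight (j k : nat) : R :=
  if (j < k)%N then rootNQ j k / ((k - j + 1)%:R * totalW j)
  else rootMQ j k / ((j - k + 1)%:R * totalW j).

(* the outer sum selects the j such that s belongs to the j-th interval *)
Definition birge (s : R) : R :=
  \sum_(1 <= j < L.+1 | s \in I j)
    \sum_(1 <= k < L.+1 | k != j) weight j k * Fhat j k.

End birge.

(* Main.v *)
From HB Require Import structures.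
Require Import Defs.
From mathcomp Require Import all_boot all_order all_algebra archimedean.
From mathcomp Require Import all_classical all_reals all_analysis.
From mathcomp Require Import measurable_realfun ring lra zify.

Set Implicit Arguments.
Unset Strict Implicit.
Unset Printing Implicit Defensive.

Import Order.TTheory GRing.Theory Num.Theory.
Import numFieldNormedType.Exports.

Local Open Scope classical_set_scope.
Local Open Scope ring_scope.

(* An observation matters for the estimator at t_j only through the bins of T
   and U: it is counted in the marginal ratio of a bin I_k, which holds a fraction
   1/K of the sample, or also in the ratio of a cell formed with I_j, which holds a
   fraction 1/K^2.  Given the bins, the indicators are independent Bernoulli
   variables; with K of order n^(1/3) only the noise of the cell ratios survives,
   and Stein's method gives its normal limit.  The bias is the average of F0 over
   I_j minus F0 t_j, about f0 t0 / (2 K).  Since |k - j| + 1 is K times the distance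
   of the bins up to one bin width, the weights, the bias and the variance are Riemann sums of
   the integrals over the two sides of t0. *)

(** * Gaussian integrals and a smoothed indicator *)

(** Two difficulties shape the proof. The estimator is normalised by a random total weight. The
    event that the standardised estimator is at most x is therefore multiplied by that weight; it
    becomes a comparison of the cell noise, linear in the indicators given the bins, with a random
    threshold close to x. Moreover h is only known to be continuous along the two sections at t0:
    the marginal densities are merely integrable and may be infinite on a null set. So the Riemann
    sums are treated as integrals of step functions, which converge at the Lebesgue points of the
    marginal densities and pass to the limit by dominated convergence. The gap eps in the support
    keeps the contributing bins at a fixed distance from t0, which bounds K times each weight, and
    away from 0 and 1, where f0 may be unbounded. The probabilistic limit is taken in a finite
    model: each observation is coded by one of finitely many classes and one bit, and the law of the
    estimator becomes a finite sum. *)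

Lemma mvt_is_derive {R : realType} (f df : R -> R) (a b : R) : a <= b ->
  (forall x, a <= x <= b -> is_derive x (1 : R) f (df x)) ->
  exists2 c, a <= c <= b & f b - f a = df c * (b - a).
Proof.
move=> ab fdf.
have [||c] := @MVT_segment R f df a b ab.
- by move=> x; rewrite in_itv/= => /andP[ax xb]; apply: fdf; rewrite !ltW.
- apply: derivable_within_continuous => x; rewrite in_itv/= => /fdf dfx.
  exact: ex_derive.
- by rewrite in_itv/=; exists c.
Qed.

Section stein.
Context {R : realType}.
Variables (m s : R).
Hypothesis s_gt0 : 0 < s.
Local Notation mu := (@lebesgue_measure R).
Local Notation phi := (normal_pdf m s).

Let s_neq0 : s != 0. Proof. by rewrite gt_eqF. Qed.

Lemma normal_pdf_gt0 x : 0 < phi x.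
Proof. by rewrite normal_pdfE// mulr_gt0 ?expR_gt0// normal_peak_gt0. Qed.

Lemma is_derive_normal_pdf (x : R) :
  is_derive x (1 : R) phi (- ((x - m) / s ^+ 2) * phi x).
Proof.
rewrite normal_pdfE// /normal_fun.
have H : is_derive x (1:R) (fun y => - (y - m) ^+ 2 / (s ^+ 2 *+ 2))
    (- ((x - m) / s ^+ 2)).
  by apply: is_derive_eq; rewrite /GRing.scale/=; field.
have H2 := is_derive1_comp (is_derive_expR _) H.
by apply: is_derive_eq; rewrite /GRing.scale/=; ring.
Qed.

Lemma normal_pdf_int (A : set R) (f : R -> R) : measurable A -> measurable_fun A f ->
  (forall x, 0 <= f x <= 1) -> mu.-integrable A (EFin \o (fun x => f x * phi x)).
Proof.
move=> mA mf f01.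
have phi_int : mu.-integrable A (EFin \o phi).
  have := integrable_normal_pdf m s; apply: integrableS => //.
apply: le_integrable phi_int => //.
- apply/measurable_EFinP; apply: measurable_funM => //.
  exact: measurable_funTS (measurable_normal_pdf m s).
- move=> x _ /=; rewrite lee_fin normrM ler_piMl//.
  by rewrite ger0_norm; case/andP: (f01 x).
Qed.

Definition npart (f : R -> R) (x : R) : R :=
  \int[mu]_(t in `]-oo, x]) (f t * phi t).
Definition nupper (f : R -> R) (x : R) : R :=
  \int[mu]_(t in `]x, +oo[) (f t * phi t).
Definition ntotal (f : R -> R) : R := \int[mu]_t (f t * phi t).

Section test_function.
Variable f : R -> R.
Hypothesis f_cont : continuous f.
Hypothesis f01 : forall x, 0 <= f x <= 1.

Let mf A : measurable A -> measurable_fun A f.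
Proof. by move=> mA; apply: measurable_funTS; exact: continuous_measurable_fun. Qed.

Let fint A : measurable A -> mu.-integrable A (EFin \o (fun x => f x * phi x)).
Proof. by move=> mA; apply: normal_pdf_int => //; exact: mf. Qed.

Lemma is_derive_npart (x : R) : is_derive x (1 : R) (npart f) (f x * phi x).
Proof.
have [||||dF F'] := @continuous_FTC1 R (fun t => f t * phi t) -oo%O x (x + 1).
- by rewrite ltrDl.
- exact: fint.
- by rewrite ltNyr.
- by apply: cvgM; [exact: f_cont|exact: continuous_normal_pdf].
by apply: DeriveDef; [exact: dF|rewrite -derive1E; exact: F'].
Qed.

Lemma ntotalE x : ntotal f = npart f x + nupper f x.
Proof.
rewrite /ntotal -(itv_setU_setT false x) Rintegral_setU//.
  by rewrite itv_setU_setT; exact: fint.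
exact: disjoint_rays.
Qed.

Lemma npart_ge0 x : 0 <= npart f x.
Proof.
apply: Rintegral_ge0 => t _.
by rewrite mulr_ge0 ?normal_pdf_ge0//; case/andP: (f01 t).
Qed.

Lemma nupper_ge0 x : 0 <= nupper f x.
Proof.
apply: Rintegral_ge0 => t _.
by rewrite mulr_ge0 ?normal_pdf_ge0//; case/andP: (f01 t).
Qed.

End test_function.

Let cst1_cont : continuous (cst (1 : R) : R -> R).
Proof. by move=> x; exact: cvg_cst. Qed.

Let cst1_01 (x : R) : 0 <= cst (1 : R) x <= 1.
Proof. by rewrite /= ler01 lexx. Qed.

Lemma npart_le (f g : R -> R) x : continuous f -> continuous g ->
  (forall x, 0 <= f x <= 1) -> (forall x, 0 <= g x <= 1) ->
  (forall t, t <= x -> f t <= g t) -> npart f x <= npart g x.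
Proof.
move=> cf cg f01 g01 fg; apply: le_Rintegral => //.
- apply: normal_pdf_int => //.
  by apply: measurable_funTS; exact: continuous_measurable_fun.
- apply: normal_pdf_int => //.
  by apply: measurable_funTS; exact: continuous_measurable_fun.
- move=> t /=; rewrite in_itv/= => /fg ?.
  by apply: ler_wpM2r => //; exact: normal_pdf_ge0.
Qed.

Lemma nupper_le (f g : R -> R) x : continuous f -> continuous g ->
  (forall x, 0 <= f x <= 1) -> (forall x, 0 <= g x <= 1) ->
  (forall t, x < t -> f t <= g t) -> nupper f x <= nupper g x.
Proof.
move=> cf cg f01 g01 fg; apply: le_Rintegral => //.
- apply: normal_pdf_int => //.
  by apply: measurable_funTS; exact: continuous_measurable_fun.
- apply: normal_pdf_int => //.
  by apply: measurable_funTS; exact: continuous_measurable_fun.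
- move=> t /=; rewrite in_itv/= andbT => /fg ?.
  by apply: ler_wpM2r => //; exact: normal_pdf_ge0.
Qed.

Local Notation Phi := (npart (cst 1)).
Local Notation Psi := (nupper (cst 1)).

Lemma normal_prob_npart x : fine (normal_prob m s `]-oo, x]) = Phi x.
Proof. by apply: eq_Rintegral => t _ /=; rewrite mul1r. Qed.

Lemma ntotal1 : ntotal (cst 1) = 1.
Proof.
rewrite /ntotal; under eq_Rintegral do rewrite /= mul1r.
by rewrite /Rintegral integral_normal_pdf.
Qed.

(** The identity under the normal law is a random variable, so the limits of a cdf and of its
    complement at infinity apply to [Phi] and [Psi]. *)
Let idR : measurableTypeR R -> R := idfun.
HB.instance Definition _ :=
  @isMeasurableFun.Build _ _ _ _ idR (@measurable_id _ _ setT).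

Lemma npart_lim (e y : R) : 0 < e -> exists2 x, x <= y & Phi x < e.
Proof.
move=> e0.
have /fine_cvgP[_] := cvg_cdfNy0 (idR : {RV (normal_prob m s) >-> R}).
move/cvgrPdist_lt => /(_ _ e0) [M [_ HM]].
have xM : Num.min (M - 1) y < M by rewrite gt_min ltrBlDr ltrDl ltr01.
exists (Num.min (M - 1) y); first by rewrite ge_min lexx orbT.
have := HM _ xM; rewrite sub0r normrN => /(le_lt_trans (ler_norm _)).
by rewrite -normal_prob_npart.
Qed.

Lemma nupper_lim (e y : R) : 0 < e -> exists2 x, y <= x & Psi x < e.
Proof.
move=> e0.
have /fine_cvgP[_] := cvg_ccdfy0 (idR : {RV (normal_prob m s) >-> R}).
move/cvgrPdist_lt => /(_ _ e0) [M [_ HM]].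
have xM : M < Num.max (M + 1) y by rewrite lt_max ltrDl ltr01.
exists (Num.max (M + 1) y); first by rewrite le_max lexx orbT.
have := HM _ xM; rewrite sub0r normrN => /(le_lt_trans (ler_norm _)).
congr (_ < _); apply: eq_Rintegral => t _ /=; by rewrite mul1r.
Qed.

Lemma is_derive_nupper (x : R) : is_derive x (1 : R) Psi (- phi x).
Proof.
have -> : Psi = (fun y => 1 - Phi y).
  apply/funext => y; have := ntotalE cst1_cont cst1_01 y.
  by rewrite ntotal1; lra.
have := is_derive_npart cst1_cont cst1_01 x => H.
by apply: is_derive_eq; rewrite /=; ring.
Qed.

(* Mills' ratio: the difference of both sides is monotone and tends to 0 at infinity. *)
Lemma mills_lower (x : R) : x < m -> (m - x) * Phi x <= s ^+ 2 * phi x.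
Proof.
move=> xm; rewrite mulrC -ler_pdivlMr ?subr_gt0//.
pose rho y := s ^+ 2 * phi y / (m - y) - Phi y.
have rho_nd y : y <= x -> rho y <= rho x.
  move=> yx; have [|c /andP[yc cx] E] := @mvt_is_derive R rho
    (fun z => s ^+ 2 * phi z / (m - z) ^+ 2) y x yx; last first.
    rewrite -subr_ge0 E mulr_ge0 ?subr_ge0//.
    by rewrite divr_ge0 ?sqr_ge0// mulr_ge0 ?sqr_ge0 ?normal_pdf_ge0.
  move=> z /andP[yz zx]; rewrite /rho.
  have mz : m - z != 0 by rewrite gt_eqF// subr_gt0 (le_lt_trans zx).
  have H1 := is_derive_npart cst1_cont cst1_01 z.
  have H2 := is_derive_normal_pdf z.
  have H3 : is_derive z (1:R) (fun y => (m - y)^-1) ((m - z) ^- 2).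
    by apply: is_derive_eq; rewrite /GRing.scale/=; field.
  apply: is_derive_eq; rewrite /GRing.scale/=; field.
  by rewrite s_neq0 mz.
have rhoE y : y <= x -> - Phi y <= rho y.
  move=> yx; rewrite /rho lerBDl addrN.
  apply: divr_ge0; last lra.
  by rewrite mulr_ge0 ?sqr_ge0 ?normal_pdf_ge0.
(* A negative [rho x] would persist to the left by monotonicity, whereas [rho y >= - Phi y] and
   [Phi y] can be made smaller than [- rho x]. *)
rewrite -subr_ge0 -/(rho x) leNgt; apply/negP; rewrite -oppr_gt0 => rx.
have [y yx Py] := npart_lim x rx.
have := rho_nd _ yx; have := rhoE _ yx; lra.
Qed.

Lemma mills_upper (x : R) : m < x -> (x - m) * Psi x <= s ^+ 2 * phi x.
Proof.
move=> xm; rewrite mulrC -ler_pdivlMr ?subr_gt0//.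
pose rho y := s ^+ 2 * phi y / (y - m) - Psi y.
have rho_nd y : x <= y -> rho y <= rho x.
  move=> yx; have [|c /andP[yc cx] E] := @mvt_is_derive R rho
    (fun z => - (s ^+ 2 * phi z / (z - m) ^+ 2)) x y yx; last first.
    rewrite -subr_le0 E mulNr oppr_le0 mulr_ge0 ?subr_ge0//.
    by rewrite divr_ge0 ?sqr_ge0// mulr_ge0 ?sqr_ge0 ?normal_pdf_ge0.
  move=> z /andP[yz zx]; rewrite /rho.
  have mz : z - m != 0 by rewrite gt_eqF// subr_gt0 (lt_le_trans xm).
  have H1 := is_derive_nupper z.
  have H2 := is_derive_normal_pdf z.
  have H3 : is_derive z (1:R) (fun y => (y - m)^-1) (- (z - m) ^- 2).
    by apply: is_derive_eq; rewrite /GRing.scale/=; field.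
  apply: is_derive_eq; rewrite /GRing.scale/=; field.
  by rewrite s_neq0 mz.
have rhoE y : x <= y -> - Psi y <= rho y.
  move=> yx; rewrite /rho lerBDl addrN.
  apply: divr_ge0; last lra.
  by rewrite mulr_ge0 ?sqr_ge0 ?normal_pdf_ge0.
rewrite -subr_ge0 -/(rho x) leNgt; apply/negP; rewrite -oppr_gt0 => rx.
have [y yx Py] := nupper_lim x rx.
have := rho_nd _ yx; have := rhoE _ yx; lra.
Qed.

Section stein_solution.
Variable f : R -> R.
Hypothesis f_cont : continuous f.
Hypothesis f01 : forall x, 0 <= f x <= 1.

(** Solution of Stein's equation for N(m, s ^ 2): [g' - (x - m) / s ^ 2 * g] equals [f] minus its
    Gaussian mean. It comes from the integrating factor [phi]; [stein_der] reads the derivative off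
    the equation. *)
Definition stein_sol (x : R) : R := (npart f x - ntotal f * Phi x) / phi x.
Definition stein_der (x : R) : R :=
  f x - ntotal f + (x - m) / s ^+ 2 * stein_sol x.

Lemma is_derive_stein_sol (x : R) : is_derive x (1 : R) stein_sol (stein_der x).
Proof.
have p0 : phi x != 0 by rewrite gt_eqF// normal_pdf_gt0.
have H1 := is_derive_npart cst1_cont cst1_01 x.
have H2 := is_derive_npart f_cont f01 x.
have H3 := is_derive_normal_pdf x.
have H4 : is_derive x (1:R) (fun y => (phi y)^-1) ((x - m) / s ^+ 2 / phi x).
  apply: is_derive_eq; rewrite /GRing.scale/=; field.
  by rewrite s_neq0 p0.
apply: is_derive_eq; rewrite /GRing.scale/= /stein_der /stein_sol.
by field; rewrite s_neq0 p0.
Qed.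

Lemma stein_der_cont : continuous stein_der.
Proof.
move=> x; apply: cvgD; first by apply: cvgB; [exact: f_cont|exact: cvg_cst].
apply: cvgM.
  apply: cvgM; last exact: cvg_cst.
  by apply: cvgB; [exact: cvg_id|exact: cvg_cst].
apply/differentiable_continuous/derivable1_diffP.
by have := is_derive_stein_sol x => H; exact: ex_derive.
Qed.

Let PhiPsi x : Phi x + Psi x = 1.
Proof. by rewrite -(ntotalE cst1_cont cst1_01 x) ntotal1. Qed.

Let tot01 : 0 <= ntotal f <= 1.
Proof.
have h1 := npart_ge0 f01 0; have h2 := nupper_ge0 f01 0.
have h3 : npart f 0 <= Phi 0.
  apply: (npart_le f_cont cst1_cont f01 cst1_01) => t _.
  by case/andP: (f01 t).
have h4 : nupper f 0 <= Psi 0.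
  apply: (nupper_le f_cont cst1_cont f01 cst1_01) => t _.
  by case/andP: (f01 t).
have := PhiPsi 0; have := ntotalE f_cont f01 0; lra.
Qed.

(** The numerator [d] of the solution is at most [Phi x] in absolute value and, rewritten with the
    upper tails, at most [Psi x]. Mills' ratio for the tail on the side of [x] then absorbs the
    factor [x - m]. *)
Lemma stein_der_le x : `|stein_der x| <= 2.
Proof.
have [t0 t1] := andP tot01; have [f0 f1] := andP (f01 x).
suff H : `|(x - m) / s ^+ 2 * stein_sol x| <= 1.
  move: H; rewrite /stein_der !ler_norml => /andP[? ?]; lra.
have p0 := normal_pdf_gt0 x.
set d := npart f x - ntotal f * Phi x.
have P0 : 0 <= Phi x by exact: npart_ge0.
have Q0 : 0 <= Psi x by exact: nupper_ge0.
have p1 : npart f x <= Phi x.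
  by apply: npart_le => // t _; case/andP: (f01 t).
have p2 : nupper f x <= Psi x.
  by apply: nupper_le => // t _; case/andP: (f01 t).
have P0' : 0 <= npart f x by exact: npart_ge0.
have Q0' : 0 <= nupper f x by exact: nupper_ge0.
have dPhi : `|d| <= Phi x.
  rewrite ler_norml /d; apply/andP; split; nra.
have dPsi : `|d| <= Psi x.
  have dE : d = ntotal f * Psi x - nupper f x.
    have := ntotalE f_cont f01 x.
    have -> : Psi x = 1 - Phi x by have := PhiPsi x; lra.
    by rewrite /d; lra.
  rewrite dE ler_norml; apply/andP; split; nra.
have s2 : 0 < s ^+ 2 by rewrite exprn_gt0.
have H : `|(x - m) * d| <= s ^+ 2 * phi x.
  rewrite normrM; have [xm|xm|->] := ltgtP x m.
  - rewrite ltr0_norm ?subr_lt0// opprB.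
    by apply: (le_trans _ (mills_lower xm)); rewrite ler_wpM2l// subr_ge0 ltW.
  - rewrite gtr0_norm ?subr_gt0//.
    by apply: (le_trans _ (mills_upper xm)); rewrite ler_wpM2l// subr_ge0 ltW.
  - by rewrite subrr normr0 mul0r mulr_ge0 ?sqr_ge0 ?normal_pdf_ge0.
rewrite /stein_sol -/d mulf_div normrM normfV (gtr0_norm (mulr_gt0 s2 p0)).
by rewrite ler_pdivrMr ?mulr_gt0// mul1r.
Qed.

End stein_solution.

Lemma npart_cst1_cont : continuous Phi.
Proof.
move=> x; apply/differentiable_continuous/derivable1_diffP.
by have := is_derive_npart cst1_cont cst1_01 x => H; exact: ex_derive.
Qed.

(** Piecewise linear substitute for the indicator of a half-line: for [a < b] it is 1 up to [a] and
    0 from [b] on. Its continuity makes the derivative of the Stein solution continuous. *)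
Definition ramp (a b x : R) : R := Num.min 1 (Num.max 0 ((b - x) / (b - a))).

Lemma ramp01 a b x : 0 <= ramp a b x <= 1.
Proof. by rewrite /ramp le_min ler01 le_max lexx ge_min lexx. Qed.

Lemma ramp_cont a b : continuous (ramp a b).
Proof.
move=> x.
suff : {for x, continuous (cst 1 \min (cst 0 \max (fun y => (b - y) / (b - a))))} by [].
apply: continuous_min; first exact: cvg_cst.
apply: continuous_max; first exact: cvg_cst.
by apply: cvgM; [apply: cvgB; [exact: cvg_cst|exact: cvg_id]|exact: cvg_cst].
Qed.

Lemma ramp1 a b x : a < b -> x <= a -> ramp a b x = 1.
Proof.
move=> ab xa; rewrite /ramp min_l// le_max; apply/orP; right.
by rewrite ler_pdivlMr ?subr_gt0// mul1r; lra.
Qed.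

Lemma ramp0 a b x : a < b -> b <= x -> ramp a b x = 0.
Proof.
move=> ab bx; rewrite /ramp max_l ?min_r ?ler01//.
by rewrite mulr_le0_ge0// ?invr_ge0; lra.
Qed.

Lemma ntotal_ramp a b : a < b -> Phi a <= ntotal (ramp a b) <= Phi b.
Proof.
move=> ab; have fc := @ramp_cont a b; have f01 := @ramp01 a b.
rewrite {1}(ntotalE fc f01 a) (ntotalE fc f01 b); apply/andP; split.
  rewrite -[leLHS]addr0 lerD ?nupper_ge0//.
  by apply: npart_le => // t ta; rewrite /= ramp1.
have -> : nupper (ramp a b) b = 0.
  rewrite /nupper (@eq_Rintegral _ _ _ _ _ (cst 0)).
    by rewrite Rintegral_cst// mul0r.
  by move=> t; rewrite inE/= in_itv/= andbT => bt; rewrite ramp0 ?mul0r// ltW.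
by rewrite addr0; apply: npart_le => // t _; case/andP: (f01 t).
Qed.

End stein.

(** Stein's method is run below with a derivative [k] that is bounded and continuous, but has no
    Lipschitz constant. The price is the weight [1 + x ^ 2], harmless because the second moments are
    under control. *)
Lemma weighted_unif_cont {R : realType} (k : R -> R) (C : R) :
  continuous k -> (forall x, `|k x| <= C) ->
  forall w, 0 < w -> exists2 eta, 0 < eta &
    forall x y, `|x - y| <= eta -> `|k x - k y| <= w * (1 + x ^+ 2).
Proof.
move=> kc kC w w0.
have C0 : 0 <= C by exact: le_trans (kC 0).
(* Beyond [A >= 1] the crude bound [2 * C = w * (A - 1)] on the oscillation is below [w * x ^ 2]. *)
pose A : R := 1 + 2 * C / w.
have A1 : 1 <= A by rewrite /A lerDl divr_ge0 ?mulr_ge0// ltW.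
have /compact_near_coveringP cvA := @segment_compact R (- A) A.
(* Compactness in the form of a near covering: the modulus [e] runs through right neighbourhoods of
   0, and balls of half the radius leave room to move both arguments. *)
have [|eta /= eta0 Heta] := cvA R (nbhs 0^'+)
    (fun e x => forall y, `|x - y| <= e -> `|k x - k y| <= w) _.
  move=> x _.
  have [r r0 Hr] : exists2 r, 0 < r & forall y, `|x - y| < r -> `|k x - k y| < w / 2.
    have /cvgrPdist_lt/(_ (w / 2)) := kc x; rewrite divr_gt0// => /(_ isT).
    by move=> [r r0 Hr]; exists r.
  exists (ball x (r / 2), `]0, (r / 2)[%classic) => /=.
    split; first by apply: nbhsx_ballx; rewrite divr_gt0.
    exists (r / 2) => /=; first by rewrite divr_gt0.
    by move=> z /=; rewrite sub0r normrN in_itv/= => zr z0; rewrite z0/= (le_lt_trans (ler_norm _)).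
  move=> [x' e] /= [xx']; rewrite in_itv/= => /andP[e0 er] y x'y.
  move: xx'; rewrite /ball/= => xx'.
  have h1 : `|k x - k x'| < w / 2 by apply: Hr; lra.
  have h2 : `|k x - k y| < w / 2.
    apply: Hr; rewrite -(subrKA x') (le_lt_trans (ler_normD _ _))//.
    by rewrite [ltRHS](splitr r) ltr_leD// (le_trans x'y)// ltW.
  rewrite -(subrKA (k x)) (le_trans (ler_normD _ _))// [leRHS](splitr w).
  by rewrite lerD// ltW// distrC.
exists (eta / 2); first by rewrite divr_gt0.
move=> x y xy.
have x20 : 0 <= x ^+ 2 by exact: sqr_ge0.
have [xA|Ax] := leP `|x| A.
  have h : `|k x - k y| <= w.
    apply: (Heta (eta / 2)) => //=.
    - rewrite sub0r normrN gtr0_norm ?divr_gt0//; lra.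
    - by rewrite divr_gt0.
    - by rewrite in_itv/= -ler_norml.
  by apply: (le_trans h); nra.
have h : `|k x - k y| <= 2 * C.
  by rewrite (le_trans (ler_normB _ _))// mulrDl !mul1r lerD.
have Ax2 : A <= x ^+ 2.
  rewrite -real_normK ?num_real// expr2.
  by have := ltW Ax; nra.
apply: (le_trans h).
have -> : 2 * C = w * (A - 1).
  by rewrite /A; field; rewrite gt_eqF.
by rewrite ler_pM2l//; lra.
Qed.

(* The constant c is the Gaussian integral of the ramp, and k is the derivative of g. *)
Lemma stein_pair {R : realType} (m s a b : R) : 0 < s -> a < b ->
  exists g k c, [/\ forall x, is_derive x (1 : R) g (k x),
    forall x, k x = ramp a b x - c + (x - m) / s ^+ 2 * g x,
    exists C, forall x, `|k x| <= C,
    forall w, 0 < w -> exists2 eta, 0 < eta &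
      forall x y, `|x - y| <= eta -> `|k x - k y| <= w * (1 + x ^+ 2) &
    fine (normal_prob m s `]-oo, a]) <= c <= fine (normal_prob m s `]-oo, b])].
Proof.
move=> s0 ab; have fc := @ramp_cont R a b; have f01 := @ramp01 R a b.
exists (stein_sol m s (ramp a b)), (stein_der m s (ramp a b)).
exists (ntotal m s (ramp a b)).
split => //.
- exact: is_derive_stein_sol.
- by exists 2; exact: stein_der_le.
- apply: (@weighted_unif_cont _ _ 2); last exact: stein_der_le.
  exact: stein_der_cont.
- by rewrite !normal_prob_npart; exact: ntotal_ramp.
Qed.

Lemma normal_cdf_cont {R : realType} (m s : R) : 0 < s ->
  continuous (fun x => fine (normal_prob m s `]-oo, x])).
Proof.
move=> s0; under eq_fun do rewrite normal_prob_npart.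
exact: npart_cst1_cont.
Qed.

(** * Expectations over finite product laws *)

Section product_expectation.
Context {R : realType} {A : finType} (n : nat) (r : 'I_n -> A -> R).
Hypothesis r_ge0 : forall i a, 0 <= r i a.
Hypothesis r_sum : forall i, \sum_a r i a = 1.
Implicit Types (x : {ffun 'I_n -> A}) (f g : {ffun 'I_n -> A} -> R).

Definition pweight x : R := \prod_i r i (x i).
Definition pexp f : R := \sum_x pweight x * f x.
Definition upd x (i : 'I_n) (a : A) : {ffun 'I_n -> A} :=
  [ffun k => if k == i then a else x k].

Lemma pweight_ge0 x : 0 <= pweight x.
Proof. exact: prodr_ge0. Qed.

Lemma pexp_cst (a : R) : pexp (fun=> a) = a.
Proof.
rewrite /pexp -mulr_suml.
have -> : \sum_x pweight x = 1; last by rewrite mul1r.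
rewrite /pweight -(bigA_distr_bigA r) /=.
by rewrite big1.
Qed.

Lemma pexpD f g : pexp (fun x => f x + g x) = pexp f + pexp g.
Proof. by rewrite /pexp -big_split; apply: eq_bigr => x _ /=; rewrite mulrDr. Qed.

Lemma pexpZ a f : pexp (fun x => a * f x) = a * pexp f.
Proof. by rewrite /pexp mulr_sumr; apply: eq_bigr => x _; rewrite mulrCA. Qed.

Lemma pexpB f g : pexp (fun x => f x - g x) = pexp f - pexp g.
Proof. by rewrite /pexp -sumrB; apply: eq_bigr => x _ /=; rewrite mulrBr. Qed.

Lemma pexp_sum (I : Type) (s : seq I) (P : pred I) (F : I -> {ffun 'I_n -> A} -> R) :
  pexp (fun x => \sum_(i <- s | P i) F i x) = \sum_(i <- s | P i) pexp (F i).
Proof.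
rewrite /pexp exchange_big; apply: eq_bigr => x _ /=.
by rewrite mulr_sumr.
Qed.

Lemma eq_pexp f g : f =1 g -> pexp f = pexp g.
Proof. by move=> fg; apply: eq_bigr => x _; rewrite fg. Qed.

Lemma ler_pexp_pos f g : (forall x, 0 < pweight x -> f x <= g x) ->
  pexp f <= pexp g.
Proof.
move=> fg; apply: ler_sum => x _.
have := pweight_ge0 x; rewrite le_eqVlt => /predU1P[<-|w0]; first by rewrite !mul0r.
by rewrite ler_wpM2l ?fg// ltW.
Qed.

Lemma ler_pexp f g : (forall x, f x <= g x) -> pexp f <= pexp g.
Proof. by move=> fg; apply: ler_pexp_pos. Qed.

Lemma pexp_ge0 f : (forall x, 0 <= f x) -> 0 <= pexp f.
Proof. by move=> f0; apply: sumr_ge0 => x _; rewrite mulr_ge0 ?pweight_ge0. Qed.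

Lemma ler_norm_pexp f : `|pexp f| <= pexp (fun x => `|f x|).
Proof.
rewrite (le_trans (ler_norm_sum _ _ _))//; apply: ler_sum => x _.
by rewrite normrM ger0_norm ?pweight_ge0.
Qed.

(* Replacing one coordinate by an independent copy does not change the law. *)
Lemma pexp_resample i f :
  pexp f = pexp (fun x => \sum_a r i a * f (upd x i a)).
Proof.
rewrite /pexp; under [RHS]eq_bigr do rewrite mulr_sumr.
rewrite pair_big /=.
(* Exchanges the i-th coordinate with the fresh copy: an involution that preserves the joint weight
   of the vector and the copy. *)
pose phi (y : {ffun 'I_n -> A} * A) := (upd y.1 i y.2, y.1 i).
have phiK : involutive phi.
  move=> [x a]; congr pair; last by rewrite ffunE eqxx.
  by apply/ffunP => k; rewrite !ffunE /=; case: eqP => [->|].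
rewrite (reindex_inj (inv_inj phiK)) /=.
have H (y : {ffun 'I_n -> A} * A) :
    pweight (upd y.1 i y.2) * (r i (y.1 i) * f (upd (upd y.1 i y.2) i (y.1 i)))
    = pweight y.1 * f y.1 * r i y.2.
  have -> : upd (upd y.1 i y.2) i (y.1 i) = y.1.
    by apply/ffunP => k; rewrite !ffunE; case: eqP => [->|].
  rewrite mulrA [RHS]mulrAC; congr (_ * _).
  rewrite /pweight (bigD1 i)//= [in RHS](bigD1 i)//= ffunE eqxx.
  under eq_bigr => k ki do rewrite ffunE (negbTE ki).
  by ring.
rewrite [RHS](eq_bigr _ (fun y _ => H y)).
rewrite -(pair_big xpredT xpredT (fun x a => pweight x * f x * r i a)) /=.
by apply: eq_bigr => x _; rewrite -mulr_sumr r_sum mulr1.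
Qed.

Lemma pexp_coord i (u : A -> R) f : (forall x a, f (upd x i a) = f x) ->
  pexp (fun x => u (x i) * f x) = (\sum_a r i a * u a) * pexp f.
Proof.
move=> fi; rewrite (pexp_resample i) -pexpZ; apply: eq_pexp => x.
rewrite mulr_suml; apply: eq_bigr => a _.
by rewrite fi ffunE eqxx mulrA.
Qed.

Lemma pexp_coord1 i (u : A -> R) : pexp (fun x => u (x i)) = \sum_a r i a * u a.
Proof.
have := @pexp_coord i u (fun=> 1) (fun _ _ => erefl).
rewrite pexp_cst mulr1 => <-.
by apply: eq_pexp => x; rewrite mulr1.
Qed.

Lemma pexp_coord2 i j (u v : A -> R) : i != j ->
  pexp (fun x => u (x i) * v (x j)) = (\sum_a r i a * u a) * (\sum_a r j a * v a).
Proof.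
move=> ij; rewrite (@pexp_coord i u (fun x => v (x j))) ?pexp_coord1// => x a.
by rewrite ffunE eq_sym (negbTE ij).
Qed.

Section centered.
Variable psi : 'I_n -> A -> R.
Hypothesis psi0 : forall i, \sum_a r i a * psi i a = 0.

Definition psum x : R := \sum_i psi i (x i).
Definition pvar i : R := \sum_a r i a * psi i a ^+ 2.

Lemma pvar_ge0 i : 0 <= pvar i.
Proof. by apply: sumr_ge0 => a _; rewrite mulr_ge0 ?sqr_ge0. Qed.

Lemma pexp_psum : pexp psum = 0.
Proof. by rewrite pexp_sum big1// => i _; rewrite pexp_coord1. Qed.

Lemma pexp_psum2 : pexp (fun x => psum x ^+ 2) = \sum_i pvar i.
Proof.
transitivity (pexp (fun x => \sum_i \sum_j psi i (x i) * psi j (x j))).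
  apply: eq_pexp => x; rewrite expr2 mulr_suml; apply: eq_bigr => i _.
  by rewrite mulr_sumr.
rewrite pexp_sum; apply: eq_bigr => i _.
rewrite pexp_sum (bigD1 i)//= big1 ?addr0.
  rewrite (eq_pexp (g := fun x => psi i (x i) ^+ 2)) => [|x]; last by rewrite expr2.
  exact: (@pexp_coord1 i (fun a => psi i a ^+ 2)).
by move=> j ji; rewrite (@pexp_coord2 i j (psi i) (psi j)) 1?eq_sym// psi0 mul0r.
Qed.

Variables (m eta w : R) (g k : R -> R).
Hypothesis eta_psi : forall i a, `|psi i a| <= eta.
Hypothesis gk : forall y, is_derive y (1 : R) g (k y).
Hypothesis w_ge0 : 0 <= w.
Hypothesis kw : forall y z, `|y - z| <= eta -> `|k y - k z| <= w * (1 + y ^+ 2).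

Let V := \sum_i pvar i.
Let T x := m + psum x.
(** Leave-one-out value of the sum: it does not involve the i-th coordinate, hence is independent of
    [psi i (x i)]. *)
Let S i x := T x - psi i (x i).

Let S_upd i x a : S i (upd x i a) = S i x.
Proof.
rewrite /S /T /psum (bigD1 i)//= [in RHS](bigD1 i)//= ffunE eqxx.
under eq_bigr => j ji do rewrite ffunE (negbTE ji).
by ring.
Qed.

Let ET2 : pexp (fun x => T x ^+ 2) = m ^+ 2 + V.
Proof.
transitivity (pexp (fun=> m ^+ 2) + (2 * m) * pexp psum +
    pexp (fun x => psum x ^+ 2)); last first.
  by rewrite pexp_cst pexp_psum mulr0 addr0 pexp_psum2.
rewrite -pexpZ -!pexpD.
by apply: eq_pexp => x; rewrite /T; ring.
Qed.

(** Dropping a centred independent summand cannot increase the second moment, since the cross term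
    vanishes. *)
Let ES2 i : pexp (fun x => S i x ^+ 2) <= m ^+ 2 + V.
Proof.
rewrite -ET2 -subr_ge0.
have -> : pexp (fun x => T x ^+ 2) =
    pexp (fun x => S i x ^+ 2) + 2 * pexp (fun x => psi i (x i) * S i x)
      + pexp (fun x => psi i (x i) ^+ 2).
  by rewrite -pexpZ -!pexpD; apply: eq_pexp => x; rewrite /S; ring.
rewrite (@pexp_coord i (psi i) (S i)); last exact: S_upd.
rewrite psi0 mul0r mulr0 addr0 addrC addKr.
by apply: pexp_ge0 => x; exact: sqr_ge0.
Qed.

(** As [psi i] is centred and independent of [S i], the value [g (S i)] may be subtracted from
    [g (T)], and the mean value theorem leaves [psi i ^ 2 * k (S i)] up to the modulus of [k]. A
    second error of the same size replaces [S i] by [T] under [k]; hence the factor 2. *)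
Let stein_step i :
  `|pexp (fun x => psi i (x i) * g (T x)) - pvar i * pexp (fun x => k (T x))|
  <= 2 * w * (1 + m ^+ 2 + V) * pvar i.
Proof.
have Eg0 : pexp (fun x => psi i (x i) * g (S i x)) = 0.
  by rewrite (@pexp_coord i (psi i) (g \o S i)) ?psi0 ?mul0r// => x a; rewrite /= S_upd.
have Ek : pexp (fun x => psi i (x i) ^+ 2 * k (S i x)) =
    pvar i * pexp (fun x => k (S i x)).
  by rewrite (@pexp_coord i (fun a => psi i a ^+ 2) (k \o S i))// => x a; rewrite /= S_upd.
have Ew : pexp (fun x => psi i (x i) ^+ 2 * (w * (1 + S i x ^+ 2))) =
    pvar i * (w * (1 + pexp (fun x => S i x ^+ 2))).
  rewrite (@pexp_coord i (fun a => psi i a ^+ 2) (fun x => w * (1 + S i x ^+ 2)));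
    last by move=> x a; rewrite S_upd.
  by rewrite pexpZ pexpD pexp_cst.
have H1 : `|pexp (fun x => psi i (x i) * g (T x))
    - pexp (fun x => psi i (x i) ^+ 2 * k (S i x))|
    <= pvar i * (w * (1 + pexp (fun x => S i x ^+ 2))).
  rewrite -Ew -[X in X - _]subr0 -Eg0 -!pexpB (le_trans (ler_norm_pexp _))//.
  apply: ler_pexp => x.
  have TS : T x = S i x + psi i (x i) by rewrite /S subrK.
  set p := psi i (x i); rewrite -/p in TS.
  have -> : p * g (T x) - p * g (S i x) - p ^+ 2 * k (S i x) =
     p * (g (T x) - g (S i x) - p * k (S i x)) by ring.
  rewrite normrM -real_normK ?num_real// expr2 -mulrA ler_wpM2l//.
  have peta : `|p| <= eta by exact: eta_psi.
  (* The mean value theorem between the two sums; the cases only put its end points in order. *)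
  have [c c1 c2] : exists2 c, `|S i x - c| <= eta & g (T x) - g (S i x) = k c * p.
    have [p0|p0] := leP 0 p.
      have [|c cST E] := @mvt_is_derive R g k (S i x) (T x) _ (fun z _ => gk z).
        by rewrite TS lerDl.
      exists c; last by rewrite E TS addrAC subrr add0r.
      apply: le_trans peta; rewrite (ger0_norm p0) ler_norml.
      by apply/andP; move: cST => /andP[]; rewrite TS; split; lra.
    have [|c cST E] := @mvt_is_derive R g k (T x) (S i x) _ (fun z _ => gk z).
      by rewrite TS gerDl ltW.
    exists c; last by apply: oppr_inj; rewrite opprB E TS; ring.
    apply: le_trans peta; rewrite (ltr0_norm p0) ler_norml.
    by apply/andP; move: cST => /andP[]; rewrite TS; split; lra.
  rewrite c2 [k c * p]mulrC -mulrBr normrM ler_wpM2l// distrC.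
  exact: kw.
have H2 : `|pexp (fun x => k (S i x)) - pexp (fun x => k (T x))|
    <= w * (1 + pexp (fun x => S i x ^+ 2)).
  rewrite -[1]pexp_cst -pexpD -pexpZ -pexpB (le_trans (ler_norm_pexp _))//.
  apply: ler_pexp => x; apply: kw.
  have -> : S i x - T x = - psi i (x i) by rewrite /S addrAC subrr add0r.
  by rewrite normrN.
have H3 := ES2 i; have v0 := pvar_ge0 i.
have W0 : w * (1 + pexp (fun x => S i x ^+ 2)) <= w * (1 + m ^+ 2 + V).
  by rewrite ler_wpM2l// -addrA lerD2l.
rewrite -(subrKA (pexp (fun x => psi i (x i) ^+ 2 * k (S i x)))).
rewrite (le_trans (ler_normD _ _))// Ek -mulrBr normrM (ger0_norm v0).
have := ler_wpM2l v0 H2; have := ler_wpM2l v0 W0; rewrite Ek in H1.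
lra.
Qed.

(** Approximate form of the identity that characterises the Gaussian law of mean [m] and variance
    [V]: the mean of [(T - m) * g T] is [V] times the mean of [g' T]. *)
Lemma stein_bound :
  `|pexp (fun x => psum x * g (T x)) - V * pexp (fun x => k (T x))|
  <= 2 * w * (1 + m ^+ 2 + V) * V.
Proof.
have -> : pexp (fun x => psum x * g (T x)) =
    \sum_i pexp (fun x => psi i (x i) * g (T x)).
  by rewrite -pexp_sum; apply: eq_pexp => x; rewrite mulr_suml.
rewrite {1}/V mulr_suml -sumrB (le_trans (ler_norm_sum _ _ _))//.
rewrite [leRHS]mulr_sumr.
by apply: ler_sum => i _; exact: stein_step.
Qed.

End centered.

End product_expectation.

(** * The discrete model: variances and the central limit theorem *)

Section moments.
Context {R : realType} {A : finType} (n : nat) (r : 'I_n -> A -> R).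
Hypothesis r_ge0 : forall i a, 0 <= r i a.
Hypothesis r_sum : forall i, \sum_a r i a = 1.

(** This is the nonnegativity of the variance of the absolute value of [f]. *)
Lemma pexp_norm_sqrt (f : {ffun 'I_n -> A} -> R) :
  pexp r (fun x => `|f x|) <= Num.sqrt (pexp r (fun x => f x ^+ 2)).
Proof.
set e := pexp r (fun x => `|f x|).
have e0 : 0 <= e by apply: pexp_ge0 => // x.
have : 0 <= pexp r (fun x => (`|f x| - e) ^+ 2).
  by apply: pexp_ge0 => // x; exact: sqr_ge0.
have -> : pexp r (fun x => (`|f x| - e) ^+ 2) =
   pexp r (fun x => f x ^+ 2) - (2 * e) * e + e ^+ 2.
  rewrite -[e ^+ 2](pexp_cst r_sum) -{2}/e -pexpZ -pexpB -pexpD.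
  by apply: eq_pexp => x; rewrite -[f x ^+ 2]real_normK ?num_real//; ring.
move=> h; have : e ^+ 2 <= pexp r (fun x => f x ^+ 2) by nra.
by move/ler_wsqrtr; rewrite sqrtr_sqr ger0_norm.
Qed.

Lemma pexp_sqrt_le (f : {ffun 'I_n -> A} -> R) : (forall x, 0 <= f x) ->
  pexp r (fun x => Num.sqrt (f x)) <= Num.sqrt (pexp r f).
Proof.
move=> f0; apply: (le_trans _ (le_trans (pexp_norm_sqrt (fun x => Num.sqrt (f x))) _)).
  by apply: ler_pexp => // x; exact: ler_norm.
by rewrite ler_wsqrtr//; apply: ler_pexp => // x; rewrite sqr_sqrtr.
Qed.

End moments.

Lemma sqrt_dist {R : rcfType} (x y : R) : 0 <= x -> 0 <= y ->
  `|Num.sqrt x - Num.sqrt y| <= Num.sqrt `|x - y|.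
Proof.
suff H (a b : R) : 0 <= a -> a <= b ->
    `|Num.sqrt b - Num.sqrt a| <= Num.sqrt `|b - a|.
  move=> x0 y0; have [xy|/ltW yx] := leP x y; last exact: H.
  by rewrite distrC [`|x - y|]distrC; exact: H.
move=> a0 ab; have b0 := le_trans a0 ab.
rewrite !ger0_norm ?subr_ge0 ?ler_wsqrtr// lerBlDr.
rewrite -ler_sqr ?nnegrE ?addr_ge0 ?sqrtr_ge0// sqrrD !sqr_sqrtr ?subr_ge0//.
have := mulr_ge0 (sqrtr_ge0 (b - a)) (sqrtr_ge0 a); lra.
Qed.

Lemma min_dist {R : realDomainType} (a b a' b' : R) :
  `|Num.min a b - Num.min a' b'| <= `|a - a'| + `|b - b'|.
Proof.
suff H (x y x' y' : R) :
    Num.min x y <= Num.min x' y' + (`|x - x'| + `|y - y'|).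
  have h1 := H a b a' b'; have := H a' b' a b.
  rewrite (distrC a') (distrC b') => h2.
  by rewrite ler_norml; apply/andP; split; lra.
have h1 := ler_norm (x - x'); have h2 := ler_norm (y - y').
have h3 := normr_ge0 (x - x'); have h4 := normr_ge0 (y - y').
rewrite -lerBlDr le_min; apply/andP; split.
  have : Num.min x y <= x by rewrite ge_min lexx.
  lra.
have : Num.min x y <= y by rewrite ge_min lexx orbT.
lra.
Qed.

Section birge_model.
Context {R : realType}.
Variables (n K m : nat).
Local Notation D := (option (bool * 'I_m)).
Variables (q p : D -> R) (lam beta sg : 'I_m -> R) (C theta : R).
Implicit Types (c : {ffun 'I_n -> D}) (o : {ffun 'I_n -> bool}) (k : 'I_m).

(* (true, k) is the class of the observations counted in the k-th marginal
   ratio, (false, k) that of the observations counted in the k-th cell. *)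
Definition mA k : D := Some (true, k).
Definition mC k : D := Some (false, k).

Definition bern (x : R) (b : bool) : R := if b then x else 1 - x.
Definition Ec (f : {ffun 'I_n -> D} -> R) : R := pexp (fun _ : 'I_n => q) f.
Definition Eo c (f : {ffun 'I_n -> bool} -> R) : R :=
  pexp (fun i : 'I_n => bern (p (c i))) f.
Definition EE (F : {ffun 'I_n -> D} -> {ffun 'I_n -> bool} -> R) : R :=
  Ec (fun c => Eo c (F c)).

Definition cnt c (d : D) : nat := (\sum_(i < n | c i == d) 1)%N.
Definition suc c o (d : D) : R := \sum_(i < n | c i == d) (o i)%:R.
Definition root c k : R := Num.sqrt (minn (cnt c (mA k)) (K * cnt c (mC k)))%:R.
(** The estimator in terms of class counts. [lam k] stands for the factor 1 / (|k - j| + 1) and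
    [sg k] for the side of the bin. To the left of the anchor a success of a marginal class is
    [X <= U], so that on both sides the pilot estimate is one ratio minus [sg k] times another. *)
Definition est c o : R :=
  (\sum_k lam k * root c k *
     (suc c o (mA k) / (cnt c (mA k))%:R
      - sg k * (suc c o (mC k) / (cnt c (mC k))%:R)))
  / (\sum_k lam k * root c k).

Definition freq c (d : D) : R := (cnt c d)%:R / n%:R.
(** Normalised by the bin width: [K * freq] and [K ^ 2 * freq] approximate a marginal and a joint
    density. It differs from [root] by the factor [sqrt (n / K)], which cancels in [est]. *)
Definition rt c k : R :=
  Num.sqrt (Num.min (K%:R * freq c (mA k)) (K%:R ^+ 2 * freq c (mC k))).
Definition abar k : R := K%:R * q (mA k).
Definition cbar k : R := K%:R ^+ 2 * q (mC k).
Definition rbar k : R := Num.min (abar k) (cbar k).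

Hypothesis n_gt0 : (0 < n)%N.
Hypothesis K_gt0 : (0 < K)%N.
(** The indices will be 0, ..., L with L at most K + 1, and K + 2 is at most 3 * K. *)
Hypothesis m_le : (m <= 3 * K)%N.
Hypothesis q_ge0 : forall d, 0 <= q d.
Hypothesis q_sum : \sum_d q d = 1.
Hypothesis p01 : forall d, 0 <= p d <= 1.
Hypothesis sg1 : forall k, sg k ^+ 2 = 1.
Hypothesis C_ge0 : 0 <= C.
Hypothesis lam_le : forall k, 0 <= lam k <= C / K%:R.
Hypothesis cbar_le : forall k, cbar k <= C.
(** Both sides carry [lam k]: an index with [lam k = 0] may have an arbitrary bias. *)
Hypothesis beta_le : forall k, lam k * (K%:R * `|beta k|) <= lam k * C.
Hypothesis betaE : forall k, beta k = p (mA k) - sg k * p (mC k) - theta.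

Let q_sum' (i : 'I_n) : \sum_d q d = 1. Proof. exact: q_sum. Qed.
Let bern_ge0 c (i : 'I_n) b : 0 <= bern (p (c i)) b.
Proof. by case: b; rewrite /bern; have /andP[? ?] := p01 (c i); lra. Qed.
Let bern_sum c (i : 'I_n) : \sum_b bern (p (c i)) b = 1.
Proof. by rewrite big_bool /bern /=; ring. Qed.
Let nR : 0 < n%:R :> R. Proof. by rewrite ltr0n. Qed.
Let KR : 0 < K%:R :> R. Proof. by rewrite ltr0n. Qed.

Lemma ler_Ec f g : (forall c, f c <= g c) -> Ec f <= Ec g.
Proof. by move=> fg; apply: ler_pexp => // i; exact: q_ge0. Qed.

Lemma ler_EE F G : (forall c o, F c o <= G c o) -> EE F <= EE G.
Proof. by move=> FG; apply: ler_Ec => c; apply: ler_pexp => // i b. Qed.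

Lemma EE_cst f : EE (fun c _ => f c) = Ec f.
Proof. by apply: eq_pexp => c; rewrite /Eo pexp_cst. Qed.

Lemma EED F G : EE (fun c o => F c o + G c o) = EE F + EE G.
Proof. by rewrite /EE /Ec -pexpD; apply: eq_pexp => c; rewrite /Eo -pexpD. Qed.

Lemma EEB F G : EE (fun c o => F c o - G c o) = EE F - EE G.
Proof. by rewrite /EE /Ec -pexpB; apply: eq_pexp => c; rewrite /Eo -pexpB. Qed.

Lemma EEZ a F : EE (fun c o => a * F c o) = a * EE F.
Proof. by rewrite /EE /Ec -pexpZ; apply: eq_pexp => c; rewrite /Eo -pexpZ. Qed.

Lemma EE_markov (F : {ffun 'I_n -> D} -> {ffun 'I_n -> bool} -> R) (e : R) : 0 < e -> (forall c o, 0 <= F c o) ->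
  EE (fun c o => (e <= F c o)%R%:R) <= EE F / e.
Proof.
move=> e0 F0; rewrite ler_pdivlMr// mulrC -EEZ; apply: ler_EE => c o.
by have [h|_] := leP e (F c o); rewrite /= ?mulr1 ?mulr0.
Qed.

(** [freq c d - q d] is a sum of independent centred terms of total variance at most [q d / n], and
    the first absolute moment is at most the standard deviation. *)
Lemma freq_dist d : Ec (fun c => `|freq c d - q d|) <= Num.sqrt (q d / n%:R).
Proof.
rewrite (le_trans (pexp_norm_sqrt _ _ _))// ler_wsqrtr//.
pose psi (i : 'I_n) (a : D) : R := n%:R^-1 * ((a == d)%:R - q d).
have E1 : \sum_a q a * (a == d)%:R = q d.
  by rewrite (bigD1 d)//= eqxx mulr1 big1 ?addr0// => a /negbTE->; rewrite mulr0.
have psi0 (i : 'I_n) : \sum_a q a * psi i a = 0.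
  transitivity (n%:R^-1 * (\sum_a q a * (a == d)%:R - (\sum_a q a) * q d)).
    rewrite mulr_suml -sumrB mulr_sumr.
    by apply: eq_bigr => a _; rewrite /psi; ring.
  by rewrite E1 q_sum mul1r subrr mulr0.
have psiE c : freq c d - q d = psum psi c.
  rewrite /psum -mulr_sumr sumrB sumr_const card_ord /freq /cnt.
  have -> : \sum_(i < n) (c i == d)%:R = (\sum_(i < n | c i == d) 1)%N%:R :> R.
    by rewrite natr_sum [RHS]big_mkcond; apply: eq_bigr => i _; case: eqP.
  by rewrite -mulr_natr; field; rewrite gt_eqF.
under eq_pexp do rewrite psiE.
rewrite pexp_psum2//.
have pv (i : 'I_n) : pvar (fun=> q) psi i <= n%:R^-1 ^+ 2 * q d.
  rewrite /pvar -subr_ge0.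
  have -> : \sum_a q a * psi i a ^+ 2 =
      n%:R^-1 ^+ 2 * (\sum_a q a * (a == d)%:R - 2 * q d * (\sum_a q a * (a == d)%:R)
        + q d ^+ 2 * \sum_a q a).
    rewrite !mulr_sumr -sumrB -big_split mulr_sumr /=; apply: eq_bigr => a _.
    by rewrite /psi; case: eqP => _ /=; ring.
  rewrite E1 q_sum mulr1 -mulrBr mulr_ge0 ?sqr_ge0//.
  by have := sqr_ge0 (q d); nra.
apply: (le_trans (ler_sum _ (fun i _ => pv i))).
rewrite sumr_const card_ord -[leLHS]mulr_natr le_eqVlt; apply/orP; left.
by apply/eqP; field; rewrite gt_eqF.
Qed.

(** [dk k] bounds the mean error of the two normalised frequencies of index [k], and [Dn] bounds
    [K^-1] times their sum. The cell frequencies are consistent because K ^ 2 / n tends to 0 when K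
    is of order n^(1/3). *)
Definition dk k : R :=
  Num.sqrt (abar k * (K%:R / n%:R)) + Num.sqrt (cbar k * (K%:R ^+ 2 / n%:R)).
Definition Dn : R :=
  4 * Num.sqrt (K%:R / n%:R) + 3 * Num.sqrt (C * (K%:R ^+ 2 / n%:R)).

Lemma abar_ge0 k : 0 <= abar k. Proof. by rewrite mulr_ge0// ltW. Qed.
Lemma cbar_ge0 k : 0 <= cbar k. Proof. by rewrite mulr_ge0 ?sqr_ge0. Qed.
Lemma dk_ge0 k : 0 <= dk k. Proof. by rewrite addr_ge0 ?sqrtr_ge0. Qed.

Lemma Ec_freq_dist k :
  Ec (fun c => `|K%:R * freq c (mA k) - abar k|
             + `|K%:R ^+ 2 * freq c (mC k) - cbar k|) <= dk k.
Proof.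
rewrite /Ec pexpD lerD//.
  under eq_pexp do rewrite -mulrBr normrM ger0_norm ?ltW//.
  rewrite pexpZ (le_trans (ler_wpM2l (ltW KR) (freq_dist _)))//.
  rewrite -[X in X * _](ger0_norm (ltW KR)) -sqrtr_sqr -sqrtrM ?sqr_ge0//.
  by rewrite ler_wsqrtr// /abar le_eqVlt; apply/orP; left; apply/eqP; ring.
under eq_pexp do rewrite -mulrBr normrM ger0_norm ?sqr_ge0//.
rewrite pexpZ (le_trans (ler_wpM2l (sqr_ge0 _) (freq_dist _)))//.
rewrite -[X in X * _](ger0_norm (sqr_ge0 _)) -sqrtr_sqr -sqrtrM ?sqr_ge0//.
by rewrite ler_wsqrtr// /cbar le_eqVlt; apply/orP; left; apply/eqP; ring.
Qed.

(** The [abar k] are averages of a possibly unbounded density. What is bounded is their sum, by [K],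
    because the marginal classes are disjoint; [sqrt a <= 1 + a] brings this sum into play. The
    constants are 4 = 3 + 1 and 3, from [m <= 3 * K]. *)
Lemma sum_dk : K%:R^-1 * \sum_k dk k <= Dn.
Proof.
have qA : \sum_k q (mA k) <= 1.
  rewrite -q_sum.
  have -> : \sum_k q (mA k) = \sum_(d <- [seq mA k | k <- enum 'I_m]) q d.
    by rewrite big_map big_enum.
  rewrite big_uniq /=; last by rewrite map_inj_uniq ?enum_uniq// => x y [].
  by rewrite [leRHS](bigID (mem [seq mA k | k <- enum 'I_m]))/= lerDl sumr_ge0.
pose x : R := K%:R / n%:R.
have x0 : 0 <= x by rewrite divr_ge0 ?ler0n.
have H k : dk k <= (1 + abar k) * Num.sqrt x + Num.sqrt (C * (K%:R ^+ 2 / n%:R)).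
  apply: lerD; last first.
    by rewrite ler_wsqrtr// ler_wpM2r// divr_ge0 ?sqr_ge0// ler0n.
  rewrite sqrtrM ?abar_ge0// ler_wpM2r ?sqrtr_ge0//.
  have a0 := abar_ge0 k; rewrite -[leRHS]ger0_norm; last lra.
  rewrite -sqrtr_sqr ler_wsqrtr//; nra.
rewrite ler_pdivrMl// (le_trans (ler_sum _ (fun k _ => H k)))//.
rewrite big_split/= -mulr_suml big_split/= !sumr_const card_ord -/x.
rewrite -mulr_sumr -[1 *+ m]/(m%:R) -[_ *+ m]mulr_natl.
have mR : m%:R <= 3 * K%:R :> R by rewrite -natrM ler_nat.
have s1 := sqrtr_ge0 x; have s2 := sqrtr_ge0 (C * (K%:R ^+ 2 / n%:R)).
rewrite /Dn -/x mulrDr lerD//.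
  rewrite (mulrA K%:R) ler_wpM2r//.
  by have := ler_wpM2l (ltW KR) qA; lra.
by rewrite -[leLHS]mulr_natl (mulrA K%:R) ler_wpM2r//; lra.
Qed.

Lemma Dn_gt0 : 0 < Dn.
Proof. by rewrite ltr_wpDr ?mulr_ge0 ?sqrtr_ge0// mulr_gt0// sqrtr_gt0 divr_gt0. Qed.

(** The root is linearised by [sqrt d <= e + d / e]. With [e = sqrt Dn] the two parts have the same
    order and add up to [3 * e + e]. *)
Lemma sum_sqrt_dk : K%:R^-1 * \sum_k Num.sqrt (dk k) <= 4 * Num.sqrt Dn.
Proof.
set e := Num.sqrt Dn.
have e0 : 0 < e by rewrite sqrtr_gt0 Dn_gt0.
have H k : Num.sqrt (dk k) <= e + dk k / e.
  have d0 := dk_ge0 k; have s0 := sqrtr_ge0 (dk k).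
  rewrite -{2}(sqr_sqrtr d0) -subr_ge0.
  have -> : e + Num.sqrt (dk k) ^+ 2 / e - Num.sqrt (dk k) =
      (e ^+ 2 + Num.sqrt (dk k) ^+ 2 - Num.sqrt (dk k) * e) / e.
    by field; rewrite gt_eqF.
  by rewrite divr_ge0 ?(ltW e0)//; nra.
apply: (le_trans (ler_wpM2l _ (ler_sum _ (fun k _ => H k)))).
  by rewrite invr_ge0 ltW.
rewrite big_split/= sumr_const card_ord -mulr_suml mulrDr mulrA.
have mR : m%:R <= 3 * K%:R :> R by rewrite -natrM ler_nat.
have h1 : K%:R^-1 * (e *+ m) <= 3 * e.
  rewrite ler_pdivrMl// -[leLHS]mulr_natl (mulrA K%:R).
  by rewrite ler_wpM2r ?(ltW e0)//; lra.
have h2 : K%:R^-1 * (\sum_k dk k) / e <= e.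
  by rewrite ler_pdivrMr// -expr2 sqr_sqrtr ?sum_dk// ltW// Dn_gt0.
lra.
Qed.

(** The minimum is 1-Lipschitz, the square root is 1/2-Hoelder, and Jensen's inequality moves the
    expectation under the root. *)
Lemma rt_dist k : Ec (fun c => `|rt c k - Num.sqrt (rbar k)|) <= Num.sqrt (dk k).
Proof.
have freq_ge0 c d : 0 <= freq c d by rewrite divr_ge0.
have H c : `|rt c k - Num.sqrt (rbar k)| <=
    Num.sqrt (`|K%:R * freq c (mA k) - abar k|
             + `|K%:R ^+ 2 * freq c (mC k) - cbar k|).
  rewrite (le_trans (sqrt_dist _ _))//.
  - by rewrite le_min !mulr_ge0 ?sqr_ge0// ltW.
  - by rewrite le_min abar_ge0 cbar_ge0.
  - by rewrite ler_wsqrtr// min_dist.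
apply: (le_trans (ler_Ec H)).
rewrite (le_trans (pexp_sqrt_le _ _ _))//.
by rewrite ler_wsqrtr// Ec_freq_dist.
Qed.

Lemma sum_rt_dist (l : 'I_m -> R) (B : R) : 0 <= B ->
  (forall k, 0 <= l k <= B / K%:R) ->
  Ec (fun c => \sum_k l k * `|rt c k - Num.sqrt (rbar k)|) <= B * (4 * Num.sqrt Dn).
Proof.
move=> B0 lB; rewrite /Ec pexp_sum.
apply: (@le_trans _ _ (\sum_k B / K%:R * Num.sqrt (dk k))).
  apply: ler_sum => k _; rewrite pexpZ; have /andP[l0 l1] := lB k.
  by rewrite ler_pM ?rt_dist//; apply: pexp_ge0 => // i.
by rewrite -mulr_sumr -mulrA ler_wpM2l// sum_sqrt_dk.
Qed.

Definition pq k : R := p (mC k) * (1 - p (mC k)).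
Definition rho c : R := \sum_k lam k * rt c k.
Definition rhobar : R := \sum_k lam k * Num.sqrt (rbar k).
Definition bias c : R := \sum_k lam k * rt c k * (K%:R * beta k).
Definition biasbar : R := \sum_k lam k * Num.sqrt (rbar k) * (K%:R * beta k).
(** Contribution of a cell to the conditional variance. This quotient is unstable where the cell
    density is small; [edge b] measures the total weight of the indices where that density is below
    [b]. *)
Definition vratio c k : R :=
  Num.min (K%:R * freq c (mA k)) (K%:R ^+ 2 * freq c (mC k))
  / (K%:R ^+ 2 * freq c (mC k)).
(** Up to a deterministic factor, the variance of the cell noise given the classes; [noiseC_var]
    makes the factor explicit. *)
Definition vcond c : R := \sum_k K%:R * lam k ^+ 2 * vratio c k * pq k.
Definition vbar : R := \sum_k K%:R * lam k ^+ 2 * (rbar k / cbar k) * pq k.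
Definition edge (b : R) : R := \sum_k K%:R * lam k ^+ 2 * (cbar k < b)%R%:R.

Lemma rho_dist : Ec (fun c => `|rho c - rhobar|) <= C * (4 * Num.sqrt Dn).
Proof.
apply: (le_trans _ (sum_rt_dist C_ge0 lam_le)); apply: ler_Ec => c.
rewrite /rho /rhobar -sumrB (le_trans (ler_norm_sum _ _ _))//.
apply: ler_sum => k _; rewrite -mulrBr normrM ger0_norm//.
by case/andP: (lam_le k).
Qed.

Lemma bias_dist : Ec (fun c => `|bias c - biasbar|) <= C * (C * (4 * Num.sqrt Dn)).
Proof.
apply: (le_trans _ (ler_wpM2l C_ge0 (sum_rt_dist C_ge0 lam_le))).
rewrite /Ec -pexpZ; apply: ler_Ec => c.
rewrite /bias /biasbar -sumrB (le_trans (ler_norm_sum _ _ _))// mulr_sumr.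
apply: ler_sum => k _; have /andP[l0 _] := lam_le k.
rewrite -mulrBl -mulrBr !normrM (ger0_norm l0) (ger0_norm (ltW KR)).
by rewrite mulrAC mulrA [C * _]mulrC ler_wpM2r.
Qed.

Lemma pq01 k : 0 <= pq k <= 1.
Proof. by rewrite /pq; have /andP[? ?] := p01 (mC k); apply/andP; split; nra. Qed.

Lemma freq_ge0 c d : 0 <= freq c d. Proof. by rewrite divr_ge0. Qed.

Lemma vratio01 c k : 0 <= vratio c k <= 1.
Proof.
have h1 := freq_ge0 c (mA k); have h2 := freq_ge0 c (mC k).
have h3 : 0 <= K%:R ^+ 2 * freq c (mC k) by rewrite mulr_ge0 ?sqr_ge0.
rewrite /vratio divr_ge0//=; last by rewrite le_min h3 mulr_ge0// ltW.
move: h3; rewrite le_eqVlt => /predU1P[<-|h3]; first by rewrite invr0 mulr0.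
by rewrite ler_pdivrMr// mul1r ge_min lexx orbT.
Qed.

(** Where the cell density is at least [b], the quotient inherits the error of the frequencies.
    Elsewhere both quotients lie in the unit interval, and the error 1 is charged to the
    indicator. *)
Lemma vratio_dist (b : R) k : 0 < b -> Ec (fun c => `|vratio c k - rbar k / cbar k|)
  <= 2 / b * dk k + (cbar k < b)%R%:R.
Proof.
move=> b0; have [cb|bc] := ltP (cbar k) b.
  apply: (@le_trans _ _ 1); last by rewrite lerDr mulr_ge0 ?dk_ge0// divr_ge0// ltW.
  rewrite -[leRHS](pexp_cst q_sum'); apply: ler_Ec => c.
  have /andP[? ?] := vratio01 c k.
  suff /andP[? ?] : 0 <= rbar k / cbar k <= 1 by rewrite ler_norml; apply/andP; split; lra.
  have a0 := abar_ge0 k; have c0 := cbar_ge0 k.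
  rewrite divr_ge0 ?le_min ?a0 ?c0//=.
  move: c0; rewrite le_eqVlt => /predU1P[<-|c0]; first by rewrite invr0 mulr0.
  by rewrite ler_pdivrMr// mul1r ge_min lexx orbT.
rewrite addr0; have c0 := lt_le_trans b0 bc.
apply: (le_trans _ (ler_wpM2l _ (Ec_freq_dist k))); last by rewrite divr_ge0// ltW.
rewrite /Ec -pexpZ; apply: ler_Ec => c; rewrite /vratio /rbar.
set a := abar k; set d := cbar k; set a' := K%:R * _; set d' := K%:R ^+ 2 * _.
have a0 : 0 <= a by exact: abar_ge0.
have a'0 : 0 <= a' by rewrite mulr_ge0 ?freq_ge0// ltW.
have d'0 : 0 <= d' by rewrite mulr_ge0 ?freq_ge0 ?sqr_ge0.
have md := min_dist a' d' a d.
set x := Num.min a' d'; set y := Num.min a d; rewrite -/x -/y in md.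
have xd : x <= d' by rewrite ge_min lexx orbT.
have x0 : 0 <= x by rewrite le_min a'0.
have E : `|x / d' - y / d| <= (`|x - y| + `|d' - d|) / d.
  (* Only the deterministic [d] is divided by. The factor [x / d'] lies in the unit interval, also
     when the empirical [d'] is 0, so [d'] needs no lower bound. *)
  have -> : x / d' - y / d = ((x - y) + x / d' * (d - d')) / d.
    move: d'0; rewrite le_eqVlt => /predU1P[d'0|d'0].
      have -> : x = 0 by apply/eqP; rewrite eq_le x0 andbT d'0.
      by rewrite !mul0r addr0 !sub0r mulNr.
    by field; rewrite !gt_eqF.
  rewrite normrM normfV (gtr0_norm c0) ler_wpM2r ?invr_ge0 ?(ltW c0)//.
  rewrite (le_trans (ler_normD _ _))// lerD2l normrM distrC ler_piMl//.
  rewrite ger0_norm ?divr_ge0//.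
  move: d'0; rewrite le_eqVlt => /predU1P[<-|d'0]; first by rewrite invr0 mulr0.
  by rewrite ler_pdivrMr// mul1r.
apply: (le_trans E).
apply: (@le_trans _ _ ((2 * (`|a' - a| + `|d' - d|)) / d)).
  rewrite ler_wpM2r ?invr_ge0 ?(ltW c0)//.
  have := normr_ge0 (a' - a); have := normr_ge0 (d' - d); lra.
rewrite mulrAC ler_wpM2r ?addr_ge0// ler_wpM2l// lef_pV2//.
Qed.

Lemma vcond_dist (b : R) : 0 < b ->
  Ec (fun c => `|vcond c - vbar|) <= C ^+ 2 * (2 / b) * Dn + edge b.
Proof.
move=> b0.
have L k : 0 <= K%:R * lam k ^+ 2 <= C ^+ 2 / K%:R.
  have /andP[l0 l1] := lam_le k; rewrite mulr_ge0 ?sqr_ge0 ?(ltW KR)//=.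
  have -> : C ^+ 2 / K%:R = K%:R * (C / K%:R) ^+ 2 by field; rewrite gt_eqF.
  by rewrite ler_wpM2l ?(ltW KR)// ler_sqr// nnegrE// divr_ge0// ltW.
apply: (@le_trans _ _ (Ec (fun c => \sum_k K%:R * lam k ^+ 2 *
    `|vratio c k - rbar k / cbar k|))).
  apply: ler_Ec => c; rewrite /vcond /vbar -sumrB (le_trans (ler_norm_sum _ _ _))//.
  apply: ler_sum => k _; have /andP[L0 _] := L k; have /andP[v0 v1] := pq01 k.
  have -> : K%:R * lam k ^+ 2 * vratio c k * pq k -
      K%:R * lam k ^+ 2 * (rbar k / cbar k) * pq k =
      K%:R * lam k ^+ 2 * (vratio c k - rbar k / cbar k) * pq k by ring.
  by rewrite normrM normrM (ger0_norm v0) (ger0_norm L0) ler_piMr// mulr_ge0.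
rewrite /Ec pexp_sum.
apply: (@le_trans _ _ (\sum_k (C ^+ 2 / K%:R * (2 / b * dk k)
    + K%:R * lam k ^+ 2 * (cbar k < b)%R%:R))).
  apply: ler_sum => k _; have /andP[L0 L1] := L k; rewrite pexpZ.
  apply: (le_trans (ler_wpM2l L0 (vratio_dist k b0))).
  by rewrite mulrDr lerD2r ler_wpM2r// mulr_ge0 ?dk_ge0// divr_ge0// ltW.
rewrite big_split/= lerD2r -mulr_sumr -mulr_sumr.
have -> : C ^+ 2 / K%:R * (2 / b * \sum_k dk k) =
   C ^+ 2 * (2 / b) * (K%:R^-1 * \sum_k dk k) by ring.
by rewrite ler_wpM2l ?sum_dk// mulr_ge0 ?sqr_ge0// divr_ge0// ltW.
Qed.

(** Given the classes, a linear combination of centred success counts is a sum of independent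
    centred contributions of single observations; those of class [None] contribute nothing. *)
Definition noise c (al : bool * 'I_m -> R) (i : 'I_n) (b : bool) : R :=
  if c i is Some d then al d * (b%:R - p (Some d)) else 0.

Lemma sum_class c (F : bool * 'I_m -> 'I_n -> R) :
  \sum_i (if c i is Some d then F d i else 0) =
  \sum_d \sum_(i < n | c i == Some d) F d i.
Proof.
under [RHS]eq_bigr do rewrite big_mkcond.
rewrite exchange_big; apply: eq_bigr => i _ /=.
case: (c i) => [d|]; last by rewrite big1.
rewrite (bigD1 d)//= eqxx big1 ?addr0// => d' d'd.
by case: eqP => // -[dd]; rewrite dd eqxx in d'd.
Qed.

Lemma noise_mean c al i : \sum_b bern (p (c i)) b * noise c al i b = 0.
Proof.
rewrite big_bool /bern /noise /=; case: (c i) => [d|]; last by rewrite !mulr0 addr0.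
by ring.
Qed.

Lemma noise_sum c al o : psum (noise c al) o =
  \sum_d al d * (suc c o (Some d) - (cnt c (Some d))%:R * p (Some d)).
Proof.
rewrite /psum (sum_class c (fun d i => al d * ((o i)%:R - p (Some d)))).
apply: eq_bigr => d _; rewrite -mulr_sumr sumrB /suc /cnt natr_sum mulr_suml.
by congr (_ * (_ - _)); apply: eq_bigr => i _; rewrite mul1r.
Qed.

Lemma noise_var c al :
  \sum_i pvar (fun i => bern (p (c i))) (noise c al) i =
  \sum_d al d ^+ 2 * (cnt c (Some d))%:R * (p (Some d) * (1 - p (Some d))).
Proof.
transitivity (\sum_i (if c i is Some d then
    al d ^+ 2 * (p (Some d) * (1 - p (Some d))) else 0)).
  apply: eq_bigr => i _; rewrite /pvar big_bool /bern /noise /=.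
  by case: (c i) => [d|]; ring.
rewrite (sum_class c (fun d _ => al d ^+ 2 * (p (Some d) * (1 - p (Some d))))).
apply: eq_bigr => d _; rewrite /cnt natr_sum mulr_sumr mulr_suml.
by apply: eq_bigr => i _; ring.
Qed.

(** An empty class has weight zero, so the value 0 of a ratio with zero denominator never
    matters. *)
Lemma rt_cnt0 c k : cnt c (mA k) = 0%N \/ cnt c (mC k) = 0%N -> rt c k = 0.
Proof.
move=> h; apply/eqP; rewrite sqrtr_eq0 /freq.
by case: h => ->; rewrite mul0r mulr0 ge_min lexx ?orbT.
Qed.

Lemma root_rt c k : root c k = Num.sqrt (n%:R / K%:R) * rt c k.
Proof.
rewrite /root /rt -sqrtrM ?divr_ge0//; congr Num.sqrt.
rewrite minr_pMr ?divr_ge0// /freq natr_min natrM.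
by congr Num.min; field; rewrite !gt_eqF.
Qed.

Lemma rt_sq c k : rt c k ^+ 2 =
  Num.min (K%:R * freq c (mA k)) (K%:R ^+ 2 * freq c (mC k)).
Proof.
by rewrite sqr_sqrtr// le_min !mulr_ge0 ?freq_ge0 ?sqr_ge0// ltW.
Qed.

Section standardised.
Variables (sn w mu : R).
Hypothesis sn_gt0 : 0 < sn.
Hypothesis w_gt0 : 0 < w.

(** Coefficients of the noise of the marginal ratios and of the cell ratios. Only the latter are
    scaled by [sn / w]: their noise is the one that survives in the limit, while the former is an
    error term. *)
Definition alA c (d : bool * 'I_m) : R :=
  if d.1 then lam d.2 * rt c d.2 / (cnt c (Some d))%:R else 0.
Definition alC c (d : bool * 'I_m) : R :=
  if d.1 then 0
  else - (sg d.2 * sn / w) * (lam d.2 * rt c d.2 / (cnt c (Some d))%:R).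

Definition noiseA c o : R := psum (noise c (alA c)) o.
Definition noiseC c o : R := psum (noise c (alC c)) o.

Let sum_pair (F : bool * 'I_m -> R) :
  \sum_d F d = \sum_k F (true, k) + \sum_k F (false, k).
Proof.
transitivity (\sum_b \sum_k F (b, k)); last by rewrite big_bool.
by rewrite pair_bigA; apply: eq_bigr => -[].
Qed.

Lemma noiseAE c o : noiseA c o =
  \sum_k lam k * rt c k * (suc c o (mA k) / (cnt c (mA k))%:R - p (mA k)).
Proof.
rewrite /noiseA noise_sum sum_pair /alA /= [X in _ + X]big1 ?addr0; last first.
  by move=> k _; rewrite mul0r.
apply: eq_bigr => k _; have [N0|N0] := eqVneq (cnt c (mA k)) 0%N.
  by rewrite rt_cnt0; [rewrite !mulr0 !mul0r|left].
by rewrite /mA; field; rewrite pnatr_eq0.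
Qed.

Lemma noiseCE c o : noiseC c o = - (sn / w) *
  \sum_k lam k * rt c k * (sg k * (suc c o (mC k) / (cnt c (mC k))%:R - p (mC k))).
Proof.
rewrite /noiseC noise_sum sum_pair /alC /= [X in X + _]big1 ?add0r; last first.
  by move=> k _; rewrite mul0r.
rewrite mulr_sumr; apply: eq_bigr => k _.
have [N0|N0] := eqVneq (cnt c (mC k)) 0%N.
  by rewrite rt_cnt0; [rewrite !(mulr0, mul0r)|right].
have N0R : (cnt c (Some (false, k)))%:R != 0 :> R by rewrite pnatr_eq0.
by rewrite /mC; field; rewrite N0R gt_eqF.
Qed.

(** For a marginal class with [N] members [rt ^ 2 / N] is at most [K / n], so each of the at most
    [3 * K] indices adds at most [(C / K) ^ 2 * (K / n)]. A total of order 1 / n stays negligible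
    after multiplication by [sn ^ 2] when [sn] is of order n^(1/3). *)
Lemma Eo_noiseA c : Eo c (fun o => noiseA c o ^+ 2) <= 3 * C ^+ 2 / n%:R.
Proof.
rewrite /Eo pexp_psum2//; last exact: noise_mean.
rewrite noise_var sum_pair /alA /= [X in _ + X]big1 ?addr0; last first.
  by move=> k _; rewrite expr0n/= !mul0r.
apply: (@le_trans _ _ (\sum_(k < m) (C / K%:R) ^+ 2 * (K%:R / n%:R))).
  apply: ler_sum => k _.
  set N : R := (cnt c (Some (true, k)))%:R.
  have N0 : 0 <= N by exact: ler0n.
  have /andP[p0 p1] := p01 (Some (true, k)); have /andP[l0 l1] := lam_le k.
  have v1 : p (Some (true, k)) * (1 - p (Some (true, k))) <= 1 by nra.
  have v0 : 0 <= p (Some (true, k)) * (1 - p (Some (true, k))) by nra.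
  have A0 : 0 <= (lam k * rt c k / N) ^+ 2 * N by rewrite mulr_ge0 ?sqr_ge0.
  apply: (le_trans (ler_piMr A0 v1)).
  have -> : (lam k * rt c k / N) ^+ 2 * N = lam k ^+ 2 * (rt c k ^+ 2 / N).
    have [->|NN] := eqVneq N 0; first by rewrite invr0 !mulr0.
    by field.
  rewrite ler_pM ?sqr_ge0 ?divr_ge0 ?sqr_ge0// ?ler_sqr ?nnegrE ?divr_ge0 ?(ltW KR)//.
  rewrite rt_sq; move: N0; rewrite le_eqVlt => /predU1P[<-|N0].
    by rewrite invr0 mulr0 divr_ge0// ltW.
  rewrite ler_pdivrMr// (@le_trans _ _ (K%:R * freq c (mA k)))//.
    by rewrite ge_min lexx.
  by rewrite /freq /mA -/N le_eqVlt; apply/orP; left; apply/eqP; ring.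
rewrite sumr_const card_ord -[leLHS]mulr_natl.
have mR : m%:R <= 3 * K%:R :> R by rewrite -natrM ler_nat.
have -> : 3 * C ^+ 2 / n%:R = 3 * K%:R * ((C / K%:R) ^+ 2 * (K%:R / n%:R)).
  by field; rewrite !gt_eqF.
by rewrite ler_wpM2r// mulr_ge0 ?sqr_ge0// divr_ge0// ltW.
Qed.

Lemma EE_noiseA : EE (fun c o => `|noiseA c o|) <= Num.sqrt (3 * C ^+ 2 / n%:R).
Proof.
rewrite -[leRHS](pexp_cst q_sum'); apply: ler_Ec => c.
by rewrite (le_trans (pexp_norm_sqrt _ _ _))// ler_wsqrtr// Eo_noiseA.
Qed.

Lemma noiseC_var c :
  \sum_i pvar (fun i => bern (p (c i))) (noise c (alC c)) i =
  sn ^+ 2 * K%:R / n%:R / w ^+ 2 * vcond c.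
Proof.
rewrite noise_var sum_pair /alC /= [X in X + _]big1 ?add0r; last first.
  by move=> k _; rewrite expr0n/= !mul0r.
rewrite /vcond mulr_sumr; apply: eq_bigr => k _.
rewrite /vratio -rt_sq /pq /mC /freq.
have [N0|N0] := eqVneq (cnt c (Some (false, k))) 0%N.
  by rewrite N0 rt_cnt0; [rewrite expr0n /= !(mulr0, mul0r)|right].
have -> : (- (sg k * sn / w) * (lam k * rt c k / (cnt c (Some (false, k)))%:R)) ^+ 2
   = sg k ^+ 2 * (sn / w * (lam k * rt c k / (cnt c (Some (false, k)))%:R)) ^+ 2.
  by ring.
have N0R : (cnt c (Some (false, k)))%:R != 0 :> R by rewrite pnatr_eq0.
by rewrite sg1; field; rewrite N0R !gt_eqF.
Qed.

(** The observation itself makes the size [N] of its class at least 1, and [rt / N <= K * sqrt (N /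
    n) / N <= K / sqrt n]. With [sn] of order n^(1/3) the bound tends to 0: the summands are
    uniformly small, as Stein's method requires. *)
Lemma noiseC_le c i b : `|noise c (alC c) i b| <= sn * C / (w * Num.sqrt n%:R).
Proof.
have sq0 : 0 < Num.sqrt (n%:R : R) by rewrite sqrtr_gt0.
have B0 : 0 <= sn * C / (w * Num.sqrt n%:R).
  by rewrite divr_ge0 ?mulr_ge0 ?sqrtr_ge0// ltW.
have sn0 := ltW sn_gt0; have w0 := ltW w_gt0; have K0 := ltW KR.
rewrite /noise; case E : (c i) => [[bb k]|]; last by rewrite normr0.
rewrite /alC /=; case: bb E => E; first by rewrite mul0r normr0.
set N := cnt c (Some (false, k)).
have N1 : (1 <= N)%N by rewrite /N /cnt (bigD1 i) ?E//=.
have N1R : 1 <= N%:R :> R by rewrite ler1n.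
have N0R : 0 < N%:R :> R by rewrite ltr0n.
have b1 : `|b%:R - p (Some (false, k))| <= 1.
  have /andP[p0 p1] := p01 (Some (false, k)).
  by rewrite ler_norml; case: b => /=; apply/andP; split; lra.
rewrite normrM -[leRHS]mulr1 ler_pM// normrM normrN normrM normrM normfV.
have -> : `|sg k| = 1.
  apply/eqP; rewrite -(@eqrXn2 _ 2)// ?normr_ge0// real_normK ?num_real// sg1.
  by rewrite expr1n.
rewrite (gtr0_norm sn_gt0) (gtr0_norm w_gt0) mul1r.
have /andP[l0 l1] := lam_le k.
have rt0 : 0 <= rt c k by exact: sqrtr_ge0.
rewrite ger0_norm ?divr_ge0 ?mulr_ge0//.
have rtN : rt c k / N%:R <= K%:R / Num.sqrt n%:R.
  rewrite ler_pdivrMr// (@le_trans _ _ (Num.sqrt (K%:R ^+ 2 * freq c (mC k))))//.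
    by rewrite ler_wsqrtr// ge_min lexx orbT.
  rewrite sqrtrM ?sqr_ge0// sqrtr_sqr (gtr0_norm KR) -mulrA ler_wpM2l ?(ltW KR)//.
  rewrite /freq sqrtrM// mulrC sqrtrV// ler_wpM2l ?invr_ge0 ?sqrtr_ge0//.
  rewrite -/N -[leRHS]ger0_norm ?(ltW N0R)// -sqrtr_sqr ler_wsqrtr//.
  by rewrite expr2 ler_peMl// ltW.
have -> : sn * C / (w * Num.sqrt n%:R) =
    sn / w * (C / K%:R * (K%:R / Num.sqrt n%:R)).
  by field; rewrite !gt_eqF.
by rewrite ler_wpM2l ?divr_ge0// -mulrA ler_pM// divr_ge0.
Qed.

Definition zst c o : R := sn * (est c o - theta).
Definition tst c o : R := mu + noiseC c o.
Definition yst (x : R) c o : R :=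
  mu + (x * rho c - sn / K%:R * bias c - sn * noiseA c o) / w.

(** Multiplying by the positive denominator [rho] turns the event into a linear inequality. The cell
    noise goes to one side; bias, marginal noise and the fluctuation of [rho] form the threshold
    [yst] on the other, which is close to [x] when [rho] is close to [w], [sn / K * bias] to
    [w * mu] and [noiseA] is negligible. *)
Lemma zst_le x c o : 0 < rho c -> (zst c o <= x) = (tst c o <= yst x c o).
Proof.
move=> r0; set H := \sum_k lam k * rt c k *
  (sg k * (suc c o (mC k) / (cnt c (mC k))%:R - p (mC k))).
have q0 : 0 < Num.sqrt (n%:R / K%:R : R) by rewrite sqrtr_gt0 divr_gt0.
rewrite /zst.
have -> : est c o = theta + (bias c / K%:R + noiseA c o - H) / rho c.
  have -> : est c o = (\sum_k lam k * rt c k *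
     (suc c o (mA k) / (cnt c (mA k))%:R
      - sg k * (suc c o (mC k) / (cnt c (mC k))%:R))) / rho c.
    have E (F : 'I_m -> R) : \sum_k lam k * root c k * F k =
        Num.sqrt (n%:R / K%:R) * \sum_k lam k * rt c k * F k.
      by rewrite mulr_sumr; apply: eq_bigr => k _; rewrite root_rt; ring.
    have E1 : \sum_k lam k * root c k = Num.sqrt (n%:R / K%:R) * rho c.
      by rewrite mulr_sumr; apply: eq_bigr => k _; rewrite root_rt; ring.
    by rewrite /est E E1 -mulf_div divff ?mul1r// gt_eqF.
  have -> : \sum_k lam k * rt c k *
     (suc c o (mA k) / (cnt c (mA k))%:R
      - sg k * (suc c o (mC k) / (cnt c (mC k))%:R)) =
     theta * rho c + bias c / K%:R + noiseA c o - H.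
    rewrite noiseAE /H /rho /bias mulr_sumr mulr_suml -big_split -big_split -sumrB /=.
    apply: eq_bigr => k _; rewrite betaE.
    set t1 := suc c o (mA k) / _; set t2 := suc c o (mC k) / _.
    by field; rewrite gt_eqF.
  by field; rewrite !gt_eqF.
rewrite /tst /yst [theta + _]addrC addrK mulrA ler_pdivrMr// lerD2l noiseCE -/H.
rewrite ler_pdivlMr// -[LHS]subr_ge0 -[RHS]subr_ge0; congr (0 <= _).
by field; rewrite !gt_eqF.
Qed.

Definition rho_err : R := C * (4 * Num.sqrt Dn) + `|rhobar - w|.
Definition yst_err (x : R) : R :=
  (`|x| * rho_err + sn / K%:R * (C * (C * (4 * Num.sqrt Dn)))
   + `|sn / K%:R * biasbar - w * mu| + sn * Num.sqrt (3 * C ^+ 2 / n%:R)) / w.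

Lemma rho_dist_w : Ec (fun c => `|rho c - w|) <= rho_err.
Proof.
apply: (le_trans _ (lerD rho_dist (lexx _))).
rewrite -[`|rhobar - w|](pexp_cst q_sum') /Ec -pexpD; apply: ler_Ec => c.
by rewrite -(subrKA rhobar) ler_normD.
Qed.

Lemma yst_dist x : EE (fun c o => `|yst x c o - x|) <= yst_err x.
Proof.
have sK : 0 <= sn / K%:R by rewrite divr_ge0// ltW.
apply: (@le_trans _ _ (EE (fun c o => w^-1 * (`|x| * `|rho c - w| +
  sn / K%:R * `|bias c - biasbar| + `|sn / K%:R * biasbar - w * mu| +
  sn * `|noiseA c o|)))).
  apply: ler_EE => c o.
  have -> : yst x c o - x = w^-1 * (x * (rho c - w) - sn / K%:R * (bias c - biasbar)
     - (sn / K%:R * biasbar - w * mu) - sn * noiseA c o).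
    by rewrite /yst; field; rewrite !gt_eqF.
  rewrite normrM gtr0_norm ?invr_gt0// ler_wpM2l ?invr_ge0 ?(ltW w_gt0)//.
  rewrite (le_trans (ler_normB _ _))// lerD//; last by rewrite normrM gtr0_norm.
  rewrite (le_trans (ler_normB _ _))// lerD// (le_trans (ler_normB _ _))// lerD//.
    by rewrite normrM.
  by rewrite normrM ger0_norm.
rewrite EEZ !EED /yst_err mulrC ler_wpM2r ?invr_ge0 ?(ltW w_gt0)//.
have h1 : EE (fun c _ => `|x| * `|rho c - w|) <= `|x| * rho_err.
  rewrite (EEZ `|x| (fun c _ => `|rho c - w|)) ler_wpM2l//.
  by rewrite (EE_cst (fun c => `|rho c - w|)) rho_dist_w.
have h2 : EE (fun c _ => sn / K%:R * `|bias c - biasbar|) <=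
    sn / K%:R * (C * (C * (4 * Num.sqrt Dn))).
  rewrite (EEZ (sn / K%:R) (fun c _ => `|bias c - biasbar|)) ler_wpM2l//.
  by rewrite (EE_cst (fun c => `|bias c - biasbar|)) bias_dist.
have h3 (a : R) : EE (fun _ _ => a) = a.
  by rewrite (EE_cst (fun=> a)) /Ec pexp_cst.
have h4 : EE (fun c o => sn * `|noiseA c o|) <= sn * Num.sqrt (3 * C ^+ 2 / n%:R).
  by rewrite EEZ ler_wpM2l ?EE_noiseA// ltW.
by rewrite h3 !lerD.
Qed.

(** Markov's inequality bounds two exceptional events. Off the first, [rho] is within [w] of [w],
    hence positive and [zst_le] applies; off the second, the threshold is below [x + e], where the
    ramp equals 1. *)
Lemma cdf_le (x e : R) : 0 < e ->
  EE (fun c o => (zst c o <= x)%R%:R) <=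
  EE (fun c o => ramp (x + e) (x + 2 * e) (tst c o)) + (rho_err / w + yst_err x / e).
Proof.
move=> e0.
apply: (le_trans _ (lerD (lexx _) (lerD (ler_wpM2r _ rho_dist_w) (ler_wpM2r _ (yst_dist x))))).
- rewrite -(EE_cst (fun c => `|rho c - w|)).
  apply: (le_trans _ (lerD (lexx _) (lerD (EE_markov w_gt0 _) (EE_markov e0 _)))) => //.
  rewrite -!EED; apply: ler_EE => c o.
  have /andP[r0 r1] := ramp01 (x + e) (x + 2 * e) (tst c o).
  have [h1|h1] := leP w `|rho c - w|; have [h2|h2] := leP e `|yst x c o - x|;
    have [h3|h3] /= := leP (zst c o) x; try lra.
  have rc : 0 < rho c by move: h1; rewrite ltr_norml => /andP[]; lra.
  rewrite ramp1; [lra|lra|].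
  move: h3; rewrite zst_le// => h3; rewrite (le_trans h3)//.
  by move: h2; rewrite ltr_norml => /andP[]; lra.
- by rewrite invr_ge0 ltW.
- by rewrite invr_ge0 ltW.
Qed.

Lemma cdf_ge (x e : R) : 0 < e ->
  EE (fun c o => ramp (x - 2 * e) (x - e) (tst c o)) - (rho_err / w + yst_err x / e)
  <= EE (fun c o => (zst c o <= x)%R%:R).
Proof.
move=> e0; rewrite lerBlDr.
apply: (le_trans _ (lerD (lexx _) (lerD (ler_wpM2r _ rho_dist_w) (ler_wpM2r _ (yst_dist x))))).
- rewrite -(EE_cst (fun c => `|rho c - w|)).
  apply: (le_trans _ (lerD (lexx _) (lerD (EE_markov w_gt0 _) (EE_markov e0 _)))) => //.
  rewrite -!EED; apply: ler_EE => c o.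
  have /andP[r0 r1] := ramp01 (x - 2 * e) (x - e) (tst c o).
  have [h1|h1] := leP w `|rho c - w|; have [h2|h2] := leP e `|yst x c o - x|;
    have [h3|h3] /= := leP (zst c o) x; try lra.
  have rc : 0 < rho c by move: h1; rewrite ltr_norml => /andP[]; lra.
  rewrite ramp0; [lra|lra|].
  move: h3; rewrite ltNge zst_le// -ltNge => h3; rewrite (le_trans _ (ltW h3))//.
  by move: h2; rewrite ltr_norml => /andP[]; lra.
- by rewrite invr_ge0 ltW.
- by rewrite invr_ge0 ltW.
Qed.

Section stein_comparison.
Variables (s eta om Ck c0 b : R) (f g k : R -> R).
Hypothesis s_gt0 : 0 < s.
Hypothesis b_gt0 : 0 < b.
Hypothesis om_ge0 : 0 <= om.
Hypothesis gk : forall y, is_derive y (1 : R) g (k y).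
Hypothesis kE : forall y, k y = f y - c0 + (y - mu) / s ^+ 2 * g y.
Hypothesis k_le : forall y, `|k y| <= Ck.
Hypothesis k_om : forall y z, `|y - z| <= eta -> `|k y - k z| <= om * (1 + y ^+ 2).
Hypothesis eta_le : sn * C / (w * Num.sqrt n%:R) <= eta.

Let kap : R := sn ^+ 2 * K%:R / n%:R / w ^+ 2.

Lemma vcond_le c : 0 <= vcond c <= 3 * C ^+ 2.
Proof.
have H k' : 0 <= K%:R * lam k' ^+ 2 * vratio c k' * pq k' <= C ^+ 2 / K%:R.
  have /andP[l0 l1] := lam_le k'; have /andP[v0 v1] := vratio01 c k'.
  have /andP[p0 p1] := pq01 k'.
  have L0 : 0 <= K%:R * lam k' ^+ 2 by rewrite mulr_ge0 ?sqr_ge0// ltW.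
  have L1 : K%:R * lam k' ^+ 2 <= C ^+ 2 / K%:R.
    have -> : C ^+ 2 / K%:R = K%:R * (C / K%:R) ^+ 2 by field; rewrite gt_eqF.
    by rewrite ler_wpM2l ?(ltW KR)// ler_sqr// nnegrE// divr_ge0// ltW.
  apply/andP; split; first by rewrite mulr_ge0// mulr_ge0.
  by apply: le_trans L1; rewrite -[leLHS]mulrA ler_piMr//; nra.
apply/andP; split; first by apply: sumr_ge0 => k' _; case/andP: (H k').
apply: (@le_trans _ _ (\sum_(k' < m) C ^+ 2 / K%:R)).
  by apply: ler_sum => k' _; case/andP: (H k').
rewrite sumr_const card_ord -[leLHS]mulr_natl.
have mR : m%:R <= 3 * K%:R :> R by rewrite -natrM ler_nat.
have -> : 3 * C ^+ 2 = 3 * K%:R * (C ^+ 2 / K%:R) by field; rewrite gt_eqF.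
by rewrite ler_wpM2r// divr_ge0 ?sqr_ge0// ltW.
Qed.

(** Multiplied by [s ^ 2], Stein's equation turns the left side into the mean of
    [s ^ 2 * k - noiseC * g]. Given the classes, [stein_bound] replaces the second term by
    [kap * vcond] times the mean of [k]. What remains is the distance of the random conditional
    variance from [s ^ 2], against the bound [Ck] of [k]. *)
Lemma stein_comparison : `|EE (fun c o => f (tst c o)) - c0| <=
  (Ck * (kap * (C ^+ 2 * (2 / b) * Dn + edge b) + `|s ^+ 2 - kap * vbar|)
   + 2 * om * (1 + mu ^+ 2 + kap * (3 * C ^+ 2)) * (kap * (3 * C ^+ 2))) / s ^+ 2.
Proof.
have s2 : 0 < s ^+ 2 by rewrite exprn_gt0.
have Ck0 : 0 <= Ck by exact: le_trans (k_le 0).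
have kap0 : 0 <= kap.
  by rewrite /kap !divr_ge0 ?mulr_ge0 ?sqr_ge0// ltW.
rewrite ler_pdivlMr// -[X in _ * X](gtr0_norm s2) -normrM.
have -> : (EE (fun c o => f (tst c o)) - c0) * s ^+ 2 =
    EE (fun c o => s ^+ 2 * k (tst c o) - noiseC c o * g (tst c o)).
  rewrite -[X in _ - X](pexp_cst q_sum') -/(Ec (fun=> c0)) -EE_cst -EEB mulrC -EEZ.
  apply: eq_pexp => c; apply: eq_pexp => o; rewrite kE /tst.
  by field; rewrite gt_eqF.
have H c : `|Eo c (fun o => s ^+ 2 * k (tst c o) - noiseC c o * g (tst c o))| <=
    Ck * (kap * `|vcond c - vbar| + `|s ^+ 2 - kap * vbar|) +
    2 * om * (1 + mu ^+ 2 + kap * (3 * C ^+ 2)) * (kap * (3 * C ^+ 2)).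
  have /andP[v0 v1] := vcond_le c.
  have V1 : kap * vcond c <= kap * (3 * C ^+ 2) by rewrite ler_wpM2l.
  have V0 : 0 <= kap * vcond c by rewrite mulr_ge0.
  have psi_eta i a : `|noise c (alC c) i a| <= eta.
    by rewrite (le_trans (noiseC_le _ _ _)).
  have := @stein_bound _ _ _ _ (bern_ge0 c) (bern_sum c) _ (noise_mean c (alC c))
    mu eta om g k psi_eta gk om_ge0 k_om.
  rewrite noiseC_var -/kap => SB.
  have Ek : `|Eo c (fun o => k (tst c o))| <= Ck.
    rewrite (le_trans (ler_norm_pexp _ _))//.
    rewrite -[leRHS](pexp_cst (bern_sum c)); apply: ler_pexp => // o.
  rewrite /Eo pexpB pexpZ.
  set A := pexp _ (fun o => k (tst c o)); rewrite -/A in SB Ek.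
  set B := pexp _ (fun o => noiseC c o * g _); rewrite -/B in SB.
  have -> : s ^+ 2 * A - B = (s ^+ 2 - kap * vcond c) * A - (B - kap * vcond c * A).
    by ring.
  rewrite (le_trans (ler_normB _ _))// lerD//.
    rewrite normrM mulrC ler_pM//.
    have -> : s ^+ 2 - kap * vcond c =
      (s ^+ 2 - kap * vbar) - kap * (vcond c - vbar) by ring.
    by rewrite (le_trans (ler_normB _ _))// addrC normrM (ger0_norm kap0).
  apply: (le_trans SB); rewrite ler_pM//; last first.
    by rewrite ler_wpM2l ?mulr_ge0// lerD2l.
  by rewrite !mulr_ge0// addr_ge0// addr_ge0// sqr_ge0.
apply: (le_trans (ler_norm_pexp _ _)); first by move=> i; exact: q_ge0.
apply: (le_trans (ler_Ec H)).
rewrite /Ec pexpD pexp_cst// pexpZ pexpD pexp_cst// pexpZ.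
rewrite lerD2r ler_wpM2l// lerD2r ler_wpM2l//.
exact: vcond_dist.
Qed.

End stein_comparison.

End standardised.

End birge_model.

(** * Asymptotics of the discrete model *)

Definition cbrt {R : realType} (n : nat) : R := n%:R `^ 3^-1.

Lemma cbrt3 {R : realType} (n : nat) : cbrt n ^+ 3 = n%:R :> R.
Proof.
by rewrite -powR_mulrn ?powR_ge0// /cbrt -powRrM mulVf ?powRr1.
Qed.

Lemma cbrt_gt0 {R : realType} (n : nat) : (0 < n)%N -> 0 < cbrt n :> R.
Proof. by move=> n0; rewrite powR_gt0// ltr0n. Qed.

Lemma cvg_cbrtV {R : realType} : (cbrt n)^-1 @[n --> \oo] --> (0 : R).
Proof.
apply/cvgrPdist_lt => e e0; near=> n.
have n0 : (0 < n)%N by near: n; exists 1%N.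
have s0 : 0 < cbrt n :> R by exact: cbrt_gt0.
rewrite sub0r normrN gtr0_norm ?invr_gt0// invf_plt ?posrE//.
rewrite ltNge; apply/negP => h.
have : n%:R <= e^-1 ^+ 3 :> R.
  by rewrite -cbrt3 lerXn2r// nnegrE ?ltW// invr_gt0.
apply/negP; rewrite -ltNge; near: n.
exact: nbhs_infty_gtr.
Unshelve. all: by end_near. Qed.

(* C bounds the normalised parameters; lam k is zero for the indices k that do
   not contribute. *)
Record bmodel (R : realType) := BModel {
  bK : nat; bm : nat;
  bq : option (bool * 'I_bm) -> R; bp : option (bool * 'I_bm) -> R;
  blam : 'I_bm -> R; bbeta : 'I_bm -> R; bsg : 'I_bm -> R; btheta : R }.
Arguments bq {R} b _.
Arguments bp {R} b _.
Arguments blam {R} b _.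
Arguments bbeta {R} b _.
Arguments bsg {R} b _.

Definition bmodel_ok (R : realType) (C : R) (M : bmodel R) : Prop :=
  [/\ [/\ (0 < bK M)%N, (bm M <= 3 * bK M)%N, (forall d, 0 <= bq M d),
      \sum_d bq M d = 1 & (forall d, 0 <= bp M d <= 1)],
    (forall k, bsg M k ^+ 2 = 1),
    (forall k, 0 <= blam M k <= C / (bK M)%:R),
    (forall k, cbar (bK M) (bq M) k <= C) &
    (forall k, blam M k * ((bK M)%:R * `|bbeta M k|) <= blam M k * C) /\
    (forall k, bbeta M k = bp M (mA k) - bsg M k * bp M (mC k) - btheta M)].

(** The finite bounds are evaluated at [sn = cbrt n]. Since [sn / K] tends to [c] and
    [sn ^ 2 * K / n] to [c^-1], the limits prescribed for [biasbar] and [vbar] produce the mean [mu]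
    and the variance [tau / (c * w ^ 2)]. Ramps on both sides of [x] squeeze the distribution
    function, and continuity of the Gaussian one closes the gap. *)
Theorem discrete_clt (R : realType) (M : nat -> bmodel R) (C b w mu tau s c : R) :
  0 <= C -> 0 < b -> 0 < w -> 0 < c -> 0 < s -> s ^+ 2 = tau / (c * w ^+ 2) ->
  (\forall n \near \oo, bmodel_ok C (M n)) ->
  (bK (M n))%:R / cbrt n @[n --> \oo] --> c^-1 ->
  rhobar (bK (M n)) (bq (M n)) (blam (M n)) @[n --> \oo] --> w ->
  biasbar (bK (M n)) (bq (M n)) (blam (M n)) (bbeta (M n)) @[n --> \oo] -->
    w * (mu / c) ->
  vbar (bK (M n)) (bq (M n)) (bp (M n)) (blam (M n)) @[n --> \oo] --> tau ->
  edge (bK (M n)) (bq (M n)) (blam (M n)) b @[n --> \oo] --> (0 : R) ->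
  forall x, EE (bq (M n)) (bp (M n))
    (fun (cl : {ffun 'I_n -> _}) o =>
      (zst (bK (M n)) (blam (M n)) (bsg (M n)) (btheta (M n)) (cbrt n) cl o <= x)%R%:R)
    @[n --> \oo] --> fine (normal_prob mu s `]-oo, x]).
Proof.
move=> C0 b0 w0 c0 s0 sE okM uc rhoc biasc vc edgec x.
pose Kn n := bK (M n).
(* All rates reduce to [u] and [v]: [K / n = u * v ^ 2] and [K ^ 2 / n = u ^ 2 * v]. At [n = 0] both
   sides are 0 because the inverse of 0 is 0. *)
pose u n : R := (Kn n)%:R / cbrt n.
pose v n : R := (cbrt n)^-1.
have vc0 : v n @[n --> \oo] --> (0 : R) by exact: cvg_cbrtV.
have nE n : n%:R = cbrt n ^+ 3 :> R by rewrite cbrt3.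
have sqc (f : nat -> R) (l : R) : f n @[n --> \oo] --> l ->
    Num.sqrt (f n) @[n --> \oo] --> Num.sqrt l.
  by move=> fl; apply: (cvg_comp _ _ fl); exact: sqrt_continuous.
have Dc : Dn n (Kn n) C @[n --> \oo] --> (0 : R).
  have -> : (fun n => Dn n (Kn n) C) = (fun n => 4 * Num.sqrt (u n * v n ^+ 2) +
     3 * Num.sqrt (C * (u n ^+ 2 * v n))).
    apply/funext => n; rewrite /Dn /u /v (nE n).
    have [->|sn0] := eqVneq (cbrt n : R) 0.
      by rewrite !(expr0n, invr0, mulr0)/=.
    by congr (4 * Num.sqrt _ + 3 * Num.sqrt _); field.
  have -> : (0 : R) = 4 * Num.sqrt (c^-1 * 0 ^+ 2) + 3 * Num.sqrt (C * (c^-1 ^+ 2 * 0)).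
    by rewrite expr0n/= !mulr0 sqrtr0 !mulr0 addr0.
  apply: cvgD; apply: cvgMr; apply: sqc.
    by apply: cvgM => //; exact: (cvgM vc0 vc0).
  by apply: cvgMr; apply: cvgM => //; exact: (cvgM uc uc).
have sDc : Num.sqrt (Dn n (Kn n) C) @[n --> \oo] --> (0 : R).
  by rewrite -[X in _ --> X]sqrtr0; exact: sqc.
pose re n := rho_err n (Kn n) (bq (M n)) (blam (M n)) C w.
have rec : re n @[n --> \oo] --> (0 : R).
  have -> : (0 : R) = C * (4 * 0) + `|w - w| by rewrite subrr normr0 !mulr0 addr0.
  apply: cvgD; first by apply: cvgMr; exact: cvgMr.
  by apply: cvg_norm; apply: cvgB => //; exact: cvg_cst.
have c0' : c != 0 by rewrite gt_eqF.
have cKc : cbrt n / (Kn n)%:R @[n --> \oo] --> c.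
  have -> : (fun n => cbrt n / (Kn n)%:R) = (fun n => (u n)^-1).
    by apply/funext => n; rewrite /u invf_div.
  by rewrite -[X in _ --> X]invrK; apply: cvgV => //; rewrite invr_eq0.
pose ye n := yst_err n (Kn n) (bq (M n)) (blam (M n)) (bbeta (M n)) C (cbrt n) w mu x.
have yec : ye n @[n --> \oo] --> (0 : R).
  have -> : (0 : R) = (`|x| * 0 + c * (C * (C * (4 * 0))) + `|c * (w * (mu / c)) - w * mu|
      + Num.sqrt (3 * C ^+ 2 * 0)) / w.
    have -> : c * (w * (mu / c)) - w * mu = 0 by field.
    by rewrite normr0 !mulr0 sqrtr0 !addr0 mul0r.
  apply: cvgMl; apply: cvgD.
    apply: cvgD; [apply: cvgD|].
    - by apply: cvgMr; exact: rec.
    - by apply: cvgM => //; apply: cvgMr; apply: cvgMr; exact: cvgMr.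
    - by apply: cvg_norm; apply: cvgB; [exact: cvgM|exact: cvg_cst].
  have -> : (fun n => cbrt n * Num.sqrt (3 * C ^+ 2 / n%:R)) =
      (fun n => Num.sqrt (3 * C ^+ 2 * v n)).
    apply/funext => n; have cb0 : 0 <= cbrt n :> R by exact: powR_ge0.
    rewrite -[X in X * _]ger0_norm// -sqrtr_sqr -sqrtrM ?sqr_ge0// (nE n) /v.
    have [->|sn0] := eqVneq (cbrt n : R) 0.
      by rewrite expr0n/= mul0r invr0 mulr0.
    by congr Num.sqrt; field.
  by apply: sqc; exact: cvgMr.
pose kap n : R := cbrt n ^+ 2 * (Kn n)%:R / n%:R / w ^+ 2.
have kapc : kap n @[n --> \oo] --> c^-1 / w ^+ 2.
  have -> : kap = (fun n => u n / w ^+ 2).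
    apply/funext => n; rewrite /kap /u (nE n).
    have [->|sn0] := eqVneq (cbrt n : R) 0.
      by rewrite !expr0n/= !mul0r invr0 mulr0 mul0r.
    by field; rewrite sn0 gt_eqF.
  exact: cvgMl.
have etac : cbrt n * C / (w * Num.sqrt n%:R) @[n --> \oo] --> (0 : R).
  have -> : (fun n => cbrt n * C / (w * Num.sqrt n%:R)) =
      (fun n => C / w * Num.sqrt (v n)).
    apply/funext => n; have cb0 : 0 <= cbrt n :> R by exact: powR_ge0.
    rewrite /v sqrtrV// (nE n) exprS sqrtrM// sqrtr_sqr ger0_norm//.
    have [->|sn0] := eqVneq (cbrt n : R) 0.
      by rewrite sqrtr0 !mul0r invr0 mulr0.
    have sq0 : Num.sqrt (cbrt n : R) != 0 by rewrite sqrtr_eq0 -ltNge lt_neqAle eq_sym sn0.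
    by field; rewrite sq0 sn0 gt_eqF.
  have -> : (0 : R) = C / w * Num.sqrt 0 by rewrite sqrtr0 mulr0.
  by apply: cvgMr; exact: sqc.
pose Phi y := fine (normal_prob mu s `]-oo, y]).
pose Er a a' n := EE (bq (M n)) (bp (M n))
  (fun (cl : {ffun 'I_n -> _}) o => ramp a a'
      (tst (Kn n) (bp (M n)) (blam (M n)) (bsg (M n)) (cbrt n) w mu cl o)).
have rampc a a' : a < a' -> exists2 cc, Phi a <= cc <= Phi a' &
    Er a a' n @[n --> \oo] --> cc.
  move=> aa'; have [g [k [cc [gk kE [Ck kC] kw Phic]]]] := stein_pair mu s0 aa'.
  exists cc => //; apply/cvgrPdist_lt => e e0.
  have Ck0 : 0 <= Ck by exact: le_trans (kC 0).
  (* [V1] exceeds the limit of [kap n * (3 * C ^ 2)], hence eventually bounds it; [om] is then tuned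
     so that the remainder of Stein's method costs at most [e * s ^ 2 / 2], half of the
     tolerance. *)
  pose V1 := c^-1 / w ^+ 2 * (3 * C ^+ 2) + 1.
  have V1_ge1 : 1 <= V1.
    by rewrite lerDr !mulr_ge0 ?invr_ge0 ?sqr_ge0// ltW.
  have V1_gt0 : 0 < V1 by exact: lt_le_trans V1_ge1.
  have Z0 : 0 < 1 + mu ^+ 2 + V1 by have := sqr_ge0 mu; lra.
  have s20 : 0 < s ^+ 2 by rewrite exprn_gt0.
  pose om := e * s ^+ 2 / (4 * (1 + mu ^+ 2 + V1) * V1).
  have om0 : 0 < om by rewrite divr_gt0 ?mulr_gt0.
  have [eta eta0 kom] := kw _ om0.
  have H1 : Ck * (kap n * (C ^+ 2 * (2 / b) * Dn n (Kn n) C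
      + edge (Kn n) (bq (M n)) (blam (M n)) b)
      + `|s ^+ 2 - kap n * vbar (Kn n) (bq (M n)) (bp (M n)) (blam (M n))|)
      @[n --> \oo] --> (0 : R).
    have -> : (0 : R) = Ck * (c^-1 / w ^+ 2 * (C ^+ 2 * (2 / b) * 0 + 0) +
        `|s ^+ 2 - c^-1 / w ^+ 2 * tau|).
      have -> : s ^+ 2 - c^-1 / w ^+ 2 * tau = 0.
        by rewrite sE; field; rewrite c0' gt_eqF.
      by rewrite normr0 !(mulr0, addr0).
    apply: cvgMr; apply: cvgD.
      by apply: cvgM => //; apply: cvgD => //; exact: cvgMr.
    by apply: cvg_norm; apply: cvgB; [exact: cvg_cst|exact: cvgM].
  have H2 : kap n * (3 * C ^+ 2) @[n --> \oo] --> c^-1 / w ^+ 2 * (3 * C ^+ 2).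
    exact: cvgMl.
  have e2 : 0 < e * s ^+ 2 / 2 by rewrite divr_gt0// mulr_gt0.
  near=> n.
  have n0 : (0 < n)%N by near: n; exists 1%N.
  have okn : bmodel_ok C (M n) by near: n.
  have [[K0 mK q0 q1 p01] sg1 lamC cbC [betaC betaE]] := okn.
  have cb0 : 0 < cbrt n :> R by exact: cbrt_gt0.
  have kap0 : 0 <= kap n.
    by rewrite /kap !divr_ge0 ?sqr_ge0// mulr_ge0 ?sqr_ge0.
  have etan : cbrt n * C / (w * Num.sqrt n%:R) <= eta.
    by apply: ltW; near: n; exact: cvgr_lt etac _ eta0.
  rewrite distrC.
  have := stein_comparison n0 K0 mK q0 q1 p01 sg1 C0 lamC cbC cb0 w0 s0 b0
    (ltW om0) gk kE kC kom etan.
  move=> /le_lt_trans; apply; rewrite -/(kap n) ltr_pdivrMr//.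
  have h1 : Ck * (kap n * (C ^+ 2 * (2 / b) * Dn n (Kn n) C
      + edge (Kn n) (bq (M n)) (blam (M n)) b)
      + `|s ^+ 2 - kap n * vbar (Kn n) (bq (M n)) (bp (M n)) (blam (M n))|)
      < e * s ^+ 2 / 2 by near: n; exact: cvgr_lt H1 _ e2.
  have h2 : kap n * (3 * C ^+ 2) <= V1.
    by apply: ltW; near: n; apply: (cvgr_lt _ H2); rewrite ltrDl.
  have h20 : 0 <= kap n * (3 * C ^+ 2) by rewrite mulr_ge0// mulr_ge0// sqr_ge0.
  have h3 : 2 * om * (1 + mu ^+ 2 + kap n * (3 * C ^+ 2)) * (kap n * (3 * C ^+ 2))
      <= e * s ^+ 2 / 2.
    have -> : e * s ^+ 2 / 2 = 2 * om * (1 + mu ^+ 2 + V1) * V1.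
      by rewrite /om; field; rewrite !gt_eqF.
    have om2 : 0 <= 2 * om by rewrite mulr_ge0// ltW.
    have Z1 : 0 <= 1 + mu ^+ 2 + kap n * (3 * C ^+ 2).
      by have := sqr_ge0 mu; lra.
    have oZ : 2 * om * (1 + mu ^+ 2 + kap n * (3 * C ^+ 2)) <=
        2 * om * (1 + mu ^+ 2 + V1) by rewrite ler_wpM2l// lerD2l.
    exact: (ler_pM (mulr_ge0 om2 Z1) h20 oZ h2).
  by rewrite [ltRHS](splitr (e * s ^+ 2)); exact: ltr_leD h1 h3.
have Phi_cont := @normal_cdf_cont R mu s s0.
apply/cvgrPdist_lt => e e0.
have e4 : 0 < e / 4 by rewrite divr_gt0.
have /cvgrPdist_lt/(_ _ e4) [r /= r0 Hr] := Phi_cont x.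
(* Both ramps stay within [2 * d < r] of [x], where the Gaussian distribution function varies by
   less than [e / 4]. *)
pose d := r / 4.
have d0 : 0 < d by rewrite divr_gt0.
have [|cc1 /andP[Pc1 _] rc1] := rampc (x - 2 * d) (x - d); first lra.
have [|cc2 /andP[_ Pc2] rc2] := rampc (x + d) (x + 2 * d); first lra.
have P1 : `|Phi x - Phi (x - 2 * d)| < e / 4.
  by apply: Hr; rewrite /ball_ /=; rewrite opprB addrC subrK gtr0_norm /d; lra.
have P2 : `|Phi x - Phi (x + 2 * d)| < e / 4.
  apply: Hr; rewrite /ball_ /=.
  have -> : x - (x + 2 * d) = - (2 * d) by ring.
  by rewrite normrN gtr0_norm /d; lra.
have errc : re n / w + ye n / d @[n --> \oo] --> (0 : R).
  have -> : (0 : R) = 0 / w + 0 / d by rewrite !mul0r addr0.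
  by apply: cvgD; exact: cvgMl.
move/cvgrPdist_lt : rc1 => /(_ _ e4) rc1; move/cvgrPdist_lt : rc2 => /(_ _ e4) rc2.
near=> n.
have n0 : (0 < n)%N by near: n; exists 1%N.
have okn : bmodel_ok C (M n) by near: n.
have [[K0 mK q0 q1 p01] sg1 lamC cbC [betaC betaE]] := okn.
have cb0 : 0 < cbrt n :> R by exact: cbrt_gt0.
have err : re n / w + ye n / d < e / 4 by near: n; exact: cvgr_lt errc _ e4.
have := cdf_le n0 K0 mK q0 q1 p01 C0 lamC cbC betaC betaE mu cb0 w0 x d0.
have := cdf_ge n0 K0 mK q0 q1 p01 C0 lamC cbC betaC betaE mu cb0 w0 x d0.
rewrite -/(Kn n) -/(re n) -/(ye n) -/(Er _ _ n) -/(Er _ _ n).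
set F := EE _ _ (fun cl o => (_ <= x)%R%:R) => G L.
have r1 : `|cc1 - Er (x - 2 * d) (x - d) n| < e / 4 by near: n.
have r2 : `|cc2 - Er (x + d) (x + 2 * d) n| < e / 4 by near: n.
move: P1 P2 r1 r2; rewrite !ltr_norml -/(Phi x).
move=> /andP[? ?] /andP[? ?] /andP[? ?] /andP[? ?].
by apply/andP; split; lra.
Unshelve. all: by end_near. Qed.

(** * Independence, marginal densities *)

Section pi_system_independence.
Context {d d' : measure_display} {Omega : measurableType d}
  {E : measurableType d'} {R : realType} (P : probability Omega R).
Variables (W : nat -> {mfun Omega >-> E}) (G : set (set E)).
Hypothesis G_gen : (measurable : set (set E)) = <<s G >>.
Hypothesis G_setI : setI_closed G.
Hypothesis G_T : G setT.
Hypothesis G_indep : forall (n : nat) (A : nat -> set E), (forall i, G (A i)) ->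
  P (\bigcap_(i in `I_n) (W i @^-1` A i)) = (\prod_(i < n) P (W i @^-1` A i))%E.

Let upd (A : nat -> set E) m B i := if i == m then B else A i.
Let C n m A := \bigcap_(i in [set i | (i < n)%N && (i != m)]) (W i @^-1` A i).

Let bigcap_upd n m A B : (m < n)%N ->
  \bigcap_(i in `I_n) (W i @^-1` upd A m B i) = W m @^-1` B `&` C n m A.
Proof.
move=> mn; apply/seteqP; split => [w Hw|w [wm wC] i /= ni].
  split; first by have := Hw m mn; rewrite /upd /= eqxx.
  by move=> i /= /andP[ni im]; have := Hw i ni; rewrite /upd /= (negbTE im).
by rewrite /upd; case: eqVneq => [->//|im]; apply: wC; rewrite /= ni im.
Qed.

Let prod_upd n m A B (mn : (m < n)%N) :
  (\prod_(i < n) P (W i @^-1` upd A m B i) =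
   P (W m @^-1` B) * \prod_(i < n | (i : nat) != m) P (W i @^-1` A i))%E.
Proof.
rewrite (bigD1 (Ordinal mn))//= /upd eqxx; congr (_ * _)%E.
rewrite [LHS](eq_bigl (fun i : 'I_n => (i : nat) != m)) => [|i]; last by rewrite -val_eqE.
by apply: eq_bigr => i im; rewrite (negbTE im).
Qed.

Let mpre i B : measurable B -> measurable (W i @^-1` B).
Proof. by move=> mB; rewrite -[X in measurable X]setTI; exact: measurable_funP. Qed.

(** Induction on the number [m] of leading coordinates whose sets are arbitrary, the others being in
    [G]. To free coordinate [m], fix the sets of the other coordinates and apply uniqueness of
    measures on the generating pi-system [G]. *)
Lemma mutually_independent_pi_system : mutually_independent P W.
Proof.
move=> n A mA.
suff H m : forall A, (forall i, measurable (A i)) ->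
    (forall i, (m <= i < n)%N -> G (A i)) ->
    P (\bigcap_(i in `I_n) (W i @^-1` A i)) = (\prod_(i < n) P (W i @^-1` A i))%E.
  by apply: (H n) => // i /andP[/leq_ltn_trans h /h]; rewrite ltnn.
elim: m {A mA} => [|m IH] A mA GA.
  have -> : \bigcap_(i in `I_n) (W i @^-1` A i) =
     \bigcap_(i in `I_n) (W i @^-1` (if (i < n)%N then A i else setT)).
    by apply: eq_bigcapr => i /= ->.
  rewrite (G_indep n (A := fun i => if (i < n)%N then A i else setT)).
    by apply: eq_bigr => i _; rewrite ltn_ord.
  by move=> i; case: ifP => // ni; exact: GA.
have [mn|nm] := ltnP m n; last first.
  apply: IH => // i /andP[mi ni]; have := leq_ltn_trans (leq_trans nm mi) ni.
  by rewrite ltnn.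
pose Q : \bar R := (\prod_(i < n | (i : nat) != m) P (W i @^-1` A i))%E.
have mC : measurable (C n m A).
  by apply: bigcap_measurableType => i _; exact: mpre.
have step B : G B -> P (W m @^-1` B `&` C n m A) = (P (W m @^-1` B) * Q)%E.
  move=> GB; rewrite -bigcap_upd// IH; first exact: prod_upd.
    move=> i; rewrite /upd; case: eqP => // _.
    by rewrite G_gen; exact: sub_sigma_algebra.
  move=> i /andP[mi ni]; rewrite /upd; case: eqVneq => // im.
  by apply: GA; rewrite ni andbT ltn_neqAle eq_sym im.
have PC : P (C n m A) = Q.
  by have := step _ G_T; rewrite preimage_setT setTI probability_setT mul1e.
have AE : A = upd A m (A m).
  by apply/funext => i; rewrite /upd; case: eqP => [->|].
rewrite AE bigcap_upd// prod_upd// -/Q -PC.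
have PCfin : P (C n m A) \is a fin_num by exact: fin_num_measure.
(* As functions of the set in coordinate [m], both sides of the product rule are finite measures
   that agree on [G]; [r] is the mass of the event of the other coordinates. *)
pose r := NngNum (fine_ge0 (measure_ge0 P (C n m A))).
pose m1 : {measure set E -> \bar R} := pushforward (mrestr P mC) (W m).
pose m2 : {measure set E -> \bar R} := mscale r (pushforward P (W m)).
have mW : measurable_fun setT (W m) by [].
have E12 B : measurable B -> m1 mW B = m2 mW B.
  apply: (@measure_unique _ _ _ G (fun=> setT)) => //.
  - by rewrite bigcup_const//; exists 0%N.
  - move=> B' GB'; rewrite /m1 /m2 /= /pushforward /mrestr /mscale /= fineK//.
    by rewrite step// -PC muleC.
  - move=> k; rewrite /m1 /= /pushforward /mrestr preimage_setT setTI.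
    by rewrite ltey_eq PCfin.
have := E12 _ (mA m).
by rewrite /m1 /m2 /= /pushforward /mrestr /mscale /= fineK// muleC.
Qed.

End pi_system_independence.

Section pairing.
Context {d d1 d2 : measure_display} {T : measurableType d}
  {T1 : measurableType d1} {T2 : measurableType d2}.
Variables (f : {mfun T >-> T1}) (g : {mfun T >-> T2}).

Definition pair_mfun (w : T) : T1 * T2 := (f w, g w).

Let mpair : measurable_fun setT pair_mfun.
Proof. exact: measurable_fun_pair. Qed.

HB.instance Definition _ := isMeasurableFun.Build _ _ _ _ pair_mfun mpair.

End pairing.

(** The integral against [nu] is read through the Radon-Nikodym derivative, which equals [h] almost
    everywhere because both have the same integrals over measurable sets. *)
Lemma integral_density {d : measure_display} {T : measurableType d} {R : realType}
    (mu : {sigma_finite_measure set T -> \bar R})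
    (nu : probability T R) (h f : T -> R) (A : set T) :
  measurable_fun setT h -> (forall z, 0 <= h z) ->
  (forall B, measurable B -> nu B = \int[mu]_(z in B) (h z)%:E)%E ->
  measurable A -> measurable_fun setT f -> (forall z, 0 <= f z <= 1) ->
  (\int[nu]_(z in A) (f z)%:E = \int[mu]_(z in A) (f z * h z)%:E)%E.
Proof.
move=> mh h0 hE mA mf f01.
have dom : nu `<< mu.
  apply/null_content_dominatesP => B mB B0.
  rewrite /= hE// null_set_integral//.
  exact/measurable_funTS/measurable_EFinP.
have fint : nu.-integrable A (EFin \o f).
  apply: (@le_integrable _ _ _ _ _ _ _ (cst 1%E)) => //.
  - exact/measurable_funTS/measurable_EFinP.
  - move=> z _ /=; have /andP[f0 f1] := f01 z.
    by rewrite lee_fin !ger0_norm.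
  - exact: finite_measure_integrable_cst.
rewrite -(Radon_Nikodym_change_of_variables dom)//=.
apply: ae_eq_integral => //.
- apply: emeasurable_funM; first exact/measurable_funTS/measurable_EFinP.
  apply: (measurable_int mu).
  apply: (integrableS _ _ (@subsetT _ _)) => //=.
  by apply: Radon_Nikodym_integrable; exact: dom.
- by apply/measurable_funTS/measurable_EFinP; exact: measurable_funM.
- under [X in ae_eq _ _ _ X]eq_fun do rewrite EFinM.
  apply: ae_eqe_mul2l => /=.
  rewrite Radon_NikodymE//=; case: cid => /= g [g1 g2 g3].
  apply: integral_ae_eq => //=.
  + exact: integrableS g2.
  + exact/measurable_funTS/measurable_EFinP.
  + by move=> B BA mB; rewrite -g3//= hE.
Qed.

Lemma leb2_sigma_finite {R : realType} :
  sigma_finite setT (@lebesgue_measure R \x @lebesgue_measure R)%E.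
Proof.
have /sigma_finiteP[F [TF ndF Foo]] := sigma_finiteT (@lebesgue_measure R).
exists (fun n => F n `*` F n).
  rewrite -setXTT TF predeqE => -[x y]; split.
    move=> [/= [n _ Fnx] [k _ Gky]]; exists (maxn n k) => //; split.
    - by move: x Fnx; exact/subsetPset/ndF/leq_maxl.
    - by move: y Gky; exact/subsetPset/ndF/leq_maxr.
  by move=> [n _ []/= ? ?]; split; exists n.
move=> k; have [? ?] := Foo k; split; first exact: measurableX.
by rewrite product_measure1E// lte_mul_pinfty// ge0_fin_numE.
Qed.

(** * The law of the observations *)

Section observation_law.
Context {R : realType} {d : measure_display} {Omega : measurableType d}
  (P : probability Omega R).
Variables (X : nat -> {RV P >-> R}) (TU : nat -> {RV P >-> (R * R)%type})
  (F0 : R -> R) (h : R * R -> R).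
Hypothesis X_law : forall i x, cdf (X i) x = (F0 x)%:E.
Hypothesis TU_law : forall i, has_joint_density P (TU i) h.
Hypothesis X_indep : mutually_independent P X.
Hypothesis TU_indep : mutually_independent P TU.
Hypothesis X_TU_indep : independent_sequences P X TU.

Local Notation leb2 := (@lebesgue_measure R \x @lebesgue_measure R)%E.

Local Notation mR := (measurableTypeR R).

(* The product measure lives on measurableTypeR R, whose display differs from
   that of the canonical measurable structure of R. *)
Let mXr i : measurable_fun setT (X i : Omega -> mR).
Proof. exact: (measurable_funPT (X i)). Qed.
Let mTUr i : measurable_fun setT (TU i : Omega -> (mR * mR)%type).
Proof. exact: (measurable_funPT (TU i)). Qed.
Definition Xr i : {mfun Omega >-> mR} :=
  HB.pack (X i : Omega -> mR) (isMeasurableFun.Build _ _ _ _ _ (mXr i)).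
Definition TUr i : {mfun Omega >-> (mR * mR)%type} :=
  HB.pack (TU i : Omega -> (mR * mR)%type) (isMeasurableFun.Build _ _ _ _ _ (mTUr i)).

Definition obs (i : nat) : {mfun Omega >-> ((mR * mR) * mR)%type} :=
  pair_mfun (TUr i) (Xr i).

Lemma obs_indep1 i (A : set (R * R)) (B : set R) : measurable A -> measurable B ->
  P (obs i @^-1` (A `*` B)) = (P (TU i @^-1` A) * P (X i @^-1` B))%E.
Proof.
move=> mA mB.
(* Independence of the sequences concerns initial segments; taking [setT] at all places but [i]
   isolates one index. *)
pose sel (T : Type) (S : set T) k := if k == i then S else setT.
have selE (T : Type) (Y : nat -> Omega -> T) (S : set T) :
    \bigcap_(k in `I_i.+1) (Y k @^-1` sel T S k) = Y i @^-1` S.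
  apply/seteqP; split => [w /(_ i)|w wS k _].
    by rewrite /sel eqxx; apply; exact: ltnSn.
  by rewrite /sel; case: eqP => // ->.
have := @X_TU_indep i.+1 (sel _ B) (sel _ A).
rewrite (selE _ (fun k => X k : Omega -> R)).
rewrite (selE _ (fun k => TU k : Omega -> (R * R)%type)).
rewrite muleC => <-; last 2 first.
- by move=> k; rewrite /sel; case: ifP.
- by move=> k; rewrite /sel; case: ifP.
by congr (P _); apply/seteqP; split => w /= [].
Qed.

(** Rectangles form a generating pi-system, and on them the event separates into a part for [X] and
    a part for [TU]. *)
Lemma obs_indep : mutually_independent P obs.
Proof.
apply: (@mutually_independent_pi_system _ _ _ _ _ _ _
  [set A `*` B | A in measurable & B in measurable]).
- exact: measurable_prod_measurableType.
- move=> _ _ [A mA [B mB <-]] [A' mA' [B' mB' <-]].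
  exists (A `&` A'); first exact: measurableI.
  by exists (B `&` B'); [exact: measurableI|rewrite setXI].
- by exists setT => //; exists setT => //; rewrite setXTT.
move=> n S GS.
have [A [B AB]] : exists A : nat -> set (R * R), exists B : nat -> set R,
    forall i, [/\ measurable (A i), measurable (B i) & S i = A i `*` B i].
  have H i : exists AB : set (R * R) * set R,
      [/\ measurable AB.1, measurable AB.2 & S i = AB.1 `*` AB.2].
    by have [A mA [B mB <-]] := GS i; exists (A, B).
  have [f Hf] := choice H.
  by exists (fun i => (f i).1), (fun i => (f i).2).
have mA i : measurable (A i) by case: (AB i).
have mB i : measurable (B i) by case: (AB i).
have SE i : S i = A i `*` B i by case: (AB i).
transitivity (P (\bigcap_(i in `I_n) (X i @^-1` B i) `&`
                 \bigcap_(i in `I_n) (TU i @^-1` A i))).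
  congr (P _); apply/seteqP; split.
    by move=> w H; split=> i /H; rewrite SE => -[].
  by move=> w [H1 H2] i ni; rewrite SE; split; [exact: H2|exact: H1].
rewrite X_TU_indep// X_indep// TU_indep// -big_split /=.
by apply: eq_bigr => i _; rewrite SE obs_indep1// muleC.
Qed.

Lemma obs_prod i (S : set ((R * R) * R)) : measurable S ->
  P (obs i @^-1` S) = (\int[distribution P (TUr i)]_z distribution P (Xr i) (xsection S z))%E.
Proof.
move=> mS; rewrite -[LHS]/(distribution P (obs i) S).
rewrite -(@product_measure_unique _ _ _ _ _ (distribution P (TUr i)) (distribution P (Xr i))
   (distribution P (obs i)))//.
by move=> A B mA mB; exact: obs_indep1.
Qed.

Lemma F0_01 x : 0 <= F0 x <= 1.
Proof. by rewrite -!lee_fin -(X_law 0) cdf_ge0 cdf_le1. Qed.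

Lemma F0_nondecreasing x y : x <= y -> F0 x <= F0 y.
Proof. by move=> xy; rewrite -lee_fin -!(X_law 0) cdf_nondecreasing. Qed.

Lemma measurable_F0 : measurable_fun setT F0.
Proof.
apply/measurable_EFinP.
have -> : EFin \o F0 = cdf (X 0%N) by apply/funext => x; rewrite X_law.
exact: cdf_measurable.
Qed.

Let mh : measurable_fun setT h. Proof. by case: (TU_law 0). Qed.
Let h_ge0 z : 0 <= h z. Proof. by case: (TU_law 0). Qed.

Lemma integral_TU i (A : set (R * R)) (f : R * R -> R) : measurable A ->
  measurable_fun setT f -> (forall z, 0 <= f z <= 1) ->
  (\int[distribution P (TUr i)]_(z in A) (f z)%:E = \int[leb2]_(z in A) (f z * h z)%:E)%E.
Proof.
move=> mA mf f01.
have [_ _ hE] := TU_law i.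
pose mu2 : {sigma_finite_measure set (mR * mR)%type -> \bar R} :=
  HB.pack leb2 (Measure_isSigmaFinite.Build _ _ _ leb2 leb2_sigma_finite).
exact: (@integral_density _ _ _ mu2 (distribution P (TUr i)) h f A mh h_ge0 hE mA mf f01).
Qed.

(* Conditioning on (T, U) turns the event X <= phi (T, U) into a factor F0 (phi (T, U)). *)
Lemma prob_le i (A : set (R * R)) (phi : R * R -> R) : measurable A ->
  measurable_fun setT phi ->
  P [set w | A (TU i w) /\ X i w <= phi (TU i w)] =
  (\int[leb2]_(z in A) (F0 (phi z) * h z)%:E)%E.
Proof.
move=> mA mphi.
pose S : set ((R * R) * R) := [set y | A y.1 /\ y.2 <= phi y.1].
have mS : measurable S.
  have -> : S = (A `*` setT) `&` [set y | y.2 <= phi y.1].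
    by apply/seteqP; split => -[z x] /=; [move=> []|move=> [[]]].
  apply: measurableI; first exact: measurableX.
  rewrite -[X in measurable X]setTI; apply: measurable_fun_le => //.
  exact: (measurableT_comp mphi).
have -> : [set w | A (TU i w) /\ X i w <= phi (TU i w)] = obs i @^-1` S by [].
rewrite obs_prod// -(@integral_TU i)//; last by move=> z; exact: F0_01.
  
rewrite [RHS]integral_mkcond; apply: eq_integral => z _.
rewrite patchE; case: ifPn => [|] zA.
  rewrite -(X_law i) /cdf; congr (distribution P (Xr i) _).
  apply/seteqP; split => x; rewrite /xsection /= inE /S /= in_itv/=.
    by case.
  by move=> xz; split => //; move: zA; rewrite inE.
rewrite (_ : xsection S z = set0) ?measure0//.
apply/seteqP; split => x //; rewrite /xsection /= inE /S /= => -[Az _].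
  by move: zA; rewrite notin_setE.
exact: (measurableT_comp measurable_F0 mphi).
Qed.

Lemma prob_TU i (A : set (R * R)) : measurable A ->
  P (TU i @^-1` A) = (\int[leb2]_(z in A) (h z)%:E)%E.
Proof. by have [_ _] := TU_law i; exact. Qed.

End observation_law.

Section marginals.
Context {R : realType}.
Local Notation leb := (@lebesgue_measure R).
Local Notation leb2 := (@lebesgue_measure R \x @lebesgue_measure R)%E.

Lemma leb2_tonelli (f : R * R -> \bar R) (I J : set R) :
  measurable I -> measurable J -> measurable_fun setT f -> (forall z, 0 <= f z)%E ->
  (\int[leb2]_(z in I `*` J) f z = \int[leb]_(x in I) \int[leb]_(y in J) f (x, y) /\
   \int[leb2]_(z in I `*` J) f z = \int[leb]_(y in J) \int[leb]_(x in I) f (x, y))%E.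
Proof.
move=> mI mJ mf f0.
have mIJ : measurable (I `*` J) by exact: measurableX.
pose g := f \_ (I `*` J).
have mg : measurable_fun setT g by apply/(measurable_restrictT f mIJ); exact: measurable_funTS.
have g0 z : (0 <= g z)%E by rewrite /g patchE; case: ifP.
have gE x y : g (x, y) = if (x \in I) && (y \in J) then f (x, y) else 0%E.
  rewrite /g patchE; congr (if _ then _ else _).
  by rewrite in_setX.
split; rewrite integral_mkcond -/g.
  rewrite [LHS](@fubini_tonelli1 _ _ _ _ _ leb leb g mg g0).
  rewrite [RHS]integral_mkcond; apply: eq_integral => x _.
  rewrite patchE /fubini_F; case: ifPn => xI.
    rewrite [RHS]integral_mkcond; apply: eq_integral => y _.
    by rewrite gE xI patchE.
  by rewrite integral0_eq// => y _; rewrite gE (negbTE xI).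
rewrite [LHS](@fubini_tonelli2 _ _ _ _ _ leb leb g mg g0).
rewrite [RHS]integral_mkcond; apply: eq_integral => y _.
rewrite patchE /fubini_G; case: ifPn => yJ.
  rewrite [RHS]integral_mkcond; apply: eq_integral => x _.
  by rewrite gE yJ andbT patchE.
by rewrite integral0_eq// => x _; rewrite gE (negbTE yJ) andbF.
Qed.

Lemma leb2_swap (f : R * R -> \bar R) (I J : set R) :
  measurable I -> measurable J -> measurable_fun setT f -> (forall z, 0 <= f z)%E ->
  (\int[leb2]_(z in I `*` J) f z = \int[leb2]_(z in J `*` I) f (z.2, z.1))%E.
Proof.
move=> mI mJ mf f0.
have mf' : measurable_fun setT (fun z : R * R => f (z.2, z.1)).
  have msw : measurable_fun setT (fun z : R * R => (z.2, z.1)).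
    by apply: measurable_fun_pair; [exact: measurable_snd|exact: measurable_fst].
  exact: (measurableT_comp mf msw).
have [-> _] := leb2_tonelli mI mJ mf f0.
have [_ ->] := leb2_tonelli mJ mI mf' (fun z => f0 (z.2, z.1)).
by [].
Qed.

Lemma section_measurable1 (f : R * R -> R) (x : R) :
  measurable_fun setT f -> measurable_fun setT (fun y => f (x, y)).
Proof. move=> mf; exact: (measurable_fun_pair2 x mf). Qed.

Lemma section_measurable2 (f : R * R -> R) (y : R) :
  measurable_fun setT f -> measurable_fun setT (fun x => f (x, y)).
Proof. move=> mf; exact: (measurable_fun_pair1 y mf). Qed.

Variables (h : R * R -> R) (eps : R).
Hypothesis mh : measurable_fun setT h.
Hypothesis h_ge0 : forall z, 0 <= h z.
Hypothesis h_supp : forall z, h z != 0 -> sep_triangle eps z.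
Hypothesis eps_ge0 : 0 <= eps.
Hypothesis h_int1 : (\int[leb2]_z (h z)%:E = 1)%E.

(** Real-valued version of the marginal density, with value 0 where [g1] is infinite. Since [h] has
    integral 1, this happens only on a null set. *)
Definition G1 (t : R) : R := fine (g1 h t).
Definition G2 (t : R) : R := fine (g2 h t).

(** The triangle lies above the diagonal and inside the unit square, and [h] vanishes off it, so the
    range of integration may be the whole line. *)
Lemma g1_int t : g1 h t = (\int[leb]_u (h (t, u))%:E)%E.
Proof.
rewrite /g1 integral_mkcond; apply: eq_integral => u _; rewrite patchE.
case: ifPn => //; rewrite notin_setE /= in_itv /= => tu.
have [->//|/h_supp [/= t0 tu' u1]] := eqVneq (h (t, u)) 0.
by exfalso; apply: tu; rewrite u1 andbT (le_trans _ tu')// lerDl.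
Qed.

Lemma g2_int t : g2 h t = (\int[leb]_u (h (u, t))%:E)%E.
Proof.
rewrite /g2 integral_mkcond; apply: eq_integral => u _; rewrite patchE.
case: ifPn => //; rewrite notin_setE /= in_itv /= => tu.
have [->//|/h_supp [/= t0 tu' u1]] := eqVneq (h (u, t)) 0.
by exfalso; apply: tu; rewrite t0 /= (le_trans _ tu')// lerDl.
Qed.

Lemma g1_ge0 t : (0 <= g1 h t)%E.
Proof. by apply: integral_ge0 => u _; rewrite lee_fin. Qed.
Lemma g2_ge0 t : (0 <= g2 h t)%E.
Proof. by apply: integral_ge0 => u _; rewrite lee_fin. Qed.

Let mEh : measurable_fun setT (EFin \o h).
Proof. exact/measurable_EFinP. Qed.

Lemma g1_measurable : measurable_fun setT (g1 h).
Proof.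
have -> : g1 h = fubini_F leb (EFin \o h) by apply/funext => t; rewrite g1_int.
by apply: measurable_fun_fubini_tonelli_F => // z; rewrite lee_fin.
Qed.

Lemma g2_measurable : measurable_fun setT (g2 h).
Proof.
have -> : g2 h = fubini_G leb (EFin \o h) by apply/funext => t; rewrite g2_int.
by apply: measurable_fun_fubini_tonelli_G => // z; rewrite lee_fin.
Qed.

Lemma g1_integrable : leb.-integrable setT (g1 h).
Proof.
apply/integrableP; split; first exact: g1_measurable.
under eq_integral do rewrite gee0_abs ?g1_ge0//.
have mE0 z : (0 <= (EFin \o h) z)%E by rewrite lee_fin.
have := @fubini_tonelli1 _ _ _ _ _ leb leb (EFin \o h) mEh mE0.
rewrite -[X in X = _]/(\int[leb2]_z (h z)%:E)%E h_int1 => H.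
have -> : (\int[leb]_x g1 h x = 1)%E.
  by rewrite H; apply: eq_integral => t _; rewrite g1_int.
exact: ltry.
Qed.

Lemma g2_integrable : leb.-integrable setT (g2 h).
Proof.
apply/integrableP; split; first exact: g2_measurable.
under eq_integral do rewrite gee0_abs ?g2_ge0//.
have mE0 z : (0 <= (EFin \o h) z)%E by rewrite lee_fin.
have := @fubini_tonelli2 _ _ _ _ _ leb leb (EFin \o h) mEh mE0.
rewrite -[X in X = _]/(\int[leb2]_z (h z)%:E)%E h_int1 => H.
have -> : (\int[leb]_x g2 h x = 1)%E.
  by rewrite H; apply: eq_integral => t _; rewrite g2_int.
exact: ltry.
Qed.

Lemma marginal_fine (g : R -> \bar R) : measurable_fun setT g ->
  (forall t, 0 <= g t)%E -> leb.-integrable setT g ->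
  forall (phi : R -> R) I, measurable I -> measurable_fun setT phi ->
  (forall t, 0 <= phi t <= 1) ->
  (\int[leb]_(t in I) ((phi t)%:E * g t) = \int[leb]_(t in I) (phi t * fine (g t))%:E)%E.
Proof.
move=> mg g0 ig phi I mI mphi phi01.
have mfg : measurable_fun setT (fun t => fine (g t)).
  exact: (measurableT_comp (fine_measurable measurableT) mg).
apply: ae_eq_integral => //.
- apply: measurable_funTS; apply: emeasurable_funM => //.
  exact/measurable_EFinP.
- by apply: measurable_funTS; apply/measurable_EFinP; exact: measurable_funM.
have := integrable_ae measurableT ig; apply: filterS => t /(_ Logic.I) gt _.
by rewrite EFinM fineK.
Qed.

Lemma marginal1 (phi : R -> R) I : measurable I -> measurable_fun setT phi ->
  (forall t, 0 <= phi t <= 1) ->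
  (\int[leb2]_(z in I `*` setT) (phi z.1 * h z)%:E =
   \int[leb]_(t in I) (phi t * G1 t)%:E)%E.
Proof.
move=> mI mphi phi01.
have phi0 t : 0 <= phi t by case/andP: (phi01 t).
have mf : measurable_fun setT (fun z : R * R => (phi z.1 * h z)%:E).
  apply/measurable_EFinP; apply: measurable_funM => //.
  exact: (measurableT_comp mphi measurable_fst).
have f0 z : (0 <= (phi z.1 * h z)%:E)%E by rewrite lee_fin mulr_ge0.
have [-> _] := leb2_tonelli mI measurableT mf f0.
rewrite -(marginal_fine g1_measurable g1_ge0 g1_integrable)//.
apply: eq_integral => t _ /=; rewrite g1_int -ge0_integralZl_EFin//.
  by move=> u _; rewrite lee_fin.
by apply/measurable_EFinP; exact: section_measurable1.
Qed.

Lemma marginal2 (phi : R -> R) I : measurable I -> measurable_fun setT phi ->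
  (forall t, 0 <= phi t <= 1) ->
  (\int[leb2]_(z in setT `*` I) (phi z.2 * h z)%:E =
   \int[leb]_(t in I) (phi t * G2 t)%:E)%E.
Proof.
move=> mI mphi phi01.
have phi0 t : 0 <= phi t by case/andP: (phi01 t).
have mf : measurable_fun setT (fun z : R * R => (phi z.2 * h z)%:E).
  apply/measurable_EFinP; apply: measurable_funM => //.
  exact: (measurableT_comp mphi measurable_snd).
have f0 z : (0 <= (phi z.2 * h z)%:E)%E by rewrite lee_fin mulr_ge0.
have [_ ->] := leb2_tonelli measurableT mI mf f0.
rewrite -(marginal_fine g2_measurable g2_ge0 g2_integrable)//.
apply: eq_integral => t _ /=; rewrite g2_int -ge0_integralZl_EFin//.
  by move=> u _; rewrite lee_fin.
by apply/measurable_EFinP; exact: section_measurable2.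
Qed.

End marginals.

(** * Averages over shrinking cells *)

Section averages.
Context {R : realType}.

Lemma bounded_integrable {d : measure_display} {T : measurableType d}
    (mu : {measure set T -> \bar R}) (S : set T) (f : T -> R) (C : R) :
  measurable S -> (mu S < +oo)%E -> measurable_fun S f ->
  (forall y, S y -> `|f y| <= C) -> mu.-integrable S (EFin \o f).
Proof.
move=> mS Soo mf fC.
have iC : mu.-integrable S (EFin \o cst C).
  apply/integrableP; split; first by apply/measurable_EFinP.
  by rewrite /= integral_cst//= lte_mul_pinfty.
apply: le_integrable iC => //; first exact/measurable_EFinP.
move=> y Sy /=; rewrite lee_fin (le_trans (fC _ Sy))//.
exact: ler_norm.
Qed.

Lemma dist_weighted {d : measure_display} {T : measurableType d}
    (mu : {measure set T -> \bar R}) (S : set T) (g th : T -> R) (g0 C : R) :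
  measurable S -> (mu S < +oo)%E -> mu.-integrable S (EFin \o g) ->
  measurable_fun S th -> (forall y, S y -> `|th y| <= C) ->
  `|\int[mu]_(y in S) (th y * g y) - g0 * \int[mu]_(y in S) th y|
  <= C * \int[mu]_(y in S) `|g y - g0|.
Proof.
move=> mS Soo ig mth thC.
have mg : measurable_fun S g by move/measurable_int : ig => /measurable_EFinP.
have ith := bounded_integrable mS Soo mth thC.
have i0 : mu.-integrable S (EFin \o cst g0).
  by apply: (@bounded_integrable _ _ _ _ _ `|g0|).
have igg : mu.-integrable S (EFin \o (fun y => `|g y - g0|)).
  have := integrable_abse (integrableB mS ig i0).
  by apply: eq_integrable => // y _.
have iC : mu.-integrable S (EFin \o (fun y => C * `|g y - g0|)).
  have := integrableZl mS C igg.
  by apply: eq_integrable => // y _.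
have itg : mu.-integrable S (EFin \o (fun y => th y * (g y - g0))).
  apply: le_integrable iC => //.
    apply/measurable_EFinP; apply: measurable_funM => //.
    by apply: measurable_funB.
  move=> y Sy /=; rewrite lee_fin !normrM normr_id ler_wpM2r// (le_trans (thC _ Sy))//.
  exact: ler_norm.
have i0th : mu.-integrable S (EFin \o (fun y => g0 * th y)).
  have := integrableZl mS g0 ith.
  by apply: eq_integrable => // y _.
have E : \int[mu]_(y in S) (th y * g y) =
    \int[mu]_(y in S) (th y * (g y - g0)) + \int[mu]_(y in S) (g0 * th y).
  by rewrite -RintegralD//; apply: eq_Rintegral => y _; ring.
rewrite E RintegralZl// addrK (le_trans (le_normr_Rintegral _ _))//.
rewrite -RintegralZl//; apply: le_Rintegral => //.
  have := integrable_abse itg.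
  by apply: eq_integrable => // y _.
by move=> y Sy; rewrite normrM ler_wpM2r// thC.
Qed.

(** The weight [g] is only required to be close to [g0] in mean over the shrinking sets, as at a
    Lebesgue point. A bounded factor [th] cannot magnify this error, so it may be averaged as if [g]
    were constant. *)
Lemma cvg_weighted_avg {d : measure_display} {T : measurableType d}
    (mu : {measure set T -> \bar R}) {I : Type} (F : set_system I) {FF : Filter F}
    (S : I -> set T) (m : I -> R) (g : T -> R) (th : I -> T -> R) (g0 th0 C : R) :
  (\forall p \near F, [/\ measurable (S p), mu (S p) = (m p)%:E, 0 < m p,
     mu.-integrable (S p) (EFin \o g) & measurable_fun (S p) (th p) /\
     forall y, S p y -> `|th p y| <= C]) ->
  (m p)^-1 * \int[mu]_(y in S p) `|g y - g0| @[p --> F] --> (0 : R) ->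
  (m p)^-1 * \int[mu]_(y in S p) th p y @[p --> F] --> th0 ->
  (m p)^-1 * \int[mu]_(y in S p) (th p y * g y) @[p --> F] --> th0 * g0.
Proof.
move=> HF cg cth.
have cth' : g0 * ((m p)^-1 * \int[mu]_(y in S p) th p y) @[p --> F] --> th0 * g0.
  by rewrite [th0 * _]mulrC; exact: cvgMr.
have cd : (m p)^-1 * \int[mu]_(y in S p) (th p y * g y) -
   g0 * ((m p)^-1 * \int[mu]_(y in S p) th p y) @[p --> F] --> (0 : R).
  apply: (@squeeze_cvgr _ _ _ _ (fun p => - (C * ((m p)^-1 * \int[mu]_(y in S p) `|g y - g0|)))
    (fun p => C * ((m p)^-1 * \int[mu]_(y in S p) `|g y - g0|))).
  - near=> p.
    have [mS Sm m0 ig [mth thC]] : [/\ measurable (S p), mu (S p) = (m p)%:E, 0 < m p,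
     mu.-integrable (S p) (EFin \o g) & measurable_fun (S p) (th p) /\
     forall y, S p y -> `|th p y| <= C] by near: p.
    have Soo : (mu (S p) < +oo)%E by rewrite Sm ltry.
    rewrite -ler_norml [C * _]mulrCA [g0 * _]mulrCA -mulrBr normrM.
    rewrite gtr0_norm ?invr_gt0// ler_wpM2l ?invr_ge0 ?(ltW m0)//.
    exact: dist_weighted.
  - by rewrite -oppr0; apply: cvgN; rewrite -(mulr0 C); exact: cvgMr.
  - by rewrite -(mulr0 C); exact: cvgMr.
have -> : (fun p => (m p)^-1 * \int[mu]_(y in S p) (th p y * g y)) =
  (fun p => ((m p)^-1 * \int[mu]_(y in S p) (th p y * g y) -
   g0 * ((m p)^-1 * \int[mu]_(y in S p) th p y)) +
   g0 * ((m p)^-1 * \int[mu]_(y in S p) th p y)).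
  by apply/funext => p; rewrite subrK.
by rewrite -[th0 * g0]add0r; exact: cvgD.
Unshelve. all: by end_near. Qed.

End averages.

Section small_cells.
Context {R : realType}.
Local Notation leb := (@lebesgue_measure R).
Local Notation leb2 := (@lebesgue_measure R \x @lebesgue_measure R)%E.

Definition cell (x de : R) : set R := `[x, (x + de)%R[%classic.

Lemma leb_cell (x de : R) : 0 <= de -> leb (cell x de) = de%:E.
Proof.
rewrite le_eqVlt /cell lebesgue_measure_itv/= lte_fin ltrDl => /predU1P[<-|d0].
  by rewrite ltxx.
by rewrite d0 -EFinD addrAC subrr add0r.
Qed.

Lemma measurable_cell (x de : R) :
  measurable (cell x de : set (measurableTypeR R)).
Proof. exact: measurable_itv. Qed.

Lemma int_cell_cst (x de c : R) : 0 <= de ->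
  \int[leb]_(_ in cell x de) c = c * de.
Proof.
move=> d0; rewrite Rintegral_cst; last exact: measurable_cell.
by congr (_ * _); have := leb_cell x d0 => /(congr1 fine).
Qed.

Lemma leb2_cell (x y de : R) : 0 <= de ->
  leb2 (cell x de `*` cell y de) = (de ^+ 2)%:E.
Proof.
move=> d0; transitivity (leb (cell x de) * leb (cell y de))%E.
  by apply: product_measure1E; exact: measurable_cell.
by rewrite !leb_cell// -EFinM.
Qed.

Lemma int_cell_id (x de : R) : 0 < de ->
  \int[leb]_(y in cell x de) (y - x) = de ^+ 2 / 2.
Proof.
move=> d0; have c1 : continuous (fun y : R => y - x).
  by move=> y; apply: cvgB; [exact: cvg_id|exact: cvg_cst].
rewrite /cell Rintegral_itv_bndo_bndc; last first.
  apply: (@bounded_integrable _ _ _ _ _ _ de) => //.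
  - by rewrite /= lebesgue_measure_itv/= lte_fin ltrDl d0 -EFinD ltry.
  - by apply: measurable_funTS; exact: continuous_measurable_fun.
  - by move=> y /=; rewrite in_itv/= => /andP[? ?]; rewrite ler_norml; apply/andP; split; lra.
have dF (z : R) : is_derive z (1 : R) (fun y => (y - x) ^+ 2 / 2) (z - x).
  by apply: is_derive_eq; rewrite /GRing.scale/=; field.
rewrite /Rintegral (@continuous_FTC2 _ _ (fun y => (y - x) ^+ 2 / 2)).
- by rewrite -EFinB /= subrr expr0n/= mul0r subr0 addrAC subrr add0r.
- by rewrite ltrDl.
- exact: continuous_subspaceT.
- have cF : continuous (fun y : R => (y - x) ^+ 2 / 2).
    move=> z; apply/differentiable_continuous/derivable1_diffP.
    by have := dF z => H; exact: ex_derive.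
  split; [|exact/cvg_at_right_filter/cF|exact/cvg_at_left_filter/cF].
  by move=> z _; have := dF z => H; exact: ex_derive.
- by move=> z _; rewrite derive1E; have := dF z => H; rewrite derive_val.
Qed.

Variables (I : Type) (F : set_system I).
Context {FF : Filter F}.
Variables (de x : I -> R) (u : R).
Hypothesis de_gt0 : \forall p \near F, 0 < de p.
Hypothesis de_cvg : de p @[p --> F] --> (0 : R).
Hypothesis x_cvg : x p @[p --> F] --> u.

Let near_cell (r : R) : 0 < r ->
  \forall p \near F, forall y, x p <= y <= x p + de p -> `|u - y| < r.
Proof.
move=> r0; have r2 : 0 < r / 2 by rewrite divr_gt0.
near=> p => y /andP[y1 y2].
have d0 : 0 < de p by near: p.
have dr : de p < r / 2 by near: p; exact: cvgr_lt de_cvg _ r2.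
have xr : `|u - x p| < r / 2.
  by near: p; move/cvgrPdist_lt : x_cvg; apply.
by move: xr; rewrite !ltr_norml => /andP[? ?]; apply/andP; split; lra.
Unshelve. all: by end_near. Qed.

(** By the mean value theorem the increment is [f' u * (y - x)] up to a uniform o(de) on the cell,
    and the mean of [y - x] over a cell is half of its length. *)
Lemma cell_incr_avg (f f' : R -> R) (a b : R) : a < u < b ->
  measurable_fun setT f ->
  (forall y, a < y < b -> is_derive y (1 : R) f (f' y)) ->
  {for u, continuous f'} ->
  (de p)^-1 * \int[leb]_(y in cell (x p) (de p)) ((de p)^-1 * (f y - f (x p)))
    @[p --> F] --> f' u / 2.
Proof.
move=> /andP[au ub] mf df cf'; apply/cvgrPdist_le => e e0.
have /cvgrPdist_lt/(_ _ e0) [r /= r0 Hr] := cf'.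
pose r' := Num.min r (Num.min (u - a) (b - u)).
have r'0 : 0 < r' by rewrite !lt_min r0 !subr_gt0 au.
near=> p.
have d0 : 0 < de p by near: p.
have nc : forall y, x p <= y <= x p + de p -> `|u - y| < r'.
  by near: p; exact: near_cell.
have inab y : x p <= y <= x p + de p -> [/\ a < y, y < b & `|f' u - f' y| < e].
  move=> /nc; rewrite !lt_min => /andP[yr /andP[ya yb]]; split.
  - by move: ya; rewrite ltr_norml => /andP[_]; lra.
  - by move: yb; rewrite ltr_norml => /andP[+ _]; lra.
  - exact: Hr.
have bnd y : cell (x p) (de p) y -> `|(f y - f (x p)) - f' u * (y - x p)| <= e * de p.
  rewrite /cell /= in_itv /= => /andP[y1 y2].
  have [|z /andP[z1 z2] ->] := @mvt_is_derive R f f' (x p) y y1.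
    move=> z /andP[z1 z2]; apply: df.
    by have [|-> ->//] := inab z; rewrite z1 (le_trans z2)// ltW.
  have [|_ _ fz] := inab z; first by rewrite z1 (le_trans z2)// ltW.
  rewrite -mulrBl normrM distrC ler_pM// ?(ltW fz)//.
  by rewrite ger0_norm ?subr_ge0// lerBlDl ltW.
have mc := measurable_cell (x p) (de p).
have coo : (leb (cell (x p) (de p)) < +oo)%E by rewrite leb_cell ?ltry// ltW.
have mid : measurable_fun setT (fun y : R => y - x p).
  by apply: measurable_funB.
have id_le y : cell (x p) (de p) y -> `|y - x p| <= de p.
  rewrite /cell /= in_itv /= => /andP[y1 y2].
  by rewrite ger0_norm ?subr_ge0// lerBlDl ltW.
have i1 : leb.-integrable (cell (x p) (de p)) (EFin \o (fun y => f' u * (y - x p))).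
  apply: (@bounded_integrable _ _ _ _ _ _ (`|f' u| * de p)) => //.
    by apply: measurable_funTS; exact: measurable_funM.
  by move=> y /id_le yd; rewrite normrM ler_wpM2l.
have mfx : measurable_fun (cell (x p) (de p)) (fun y => f y - f (x p)).
  by apply: measurable_funTS; exact: measurable_funB.
have i2 : leb.-integrable (cell (x p) (de p)) (EFin \o (fun y => f y - f (x p))).
  apply: (@bounded_integrable _ _ _ _ _ _ (e * de p + `|f' u| * de p)) => //.
  move=> y yc; rewrite -(subrK (f' u * (y - x p)) (f y - f (x p))).
  by rewrite (le_trans (ler_normD _ _))// lerD ?bnd// normrM ler_wpM2l// id_le.
have i3 : leb.-integrable (cell (x p) (de p)) (EFin \o (fun y => y - x p)).
  apply: (@bounded_integrable _ _ _ _ _ _ (de p)) => //.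
  exact: measurable_funTS.
rewrite RintegralZl//.
have -> : f' u / 2 - (de p)^-1 * ((de p)^-1 * \int[leb]_(y in cell (x p) (de p)) (f y - f (x p)))
  = - ((de p)^-1 ^+ 2 * \int[leb]_(y in cell (x p) (de p)) ((f y - f (x p)) - f' u * (y - x p))).
  rewrite (RintegralB mc i2 i1) (RintegralZl (f' u) mc i3) int_cell_id//.
  by field; rewrite gt_eqF.
rewrite normrN normrM ger0_norm ?sqr_ge0//.
have -> : e = (de p)^-1 ^+ 2 * (e * de p * de p) by field; rewrite gt_eqF.
rewrite ler_wpM2l ?sqr_ge0//.
have i4 := integrableB mc i2 i1.
rewrite (le_trans (le_normr_Rintegral _ _))//.
apply: (@le_trans _ _ (\int[leb]_(y in cell (x p) (de p)) (e * de p))).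
  apply: le_Rintegral => //.
    have := integrable_abse i4; by apply: eq_integrable => // y _.
  by apply: (@bounded_integrable _ _ _ _ _ _ `|e * de p|).
by rewrite int_cell_cst// ltW.
Unshelve. all: by end_near. Qed.

(** The cell contains [u] but is not centred there. It lies in the ball of radius twice its length,
    whose measure is four times that of the cell, so the averages of the differentiation theorem
    dominate. *)
Lemma cell_lebesgue_pt (g : R -> R) : leb.-integrable setT (EFin \o g) ->
  lebesgue_pt g u ->
  (\forall p \near F, x p <= u <= x p + de p) ->
  (de p)^-1 * \int[leb]_(y in cell (x p) (de p)) `|g y - g u| @[p --> F] --> (0 : R).
Proof.
move=> ig gu xu; apply/cvgrPdist_lt => e e0.
have e4 : 0 < e / 8 by rewrite divr_gt0.
have /fine_cvgP[_] := gu; move/cvgrPdist_lt => /(_ _ e4) [r /= r0 Hr].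
have r2 : 0 < r / 2 by rewrite divr_gt0.
near=> p.
have d0 : 0 < de p by near: p.
have dr : de p < r / 2 by near: p; exact: cvgr_lt de_cvg _ r2.
have /andP[xu1 xu2] : x p <= u <= x p + de p by near: p.
have d2 : 0 < 2 * de p by rewrite mulr_gt0.
have H : `|0 - fine (davg g u (2 * de p))| < e / 8.
  by apply: Hr => //; rewrite /ball_ /= sub0r normrN gtr0_norm//; lra.
have bE : leb (ball u (2 * de p)) = (2 * de p *+ 2)%:E by rewrite lebesgue_measure_ball// ltW.
have mb : measurable (ball u (2 * de p) : set (measurableTypeR R)) by exact: measurable_ball.
have boo : (leb (ball u (2 * de p)) < +oo)%E by rewrite bE ltry.
have igb : leb.-integrable (ball u (2 * de p)) (EFin \o (fun y => g y - g u)).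
  have i1 : leb.-integrable (ball u (2 * de p)) (EFin \o g).
    by apply: integrableS ig.
  have i2 : leb.-integrable (ball u (2 * de p)) (EFin \o cst (g u)).
    by apply: (@bounded_integrable _ _ _ _ _ _ `|g u|).
  have := integrableB mb i1 i2; by apply: eq_integrable => // y _.
have iga : leb.-integrable (ball u (2 * de p)) (EFin \o (fun y => `|g y - g u|)).
  have := integrable_abse igb; by apply: eq_integrable => // y _.
have HI : fine (davg g u (2 * de p)) =
    (2 * de p *+ 2)^-1 * \int[leb]_(y in ball u (2 * de p)) `|g y - g u|.
  rewrite /davg /iavg bE inver mulrn_eq0/= gt_eqF//=.
  by rewrite /Rintegral fineM//; exact: integrable_fin_num.
rewrite HI sub0r normrN ger0_norm in H; last first.
  by rewrite mulr_ge0 ?invr_ge0 ?mulrn_wge0 ?(ltW d2)//; exact: Rintegral_ge0.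
have sub : cell (x p) (de p) `<=` ball u (2 * de p).
  move=> y; rewrite /cell /ball /= in_itv /= => /andP[y1 y2].
  by rewrite ltr_norml; apply/andP; split; lra.
rewrite sub0r normrN ger0_norm; last first.
  by rewrite mulr_ge0 ?invr_ge0 ?(ltW d0)//; exact: Rintegral_ge0.
rewrite mulrC ltr_pdivrMr//.
rewrite mulrC ltr_pdivrMr ?mulrn_wgt0// in H.
have L : \int[leb]_(y in cell (x p) (de p)) `|g y - g u| <=
    \int[leb]_(y in ball u (2 * de p)) `|g y - g u|.
  rewrite /Rintegral fine_le//.
  - apply: integrable_fin_num => //; first exact: measurable_cell.
    by apply: integrableS iga => //; exact: measurable_cell.
  - exact: integrable_fin_num.
  - apply: ge0_subset_integral => //; first exact: measurable_cell.
    by move/measurable_int : iga.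
apply: (le_lt_trans L); apply: (lt_le_trans H).
by rewrite mulr2n; nra.
Unshelve. all: by end_near. Qed.

End small_cells.

Section small_cells2.
Context {R : realType}.
Local Notation leb := (@lebesgue_measure R).
Local Notation leb2 := (@lebesgue_measure R \x @lebesgue_measure R)%E.
Local Notation mR := (measurableTypeR R).

Lemma measurable_cell2 (a x de : R) :
  measurable (cell a de `*` cell x de : set (mR * mR)%type).
Proof. by apply: measurableX; exact: measurable_cell. Qed.

Lemma leb_cell_lty (x de : R) : 0 <= de -> (leb (cell x de) < +oo)%E.
Proof. by move=> d0; rewrite leb_cell// ltry. Qed.

Lemma leb2_cell_lty (a x de : R) : 0 <= de ->
  (leb2 (cell a de `*` cell x de) < +oo)%E.
Proof. by move=> d0; rewrite leb2_cell// ltry. Qed.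

Lemma int_cell2_cst (a x de c : R) : 0 <= de ->
  \int[leb2]_(_ in cell a de `*` cell x de) c = c * de ^+ 2.
Proof.
move=> d0; rewrite Rintegral_cst; last exact: measurable_cell2.
by congr (_ * _); have := leb2_cell a x d0 => /(congr1 fine).
Qed.

Lemma int_cell2_snd (th : R -> R) (a x de C : R) : 0 < de -> measurable_fun setT th ->
  (forall y, cell x de y -> 0 <= th y <= C) ->
  \int[leb2]_(z in cell a de `*` cell x de) th z.2 =
  de * \int[leb]_(y in cell x de) th y.
Proof.
move=> d0 mth thC; have d0' := ltW d0.
have mf : measurable_fun setT (fun z : R * R => (`|th z.2|)%:E).
  apply/measurable_EFinP; apply: measurableT_comp => //.
  exact: (measurableT_comp mth measurable_snd).
have f0 (z : R * R) : (0 <= (`|th z.2|)%:E)%E by rewrite lee_fin.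
have [E _] := leb2_tonelli (measurable_cell a de) (measurable_cell x de) mf f0.
rewrite /Rintegral.
have -> : (\int[leb2]_(z in cell a de `*` cell x de) (th z.2)%:E =
    \int[leb2]_(z in cell a de `*` cell x de) (`|th z.2|)%:E)%E.
  by apply: eq_integral => -[s y]; rewrite inE /= => -[_ /thC/andP[h _]]; rewrite ger0_norm.
have E2 : (\int[leb]_(y in cell x de) (th y)%:E = \int[leb]_(y in cell x de) `|th y|%:E)%E.
  by apply: eq_integral => y; rewrite inE => /thC/andP[h _]; rewrite ger0_norm.
have Ec (v : \bar R) : (\int[leb]_(_ in cell a de) v = v * de%:E)%E.
  by rewrite -(leb_cell a d0'); apply: integral_cst; exact: measurable_cell.
rewrite E; transitivity (fine (\int[leb]_(y in cell x de) (th y)%:E * de%:E)%E).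
  by congr fine; rewrite E2; refine (eq_trans _ (Ec _)); apply: eq_integral.
rewrite fineM//; first by rewrite mulrC.
apply: integrable_fin_num; first exact: measurable_cell.
apply: (@bounded_integrable _ _ _ _ _ _ C).
- exact: measurable_cell.
- exact: leb_cell_lty.
- exact: measurable_funTS.
- by move=> y /thC/andP[h0 hC]; rewrite ger0_norm.
Qed.

Lemma int_cell2_fst (th : R -> R) (a x de C : R) : 0 < de -> measurable_fun setT th ->
  (forall y, cell a de y -> 0 <= th y <= C) ->
  \int[leb2]_(z in cell a de `*` cell x de) th z.1 =
  de * \int[leb]_(y in cell a de) th y.
Proof.
move=> d0 mth thC; have d0' := ltW d0.
have mf : measurable_fun setT (fun z : R * R => (`|th z.1|)%:E).
  apply/measurable_EFinP; apply: measurableT_comp => //.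
  exact: (measurableT_comp mth measurable_fst).
have f0 (z : R * R) : (0 <= (`|th z.1|)%:E)%E by rewrite lee_fin.
rewrite -(int_cell2_snd x d0 mth thC) /Rintegral.
have E (J : set R) : (forall z, (cell a de `*` J) z -> 0 <= th z.1) ->
    (\int[leb2]_(z in cell a de `*` J) (th z.1)%:E =
    \int[leb2]_(z in cell a de `*` J) (`|th z.1|)%:E)%E.
  by move=> h; apply: eq_integral => z; rewrite inE => /h z0; rewrite ger0_norm.
rewrite E; last by move=> z [/thC/andP[]].
rewrite leb2_swap//; [|exact: measurable_cell..].
by congr fine; apply: eq_integral => z; rewrite inE => -[_ /thC/andP[h _]] /=; rewrite ger0_norm.
Qed.

Variables (I : Type) (F : set_system I).
Context {FF : Filter F}.
Variables (de x a : I -> R) (t0 u : R) (H : R * R -> R).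
Hypothesis de_gt0 : \forall p \near F, 0 < de p.
Hypothesis de_cvg : de p @[p --> F] --> (0 : R).
Hypothesis x_cvg : x p @[p --> F] --> u.
Hypothesis a_cvg : a p @[p --> F] --> t0.
Hypothesis mH : measurable_fun setT H.
Hypothesis H_cont : {for (t0, u), continuous H}.

Lemma near_in_cell (y : I -> R) (v r : R) : y p @[p --> F] --> v -> 0 < r ->
  \forall p \near F, forall z, y p <= z <= y p + de p -> `|v - z| < r.
Proof.
move=> yv r0; have r2 : 0 < r / 2 by rewrite divr_gt0.
near=> p => z /andP[y1 y2].
have d0 : 0 < de p by near: p.
have dr : de p < r / 2 by near: p; exact: cvgr_lt de_cvg _ r2.
have xr : `|v - y p| < r / 2.
  by near: p; move/cvgrPdist_lt : yv; apply.
by move: xr; rewrite !ltr_norml => /andP[? ?]; apply/andP; split; lra.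
Unshelve. all: by end_near. Qed.

Lemma near_cell2 (e : R) : 0 < e ->
  \forall p \near F, forall z, (cell (a p) (de p) `*` cell (x p) (de p)) z ->
    `|H z - H (t0, u)| < e.
Proof.
move=> e0; move/cvgrPdist_lt : H_cont => /(_ _ e0) [[A B] /= [[r1 /= r10 Ar] [r2 /= r20 Br]] HAB].
near=> p => -[s y] [/=]; rewrite /cell /= !in_itv /= => /andP[s1 s2] /andP[y1 y2].
rewrite distrC; apply: (HAB (s, y)); split => /=.
  apply: Ar; rewrite /ball_ /=.
  have : forall z, a p <= z <= a p + de p -> `|t0 - z| < r1 by near: p; exact: near_in_cell.
  by apply; rewrite s1 ltW.
apply: Br; rewrite /ball_ /=.
have : forall z, x p <= z <= x p + de p -> `|u - z| < r2 by near: p; exact: near_in_cell.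
by apply; rewrite y1 ltW.
Unshelve. all: by end_near. Qed.

Lemma cell2_cont_avg : (de p ^+ 2)^-1 *
  \int[leb2]_(z in cell (a p) (de p) `*` cell (x p) (de p)) `|H z - H (t0, u)|
  @[p --> F] --> (0 : R).
Proof.
apply/cvgrPdist_le => e e0; near=> p.
have d0 : 0 < de p by near: p.
have Hb : forall z, (cell (a p) (de p) `*` cell (x p) (de p)) z -> `|H z - H (t0, u)| < e.
  by near: p; exact: near_cell2.
have mc := measurable_cell2 (a p) (x p) (de p).
have coo := leb2_cell_lty (a p) (x p) (ltW d0).
rewrite sub0r normrN ger0_norm; last first.
  by rewrite mulr_ge0 ?invr_ge0 ?sqr_ge0//; exact: Rintegral_ge0.
rewrite ler_pdivrMl ?exprn_gt0// mulrC -(int_cell2_cst (a p) (x p) e (ltW d0)).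
apply: le_Rintegral => //.
- apply: (@bounded_integrable _ _ _ _ _ _ e) => //.
    apply: measurable_funTS; apply: measurableT_comp => //.
    exact: measurable_funB.
  by move=> z /Hb/ltW; rewrite normr_id.
- by apply: (@bounded_integrable _ _ _ _ _ _ `|e|).
- by move=> z /Hb/ltW.
Unshelve. all: by end_near. Qed.

End small_cells2.

(** * Riemann sums over moving partitions *)

Section riemann_sums.
Context {R : realType}.
Local Notation leb := (@lebesgue_measure R).
Local Notation I01 := (`[0%R, 1%R]%classic : set R).

Variables (sgn : R) (a : nat -> R) (K m : nat -> nat).
Hypothesis sgn2 : sgn ^+ 2 = 1.
Hypothesis K_gt0 : forall n, (0 < K n)%N.

Definition mesh n : R := (K n)%:R^-1.
(** Left end of the i-th bin counted from the anchor, to the right for [sgn = 1] and to the left for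
    [sgn = -1]; index 0 is the bin of the anchor itself. *)
Definition node n i : R := a n + sgn * (i%:R * mesh n).
Local Notation bincell n i := (cell (node n i) (mesh n)).

Lemma mesh_gt0 n : 0 < mesh n.
Proof. by rewrite invr_gt0 ltr0n. Qed.

Lemma bincell_inj n i k u : bincell n i u -> bincell n k u -> i = k.
Proof.
rewrite /cell /= !in_itv /= => /andP[i1 i2] /andP[k1 k2].
have d0 := mesh_gt0 n.
have H (p q : nat) : node n p <= u -> u < node n q + mesh n ->
    sgn * p%:R < sgn * q%:R + 1.
  move=> h1 h2; have := le_lt_trans h1 h2.
  rewrite /node -addrA ltrD2l !mulrA -[X in _ + X]mul1r -[_ * mesh n + _]mulrDl.
  by rewrite ltr_pM2r.
have h1 := H _ _ i1 k2; have h2 := H _ _ k1 i2.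
have : (i < k.+1)%N && (k < i.+1)%N.
  move/eqP : sgn2; rewrite sqrf_eq1 => /orP[] /eqP sE; move: h1 h2;
  by rewrite sE ?mulN1r ?mul1r -!(ltr_nat R) -!natr1 => h1 h2; apply/andP; split; lra.
by rewrite !ltnS => /anti_leq.
Qed.

(** Convergence along this filter means: [n] tends to infinity while [i] is the index of the bin
    that contains [u]. If eventually no bin contains [u], the filter is improper and every limit
    holds vacuously. *)
Definition binF (u : R) : set_system (nat * nat) :=
  [set A | \forall n \near \oo, forall i, (1 <= i < m n)%N -> bincell n i u -> A (n, i)].

Global Instance binF_filter u : Filter (binF u).
Proof.
split.
- exact: nearW.
- move=> A B hA hB; rewrite /binF /=; near=> n => i im iu; split.
    by move: i im iu; near: n.
  by move: i im iu; near: n.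
- move=> A B AB; rewrite /binF /=; apply: filterS => n h i im iu.
  by apply: AB; exact: h.
Unshelve. all: by end_near. Qed.

(** The sum is the integral of the step function with value [cf n i] on the i-th bin. It is bounded
    and converges almost everywhere. It is 0 at points in no bin, which is why coverage by bins is
    demanded where [phi u] is nonzero. *)
Lemma riemann_cvg (cf : nat -> nat -> R) (phi : R -> R) (C : R) :
  measurable_fun setT phi ->
  (\forall n \near \oo, forall i, (1 <= i < m n)%N ->
     `|cf n i| <= C /\ (cf n i != 0 -> bincell n i `<=` I01)) ->
  {ae leb, forall u, cf p.1 p.2 @[p --> binF u] --> phi u /\
     (phi u != 0 -> \forall n \near \oo, exists2 i, (1 <= i < m n)%N & bincell n i u)} ->
  (\sum_(1 <= i < m n) cf n i * mesh n) @[n --> \oo] --> \int[leb]_(u in I01) phi u.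
Proof.
move=> mphi [N _ HN] Hae.
have C0 : 0 <= Num.max C 0 by rewrite le_max lexx orbT.
pose f n u : R := \sum_(1 <= i < m n) cf n i * \1_(bincell n i) u.
have mf n : measurable_fun setT (f n).
  apply: measurable_sum => i; apply: measurable_funM => //.
  by apply: measurable_indic; exact: measurable_cell.
have fE n u i : (1 <= i < m n)%N -> bincell n i u -> f n u = cf n i.
  move=> im iu; rewrite /f (bigD1_seq i)/= ?mem_index_iota ?iota_uniq//.
  rewrite indicE mem_set// mulr1 big1 ?addr0// => k ki.
  rewrite indicE memNset ?mulr0// => ku; move/eqP: ki; apply.
  exact: bincell_inj ku iu.
have f0 n u : (forall i, (1 <= i < m n)%N -> ~ bincell n i u) -> f n u = 0.
  move=> h; rewrite /f big_nat big1// => i im; rewrite indicE memNset ?mulr0//.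
  exact: h.
have fC n u : (N <= n)%N -> `|f n u| <= Num.max C 0.
  move=> Nn; have [[i [im iu]]|h] := pselect (exists i, (1 <= i < m n)%N /\ bincell n i u).
    by rewrite (fE _ _ _ im iu) (le_trans (HN n Nn i im).1)// le_max lexx.
  by rewrite f0 ?normr0// => i im iu; apply: h; exists i.
have If n : (N <= n)%N ->
    (\int[leb]_(u in I01) (f n u)%:E = (\sum_(1 <= i < m n) cf n i * mesh n)%:E)%E.
  move=> Nn; rewrite /f.
  under eq_integral do rewrite -sumEFin.
  rewrite -sumEFin integral_sum//=; last first.
    move=> i; apply: (@bounded_integrable _ _ _ _ _ _ `|cf n i|) => //.
    - by rewrite /= lebesgue_measure_itv/= lte_fin ltr01 -EFinD ltry.
    - apply: measurable_funTS; apply: measurable_funM => //.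
      by apply: measurable_indic; exact: measurable_cell.
    - move=> u _; rewrite normrM -[leRHS]mulr1 ler_wpM2l// indicE.
      by case: (_ \in _); rewrite ?normr1 ?normr0.
  apply: eq_big_nat => i im.
  have [->|c0] := eqVneq (cf n i) 0.
    by rewrite mul0r integral0_eq// => u _; rewrite mul0r.
  have sub := (HN n Nn i im).2 c0.
  have mc := measurable_cell (node n i) (mesh n).
  have i1 : leb.-integrable I01 (fun u => (\1_(bincell n i) u)%:E : \bar R).
    apply: (@bounded_integrable _ _ _ _ _ _ 1) => //.
    - by rewrite /= lebesgue_measure_itv/= lte_fin ltr01 -EFinD ltry.
    - by move=> u _; rewrite indicE; case: (_ \in _); rewrite ?normr1 ?normr0.
  transitivity (\int[leb]_(u in I01) ((cf n i)%:E * (\1_(bincell n i) u)%:E))%E.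
    by apply: eq_integral => u _; rewrite EFinM.
  rewrite integralZl// EFinM; congr (_ * _)%E.
  rewrite integral_indic//= -[RHS](leb_cell (node n i) (ltW (mesh_gt0 n))).
  congr (leb _); apply/seteqP; split => [u []//|u iu]; split => //.
  exact: sub.
(* The bound holds only from [N] on, whereas dominated convergence asks for it at every index. *)
pose fN n u := (f (n + N)%N u)%:E.
have [] := @dominated_convergence _ _ _ leb I01 (measurable_itv _)
  fN (EFin \o phi) (EFin \o cst (Num.max C 0)).
- by move=> n; apply: measurable_funTS; apply/measurable_EFinP; exact: mf.
- by apply: measurable_funTS; apply/measurable_EFinP.
- move: Hae; apply: filterS; first exact: (ae_filter_ringOfSetsType leb).
  move=> u [cu pu] _.
  apply: cvg_EFin; first exact: nearW.
  rewrite [X in X @ _ --> _](_ : _ = fun n => f (n + N)%N u)//.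
  rewrite (cvg_shiftn N (fun n => f n u)).
  apply/cvgrPdist_lt => e e0; move/cvgrPdist_lt : cu => /(_ _ e0) cu.
  have [p0|pN0] := eqVneq (phi u) 0.
    near=> n.
    have [[i [im iu]]|h] := pselect (exists i, (1 <= i < m n)%N /\ bincell n i u).
      by rewrite (fE _ _ _ im iu); move: i im iu; near: n.
    by rewrite p0 f0 ?subrr ?normr0// => i im iu; apply: h; exists i.
  near=> n.
  have [i im iu] : exists2 i, (1 <= i < m n)%N & bincell n i u by near: n; exact: pu.
  by rewrite (fE _ _ _ im iu); move: i im iu; near: n.
- apply: (@bounded_integrable _ _ _ _ _ _ (Num.max C 0)) => //.
    by rewrite /= lebesgue_measure_itv/= lte_fin ltr01 -EFinD ltry.
  by move=> u _ /=; rewrite ger0_norm.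
- by apply: aeW => u n _ /=; rewrite lee_fin fC// leq_addl.
move=> iphi _ cvgI.
rewrite -(cvg_shiftn N) /=.
have /fine_cvgP[_] : (\int[leb]_(x in I01) fN n x)%E @[n --> \oo] -->
    (\int[leb]_(x in I01) phi x)%:E.
  by rewrite /Rintegral fineK//; apply: integrable_fin_num.
apply: cvg_trans; apply: near_eq_cvg; apply: nearW => n.
by rewrite /= If ?leq_addl.
Unshelve. all: by end_near. Qed.

End riemann_sums.

(** * Riemann sums on one side of the anchor point *)

Section one_side.
Context {R : realType}.
Local Notation leb := (@lebesgue_measure R).
Local Notation leb2 := (@lebesgue_measure R \x @lebesgue_measure R)%E.

Lemma measurable_sqrt : measurable_fun setT (@Num.sqrt R).
Proof. by apply: continuous_measurable_fun; exact: sqrt_continuous. Qed.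

Lemma measurable_invr_pos (D : set R) (f : R -> R) : measurable D ->
  measurable_fun D f -> (forall x, D x -> 0 < f x) -> measurable_fun D (fun x => (f x)^-1).
Proof.
move=> mD mf f0.
apply: (eq_measurable_fun (fun x => f x `^ (-1))).
  by move=> x; rewrite inE => /f0 fx; rewrite powR_inv1// ltW.
by apply: (measurableT_comp (f := fun x : R => x `^ (-1))) => //; exact: measurable_powR.
Qed.

Lemma near_eq_cvg_to (I : Type) (F : set_system I) (f g : I -> R) (l : R) :
  Filter F -> (\forall p \near F, f p = g p) -> f p @[p --> F] --> l ->
  g p @[p --> F] --> l.
Proof.
move=> FF fg fl; apply: cvg_trans fl; apply: near_eq_cvg.
by apply: filterS fg => p ->.
Qed.

Lemma integrable_bounded_mul {d : measure_display} {T : measurableType d}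
    (mu : {measure set T -> \bar R}) (S : set T) (g th : T -> R) (C : R) :
  measurable S -> mu.-integrable S (EFin \o g) -> measurable_fun S th ->
  (forall y, S y -> `|th y| <= C) ->
  mu.-integrable S (EFin \o (fun y => th y * g y)).
Proof.
move=> mS ig mth thC.
have mg : measurable_fun S g by move/measurable_int : ig => /measurable_EFinP.
have iC : mu.-integrable S (EFin \o (fun y => `|C| * `|g y|)).
  have := integrableZl mS `|C| (integrable_abse ig).
  by apply: eq_integrable => // y _.
apply: le_integrable iC => //.
  by apply/measurable_EFinP; exact: measurable_funM.
move=> y Sy /=; rewrite lee_fin !normrM !normr_id ler_wpM2r// (le_trans (thC _ Sy))//.
exact: ler_norm.
Qed.

Lemma wavg_shift {d : measure_display} {T : measurableType d}
    (mu : {measure set T -> \bar R}) (S : set T) (g th : T -> R) (c C : R) :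
  measurable S -> mu.-integrable S (EFin \o g) -> measurable_fun S th ->
  (forall y, S y -> `|th y| <= C) -> \int[mu]_(y in S) g y != 0 ->
  (\int[mu]_(y in S) g y)^-1 * \int[mu]_(y in S) (th y * g y) - c =
  (\int[mu]_(y in S) g y)^-1 * \int[mu]_(y in S) ((th y - c) * g y).
Proof.
move=> mS ig mth thC I0.
have i1 := integrable_bounded_mul mS ig mth thC.
have i2 : mu.-integrable S (EFin \o (fun y => c * g y)).
  have := integrableZl mS c ig; by apply: eq_integrable => // y _.
transitivity ((\int[mu]_(y in S) g y)^-1 *
    (\int[mu]_(y in S) (th y * g y) - \int[mu]_(y in S) (c * g y))).
  by rewrite RintegralZl// mulrBr mulrCA mulVf// mulr1.
by congr (_ * _); rewrite -RintegralB//; apply: eq_Rintegral => y _; ring.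
Qed.

Lemma wavg_bound {d : measure_display} {T : measurableType d}
    (mu : {measure set T -> \bar R}) (S : set T) (g th : T -> R) (c C B : R) :
  measurable S -> mu.-integrable S (EFin \o g) -> (forall y, 0 <= g y) ->
  measurable_fun S th ->
  (forall y, S y -> `|th y| <= C) -> \int[mu]_(y in S) g y != 0 ->
  (forall y, S y -> `|th y - c| <= B) ->
  `|(\int[mu]_(y in S) g y)^-1 * \int[mu]_(y in S) (th y * g y) - c| <= B.
Proof.
move=> mS ig g0 mth thC I0 thB.
have Ige0 : 0 <= \int[mu]_(y in S) g y by exact: Rintegral_ge0.
have Ipos : 0 < \int[mu]_(y in S) g y by rewrite lt_neqAle eq_sym I0.
rewrite (wavg_shift c mS ig mth thC I0) normrM gtr0_norm ?invr_gt0//.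
rewrite ler_pdivrMl// mulrC -RintegralZl//.
have mth' : measurable_fun S (fun y => th y - c) by exact: measurable_funB.
have i1 := integrable_bounded_mul mS ig mth' thB.
rewrite (le_trans (le_normr_Rintegral _ _))//; apply: le_Rintegral => //.
- have := integrable_abse i1; by apply: eq_integrable => // y _.
- have := integrableZl mS B ig; by apply: eq_integrable => // y _.
- by move=> y Sy; rewrite normrM (ger0_norm (g0 y)) ler_wpM2r// thB.
Qed.

Variables (sgn : R) (a : nat -> R) (K : nat -> nat).
Variables (G F0 : R -> R) (H : R * R -> R).
Local Notation mesh := (@mesh R K).
Local Notation node := (node sgn a K).
Local Notation bincell n i := (cell (node n i) (mesh n)).
Local Notation bincell2 n i := (cell (a n) (mesh n) `*` cell (node n i) (mesh n)).

Definition massA n i : R := \int[leb]_(y in bincell n i) G y.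
Definition massC n i : R := \int[leb2]_(z in bincell2 n i) H z.
(** A bin that fails this has, almost surely, an empty marginal class or an empty cell class, hence
    weight zero in the estimator. On good bins the averages below have nonzero denominators. *)
Definition good n i := (massA n i != 0) && (massC n i != 0).
Definition wgt n i : R := if good n i then (i.+1)%:R^-1 else 0.
Definition avA n i : R := (massA n i)^-1 * \int[leb]_(y in bincell n i) (F0 y * G y).
Definition avC n i : R :=
  (massC n i)^-1 * \int[leb2]_(z in bincell2 n i) ((F0 z.2 - F0 z.1) * H z).
(** Conditional mean of a pilot estimate minus [F0] at the anchor. The formula serves both sides:
    the first coordinate of [H] always belongs to the bin of the anchor, and to the left the
    increment from the anchor is the negative of the probability of the cell outcome. *)
Definition dev n i : R := avA n i - avC n i - F0 (a n).
Definition rmin n i : R :=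
  Num.min ((K n)%:R * massA n i) ((K n)%:R ^+ 2 * massC n i).

(** [lo] and [hi] end the range of integration, [kap] bounds the distance to [t0] from below, [rho0]
    is the margin by which bins may stick out of the range, and [F0] is Lipschitz with constant [Cf]
    on [[cL, dL]], a compact part of the open unit interval. *)
Variables (m : nat -> nat) (f0 : R -> R) (lo hi t0 b C rho0 kap cL dL Cf : R).
Hypothesis sgn2 : sgn ^+ 2 = 1.
Hypothesis K_gt0 : forall n, (0 < K n)%N.
Hypothesis mesh_cvg : mesh n @[n --> \oo] --> (0 : R).
Hypothesis a_cvg : a n @[n --> \oo] --> t0.
Hypothesis G_ge0 : forall y, 0 <= G y.
Hypothesis iG : leb.-integrable setT (EFin \o G).
Hypothesis H_ge0 : forall z, 0 <= H z.
Hypothesis iH : leb2.-integrable setT (EFin \o H).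
Hypothesis mH : measurable_fun setT H.
Hypothesis mF0 : measurable_fun setT F0.
Hypothesis F0_01 : forall y, 0 <= F0 y <= 1.
Hypothesis F0_nd : {homo F0 : x y / x <= y}.
Hypothesis F0_deriv : forall y : R, 0 < y < 1 -> is_derive y (1 : R) F0 (f0 y).
Hypothesis f0_cont : forall y : R, 0 < y < 1 -> {for y, continuous f0}.
Hypothesis F0_lip : forall y z : R, cL <= y -> y <= z -> z <= dL -> F0 z - F0 y <= Cf * (z - y).
Hypothesis cL_gt0 : 0 < cL.
Hypothesis dL_lt1 : dL < 1.
Hypothesis t0_in : cL < t0 < dL.
Hypothesis lo_ge : cL <= lo - rho0.
Hypothesis hi_le : hi + rho0 <= dL.
Hypothesis rho0_gt0 : 0 < rho0.
Hypothesis kap_gt0 : 0 < kap.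
Hypothesis b_gt0 : 0 < b.
Hypothesis Cf_ge0 : 0 <= Cf.
Hypothesis H_cont : forall u, lo < u < hi -> {for (t0, u), continuous H}.
Hypothesis H_lb : forall u, lo < u < hi -> b <= H (t0, u).
Hypothesis H_ub : forall s u, `|s - t0| < rho0 -> lo - rho0 < u < hi + rho0 -> H (s, u) <= C.
Hypothesis G_pos : {ae leb, forall u, lo < u < hi -> 0 < G u}.
Hypothesis sgn_lb : forall u, lo - rho0 < u < hi + rho0 -> kap <= sgn * (u - t0).
Hypothesis supp : forall rho, 0 < rho -> exists2 rho', 0 < rho' &
  forall s u u', `|s - t0| < rho' -> `|u - u'| < rho' -> H (s, u) != 0 -> G u' != 0 ->
  lo - rho < u < hi + rho.
Hypothesis cover : forall u, lo < u < hi ->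
  \forall n \near \oo, exists2 i, (1 <= i < m n)%N & bincell n i u.

Local Notation binF_ := (binF sgn a K m).

Let mesh0 n : 0 < mesh n. Proof. exact: mesh_gt0. Qed.
Let meshV n : (mesh n)^-1 = (K n)%:R. Proof. exact: invrK. Qed.
Let KmeshE n : (K n)%:R * mesh n = 1.
Proof. by rewrite -meshV mulVf// gt_eqF. Qed.

Let iGc n i : leb.-integrable (bincell n i) (EFin \o G).
Proof. by apply: integrableS iG => //; exact: measurable_cell. Qed.
Let iHc n i : leb2.-integrable (bincell2 n i) (EFin \o H).
Proof. by apply: integrableS iH => //; exact: measurable_cell2. Qed.

Lemma massA_ge0 n i : 0 <= massA n i.
Proof. exact: Rintegral_ge0. Qed.
Lemma massC_ge0 n i : 0 <= massC n i.
Proof. exact: Rintegral_ge0. Qed.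

Lemma Rintegral_neq0 {d : measure_display} {T : measurableType d}
    (mu : {measure set T -> \bar R}) (S : set T) (g : T -> R) :
  \int[mu]_(y in S) g y != 0 -> exists2 y, S y & g y != 0.
Proof.
move=> h; have [//|nh] := pselect (exists2 y, S y & g y != 0).
exfalso; move/eqP: h; apply; rewrite /Rintegral integral0_eq// => y Sy.
by have [->//|gy] := eqVneq (g y) 0; exfalso; apply: nh; exists y.
Qed.

Lemma near_node_gap (r : R) : 0 < r -> \forall n \near \oo, forall s, cell (a n) (mesh n) s -> `|s - t0| < r.
Proof.
move=> r0; have r2 : 0 < r / 2 by rewrite divr_gt0.
near=> n => s; rewrite /cell /= in_itv/= => /andP[s1 s2].
have d1 : mesh n < r / 2 by near: n; exact: cvgr_lt mesh_cvg _ r2.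
have : `|t0 - a n| < r / 2 by near: n; move/cvgrPdist_lt : a_cvg; apply.
by rewrite !ltr_norml => /andP[? ?]; apply/andP; split; lra.
Unshelve. all: by end_near. Qed.

(** The support of [H] confines the bin at the end facing [t0], that of [G] at the other one. A good
    bin meets both, so it stays near the range of integration. *)
Lemma good_in (rho : R) : 0 < rho -> \forall n \near \oo, forall i, good n i ->
  forall y, node n i <= y <= node n i + mesh n -> lo - rho < y < hi + rho.
Proof.
move=> r0; have r2 : 0 < rho / 2 by rewrite divr_gt0.
have [r' r'0 Hr] := supp r2.
near=> n => i /andP[/Rintegral_neq0[u' cu' Gu'] /Rintegral_neq0[[s u] [/= cs cu] Hsu]] y /andP[y1 y2].
have d1 : mesh n < rho / 2 by near: n; exact: cvgr_lt mesh_cvg _ r2.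
have d2 : mesh n < r' by near: n; exact: cvgr_lt mesh_cvg _ r'0.
have sr : forall s, cell (a n) (mesh n) s -> `|s - t0| < r' by near: n; exact: near_node_gap.
move: cu' cu; rewrite /cell /= !in_itv/= => /andP[v1 v2] /andP[u1 u2].
have /andP[] : lo - rho / 2 < u < hi + rho / 2.
  apply: Hr Hsu Gu'; first exact: sr.
  by rewrite ltr_norml; apply/andP; split; lra.
by move=> ? ?; apply/andP; split; lra.
Unshelve. all: by end_near. Qed.

Lemma node_gap n i : i%:R * mesh n = sgn * (node n i - a n).
Proof. by rewrite /node addrC addKr mulrA -expr2 sgn2 mul1r. Qed.

(** [kap] bounds the distance to [t0]; half of it is given up because the gap is measured from the
    moving anchor. *)
Lemma good_gap : \forall n \near \oo, forall i, good n i -> kap / 2 <= i%:R * mesh n.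
Proof.
have k2 : 0 < kap / 2 by rewrite divr_gt0.
near=> n => i gi; rewrite node_gap.
have gy : forall i, good n i -> forall y, node n i <= y <= node n i + mesh n ->
  lo - rho0 < y < hi + rho0 by near: n; exact: good_in.
have /sgn_lb : lo - rho0 < node n i < hi + rho0.
  by apply: (gy i gi); rewrite lexx lerDl ltW.
have : `|t0 - a n| < kap / 2 by near: n; move/cvgrPdist_lt : a_cvg; apply.
move/eqP: sgn2; rewrite sqrf_eq1 ltr_norml => /orP[] /eqP ->;
by rewrite ?mulN1r ?mul1r => /andP[? ?] ?; lra.
Unshelve. all: by end_near. Qed.

Lemma wgt_ub : \forall n \near \oo, forall i, 0 <= (K n)%:R * wgt n i <= 2 / kap.
Proof.
near=> n => i; rewrite /wgt; case: ifPn => gi; last by rewrite mulr0 lexx divr_ge0// ltW.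
have gk : forall i, good n i -> kap / 2 <= i%:R * mesh n by near: n; exact: good_gap.
have k1 : kap / 2 <= i.+1%:R * mesh n.
  by rewrite (le_trans (gk i gi))// ler_wpM2r ?ler_nat// ltW.
rewrite -meshV -invfM invr_ge0 mulr_ge0 ?(ltW (mesh0 n))//=.
rewrite mulrC -[2 / kap]invf_div lef_pV2 ?posrE; [exact: k1| |exact: divr_gt0].
by rewrite mulr_gt0 ?ltr0n.
Unshelve. all: by end_near. Qed.

Lemma massC_ub : \forall n \near \oo, forall i, good n i -> (K n)%:R ^+ 2 * massC n i <= C.
Proof.
near=> n => i gi.
have gy : forall i, good n i -> forall y, node n i <= y <= node n i + mesh n ->
  lo - rho0 < y < hi + rho0 by near: n; exact: good_in.
have sr : forall s, cell (a n) (mesh n) s -> `|s - t0| < rho0 by near: n; exact: near_node_gap.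
rewrite -meshV exprVn ler_pdivrMl ?exprn_gt0// mulrC -(int_cell2_cst (a n) (node n i) C (ltW (mesh0 n))).
have mc := measurable_cell2 (a n) (node n i) (mesh n).
apply: le_Rintegral => //.
  apply: (@bounded_integrable _ _ _ _ _ _ `|C|) => //.
  by apply: leb2_cell_lty; exact: ltW.
move=> [s u] [/= /sr cs]; rewrite /cell /= in_itv/= => /andP[u1 u2].
by apply: H_ub => //; apply: (gy i gi); rewrite u1 ltW.
Unshelve. all: by end_near. Qed.

Let mdF0 : measurable_fun setT (fun z : R * R => F0 z.2 - F0 z.1).
Proof.
apply: measurable_funB.
  exact: (measurableT_comp mF0 measurable_snd).
exact: (measurableT_comp mF0 measurable_fst).
Qed.

Let F0_le1 y : `|F0 y| <= 1.
Proof. by have /andP[h1 h2] := F0_01 y; rewrite ger0_norm. Qed.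

Let dF0_le1 (x y : R) : `|F0 x - F0 y| <= 1.
Proof.
have /andP[h1 h2] := F0_01 y; have /andP[h3 h4] := F0_01 x.
by rewrite ler_norml; apply/andP; split; lra.
Qed.

Lemma avA_shift n i c : good n i -> avA n i - c =
  (massA n i)^-1 * \int[leb]_(y in bincell n i) ((F0 y - c) * G y).
Proof.
move=> /andP[gA _]; apply: (@wavg_shift _ _ leb _ _ _ c 1) => //.
- exact: measurable_cell.
- exact: measurable_funTS.
Qed.

Lemma avC_shift n i c : good n i -> avC n i - c =
  (massC n i)^-1 * \int[leb2]_(z in bincell2 n i) ((F0 z.2 - F0 z.1 - c) * H z).
Proof.
move=> /andP[_ gC]; apply: (@wavg_shift _ _ leb2 _ _ _ c 1) => //.
- exact: measurable_cell2.
- exact: measurable_funTS.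
Qed.

Lemma avA_shift_ub n i c B : good n i ->
  (forall y, bincell n i y -> `|F0 y - c| <= B) -> `|avA n i - c| <= B.
Proof.
move=> /andP[gA _] h; apply: (@wavg_bound _ _ _ _ _ _ _ 1) => //.
- exact: measurable_cell.
- exact: measurable_funTS.
Qed.

Lemma avC_shift_ub n i c B : good n i ->
  (forall z, bincell2 n i z -> `|F0 z.2 - F0 z.1 - c| <= B) -> `|avC n i - c| <= B.
Proof.
move=> /andP[_ gC] h; apply: (@wavg_bound _ _ _ _ _ _ _ 1) => //.
- exact: measurable_cell2.
- exact: measurable_funTS.
Qed.

Lemma avC_le1 n i : good n i -> `|avC n i| <= 1.
Proof.
by move=> gi; rewrite -[avC n i]subr0; apply: avC_shift_ub => // z _; rewrite subr0.
Qed.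

(** The margin [rho0] keeps good bins inside [[cL, dL]], and the bin of the anchor gets there
    because [t0] is interior to it; the Lipschitz bound and monotonicity do the rest. *)
Lemma F0_incr_ub : \forall n \near \oo, forall i, good n i ->
  (forall y, bincell n i y -> 0 <= F0 y - F0 (node n i) <= Cf * mesh n) /\
  (forall s, cell (a n) (mesh n) s -> 0 <= F0 s - F0 (a n) <= Cf * mesh n).
Proof.
have r0 : 0 < Num.min (t0 - cL) (dL - t0) by rewrite lt_min !subr_gt0.
near=> n => i gi.
have gy : forall i, good n i -> forall y, node n i <= y <= node n i + mesh n ->
  lo - rho0 < y < hi + rho0 by near: n; exact: good_in.
have sr : forall s, cell (a n) (mesh n) s -> `|s - t0| < Num.min (t0 - cL) (dL - t0).
  by near: n; exact: near_node_gap.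
have key x y : cL <= x -> y <= dL -> x <= y -> y < x + mesh n ->
    0 <= F0 y - F0 x <= Cf * mesh n.
  move=> h1 h2 xy yx; rewrite subr_ge0 F0_nd//=.
  by rewrite (le_trans (F0_lip h1 xy h2))// ler_wpM2l// lerBlDl ltW.
split.
  move=> y; rewrite /cell /= in_itv/= => /andP[y1 y2].
  have /andP[h1 _] : lo - rho0 < node n i < hi + rho0.
    by apply: (gy i gi); rewrite lexx lerDl ltW.
  have /andP[_ h2] : lo - rho0 < y < hi + rho0.
    by apply: (gy i gi); rewrite y1 ltW.
  apply: key => //; first exact: le_trans (ltW h1).
  exact: le_trans (ltW h2) _.
move=> s cs.
have ca : cell (a n) (mesh n) (a n) by rewrite /cell /= in_itv/= lexx ltrDl mesh0.
have := sr _ cs; have := sr _ ca; rewrite !lt_min !ltr_norml.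
move=> /andP[/andP[? ?] /andP[? ?]] /andP[/andP[? ?] /andP[? ?]].
move: cs; rewrite /cell /= in_itv/= => /andP[s1 s2].
by apply: key => //; lra.
Unshelve. all: by end_near. Qed.

(** Compare [avA] with [F0] at the node and [avC] with the increment from the anchor to the node,
    each up to [Cf * mesh]; the values at the node cancel. *)
Lemma dev_ub : \forall n \near \oo, forall i, good n i -> (K n)%:R * `|dev n i| <= 2 * Cf.
Proof.
near=> n => i gi.
have [hA hC] : (forall y, bincell n i y -> 0 <= F0 y - F0 (node n i) <= Cf * mesh n) /\
  (forall s, cell (a n) (mesh n) s -> 0 <= F0 s - F0 (a n) <= Cf * mesh n).
  by move: i gi; near: n; exact: F0_incr_ub.
have h1 : `|avA n i - F0 (node n i)| <= Cf * mesh n.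
  by apply: avA_shift_ub => // y /hA/andP[? ?]; rewrite ger0_norm.
have h2 : `|avC n i - (F0 (node n i) - F0 (a n))| <= Cf * mesh n.
  apply: avC_shift_ub => // -[s y] [/= /hC/andP[? ?] /hA/andP[? ?]].
  by rewrite ler_norml; apply/andP; split; lra.
rewrite -meshV mulrC ler_pdivrMr//.
have -> : dev n i = (avA n i - F0 (node n i)) - (avC n i - (F0 (node n i) - F0 (a n))).
  by rewrite /dev; ring.
by rewrite (le_trans (ler_normB _ _))// -mulrA mulr_natl mulr2n lerD.
Unshelve. all: by end_near. Qed.

Section pointwise.
Variable u : R.
Hypothesis u_in : lo < u < hi.
Hypothesis Gu : 0 < G u.
Hypothesis u_pt : lebesgue_pt G u.
Local Notation F := (binF_ u).

Let FF : Filter F := binF_filter sgn a K m u.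
Let de (p : nat * nat) := mesh p.1.
Let xx (p : nat * nat) := node p.1 p.2.
Let aa (p : nat * nat) := a p.1.

Lemma near_binF (Q : nat * nat -> Prop) : (\forall p \near F, Q p) <->
  (\forall n \near \oo, forall i, (1 <= i < m n)%N -> bincell n i u -> Q (n, i)).
Proof. by []. Qed.

Lemma binF_fst (T : topologicalType) (v : nat -> T) (l : T) :
  v n @[n --> \oo] --> l -> v p.1 @[p --> F] --> l.
Proof.
move=> vl A nA; have h : \forall n \near \oo, A (v n) by exact: vl.
by apply/near_binF; apply: filterS h => n h i _ _.
Qed.

Let de_cvg : de p @[p --> F] --> (0 : R).
Proof. exact: binF_fst mesh_cvg. Qed.

Let de0 : \forall p \near F, 0 < de p.
Proof. by apply: nearW => p; exact: mesh0. Qed.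

Let aa_cvg : aa p @[p --> F] --> t0.
Proof. exact: binF_fst a_cvg. Qed.

Let xu : \forall p \near F, xx p <= u <= xx p + de p.
Proof.
apply/near_binF/nearW => n i _.
by rewrite /cell /= in_itv/= => /andP[h1 h2]; rewrite /xx /de h1 ltW.
Qed.

Let xx_cvg : xx p @[p --> F] --> u.
Proof.
apply/cvgrPdist_lt => e e0; near=> p.
have /andP[h1 h2] : xx p <= u <= xx p + de p by near: p.
have d1 : de p < e by near: p; exact: cvgr_lt de_cvg _ e0.
by rewrite ger0_norm ?subr_ge0//; lra.
Unshelve. all: by end_near. Qed.

Let nearF (Q : nat -> nat -> Prop) : (\forall n \near \oo, forall i, Q n i) ->
  \forall p \near F, Q p.1 p.2.
Proof. by move=> h; apply/near_binF; apply: filterS h => n h i _ _; exact: h. Qed.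

Lemma massA_cvg : (K p.1)%:R * massA p.1 p.2 @[p --> F] --> G u.
Proof.
have := @cvg_weighted_avg _ _ _ leb _ F FF (fun p => bincell p.1 p.2) de G (fun _ _ => 1)
  (G u) 1 1 _ (cell_lebesgue_pt (FF := FF) de0 de_cvg iG u_pt xu).
rewrite mul1r => h; have := h _ _.
have -> : (fun p => (de p)^-1 * \int[leb]_(y in bincell p.1 p.2) (1 * G y)) =
  fun p => (K p.1)%:R * massA p.1 p.2.
  apply/funext => p; rewrite /de meshV; congr (_ * _).
  by apply: eq_Rintegral => y _; rewrite mul1r.
apply.
- apply: nearW => p; split; [exact: measurable_cell| |exact: mesh0|exact: iGc|].
    exact: leb_cell (ltW (mesh0 _)).
  by split=> // y _; rewrite normr1.
- have -> : (fun p => (de p)^-1 * \int[leb]_(y in bincell p.1 p.2) (1 : R)) = fun _ => 1.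
    apply/funext => p; rewrite int_cell_cst ?mul1r ?mulVf//; last exact: ltW.
    by rewrite gt_eqF// /de.
  exact: cvg_cst.
Qed.

Let Hu := H (t0, u).
Let Hu0 : 0 < Hu.
Proof. exact: lt_le_trans (H_lb u_in). Qed.

(** The cells shrink to points of the section at [t0], a null set of the plane, where
    almost-everywhere statements about [H] say nothing. Continuity of [H] at [(t0, u)] takes the
    place of a Lebesgue point. *)
Lemma massC_cvg : (K p.1)%:R ^+ 2 * massC p.1 p.2 @[p --> F] --> Hu.
Proof.
have := @cvg_weighted_avg _ _ _ leb2 _ F FF (fun p => bincell2 p.1 p.2)
  (fun p => de p ^+ 2) H (fun _ _ => 1)
  Hu 1 1 _ (cell2_cont_avg (FF := FF) de0 de_cvg xx_cvg aa_cvg mH (H_cont u_in)).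
rewrite mul1r => h; have := h _ _.
have -> : (fun p => (de p ^+ 2)^-1 * \int[leb2]_(y in bincell2 p.1 p.2) (1 * H y)) =
  fun p => (K p.1)%:R ^+ 2 * massC p.1 p.2.
  apply/funext => p; rewrite /de -exprVn meshV; congr (_ * _).
  by apply: eq_Rintegral => y _; rewrite mul1r.
apply.
- apply: nearW => p; split; [exact: measurable_cell2| | |exact: iHc|].
  + exact: leb2_cell (ltW (mesh0 _)).
  + by rewrite exprn_gt0// /de.
  + by split=> // y _; rewrite normr1.
- have -> : (fun p => (de p ^+ 2)^-1 * \int[leb2]_(y in bincell2 p.1 p.2) (1 : R)) = fun _ => 1.
    apply/funext => p; rewrite int_cell2_cst ?mul1r ?mulVf//; last exact: ltW.
    by rewrite gt_eqF// exprn_gt0// /de.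
  exact: cvg_cst.
Qed.

Lemma near_good : \forall p \near F, good p.1 p.2.
Proof.
near=> p; apply/andP; split.
  have : 0 < (K p.1)%:R * massA p.1 p.2 by near: p; exact: cvgr_gt massA_cvg _ Gu.
  by apply: contraTneq => ->; rewrite mulr0 ltxx.
have : 0 < (K p.1)%:R ^+ 2 * massC p.1 p.2 by near: p; exact: cvgr_gt massC_cvg _ Hu0.
by apply: contraTneq => ->; rewrite mulr0 ltxx.
Unshelve. all: by end_near. Qed.

(** A mean of increments with weight [G]. At a Lebesgue point with [0 < G u] the weight acts as a
    constant and cancels, which leaves the uniform mean of the increments. *)
Lemma avA_dev_cvg : (K p.1)%:R * (avA p.1 p.2 - F0 (xx p)) @[p --> F] --> f0 u / 2.
Proof.
have /andP[u1 u2] := u_in.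
have u01 : 0 < u < 1.
  move: cL_gt0 dL_lt1 lo_ge hi_le rho0_gt0 => h1 h2 h3 h4 h5.
  by apply/andP; split; lra.
have cth := cell_incr_avg (FF := FF) de0 de_cvg xx_cvg u01 mF0 F0_deriv (f0_cont u01).
have cw := @cvg_weighted_avg _ _ _ leb _ F FF (fun p => bincell p.1 p.2) de G
  (fun p y => (de p)^-1 * (F0 y - F0 (xx p))) (G u) (f0 u / 2) Cf _
  (cell_lebesgue_pt (FF := FF) de0 de_cvg iG u_pt xu) cth.
have cAV : ((K p.1)%:R * massA p.1 p.2)^-1 @[p --> F] --> (G u)^-1.
  by apply: cvgV massA_cvg; rewrite gt_eqF.
have -> : f0 u / 2 = (G u)^-1 * (f0 u / 2 * G u) by field; rewrite gt_eqF.
have {}cw : (de p)^-1 * \int[leb]_(y in bincell p.1 p.2)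
    ((de p)^-1 * (F0 y - F0 (xx p)) * G y) @[p --> F] --> f0 u / 2 * G u.
  apply: cw; near=> p; split; [exact: measurable_cell| |exact: mesh0|exact: iGc|].
    exact: leb_cell (ltW (mesh0 _)).
  split.
    apply: measurable_funTS; apply: measurable_funM => //.
    exact: measurable_funB.
  have [hA _] : (forall y, bincell p.1 p.2 y -> 0 <= F0 y - F0 (node p.1 p.2) <= Cf * mesh p.1) /\
    (forall s, cell (a p.1) (mesh p.1) s -> 0 <= F0 s - F0 (a p.1) <= Cf * mesh p.1).
    have : good p.1 p.2 by near: p; exact: near_good.
    by near: p; exact: (nearF F0_incr_ub).
  move=> y /hA/andP[h1 h2]; rewrite ger0_norm ?mulr_ge0 ?invr_ge0 ?(ltW (mesh0 _))//.
  by rewrite /de ler_pdivrMl// mulrC.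
apply: near_eq_cvg_to (cvgM cAV cw); near=> p.
have gp : good p.1 p.2 by near: p; exact: near_good.
have /andP[gA _] := gp.
rewrite avA_shift//.
have mth : measurable_fun (bincell p.1 p.2) (fun y => F0 y - F0 (xx p)).
  by apply: measurable_funTS; exact: measurable_funB.
have ith := integrable_bounded_mul (measurable_cell _ _) (iGc p.1 p.2) mth
  (fun y _ => dF0_le1 y (xx p)).
have -> : \int[leb]_(y in bincell p.1 p.2) ((de p)^-1 * (F0 y - F0 (xx p)) * G y) =
    (de p)^-1 * \int[leb]_(y in bincell p.1 p.2) ((F0 y - F0 (xx p)) * G y).
  rewrite -RintegralZl//; last exact: measurable_cell.
  by apply: eq_Rintegral => y _; rewrite mulrA.
rewrite /de meshV; field; rewrite gA/= pnatr_eq0 -lt0n; exact: K_gt0.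
Unshelve. all: by end_near. Qed.

(** The uniform mean over the cell separates in the two coordinates: the outer bin yields [f0 u / 2]
    and the bin of the anchor [f0 t0 / 2], with opposite signs. *)
Lemma avC_dev_cvg :
  (K p.1)%:R * (avC p.1 p.2 - (F0 (xx p) - F0 (aa p))) @[p --> F] --> f0 u / 2 - f0 t0 / 2.
Proof.
have /andP[u1 u2] := u_in.
have u01 : 0 < u < 1.
  move: cL_gt0 dL_lt1 lo_ge hi_le rho0_gt0 => h1 h2 h3 h4 h5.
  by apply/andP; split; lra.
have t01 : 0 < t0 < 1.
  move: cL_gt0 dL_lt1 t0_in => h1 h2 /andP[h3 h4].
  by apply/andP; split; lra.
have c1 := cell_incr_avg (FF := FF) de0 de_cvg xx_cvg u01 mF0 F0_deriv (f0_cont u01).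
have c2 := cell_incr_avg (FF := FF) de0 de_cvg aa_cvg t01 mF0 F0_deriv (f0_cont t01).
pose th p (z : R * R) := (de p)^-1 * (F0 z.2 - F0 z.1 - (F0 (xx p) - F0 (aa p))).
have mth p : measurable_fun setT (th p).
  by apply: measurable_funM => //; exact: measurable_funB.
have cth : (de p ^+ 2)^-1 * \int[leb2]_(z in bincell2 p.1 p.2) th p z @[p --> F] -->
    f0 u / 2 - f0 t0 / 2.
  apply: near_eq_cvg_to (cvgB c1 c2); apply: nearW => p.
  have d0 : 0 < de p by exact: mesh0.
  have mt (v : R) : measurable_fun setT (fun y : R => (de p)^-1 * (F0 y - F0 v)).
    by apply: measurable_funM => //; exact: measurable_funB.
  have tb (v y : R) : cell v (de p) y -> 0 <= (de p)^-1 * (F0 y - F0 v) <= (de p)^-1.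
    rewrite /cell /= in_itv/= => /andP[vy _].
    rewrite mulr_ge0 ?invr_ge0 ?(ltW d0) ?subr_ge0 ?F0_nd//=.
    rewrite -[leRHS]mulr1 ler_wpM2l ?invr_ge0 ?(ltW d0)//.
    by have := dF0_le1 y v; rewrite ler_norml => /andP[].
  have i1 : leb2.-integrable (bincell2 p.1 p.2)
      (EFin \o (fun z : R * R => (de p)^-1 * (F0 z.2 - F0 (xx p)))).
    apply: (@bounded_integrable _ _ _ _ _ _ (de p)^-1).
    - exact: measurable_cell2.
    - exact: leb2_cell_lty (ltW d0).
    - apply: measurable_funTS; exact: (measurableT_comp (mt _) measurable_snd).
    - by move=> z [_ /tb/andP[? ?]]; rewrite ger0_norm.
  have i2 : leb2.-integrable (bincell2 p.1 p.2)
      (EFin \o (fun z : R * R => (de p)^-1 * (F0 z.1 - F0 (aa p)))).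
    apply: (@bounded_integrable _ _ _ _ _ _ (de p)^-1).
    - exact: measurable_cell2.
    - exact: leb2_cell_lty (ltW d0).
    - apply: measurable_funTS; exact: (measurableT_comp (mt _) measurable_fst).
    - by move=> z [/tb/andP[? ?] _]; rewrite ger0_norm.
  have -> : \int[leb2]_(z in bincell2 p.1 p.2) th p z =
     \int[leb2]_(z in bincell2 p.1 p.2) ((de p)^-1 * (F0 z.2 - F0 (xx p))) -
     \int[leb2]_(z in bincell2 p.1 p.2) ((de p)^-1 * (F0 z.1 - F0 (aa p))).
    rewrite -RintegralB//; last exact: measurable_cell2.
    by apply: eq_Rintegral => z _; rewrite /th -mulrBr; congr (_ * _); ring.
  have := int_cell2_snd (aa p) d0 (mt (xx p)) (tb (xx p)).
  have := int_cell2_fst (xx p) d0 (mt (aa p)) (tb (aa p)).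
  rewrite /= => E1 E2; rewrite [X in _ = _ * (X - _)]E2 [X in _ = _ * (_ - X)]E1 !fctE.
  by field; exact: lt0r_neq0.
have cw : (de p ^+ 2)^-1 * \int[leb2]_(z in bincell2 p.1 p.2) (th p z * H z) @[p --> F] -->
    (f0 u / 2 - f0 t0 / 2) * Hu.
  apply: (@cvg_weighted_avg _ _ _ leb2 _ F FF (fun p => bincell2 p.1 p.2)
    (fun p => de p ^+ 2) H th Hu _ Cf _
    (cell2_cont_avg (FF := FF) de0 de_cvg xx_cvg aa_cvg mH (H_cont u_in)) cth).
  near=> p; split; [exact: measurable_cell2| | |exact: iHc|].
  - exact: leb2_cell (ltW (mesh0 _)).
  - by rewrite exprn_gt0// /de.
  - split; first by apply: measurable_funTS; exact: mth.
    have [hA hC] : (forall y, bincell p.1 p.2 y -> 0 <= F0 y - F0 (node p.1 p.2) <= Cf * mesh p.1) /\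
      (forall s, cell (a p.1) (mesh p.1) s -> 0 <= F0 s - F0 (a p.1) <= Cf * mesh p.1).
      have : good p.1 p.2 by near: p; exact: near_good.
      by near: p; exact: (nearF F0_incr_ub).
    move=> z [/hC/andP[? ?] /hA/andP[? ?]]; rewrite /th normrM gtr0_norm; last first.
      by rewrite invr_gt0; exact: mesh0.
    rewrite /de ler_pdivrMl// mulrC.
    by rewrite ler_norml /xx /aa; apply/andP; split; lra.
have cCV : ((K p.1)%:R ^+ 2 * massC p.1 p.2)^-1 @[p --> F] --> Hu^-1.
  by apply: cvgV massC_cvg; rewrite gt_eqF.
have -> : f0 u / 2 - f0 t0 / 2 = Hu^-1 * ((f0 u / 2 - f0 t0 / 2) * Hu).
  by rewrite mulrCA mulVf ?mulr1// gt_eqF.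
apply: near_eq_cvg_to (cvgM cCV cw); near=> p.
have gp : good p.1 p.2 by near: p; exact: near_good.
have /andP[_ gC] := gp.
rewrite avC_shift//.
have mth' : measurable_fun (bincell2 p.1 p.2) (fun z => F0 z.2 - F0 z.1 - (F0 (xx p) - F0 (aa p))).
  by apply: measurable_funTS; exact: measurable_funB.
have bth z : bincell2 p.1 p.2 z -> `|F0 z.2 - F0 z.1 - (F0 (xx p) - F0 (aa p))| <= 2.
  by move=> _; rewrite (le_trans (ler_normB _ _))// -[2]/(1 + 1) lerD.
have ith := integrable_bounded_mul (measurable_cell2 _ _ _) (iHc p.1 p.2) mth' bth.
have -> : \int[leb2]_(z in bincell2 p.1 p.2) (th p z * H z) = (de p)^-1 *
    \int[leb2]_(z in bincell2 p.1 p.2) ((F0 z.2 - F0 z.1 - (F0 (xx p) - F0 (aa p))) * H z).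
  rewrite -RintegralZl//; last exact: measurable_cell2.
  by apply: eq_Rintegral => z _; rewrite /th mulrA.
rewrite /de -exprVn meshV; field; rewrite gC/= pnatr_eq0 -lt0n; exact: K_gt0.
Unshelve. all: by end_near. Qed.

(** The term [f0 u / 2] of the outer bin enters the marginal and the cell average alike and cancels.
    Only the bin of the anchor is left, so the limit does not depend on [u]. *)
Lemma dev_cvg : (K p.1)%:R * dev p.1 p.2 @[p --> F] --> f0 t0 / 2.
Proof.
rewrite -[f0 t0 / 2](subKr (f0 u / 2)).
apply: near_eq_cvg_to (cvgB avA_dev_cvg avC_dev_cvg); apply: nearW => p.
by rewrite !fctE /dev /xx /aa; ring.
Qed.

Let F0c (y : R) : 0 < y < 1 -> {for y, continuous F0}.
Proof.
move=> /F0_deriv h; apply/differentiable_continuous/derivable1_diffP.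
exact: ex_derive.
Qed.

Lemma avC_cvg : avC p.1 p.2 @[p --> F] --> F0 u - F0 t0.
Proof.
have /andP[u1 u2] := u_in.
have u01 : 0 < u < 1.
  move: cL_gt0 dL_lt1 lo_ge hi_le rho0_gt0 => h1 h2 h3 h4 h5.
  by apply/andP; split; lra.
have t01 : 0 < t0 < 1.
  move: cL_gt0 dL_lt1 t0_in => h1 h2 /andP[h3 h4].
  by apply/andP; split; lra.
have c1 : F0 (xx p) @[p --> F] --> F0 u by apply: (cvg_comp _ _ xx_cvg); exact: F0c.
have c2 : F0 (aa p) @[p --> F] --> F0 t0 by apply: (cvg_comp _ _ aa_cvg); exact: F0c.
rewrite -[F0 u - F0 t0]add0r -(mul0r (f0 u / 2 - f0 t0 / 2)).
apply: near_eq_cvg_to (cvgD (cvgM de_cvg avC_dev_cvg) (cvgB c1 c2)).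
by apply: nearW => p; rewrite !fctE /= mulrA [X in X * _]mulrC KmeshE mul1r subrK.
Qed.

Lemma wgt_cvg : (K p.1)%:R * wgt p.1 p.2 @[p --> F] --> (sgn * (u - t0))^-1.
Proof.
have /andP[u1 u2] := u_in.
have l0 : 0 < sgn * (u - t0).
  apply: (lt_le_trans kap_gt0); apply: sgn_lb; have := rho0_gt0.
  by move=> ?; apply/andP; split; lra.
have cx : sgn * (xx p - aa p) + de p @[p --> F] --> sgn * (u - t0).
  rewrite -[X in _ --> X]addr0; apply: cvgD de_cvg.
  by apply: cvgMr; exact: cvgB.
apply: near_eq_cvg_to (cvgV (lt0r_neq0 l0) cx); near=> p.
have gp : good p.1 p.2 by near: p; exact: near_good.
rewrite /wgt gp -meshV -invfM; congr (_^-1).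
by rewrite -node_gap -natr1 [RHS]mulrC mulrDl mul1r.
Unshelve. all: by end_near. Qed.

Lemma rmin_cvg : rmin p.1 p.2 @[p --> F] --> Num.min (G u) Hu.
Proof.
have E (x y : R) : Num.min x y = (x + y - `|x - y|) / 2.
  have [xy|xy] := leP x y.
    by rewrite ler0_norm ?subr_le0//; field.
  by rewrite gtr0_norm ?subr_gt0//; field.
rewrite E; under eq_fun do rewrite /rmin E.
apply: cvgMl; apply: cvgB; first exact: cvgD massA_cvg massC_cvg.
by apply: cvg_norm; exact: cvgB massA_cvg massC_cvg.
Qed.

End pointwise.

Local Notation oint := (`]lo, hi[%classic : set R).
Local Notation I01 := (`[0%R, 1%R]%classic : set R).

Let oint_sub : oint `<=` I01.
Proof.
move=> u; rewrite /= !in_itv/= => /andP[h1 h2].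
move: cL_gt0 dL_lt1 lo_ge hi_le rho0_gt0 => ? ? ? ? ?.
by apply/andP; split; lra.
Qed.

(** Common frame of the four limits below: the summands vanish off good bins, are bounded, and
    converge at every Lebesgue point of [G] in the open range where [G] is positive. The two end
    points form a null set; beyond them good bins eventually disappear. *)
Lemma side_cvg (cf tf : nat -> nat -> R) (phi : R -> R) (B : R) :
  (forall n i, tf n i = cf n i * mesh n) -> measurable_fun oint phi ->
  (\forall n \near \oo, forall i, `|cf n i| <= B) ->
  (forall n i, cf n i != 0 -> good n i) ->
  (forall u, lo < u < hi -> 0 < G u -> lebesgue_pt G u ->
     cf p.1 p.2 @[p --> binF_ u] --> phi u) ->
  (\sum_(1 <= i < m n) tf n i) @[n --> \oo] --> \int[leb]_(u in oint) phi u.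
Proof.
move=> tfE mphi cfB cfg cphi.
have -> : \int[leb]_(u in oint) phi u = \int[leb]_(u in I01) (phi \_ oint) u.
  by rewrite -Rintegral_mkcondr setIidr.
under eq_fun do under eq_bigr do rewrite tfE.
apply: (@riemann_cvg _ sgn a K m sgn2 K_gt0 cf (phi \_ oint) B).
- by apply/(measurable_restrictT phi); first exact: measurable_itv.
- near=> n => i _; split; first by move: i; near: n.
  move=> /cfg gi y; rewrite /cell /= !in_itv/= => /andP[y1 y2].
  have gy : forall i, good n i -> forall y, node n i <= y <= node n i + mesh n ->
    lo - rho0 < y < hi + rho0 by near: n; exact: good_in.
  have /andP[] : lo - rho0 < y < hi + rho0 by apply: (gy i gi); rewrite y1 ltW.
  move: cL_gt0 dL_lt1 lo_ge hi_le => ? ? ? ? ? ?.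
  by apply/andP; split; lra.
have aeL : \forall u \ae leb, lebesgue_pt G u.
  apply: lebesgue_differentiation; split => //.
  - by move/measurable_int : iG => /measurable_EFinP.
  - exact: openT.
  - move=> J _ cJ; have mJ : measurable J by apply: closed_measurable; exact: compact_closed.
    have iGJ : leb.-integrable J (EFin \o G) by apply: integrableS iG.
    by move/integrableP : iGJ => [_].
have aelo : \forall u \ae leb, u != lo.
  exists [set lo]; split; [exact: measurable_set1|by rewrite lebesgue_measure_set1|].
  by move=> u /= /negP; rewrite negbK => /eqP.
have aehi : \forall u \ae leb, u != hi.
  exists [set hi]; split; [exact: measurable_set1|by rewrite lebesgue_measure_set1|].
  by move=> u /= /negP; rewrite negbK => /eqP.
have FA := ae_filter_ringOfSetsType leb.
apply: (@filterS _ _ FA _ _ _ (@filterI _ _ FA _ _ (@filterI _ _ FA _ _ aeL G_pos)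
  (@filterI _ _ FA _ _ aelo aehi))) => u [[uL uG] [ulo uhi]].
rewrite patchE; case: ifPn => [|]; rewrite ?inE ?notin_setE /= in_itv/=.
  by move=> uin; split; [exact: cphi (uG uin) uL|move=> _; exact: cover].
move=> nu; split; last by rewrite eqxx.
(* A point outside the closed range keeps a distance [r] from it, so by [good_in] the bin containing
   it is eventually not good and the summand is 0. *)
have [r r0 Hr] : exists2 r, 0 < r & ~ (lo - r < u < hi + r).
  have [ul|lu] := ltP u lo.
    by exists (lo - u); rewrite ?subr_gt0// subKr ltxx.
  have [ul|hu] := ltP hi u.
    by exists (u - hi); rewrite ?subr_gt0// addrCA subrr addr0 ltxx andbF.
  by exfalso; apply: nu; rewrite !lt_neqAle eq_sym ulo lu uhi hu.
apply: cvg_near_cst; apply/(near_binF u); near=> n => i _ iu.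
apply: contrapT => /eqP ne; have gi : good n i by exact: cfg ne.
have gy : forall i, good n i -> forall y, node n i <= y <= node n i + mesh n ->
    lo - r < y < hi + r by near: n; exact: good_in.
apply: Hr; apply: (gy i gi).
by move: iu; rewrite /cell /= in_itv/= => /andP[-> /ltW->].
Unshelve. all: by end_near. Qed.

Let Hmin u := Num.min (G u) (H (t0, u)).
(** The integrands of W and of the limit variance, with the two sides unified: [sgn] turns [u - t0]
    and [F0 u - F0 t0] into nonnegative quantities. *)
Definition phi_root u : R := Num.sqrt (Hmin u) / (sgn * (u - t0)).
Definition phi_var u : R := Hmin u / (H (t0, u) * (sgn * (u - t0)) ^+ 2) *
  (sgn * (F0 u - F0 t0)) * (1 - sgn * (F0 u - F0 t0)).

Let moint : measurable oint. Proof. exact: measurable_itv. Qed.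
Let mG : measurable_fun setT G.
Proof. by move/measurable_int : iG => /measurable_EFinP. Qed.
Let mHt : measurable_fun setT (fun u => H (t0, u)).
Proof. exact: section_measurable1. Qed.
Let mHmin : measurable_fun setT Hmin.
Proof. exact: measurable_minr. Qed.
Let gap_gt0 u : lo < u < hi -> kap <= sgn * (u - t0).
Proof.
move=> /andP[? ?]; apply: sgn_lb; have := rho0_gt0.
by move=> ?; apply/andP; split; lra.
Qed.
Let mgap : measurable_fun setT (fun u : R => sgn * (u - t0)).
Proof. by apply: measurable_funM => //; exact: measurable_funB. Qed.
Let Hle u : lo < u < hi -> H (t0, u) <= C.
Proof.
move=> /andP[? ?]; apply: H_ub; first by rewrite subrr normr0.
by have := rho0_gt0 => ?; apply/andP; split; lra.
Qed.

Lemma measurable_phi_root : measurable_fun oint phi_root.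
Proof.
apply: measurable_funM.
  by apply: measurable_funTS; exact: (measurableT_comp measurable_sqrt mHmin).
apply: measurable_invr_pos => //; first exact: measurable_funTS.
by move=> u /= /[!in_itv]/= /gap_gt0; exact: lt_le_trans.
Qed.

Lemma phi_root_bound u : oint u -> 0 <= phi_root u <= Num.sqrt C / kap.
Proof.
rewrite /= in_itv/= => uin; have gu := gap_gt0 uin.
have g0 : 0 < sgn * (u - t0) by exact: lt_le_trans gu.
rewrite /phi_root divr_ge0 ?sqrtr_ge0 ?(ltW g0)//=.
apply: ler_pM => //; first by rewrite invr_ge0 ltW.
  by rewrite ler_wsqrtr// /Hmin ge_min Hle// orbT.
by rewrite lef_pV2.
Qed.

Lemma integrable_phi_root : leb.-integrable oint (EFin \o phi_root).
Proof.
apply: (@bounded_integrable _ _ _ _ _ _ (Num.sqrt C / kap)) => //.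
- rewrite /= lebesgue_measure_itv/=; case: ifP => _ //.
  by rewrite -EFinD ltry.
- exact: measurable_phi_root.
- by move=> u /phi_root_bound/andP[h1 h2]; rewrite ger0_norm.
Qed.

Lemma measurable_phi_var : measurable_fun oint phi_var.
Proof.
have mv : measurable_fun oint (fun u => sgn * (F0 u - F0 t0)).
  by apply: measurable_funTS; apply: measurable_funM => //; exact: measurable_funB.
apply: measurable_funM; last exact: measurable_funB.
apply: measurable_funM => //; apply: measurable_funM; first exact: measurable_funTS.
apply: measurable_invr_pos => //.
  apply: measurable_funTS; apply: measurable_funM => //.
  exact: measurable_funX.
move=> u /= /[!in_itv]/= uin; rewrite mulr_gt0//; first by rewrite (lt_le_trans b_gt0)// H_lb.
by rewrite exprn_gt0// (lt_le_trans kap_gt0)// gap_gt0.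
Qed.

Lemma sqrt_rmin_ub : \forall n \near \oo, forall i, good n i ->
  0 <= Num.sqrt (rmin n i) <= Num.sqrt C.
Proof.
near=> n => i gi; rewrite sqrtr_ge0 ler_wsqrtr// /rmin ge_min.
apply/orP; right; move: i gi; near: n; exact: massC_ub.
Unshelve. all: by end_near. Qed.

Lemma sum_root_cvg : (\sum_(1 <= i < m n) wgt n i * Num.sqrt (rmin n i)) @[n --> \oo] -->
  \int[leb]_(u in oint) phi_root u.
Proof.
apply: (@side_cvg (fun n i => (K n)%:R * wgt n i * Num.sqrt (rmin n i)) _ _
  (2 / kap * Num.sqrt C)).
- move=> n i; have := KmeshE n; move: (mesh n) => d kd.
  by rewrite -[LHS]mul1r -[X in X * _ = _]kd; ring.
- exact: measurable_phi_root.
- near=> n => i; have [gi|ngi] := boolP (good n i); last first.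
    rewrite /wgt (negbTE ngi) mulr0 mul0r normr0.
    by rewrite mulr_ge0 ?divr_ge0 ?sqrtr_ge0// ltW.
  have /andP[w0 w1] : 0 <= (K n)%:R * wgt n i <= 2 / kap.
    by move: i {gi}; near: n; exact: wgt_ub.
  have /andP[s0 s1] : 0 <= Num.sqrt (rmin n i) <= Num.sqrt C.
    by move: i gi {w0 w1}; near: n; exact: sqrt_rmin_ub.
  by rewrite ger0_norm; [exact: ler_pM|exact: mulr_ge0].
- move=> n i; apply: contraNT => /negbTE gi; rewrite /wgt gi mulr0 mul0r//.
- move=> u uin Gu uL.
  rewrite /phi_root mulrC; apply: cvgM; first exact: wgt_cvg.
  by apply: continuous_cvg; [exact: sqrt_continuous|exact: rmin_cvg].
Unshelve. all: by end_near. Qed.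

Lemma sum_bias_cvg : (\sum_(1 <= i < m n) wgt n i * Num.sqrt (rmin n i) *
    ((K n)%:R * dev n i)) @[n --> \oo] -->
  (\int[leb]_(u in oint) phi_root u) * (f0 t0 / 2).
Proof.
rewrite -RintegralZr//; last exact: integrable_phi_root.
apply: (@side_cvg (fun n i => (K n)%:R * wgt n i * Num.sqrt (rmin n i) * ((K n)%:R * dev n i))
  _ (fun u => phi_root u * (f0 t0 / 2)) (2 / kap * Num.sqrt C * (2 * Cf))).
- move=> n i; have := KmeshE n; move: (mesh n) => d kd.
  by rewrite -[LHS]mul1r -[X in X * _ = _]kd; ring.
- by apply: measurable_funM => //; exact: measurable_phi_root.
- near=> n => i; have [gi|ngi] := boolP (good n i); last first.
    rewrite /wgt (negbTE ngi) mulr0 !mul0r normr0.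
    by apply: mulr_ge0; rewrite mulr_ge0 ?divr_ge0 ?sqrtr_ge0 ?(ltW kap_gt0).
  have /andP[w0 w1] : 0 <= (K n)%:R * wgt n i <= 2 / kap.
    by move: i {gi}; near: n; exact: wgt_ub.
  have /andP[s0 s1] : 0 <= Num.sqrt (rmin n i) <= Num.sqrt C.
    by move: i gi {w0 w1}; near: n; exact: sqrt_rmin_ub.
  have d1 : (K n)%:R * `|dev n i| <= 2 * Cf.
    by move: i gi {w0 w1 s0 s1}; near: n; exact: dev_ub.
  rewrite normrM; apply: ler_pM => //; last by rewrite normrM ger0_norm.
  by rewrite ger0_norm; [exact: ler_pM|exact: mulr_ge0].
- move=> n i; apply: contraNT => /negbTE gi; rewrite /wgt gi mulr0 !mul0r//.
- move=> u uin Gu uL; apply: cvgM; last exact: dev_cvg.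
  rewrite /phi_root mulrC; apply: cvgM; first exact: wgt_cvg.
  by apply: continuous_cvg; [exact: sqrt_continuous|exact: rmin_cvg].
Unshelve. all: by end_near. Qed.

Lemma sum_var_cvg : (\sum_(1 <= i < m n) (K n)%:R * wgt n i ^+ 2 *
    (rmin n i / ((K n)%:R ^+ 2 * massC n i)) * (sgn * avC n i * (1 - sgn * avC n i)))
    @[n --> \oo] --> \int[leb]_(u in oint) phi_var u.
Proof.
apply: (@side_cvg (fun n i => ((K n)%:R * wgt n i) ^+ 2 *
    (rmin n i / ((K n)%:R ^+ 2 * massC n i)) * (sgn * avC n i * (1 - sgn * avC n i)))
  _ _ ((2 / kap) ^+ 2 * 1 * 2)).
- move=> n i; have := KmeshE n; move: (mesh n) => d kd.
  by rewrite -[LHS]mul1r -[X in X * _ = _]kd; ring.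
- exact: measurable_phi_var.
- near=> n => i; have [gi|ngi] := boolP (good n i); last first.
    rewrite /wgt (negbTE ngi) mulr0 expr0n/= !mul0r normr0.
    by rewrite mulr1 mulr_ge0// sqr_ge0.
  have /andP[w0 w1] : 0 <= (K n)%:R * wgt n i <= 2 / kap.
    by move: i {gi}; near: n; exact: wgt_ub.
  have s1 : `|sgn| = 1.
    by move/eqP: sgn2; rewrite sqrf_eq1 => /orP[] /eqP ->; rewrite ?normrN normr1.
  have av : `|sgn * avC n i| <= 1 by rewrite normrM s1 mul1r avC_le1.
  have Kn0 : 0 < (K n)%:R :> R by rewrite ltr0n.
  have c0 : 0 <= (K n)%:R ^+ 2 * massC n i by rewrite mulr_ge0 ?massC_ge0 ?sqr_ge0.
  have r0 : 0 <= rmin n i by rewrite /rmin le_min c0 mulr_ge0 ?massA_ge0// ltW.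
  rewrite normrM; apply: ler_pM => //.
    rewrite ger0_norm; last by rewrite mulr_ge0 ?sqr_ge0 ?divr_ge0.
    apply: ler_pM; rewrite ?sqr_ge0 ?divr_ge0//.
      by rewrite ler_sqr ?nnegrE// (le_trans w0).
    have [c00|] := eqVneq ((K n)%:R ^+ 2 * massC n i) 0; first by rewrite c00 invr0 mulr0.
    move=> cN0; rewrite ler_pdivrMr ?mul1r; last by rewrite lt_neqAle eq_sym cN0.
    by rewrite /rmin ge_min lexx orbT.
  rewrite normrM -[leRHS]mul1r; apply: ler_pM => //.
  by rewrite (le_trans (ler_normB _ _))// normr1 -[2]/(1 + 1) lerD.
- move=> n i; apply: contraNT => /negbTE gi; rewrite /wgt gi mulr0 expr0n/= !mul0r//.
- move=> u uin Gu uL.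
  have H0 : H (t0, u) != 0 by rewrite gt_eqF// (lt_le_trans b_gt0)// H_lb.
  have g0 : sgn * (u - t0) != 0 by rewrite gt_eqF// (lt_le_trans kap_gt0)// gap_gt0.
  have -> : phi_var u = (sgn * (u - t0))^-1 ^+ 2 * (Hmin u / H (t0, u)) *
      ((sgn * (F0 u - F0 t0)) * (1 - sgn * (F0 u - F0 t0))).
    by rewrite /phi_var invfM exprVn; ring.
  have cs : sgn * avC p.1 p.2 @[p --> binF_ u] --> sgn * (F0 u - F0 t0).
    by apply: cvgMr; exact: avC_cvg.
  apply: cvgM; last by apply: cvgM => //; apply: cvgB => //; exact: cvg_cst.
  apply: cvgM; first by rewrite expr2; under eq_fun do rewrite expr2; apply: cvgM; exact: wgt_cvg.
  by apply: cvgM; [exact: rmin_cvg|apply: cvgV => //; exact: massC_cvg].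
Unshelve. all: by end_near. Qed.

(** On the section the density is at least [b], so at almost every point of the range the cell
    density eventually exceeds [b / 2], and the indicator tends to 0. *)
Lemma sum_edge_cvg : (\sum_(1 <= i < m n) (K n)%:R * wgt n i ^+ 2 *
    ((K n)%:R ^+ 2 * massC n i < b / 2)%R%:R) @[n --> \oo] --> (0 : R).
Proof.
have E : \int[leb]_(u in oint) (0 : R) = 0 by rewrite Rintegral_cst// mul0r.
rewrite -[X in _ --> X]E.
apply: (@side_cvg (fun n i => ((K n)%:R * wgt n i) ^+ 2 *
    ((K n)%:R ^+ 2 * massC n i < b / 2)%R%:R) _ (fun _ => 0) ((2 / kap) ^+ 2 * 1)).
- move=> n i; have := KmeshE n; move: (mesh n) => d kd.
  by rewrite -[LHS]mul1r -[X in X * _ = _]kd; ring.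
- exact: measurable_cst.
- near=> n => i.
  have /andP[w0 w1] : 0 <= (K n)%:R * wgt n i <= 2 / kap.
    by move: i; near: n; exact: wgt_ub.
  rewrite normrM normr_nat ger0_norm ?sqr_ge0//; apply: ler_pM; rewrite ?sqr_ge0//.
    by rewrite ler_sqr ?nnegrE// (le_trans w0).
  by case: (_ < _).
- move=> n i; apply: contraNT => /negbTE gi; rewrite /wgt gi mulr0 expr0n/= !mul0r//.
- move=> u uin Gu uL.
  have hb : b / 2 < H (t0, u).
    by rewrite (lt_le_trans _ (H_lb uin))// ltr_pdivrMr// ltr_pMr// ltr1n.
  apply: cvg_near_cst; near=> p.
  have : b / 2 < (K p.1)%:R ^+ 2 * massC p.1 p.2.
    by near: p; apply: cvgr_gt hb; exact: massC_cvg.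
  by move=> /ltW; rewrite leNgt => /negbTE ->; rewrite mulr0.
Unshelve. all: by end_near. Qed.

Hypothesis v_in : forall u, lo < u < hi -> 0 < sgn * (F0 u - F0 t0) < 1.

Let phi_var_ge0 u : oint u -> 0 <= phi_var u.
Proof.
rewrite /= in_itv/= => uin; have /andP[v0 v1] := v_in uin.
have H0 : 0 < H (t0, u) by rewrite (lt_le_trans b_gt0)// H_lb.
have h0 : 0 <= Hmin u by rewrite /Hmin le_min G_ge0 ltW.
rewrite /phi_var; apply: mulr_ge0; last by rewrite subr_ge0 ltW.
apply: mulr_ge0; last exact: ltW.
by apply: divr_ge0 => //; rewrite mulr_ge0 ?sqr_ge0// ltW.
Qed.

Lemma phi_var_bound u : oint u -> `|phi_var u| <= (kap ^+ 2)^-1.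
Proof.
move=> ou; rewrite (ger0_norm (phi_var_ge0 ou)); move: ou.
rewrite /= in_itv/= => uin; have /andP[v0 v1] := v_in uin.
have H0 : 0 < H (t0, u) by rewrite (lt_le_trans b_gt0)// H_lb.
have h0 : 0 <= Hmin u by rewrite /Hmin le_min G_ge0 ltW.
have h1 : Hmin u / H (t0, u) <= 1.
  by rewrite ler_pdivrMr// mul1r /Hmin ge_min lexx orbT.
have g0 := gap_gt0 uin.
have k0 : 0 < sgn * (u - t0) by exact: lt_le_trans g0.
have k1 : ((sgn * (u - t0)) ^+ 2)^-1 <= (kap ^+ 2)^-1.
  by rewrite lef_pV2 ?posrE ?exprn_gt0// ler_sqr ?nnegrE// ltW.
have -> : phi_var u = (Hmin u / H (t0, u)) * ((sgn * (u - t0)) ^+ 2)^-1 *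
    ((sgn * (F0 u - F0 t0)) * (1 - sgn * (F0 u - F0 t0))).
  by rewrite /phi_var invfM; ring.
rewrite -[leRHS]mulr1; apply: ler_pM.
- by rewrite mulr_ge0 ?divr_ge0 ?invr_ge0 ?sqr_ge0// ltW.
- by rewrite mulr_ge0 ?subr_ge0// ltW.
- rewrite -[leRHS]mul1r; apply: ler_pM => //; first by rewrite divr_ge0// ltW.
  by rewrite invr_ge0 sqr_ge0.
- by nra.
Qed.

Lemma integrable_phi_var : leb.-integrable oint (EFin \o phi_var).
Proof.
apply: (@bounded_integrable _ _ _ _ _ _ (kap ^+ 2)^-1) => //.
- rewrite /= lebesgue_measure_itv/=; case: ifP => _ //.
  by rewrite -EFinD ltry.
- exact: measurable_phi_var.
- exact: phi_var_bound.
Qed.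

(** Both integrands contain [Hmin], and the remaining factors of [phi_var] are positive; so where
    [phi_var] vanishes, [phi_root] does too. This will make the limit variance positive because W is
    nonzero. *)
Lemma phi_var_int_eq0 : \int[leb]_(u in oint) phi_var u = 0 ->
  \int[leb]_(u in oint) phi_root u = 0.
Proof.
move=> V0.
have V0' : (\int[leb]_(u in oint) `|(EFin \o phi_var) u| = 0)%E.
  transitivity (\int[leb]_(u in oint) (EFin \o phi_var) u)%E.
    apply: eq_integral => u; rewrite inE => /phi_var_ge0 h.
    by rewrite gee0_abs// lee_fin.
  by rewrite -[LHS]fineK ?integrable_fin_num//; [rewrite [fine _]V0|exact: integrable_phi_var].
have mE : measurable_fun oint (EFin \o phi_var) by apply/measurable_EFinP; exact: measurable_phi_var.
have := (ae_eq_integral_abs leb moint mE).1 V0' => ae0.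
rewrite /Rintegral (@ae_eq_integral _ _ _ leb _ (cst 0%E))//.
- by rewrite integral0.
- by apply/measurable_EFinP; exact: measurable_phi_root.
have FA := ae_filter_ringOfSetsType leb.
apply: (@filterS _ _ FA _ _ _ ae0) => u h ou.
have := h ou => -[]; move: ou; rewrite /= in_itv/= => uin.
have /andP[v0 v1] := v_in uin.
have H0 : 0 < H (t0, u) by rewrite (lt_le_trans b_gt0)// H_lb.
have k0 : 0 < sgn * (u - t0) by exact: lt_le_trans (gap_gt0 uin).
have -> : phi_var u = Hmin u * ((H (t0, u) * (sgn * (u - t0)) ^+ 2)^-1 *
  ((sgn * (F0 u - F0 t0)) * (1 - sgn * (F0 u - F0 t0)))) by rewrite /phi_var; ring.
set q := (X in Hmin u * X); have q0 : 0 < q.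
  apply: mulr_gt0; last by apply: mulr_gt0 => //; rewrite subr_gt0.
  by rewrite invr_gt0; apply: mulr_gt0 => //; exact: exprn_gt0.
move=> /eqP; rewrite mulf_eq0 (gt_eqF q0) orbF => /eqP h0.
by rewrite /phi_root h0 sqrtr0 mul0r.
Qed.

Definition side_limits (kB CB dB : R) : Prop :=
  [/\ (\sum_(1 <= i < m n) wgt n i * Num.sqrt (rmin n i)) @[n --> \oo] -->
        \int[leb]_(u in oint) phi_root u,
      (\sum_(1 <= i < m n) wgt n i * Num.sqrt (rmin n i) * ((K n)%:R * dev n i)) @[n --> \oo] -->
        (\int[leb]_(u in oint) phi_root u) * (f0 t0 / 2),
      (\sum_(1 <= i < m n) (K n)%:R * wgt n i ^+ 2 *
        (rmin n i / ((K n)%:R ^+ 2 * massC n i)) * (sgn * avC n i * (1 - sgn * avC n i)))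
        @[n --> \oo] --> \int[leb]_(u in oint) phi_var u,
      (\sum_(1 <= i < m n) (K n)%:R * wgt n i ^+ 2 *
        ((K n)%:R ^+ 2 * massC n i < b / 2)%R%:R) @[n --> \oo] --> (0 : R) &
      [/\ (\forall n \near \oo, forall i, 0 <= (K n)%:R * wgt n i <= kB),
          (\forall n \near \oo, forall i, good n i -> (K n)%:R ^+ 2 * massC n i <= CB),
          (\forall n \near \oo, forall i, good n i -> (K n)%:R * `|dev n i| <= dB),
          (\forall n \near \oo, forall i, good n i ->
             forall y, node n i <= y <= node n i + mesh n -> lo - rho0 < y < hi + rho0) &
          [/\ 0 <= \int[leb]_(u in oint) phi_root u, 0 <= \int[leb]_(u in oint) phi_var u,
              measurable_fun oint phi_root, measurable_fun oint phi_var &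
              (\int[leb]_(u in oint) phi_var u = 0 -> \int[leb]_(u in oint) phi_root u = 0) /\
              leb.-integrable oint (EFin \o phi_root)]]].

Theorem one_side_limits : side_limits (2 / kap) C (2 * Cf).
Proof.
split; [exact: sum_root_cvg|exact: sum_bias_cvg|exact: sum_var_cvg|exact: sum_edge_cvg|].
split; [exact: wgt_ub|exact: massC_ub|exact: dev_ub|exact: good_in|].
split; [| |exact: measurable_phi_root|exact: measurable_phi_var|].
- by apply: Rintegral_ge0 => u /phi_root_bound/andP[].
- exact: Rintegral_ge0.
- by split; [exact: phi_var_int_eq0|exact: integrable_phi_root].
Qed.

End one_side.

(** * Geometry of the partition *)

Lemma measure_bigsetU_fin {d : measure_display} {T : measurableType d} {R : realType}
    (mu : {measure set T -> \bar R}) (I : finType) (A : pred I) (F : I -> set T) :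
  (forall i, measurable (F i)) -> trivIset setT F ->
  mu (\big[setU/set0]_(i | A i) F i) = (\sum_(i | A i) mu (F i))%E.
Proof.
move=> mF tF.
have E (V : Type) (idx : V) (op : Monoid.com_law idx) (f : I -> V) :
    \big[op/idx]_(i | A i) f i = \big[op/idx]_(k < #|I| | A (enum_val k)) f (enum_val k).
  by rewrite -(big_enum_val_cond (op := op) A f); exact: eq_bigl.
rewrite !E measure_bigsetU_ord//.
apply/trivIsetP => i k _ _ ik; move/trivIsetP : tF; apply => //.
by apply: contra ik => /eqP/enum_val_inj ->.
Qed.

(** * Probabilities of coded events *)

Section finite_code.
Context {d d' : measure_display} {Omega : measurableType d} {E : measurableType d'}
  {R : realType} (P : probability Omega R).

Lemma measurable_fun_code (B : finType) (code : Omega -> B) (f : Omega -> R) :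
  (forall v, measurable (code @^-1` [set v])) ->
  (forall w w', code w = code w' -> f w = f w') -> measurable_fun setT f.
Proof.
move=> mcode fcode _ A mA; rewrite setTI.
have -> : f @^-1` A = \big[setU/set0]_(v | `[< exists2 w, A (f w) & code w = v >])
    (code @^-1` [set v]).
  apply/seteqP; split => [w Aw|w]; rewrite -bigcup_seq_cond /=.
    exists (code w) => //=; rewrite mem_index_enum /=.
    by apply/asboolP; exists w.
  by move=> [v /= /andP[_ /asboolP[w' Aw' <-]] /fcode]; rewrite /preimage /= => ->.
by apply: bigsetU_measurable.
Qed.

Variables (Y : nat -> {mfun Omega >-> E}) (m : nat).
Local Notation D := (option (bool * 'I_m)).
Variables (q p : D -> R) (cls : E -> D) (bit : E -> bool).
Hypothesis mcode : forall v b, measurable [set e | cls e = v /\ bit e = b].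
Hypothesis law : forall i v b,
  P (Y i @^-1` [set e | cls e = v /\ bit e = b]) = (q v * bern (p v) b)%:E.
Hypothesis indep : mutually_independent P Y.

Definition cls_of n (w : Omega) : {ffun 'I_n -> D} := [ffun i : 'I_n => cls (Y i w)].
Definition bit_of n (w : Omega) : {ffun 'I_n -> bool} := [ffun i : 'I_n => bit (Y i w)].

(** The event is a finite disjoint union over the vectors of classes and bits. By independence each
    of them has a product weight, which factors into the weight of the classes and the conditional
    weight of the bits. *)
Lemma prob_code n (Q : {ffun 'I_n -> D} -> {ffun 'I_n -> bool} -> bool) :
  measurable [set w | Q (cls_of n w) (bit_of n w)] /\
  P [set w | Q (cls_of n w) (bit_of n w)] = (EE q p (fun c o => (Q c o)%:R))%:E.
Proof.
pose I : finType := ({ffun 'I_n -> D} * {ffun 'I_n -> bool})%type.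
(* Independence takes one set for every natural number; beyond [n] it is [setT]. *)
pose A (v : I) (i : nat) : set E :=
  if insub i is Some k then [set e | cls e = v.1 k /\ bit e = v.2 k] else setT.
have mA v i : measurable (A v i) by rewrite /A; case: insubP.
pose S (v : I) := \bigcap_(i in `I_n) (Y i @^-1` A v i).
have AE v (i : 'I_n) : A v i = [set e | cls e = v.1 i /\ bit e = v.2 i] by rewrite /A valK.
have SE v w : S v w <-> (cls_of n w = v.1 /\ bit_of n w = v.2).
  split.
    move=> H; split; apply/ffunP => i; rewrite ffunE.
      by have := H i (ltn_ord i); rewrite AE => -[].
    by have := H i (ltn_ord i); rewrite AE => -[].
  move=> [h1 h2] i ni; have := AE v (Ordinal ni); rewrite /= => ->.
  by rewrite /= -h1 -h2 !ffunE.
have mS v : measurable (S v).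
  apply: bigcap_measurableType => i _; rewrite -[X in measurable X]setTI.
  exact: measurable_funPT.
have -> : [set w | Q (cls_of n w) (bit_of n w)] = \big[setU/set0]_(v : I | Q v.1 v.2) S v.
  apply/seteqP; split => [w /= Qw|w]; rewrite -bigcup_seq_cond /=.
    by exists (cls_of n w, bit_of n w); [rewrite /= mem_index_enum|exact/SE].
  by move=> [v /= /andP[_ Qv] /SE[-> ->]].
split; first by apply: bigsetU_measurable.
rewrite measure_bigsetU_fin//; last first.
  apply/trivIsetP => v v' _ _ vv'; apply/seteqP; split => // w [/SE[h1 h2] /SE[h3 h4]].
  move/eqP: vv'; apply.
  by rewrite [v]surjective_pairing [v']surjective_pairing -h1 -h2 h3 h4.
have PS v : P (S v) = (\prod_(i < n) (q (v.1 i) * bern (p (v.1 i)) (v.2 i)))%:E.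
  rewrite indep// -prodEFin; apply: eq_bigr => i _.
  by rewrite AE law.
rewrite (eq_bigr _ (fun v _ => PS v)) sumEFin; congr (_%:E).
rewrite big_mkcond /EE /Ec /Eo /pexp.
under [RHS]eq_bigr do rewrite mulr_sumr.
rewrite pair_big /=; apply: eq_bigr => v _; rewrite /pweight big_split/= mulrA.
by case: (Q _ _); rewrite ?mulr1 ?mulr0.
Qed.

End finite_code.

Section knots.
Context {R : realType}.
Variables (t0 : R) (K : nat).
Hypothesis t0_in : 0 < t0 < 1.
Hypothesis K_gt0 : (0 < K)%N.
Local Notation L := (nbins t0 K).
Local Notation kn := (knot t0 K).
Local Notation de := ((K%:R)^-1 : R).

Let K0 : 0 < K%:R :> R. Proof. by rewrite ltr0n. Qed.
Let d0 : 0 < de. Proof. by rewrite invr_gt0. Qed.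
Let Kd : K%:R * de = 1. Proof. by rewrite mulfV// gt_eqF. Qed.

Lemma nbins_le : (K <= L <= K.+1)%N.
Proof. by rewrite /nbins; case: ifP => _; rewrite !leqnn ?leqnSn. Qed.

(** If [K * t0] is a natural number, it lies strictly between 0 and [K] because [t0] is interior, so
    [K] is at least 2; otherwise there is one bin more than [K]. *)
Lemma nbins_ge2 : (2 <= L)%N.
Proof.
rewrite /nbins; case: ifPn => // /natrP[q qE].
rewrite -(ltr_nat R) ; have /andP[h0 h1] := t0_in.
have q0 : (0 < q)%N by rewrite -(ltr_nat R) -qE mulr_gt0.
have : q%:R < K%:R :> R by rewrite -qE -[ltRHS]mulr1 ltr_pM2l.
by apply: le_lt_trans; rewrite ler_nat.
Qed.

Lemma knot1 : kn 1 = 0.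
Proof. by rewrite /knot; case: ifP => _; rewrite ?subrr ?mul0r. Qed.

(** Treats the two kinds of partition as one: from index 2 up to [L] the knots are in arithmetic
    progression with step 1 / K. Only the first and the last bin may be shorter; they are kept out
    and later shown not to contribute. *)
Lemma knot_affine : exists c0 : R,
  [/\ forall k, (2 <= k <= L)%N -> kn k = c0 + k%:R * de,
      0 <= c0 + 2 * de <= de & 1 - de <= c0 + L%:R * de < 1].
Proof.
rewrite /nbins /knot; case: (boolP (_ \is a Num.nat)) => tN.
  exists (- de); split.
  - by move=> k _; rewrite mulrBl mul1r addrC.
  - by move: d0; move: (K%:R^-1 : R) => e ?; apply/andP; split; lra.
  - by rewrite Kd; move: d0; move: (K%:R^-1 : R) => e ?; apply/andP; split; lra.
set f : R := (Num.floor (t0 * K%:R))%:~R.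
have f1 : f * de <= t0 by rewrite ler_pdivrMr// floor_le.
have f2 : t0 < (f + 1) * de.
  by rewrite ltr_pdivlMr//; have := floorD1_gt (t0 * K%:R); rewrite intrD.
exists (t0 - (f + 2) * de); split.
- move=> k /andP[k2 kK]; rewrite leqNgt k2 /= kK.
  by rewrite -/f; ring.
- by move: d0 f1 f2; move: (K%:R^-1 : R) => e *; apply/andP; split; lra.
- have -> : K.+1%:R * de = 1 + de by rewrite -natr1 mulrDl Kd mul1r.
  by move: d0 f1 f2; move: (K%:R^-1 : R) => e *; apply/andP; split; lra.
Qed.

Lemma knot_step k : (2 <= k < L)%N -> kn k.+1 = kn k + de.
Proof.
move=> /andP[k2 kL]; have [c0 [kE _ _]] := knot_affine.
by rewrite !kE ?k2 ?(ltnW kL) ?kL ?(leqW k2)// -natr1; ring.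
Qed.

Lemma knot_shift k l : (2 <= k <= L)%N -> (2 <= l <= L)%N ->
  kn l = kn k + (l%:R - k%:R) * de.
Proof.
by move=> hk hl; have [c0 [kE _ _]] := knot_affine; rewrite !kE//; ring.
Qed.

Lemma knot2_in : 0 <= kn 2 <= de.
Proof.
have [c0 [kE h _]] := knot_affine.
by rewrite kE ?nbins_ge2.
Qed.

Lemma knotL_in : 1 - de <= kn L < 1.
Proof.
have [c0 [kE _ h]] := knot_affine.
by rewrite kE ?nbins_ge2 ?leqnn.
Qed.

Lemma knot_le k l : (1 <= k)%N -> (k <= l)%N -> (l <= L)%N -> kn k <= kn l.
Proof.
move=> k1 kl lL; have [->//|kl'] := eqVneq k l.
have {kl'}kl : (k < l)%N by rewrite ltn_neqAle kl' kl.
have l2 : (2 <= l)%N by exact: leq_ltn_trans kl.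
have key q : (2 <= q)%N -> (q <= l)%N -> kn q <= kn l.
  move=> q2 ql; rewrite (@knot_shift q l) ?q2 ?l2 ?(leq_trans ql)//.
  by rewrite lerDl mulr_ge0 ?subr_ge0 ?ler_nat// ltW.
have [->|k2] : k = 1%N \/ (2 <= k)%N.
  by move: k1; rewrite leq_eqVlt => /predU1P[<-|]; [left|right].
  have /andP[h _] := knot2_in.
  by rewrite knot1 (le_trans h)// key.
exact: key (ltnW kl).
Qed.

Lemma binE k s : (2 <= k < L)%N -> (s \in bin t0 K k) = (kn k <= s < kn k + de).
Proof.
move=> /andP[k2 kL]; rewrite /bin ltn_eqF// in_itv/=.
by rewrite knot_step ?k2.
Qed.

Lemma bin_ge k s : s \in bin t0 K k -> kn k <= s.
Proof. by rewrite /bin; case: ifP => _; rewrite in_itv/= => /andP[]. Qed.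

Lemma bin_lt k s : (k < L)%N -> s \in bin t0 K k -> s < kn k.+1.
Proof. by move=> kL; rewrite /bin ltn_eqF// in_itv/= => /andP[]. Qed.

Lemma bin_lt_lt k l s u : (1 <= k)%N -> (k < l)%N -> (l <= L)%N ->
  s \in bin t0 K k -> u \in bin t0 K l -> s < u.
Proof.
move=> k1 kl lL /(bin_lt (leq_trans kl lL)) sk /bin_ge lu.
by apply: (lt_le_trans sk); apply: le_trans lu; exact: knot_le.
Qed.

Lemma bin_inj k l s : (1 <= k <= L)%N -> (1 <= l <= L)%N ->
  s \in bin t0 K k -> s \in bin t0 K l -> k = l.
Proof.
move=> /andP[k1 kL] /andP[l1 lL] sk sl.
have [kl|lk|//] := ltngtP k l.
  by have := bin_lt_lt k1 kl lL sk sl; rewrite ltxx.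
by have := bin_lt_lt l1 lk kL sl sk; rewrite ltxx.
Qed.

Lemma measurable_bin k : measurable [set` bin t0 K k].
Proof. exact: measurable_itv. Qed.

Lemma knot_in_bin k : (2 <= k < L)%N -> kn k \in bin t0 K k.
Proof. by move=> hk; rewrite binE// lexx ltrDl d0. Qed.

End knots.

(** * Compactness and monotonicity bounds *)

Section compact_bounds.
Context {R : realType}.

Lemma deriv_lipschitz (f f' : R -> R) (a b : R) : a <= b ->
  (forall y : R, a <= y <= b -> is_derive y (1 : R) f (f' y)) ->
  (forall y : R, a <= y <= b -> {for y, continuous f'}) ->
  exists2 C, 0 <= C & forall y z : R, a <= y -> y <= z -> z <= b -> f z - f y <= C * (z - y).
Proof.
move=> ab df cf.
have cW : {within `[a, b], continuous f'}.
  by apply: continuous_in_subspaceT => y /[!inE]/= /[!in_itv]/= /cf.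
have [c cin cmax] := EVT_max ab cW.
exists (Num.max (f' c) 0); first by rewrite le_max lexx orbT.
move=> y z ay yz zb.
have [|w /andP[w1 w2] ->] := @mvt_is_derive R f f' y z yz.
  by move=> w /andP[w1 w2]; apply: df; rewrite (le_trans ay)// (le_trans w2).
rewrite ler_wpM2r ?subr_ge0// le_max cmax// in_itv/=.
by rewrite (le_trans ay)// (le_trans w2).
Qed.

Lemma segment_bound (H : R * R -> R) (t0 lo hi : R) :
  (forall u, lo <= u <= hi -> exists C, \forall z \near (t0, u), H z <= C) ->
  exists rho C : R, [/\ 0 < rho, 0 <= C & forall s u, `|s - t0| < rho ->
    lo - rho < u < hi + rho -> H (s, u) <= C].
Proof.
move=> Hloc; have [lh|hl] := leP lo hi; last first.
  exists ((lo - hi) / 2), 0; split => //; first by rewrite divr_gt0// subr_gt0.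
  by move=> s u _ /andP[? ?]; exfalso; lra.
have cK : compact (`[lo, hi]%classic : set R) by exact: segment_compact.
move/compact_near_coveringP : cK => cK.
(* One parameter has two roles: [C] bounds the values and [C^-1] is the radius. The property thus
   becomes a statement near infinity, to which the near covering by compactness applies. *)
pose Q (C u : R) := forall s v, `|s - t0| < C^-1 -> `|v - u| < C^-1 -> H (s, v) <= C.
have : \forall C \near +oo%R, (`[lo, hi]%classic : set R) `<=` Q C.
  apply: cK => u /=; rewrite in_itv/= => uin.
  have [C0 [[A B] /= [[r1 /= r10 Ar] [r2 /= r20 Br]] HAB]] := Hloc u uin.
  exists (ball u (r2 / 2), [set C | [/\ C0 < C, r1^-1 < C & (r2 / 2)^-1 < C]]) => /=.
    split; first by apply: nbhsx_ballx; rewrite divr_gt0.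
    exists (Num.max C0 (Num.max r1^-1 (r2 / 2)^-1)); split; first exact: num_real.
    by move=> C; rewrite !gt_max => /andP[? /andP[? ?]]; split.
  move=> [v C] /= [uv [C1 C2 C3]] s w sC wC.
  have Cp : 0 < C by apply: lt_trans C2; rewrite invr_gt0.
  have i1 : C^-1 < r1 by rewrite -[r1]invrK ltf_pV2 ?posrE ?invr_gt0.
  have i2 : C^-1 < r2 / 2 by rewrite -[r2 / 2]invrK ltf_pV2 ?posrE ?invr_gt0 ?divr_gt0.
  apply: ltW; apply: le_lt_trans C1; apply: (HAB (s, w)); split => /=.
    by apply: Ar; rewrite /ball_ /= distrC; exact: lt_trans i1.
  apply: Br; rewrite /ball_ /=; move: uv wC; rewrite /ball /= !ltr_norml.
  by move=> /andP[? ?] /andP[? ?]; apply/andP; split; lra.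
move=> [M [_ HM]]; pose C := Num.max M 0 + 1.
have C0 : 0 < C by rewrite /C ltr_wpDl// le_max lexx orbT.
have QC := HM C _; exists C^-1, C; split; [by rewrite invr_gt0|exact: ltW|].
move=> s u sC /andP[u1 u2].
have {}QC : `[lo, hi]%classic `<=` Q C.
  by apply: QC; rewrite /C ltr_pwDr// le_max lexx.
have i0 : 0 < C^-1 by rewrite invr_gt0.
have [ul|lu] := ltP u lo.
  apply: (QC lo) => //=; first by rewrite in_itv/= lexx.
  by rewrite ltr_norml; apply/andP; split; lra.
have [hu|uh] := ltP hi u.
  apply: (QC hi) => //=; first by rewrite in_itv/= lexx lh.
  by rewrite ltr_norml; apply/andP; split; lra.
apply: (QC u) => //=; first by rewrite in_itv/= lu.
by rewrite subrr normr0.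
Qed.

(** Strictness comes from a short interval next to [t0], where the derivative is positive by
    continuity; monotonicity carries it to all [x]. *)
Lemma deriv_pos_lt (f f' : R -> R) (t0 : R) : 0 < t0 < 1 -> {homo f : x y / x <= y} ->
  (forall y : R, 0 < y < 1 -> is_derive y (1 : R) f (f' y)) ->
  {for t0, continuous f'} -> 0 < f' t0 ->
  forall x, (t0 < x -> f t0 < f x) /\ (x < t0 -> f x < f t0).
Proof.
move=> /andP[t1 t2] nd df cf f0 x.
have /cvgrPdist_lt/(_ _ f0) [r /= r0 Hr] := cf.
have fpos y : `|t0 - y| < r -> 0 < f' y.
  by move=> /Hr; rewrite ltr_norml => /andP[_]; lra.
split=> tx.
  pose e := Num.min (r / 2) (Num.min ((1 - t0) / 2) (x - t0)).
  have e0 : 0 < e by rewrite !lt_min !divr_gt0 ?subr_gt0.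
  have [e1 [e2 e3]] : e <= r / 2 /\ e <= (1 - t0) / 2 /\ e <= x - t0.
    by rewrite /e !ge_min !lexx !orbT.
  have te : t0 <= t0 + e by rewrite lerDl ltW.
  have [|z /andP[z1 z2] E] := @mvt_is_derive R f f' t0 (t0 + e) te.
    by move=> z /andP[z1 z2]; apply: df; apply/andP; split; lra.
  apply: (@lt_le_trans _ _ (f (t0 + e))); last by apply: nd; lra.
  rewrite -subr_gt0 E mulr_gt0 ?fpos//; last by lra.
  by rewrite ltr_norml; apply/andP; split; lra.
pose e := Num.min (r / 2) (Num.min (t0 / 2) (t0 - x)).
have e0 : 0 < e by rewrite !lt_min !divr_gt0 ?subr_gt0.
have [e1 [e2 e3]] : e <= r / 2 /\ e <= t0 / 2 /\ e <= t0 - x.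
  by rewrite /e !ge_min !lexx !orbT.
have te : t0 - e <= t0 by rewrite gerBl ltW.
have [|z /andP[z1 z2] E] := @mvt_is_derive R f f' (t0 - e) t0 te.
  by move=> z /andP[z1 z2]; apply: df; apply/andP; split; lra.
apply: (@le_lt_trans _ _ (f (t0 - e))); first by apply: nd; lra.
rewrite -subr_gt0 E mulr_gt0 ?fpos//; last by lra.
by rewrite ltr_norml; apply/andP; split; lra.
Qed.

End compact_bounds.

(** * The two sides of the anchor point *)

Section sides.
Context {R : realType}.
Local Notation leb := (@lebesgue_measure R).
Local Notation leb2 := (@lebesgue_measure R \x @lebesgue_measure R)%E.
Variables (F0 f0 : R -> R) (h : R * R -> R) (eps t0 b : R) (K j : nat -> nat).
Hypothesis mh : measurable_fun setT h.
Hypothesis h_ge0 : forall z, 0 <= h z.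
Hypothesis h_supp : forall z, h z != 0 -> sep_triangle eps z.
Hypothesis h_int1 : (\int[leb2]_z (h z)%:E = 1)%E.
Hypothesis eps_gt0 : 0 < eps.
Hypothesis b_gt0 : 0 < b.
Hypothesis h_lb : forall z, sep_triangle eps z -> b <= h z.
Hypothesis t0_in : 0 < t0 < 1.
Hypothesis h_contl : forall t, eps <= t <= t0 - eps ->
  h z @[z --> within (sep_triangle eps) (nbhs (t, t0))] --> h (t, t0).
Hypothesis h_contr : forall u, t0 + eps <= u <= 1 - eps ->
  h z @[z --> within (sep_triangle eps) (nbhs (t0, u))] --> h (t0, u).
Hypothesis mF0 : measurable_fun setT F0.
Hypothesis F0_01 : forall y, 0 <= F0 y <= 1.
Hypothesis F0_nd : {homo F0 : x y / x <= y}.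
Hypothesis F0_deriv : forall x : R, 0 < x < 1 -> is_derive x (1 : R) F0 (f0 x).
Hypothesis f0_cont : forall x : R, 0 < x < 1 -> {for x, continuous f0}.
Hypothesis f0_gt0 : 0 < f0 t0.
Hypothesis K_gt0 : forall n, (0 < K n)%N.
Hypothesis j_in : forall n, (1 <= j n <= nbins t0 (K n))%N.
Hypothesis mesh_cvg : @mesh R K n @[n --> \oo] --> (0 : R).

Definition anchor n : R := knot t0 (K n) (j n).
Hypothesis j_cvg : anchor n @[n --> \oo] --> t0.

Local Notation L n := (nbins t0 (K n)).
Local Notation mesh := (@mesh R K).
Let meshE n : mesh n = (K n)%:R^-1. Proof. by []. Qed.
Let mesh0 n : 0 < mesh n. Proof. exact: mesh_gt0. Qed.

(** The first knot is 0 and the last bin starts within one mesh of 1, so a knot converging to the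
    interior point [t0] eventually starts a bin of full length. *)
Lemma near_anchor : \forall n \near \oo, (2 <= j n < L n)%N /\ mesh n < eps.
Proof.
have /andP[t1 t2] := t0_in.
have t3 : 0 < (1 - t0) / 2 by rewrite divr_gt0 ?subr_gt0.
near=> n.
have a0 : 0 < anchor n by near: n; exact: cvgr_gt j_cvg _ t1.
have a1 : anchor n < t0 + (1 - t0) / 2.
  by near: n; apply: (cvgr_lt _ j_cvg); rewrite ltrDl.
have m1 : mesh n < (1 - t0) / 2 by near: n; exact: cvgr_lt mesh_cvg _ t3.
split; last by near: n; exact: cvgr_lt mesh_cvg _ eps_gt0.
have /andP[j1 jL] := j_in n.
apply/andP; split.
  rewrite ltn_neqAle j1 andbT; apply/eqP => E.
  by move: a0; rewrite /anchor -E knot1 ltxx.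
rewrite ltn_neqAle jL andbT; apply/eqP => E.
have /andP[k1 _] := knotL_in t0_in (K_gt0 n).
move: a1 k1 m1; rewrite /anchor E -meshE.
by move: (mesh n) (knot t0 (K n) (L n)) => x y *; lra.
Unshelve. all: by end_near. Qed.

Let hE z : h z != 0 -> [/\ 0 <= z.1, z.1 + eps <= z.2 & z.2 <= 1].
Proof. exact: h_supp. Qed.

(** At an interior point of the triangle continuity relative to the triangle is plain continuity. *)
Lemma h_cont_interior t u : 0 < t -> t + eps < u -> u < 1 ->
  h z @[z --> within (sep_triangle eps) (nbhs (t, u))] --> h (t, u) ->
  {for (t, u), continuous h}.
Proof.
move=> ht tu u1 hc; move=> N NN.
have hN : \forall z \near (t, u), sep_triangle eps z -> N (h z) := hc N NN.
suff : \forall z \near (t, u), N (h z) by [].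
have c1 : z.1 @[z --> (t, u)] --> t by exact: cvg_fst.
have c2 : z.2 @[z --> (t, u)] --> u by exact: cvg_snd.
have c3 : z.2 - (z.1 + eps) @[z --> (t, u)] --> u - (t + eps).
  by apply: cvgB => //; apply: cvgD => //; exact: cvg_cst.
near=> z; have : sep_triangle eps z -> N (h z) by near: z.
apply; split.
- by near: z; apply: (cvgr_ge _ c1).
- rewrite -subr_ge0; near: z; apply: (cvgr_ge _ c3); by rewrite subr_gt0.
- by near: z; apply: (cvgr_le _ c2).
Unshelve. all: by end_near. Qed.

(** At boundary points only the values inside the triangle are controlled by the limit, but off it
    [h] is zero. *)
Lemma h_bound_within t u :
  h z @[z --> within (sep_triangle eps) (nbhs (t, u))] --> h (t, u) ->
  exists C, \forall z \near (t, u), h z <= C.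
Proof.
move=> hc; exists (Num.max (h (t, u) + 1) 0).
have h1 : h (t, u) < h (t, u) + 1 by rewrite ltrDl.
have hN : \forall z \near (t, u), sep_triangle eps z -> h z < h (t, u) + 1.
  exact: (cvgr_lt _ hc _ h1).
near=> z; have [hz0|hz] := eqVneq (h z) 0; first by rewrite hz0 le_max lexx orbT.
rewrite le_max; apply/orP; left; apply: ltW.
have : sep_triangle eps z -> h z < h (t, u) + 1 by near: z.
by apply; exact: h_supp.
Unshelve. all: by end_near. Qed.

(** On the left side the anchor bin holds the second time. The reflection makes it the first
    coordinate again, so that both sides use the same lemmas. *)
Definition hswap (z : R * R) : R := h (z.2, z.1).

Let swap_cvg (s u : R) : (z.2, z.1) @[z --> (s, u)] --> (u, s).
Proof.
have c1 : z.2 @[z --> (s, u)] --> u by exact: cvg_snd.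
have c2 : z.1 @[z --> (s, u)] --> s by exact: cvg_fst.
exact: (cvg_pair c1 c2).
Qed.

Let ih : leb2.-integrable setT (EFin \o h).
Proof.
apply/integrableP; split; first exact/measurable_EFinP.
under eq_integral do rewrite /= ger0_norm//.
by rewrite h_int1 ltry.
Qed.

Let mhs : measurable_fun setT hswap.
Proof.
apply: (measurableT_comp mh).
by apply: measurable_fun_pair; [exact: measurable_snd|exact: measurable_fst].
Qed.

Lemma integrable_hswap : leb2.-integrable setT (EFin \o hswap).
Proof.
apply/integrableP; split; first exact/measurable_EFinP.
have -> : (\int[leb2]_x `|(EFin \o hswap) x| = \int[leb2]_x (h x)%:E)%E.
  rewrite -setXTT; have := @leb2_swap R (EFin \o h) setT setT measurableT measurableT.
  rewrite /= => -> //; last exact/measurable_EFinP.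
  by apply: eq_integral => z _; rewrite /= /hswap ger0_norm.
by rewrite h_int1 ltry.
Qed.

Let ihs := integrable_hswap.

Let iG1 : leb.-integrable setT (EFin \o G1 h).
Proof.
have := g1_integrable mh h_ge0 h_supp (ltW eps_gt0) h_int1.
move=> ig.
have mG : measurable_fun setT (G1 h).
  by apply: measurableT_comp => //; exact: (measurable_int leb ig).
apply: (le_integrable _ _ _ ig) => //; first exact/measurable_EFinP.
move=> u _ /=; rewrite /G1; case: (g1 h u) => [r| |] //=; by rewrite leey.
Qed.

Let iG2 : leb.-integrable setT (EFin \o G2 h).
Proof.
have := g2_integrable mh h_ge0 h_supp (ltW eps_gt0) h_int1.
move=> ig.
have mG : measurable_fun setT (G2 h).
  by apply: measurableT_comp => //; exact: (measurable_int leb ig).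
apply: (le_integrable _ _ _ ig) => //; first exact/measurable_EFinP.
move=> u _ /=; rewrite /G2; case: (g2 h u) => [r| |] //=; by rewrite leey.
Qed.

Let e2 : 0 < eps / 2. Proof. by rewrite divr_gt0. Qed.

Let lip : exists cL dL Cf : R, [/\ 0 < cL, dL < 1, cL < t0 < dL, cL <= eps / 2 /\ 1 - eps / 2 <= dL &
  0 <= Cf /\ forall y z : R, cL <= y -> y <= z -> z <= dL -> F0 z - F0 y <= Cf * (z - y)].
Proof.
have /andP[t1 t2] := t0_in.
(* The half of [eps] leaves room for the margin [rho], at most [eps / 2], around the range of
   integration; the other bounds keep [t0] strictly inside. *)
pose cL := Num.min (eps / 2) (t0 / 2); pose dL := 1 - Num.min (eps / 2) ((1 - t0) / 2).
have c0 : 0 < cL by rewrite lt_min e2 divr_gt0.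
have c1 : cL <= eps / 2 /\ cL <= t0 / 2 by rewrite /cL !ge_min !lexx !orbT.
have d0 : 0 < 1 - dL by rewrite subKr lt_min e2 divr_gt0 ?subr_gt0.
have d1 : 1 - dL <= eps / 2 /\ 1 - dL <= (1 - t0) / 2 by rewrite subKr !ge_min !lexx !orbT.
move: c1 d1 => [c1 c2] [d1 d2].
have cd : cL <= dL by lra.
have [||Cf Cf0 lipC] := @deriv_lipschitz R F0 f0 cL dL cd.
- by move=> y /andP[? ?]; apply: F0_deriv; apply/andP; split; lra.
- by move=> y /andP[? ?]; apply: f0_cont; apply/andP; split; lra.
exists cL, dL, Cf; split => //; [by lra|by apply/andP; split; lra|by split; lra].
Qed.

Let F0_lt x : (t0 < x -> F0 t0 < F0 x) /\ (x < t0 -> F0 x < F0 t0).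
Proof. exact: (deriv_pos_lt t0_in F0_nd F0_deriv (f0_cont t0_in)). Qed.

Let F0t0_in : 0 < F0 t0 < 1.
Proof.
have /andP[t1 t2] := t0_in.
have /andP[h1 _] := F0_01 0; have /andP[_ h2] := F0_01 1.
by rewrite (le_lt_trans h1 ((F0_lt 0).2 t1)) (lt_le_trans ((F0_lt 1).1 t2) h2).
Qed.

Local Notation oR := (`](t0 + eps), (1 - eps)[%classic : set R).
Local Notation oL := (`]eps, (t0 - eps)[%classic : set R).

Let node0 sgn n i : node sgn anchor K n i = anchor n + sgn * (i%:R * mesh n).
Proof. by []. Qed.

Let cover_gt u (s : R) : 0 < s * (u - t0) ->
  \forall n \near \oo, 1 < s * (u - anchor n) * (K n)%:R.
Proof.
move=> u0; have c1 : s * (u - anchor n) @[n --> \oo] --> s * (u - t0).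
  by apply: cvgMr; apply: cvgB => //; exact: cvg_cst.
have u2 : 0 < s * (u - t0) / 2 by rewrite divr_gt0.
near=> n.
have h1 : s * (u - t0) / 2 < s * (u - anchor n).
  by near: n; apply: (cvgr_gt _ c1); rewrite ltr_pdivrMr// ltr_pMr// ltr1n.
have h2 : mesh n < s * (u - t0) / 2 by near: n; exact: cvgr_lt mesh_cvg _ u2.
have := lt_trans h2 h1; rewrite meshE => h3.
by rewrite -ltr_pdivrMr ?ltr0n// mul1r.
Unshelve. all: by end_near. Qed.

Lemma G1_supp u : G1 h u != 0 -> u <= 1 - eps.
Proof.
move=> g0; rewrite leNgt; apply/negP => hu; move/eqP: g0; apply.
rewrite /G1 (g1_int h_supp (ltW eps_gt0)) integral0_eq// => v _.
have [->//|/hE/=[_ h1 h2]] := eqVneq (h (u, v)) 0.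
by exfalso; lra.
Qed.

Lemma G2_supp u : G2 h u != 0 -> eps <= u.
Proof.
move=> g0; rewrite leNgt; apply/negP => hu; move/eqP: g0; apply.
rewrite /G2 (g2_int h_supp (ltW eps_gt0)) integral0_eq// => v _.
have [->//|/hE/=[h0 h1 _]] := eqVneq (h (v, u)) 0.
by exfalso; lra.
Qed.

Let int_cst_itv (x y : R) : x < y -> (\int[leb]_(u in `[x, y]) b%:E = (b * (y - x))%:E)%E.
Proof.
move=> xy; rewrite integral_cst//= lebesgue_measure_itv/= lte_fin xy.
by rewrite -EFinB -EFinM.
Qed.

Let g1_lb u : 0 <= u -> u < 1 - eps -> (0 < g1 h u)%E.
Proof.
move=> u0 u1; have xy : u + eps < 1 by lra.
apply: (@lt_le_trans _ _ (\int[leb]_(v in `[(u + eps)%R, 1%R]) b%:E)%E).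
  by rewrite int_cst_itv// lte_fin mulr_gt0// subr_gt0.
rewrite (g1_int h_supp (ltW eps_gt0)).
have mhu : measurable_fun setT (fun v => h (u, v)) by exact: section_measurable1.
apply: (@le_trans _ _ (\int[leb]_(v in `[(u + eps)%R, 1%R]) (h (u, v))%:E)%E).
  apply: ge0_le_integral => //.
  - by move=> v _; rewrite lee_fin ltW.
  - by apply: measurable_funTS; exact/measurable_EFinP.
  - move=> v; rewrite /= in_itv/= => /andP[v1 v2]; rewrite lee_fin.
    by apply: h_lb; split.
apply: ge0_subset_integral => //; first exact/measurable_EFinP.
by move=> v _; rewrite lee_fin.
Qed.

Let g2_lb u : u <= 1 -> eps < u -> (0 < g2 h u)%E.
Proof.
move=> u0 u1; have xy : 0 < u - eps by lra.
apply: (@lt_le_trans _ _ (\int[leb]_(v in `[0%R, (u - eps)%R]) b%:E)%E).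
  by rewrite int_cst_itv// lte_fin mulr_gt0// subr0.
rewrite (g2_int h_supp (ltW eps_gt0)).
have mhu : measurable_fun setT (fun v => h (v, u)) by exact: section_measurable2.
apply: (@le_trans _ _ (\int[leb]_(v in `[0%R, (u - eps)%R]) (h (v, u))%:E)%E).
  apply: ge0_le_integral => //.
  - by move=> v _; rewrite lee_fin ltW.
  - by apply: measurable_funTS; exact/measurable_EFinP.
  - move=> v; rewrite /= in_itv/= => /andP[v1 v2]; rewrite lee_fin.
    by apply: h_lb; split => //=; lra.
apply: ge0_subset_integral => //; first exact/measurable_EFinP.
by move=> v _; rewrite lee_fin.
Qed.

Lemma g1_fin_ae : {ae leb, forall u, g1 h u \is a fin_num}.
Proof.
have ig := g1_integrable mh h_ge0 h_supp (ltW eps_gt0) h_int1.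
have FA := ae_filter_ringOfSetsType leb.
by apply: (@filterS _ _ FA _ _ _ (integrable_ae measurableT ig)) => u; exact.
Qed.

Lemma g2_fin_ae : {ae leb, forall u, g2 h u \is a fin_num}.
Proof.
have ig := g2_integrable mh h_ge0 h_supp (ltW eps_gt0) h_int1.
have FA := ae_filter_ringOfSetsType leb.
by apply: (@filterS _ _ FA _ _ _ (integrable_ae measurableT ig)) => u; exact.
Qed.

Lemma right_limits : exists kB CB dB rho : R, [/\ 0 <= kB, 0 <= CB, 0 <= dB, 0 < rho <= eps / 2 &
  side_limits 1 anchor K (G1 h) F0 h (fun n => (L n).+1 - j n)%N f0 (t0 + eps) (1 - eps) t0 b rho
    kB CB dB].
Proof.
have [cL [dL [Cf [cL0 dL1 t0cd [cLe dLe] [Cf0 lipC]]]]] := lip.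
have /andP[t1 t2] := t0_in.
have ep := eps_gt0.
have [r1 [C [r10 C0 HC]]] := @segment_bound R h t0 (t0 + eps) (1 - eps)
  (fun u hu => h_bound_within (h_contr hu)).
pose rho := Num.min r1 (eps / 2).
have rho0 : 0 < rho by rewrite lt_min r10.
have [rr re] : rho <= r1 /\ rho <= eps / 2 by rewrite !ge_min !lexx !orbT.
(* Here [kap] is [eps / 2]: the range starts at [t0 + eps] and [rho] takes away at most half of that
   gap. *)
exists (2 / (eps / 2)), C, (2 * Cf), rho; split => //.
- by rewrite divr_ge0// ltW.
- by rewrite mulr_ge0.
- by rewrite rho0.
have uin u : t0 + eps < u < 1 - eps -> sep_triangle eps (t0, u).
  by move=> /andP[? ?]; split => /=; lra.
apply: (@one_side_limits R 1 anchor K (G1 h) F0 h _ f0 (t0 + eps)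
  (1 - eps) t0 b C rho (eps / 2) cL dL Cf) => //.
- exact: expr1n.
- by move=> y; rewrite /G1 fine_ge0// g1_ge0.
- by lra.
- by lra.
- move=> u hu; have /andP[? ?] := hu; apply: h_cont_interior => //; first by lra.
  by apply: h_contr; apply/andP; split; lra.
- by move=> u /uin; exact: h_lb.
- move=> s u hs /andP[? ?]; apply: HC; first exact: lt_le_trans rr.
  by apply/andP; split; lra.
- have FA := ae_filter_ringOfSetsType leb.
  apply: (@filterS _ _ FA _ _ _ g1_fin_ae) => u gf /andP[? ?].
  by rewrite /G1 fine_gt0// g1_lb ?ltey_eq ?gf//; lra.
- by move=> u /andP[? ?]; lra.
- move=> r r0; exists (r / 2); first by rewrite divr_gt0.
  move=> s u u'; rewrite !ltr_norml => /andP[? ?] /andP[? ?] /hE/=[_ ? _] /G1_supp ?.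
  by apply/andP; split; lra.
- move=> u /andP[u1 u2].
  have u0 : 0 < 1 * (u - t0) by lra.
  near=> n.
  have [/andP[j2 jL] mn] : (2 <= j n < L n)%N /\ mesh n < eps by near: n; exact: near_anchor.
  have x1 : 1 < 1 * (u - anchor n) * (K n)%:R by near: n; exact: cover_gt.
  have K0 : 0 < (K n)%:R :> R by rewrite ltr0n.
  (* The index of the bin is the integer part of the distance from the anchor in units of the mesh;
     [x1] makes it at least 1, so the bin of the anchor is excluded. *)
  have /andP[i1 i2] : (Num.truncn (1 * (u - anchor n) * (K n)%:R))%:R <= 1 * (u - anchor n) * (K n)%:R <
      (Num.truncn (1 * (u - anchor n) * (K n)%:R)).+1%:R.
    by apply: truncn_itv; rewrite ltW// (lt_trans _ x1).
  move: i1 i2 x1; rewrite mul1r; set i := Num.truncn _ => i1 i2 x1.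
  have i1' : i%:R * mesh n <= u - anchor n by rewrite meshE ler_pdivrMr.
  have i2' : u - anchor n < i%:R * mesh n + mesh n.
    have -> : i%:R * mesh n + mesh n = i.+1%:R * mesh n by rewrite -natr1 mulrDl mul1r.
    by rewrite meshE ltr_pdivlMr.
  have i0 : (0 < i)%N.
    by rewrite lt0n; apply/eqP => E; move: i2 x1; rewrite E => ? ?; lra.
  exists i; last first.
    by rewrite /cell /= in_itv/= node0 mul1r; apply/andP; split; lra.
  (* A larger index would put [u] at least one mesh beyond knot [L], hence not below 1. *)
  rewrite i0 /= ltn_subRL ltnS leqNgt; apply/negP => Li.
  have /andP[k1 _] := knotL_in t0_in (K_gt0 n).
  have jj : (2 <= j n <= L n)%N by rewrite j2 ltnW.
  have LL : (2 <= L n <= L n)%N by rewrite leqnn (nbins_ge2 t0_in (K_gt0 n)).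
  have kE := knot_shift (K_gt0 n) jj LL.
  have : ((L n).+1)%:R <= (j n + i)%:R :> R by rewrite ler_nat.
  rewrite natrD -natr1 => Lij.
  have : ((L n)%:R - (j n)%:R + 1) * mesh n <= i%:R * mesh n.
    by rewrite ler_wpM2r ?(ltW (mesh0 n))//; lra.
  move: kE k1 i1'; rewrite -meshE -/(anchor n).
  by move: (mesh n) (knot t0 (K n) (L n)) (anchor n) => x y z *; nra.
- move=> u /andP[u1 u2]; rewrite mul1r.
  have /andP[? ?] := F0t0_in; have /andP[_ ?] := F0_01 u.
  have [+ _] := F0_lt u; move=> /(_ _) hh.
  have {}hh : F0 t0 < F0 u by apply: hh; lra.
  by apply/andP; split; lra.
Unshelve. all: by end_near. Qed.

Lemma left_limits : exists kB CB dB rho : R, [/\ 0 <= kB, 0 <= CB, 0 <= dB, 0 < rho <= eps / 2 &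
  side_limits (- 1) anchor K (G2 h) F0 hswap j f0 eps (t0 - eps) t0 b rho kB CB dB].
Proof.
have [cL [dL [Cf [cL0 dL1 t0cd [cLe dLe] [Cf0 lipC]]]]] := lip.
have /andP[t1 t2] := t0_in.
have ep := eps_gt0.
have Hloc u : eps <= u <= t0 - eps -> exists C, \forall z \near (t0, u), hswap z <= C.
  move=> hu; have [C HC] := h_bound_within (h_contl hu).
  exists C; suff : nbhs ((z.2, z.1) @[z --> (t0, u)]) [set z | h z <= C] by [].
  by first [exact: (swap_cvg HC)|exact: (@swap_cvg t0 u _ HC)|apply: swap_cvg; exact: HC].
have [r1 [C [r10 C0 HC]]] := segment_bound Hloc.
pose rho := Num.min r1 (eps / 2).
have rho0 : 0 < rho by rewrite lt_min r10.
have [rr re] : rho <= r1 /\ rho <= eps / 2 by rewrite !ge_min !lexx !orbT.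
exists (2 / (eps / 2)), C, (2 * Cf), rho; split => //.
- by rewrite divr_ge0// ltW.
- by rewrite mulr_ge0.
- by rewrite rho0.
have uin u : eps < u < t0 - eps -> sep_triangle eps (u, t0).
  by move=> /andP[? ?]; split => /=; lra.
apply: (@one_side_limits R (- 1) anchor K (G2 h) F0 hswap _ f0 eps
  (t0 - eps) t0 b C rho (eps / 2) cL dL Cf) => //.
- by rewrite sqrrN expr1n.
- by move=> y; rewrite /G2 fine_ge0// g2_ge0.
- by move=> z; exact: h_ge0.
- by lra.
- by lra.
- move=> u hu; have /andP[? ?] := hu.
  have hc : {for (u, t0), continuous h}.
    apply: h_cont_interior => //; [by lra|by lra|].
    by apply: h_contl; apply/andP; split; lra.
  move=> N NN; have hN : nbhs (u, t0) (h @^-1` N) by exact: hc.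
  suff : nbhs ((z.2, z.1) @[z --> (t0, u)]) (h @^-1` N) by [].
  by first [exact: (swap_cvg hN)|exact: (@swap_cvg t0 u _ hN)|apply: swap_cvg; exact: hN].
- by move=> u /uin; exact: h_lb.
- move=> s u hs /andP[? ?]; apply: HC; first exact: lt_le_trans rr.
  by apply/andP; split; lra.
- have FA := ae_filter_ringOfSetsType leb.
  apply: (@filterS _ _ FA _ _ _ g2_fin_ae) => u gf /andP[? ?].
  by rewrite /G2 fine_gt0// g2_lb ?ltey_eq ?gf//; lra.
- by move=> u /andP[? ?]; lra.
- move=> r r0; exists (r / 2); first by rewrite divr_gt0.
  move=> s u u'; rewrite !ltr_norml => /andP[? ?] /andP[? ?] /hE/=[_ ? _] /G2_supp ?.
  by apply/andP; split; lra.
- move=> u /andP[u1 u2].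
  have u0 : 0 < -1 * (u - t0) by lra.
  near=> n.
  have [/andP[j2 jL] mn] : (2 <= j n < L n)%N /\ mesh n < eps by near: n; exact: near_anchor.
  have x1 : 1 < -1 * (u - anchor n) * (K n)%:R by near: n; exact: cover_gt.
  have K0 : 0 < (K n)%:R :> R by rewrite ltr0n.
  set x := -1 * (u - anchor n) * (K n)%:R in x1.
  (* To the left the distance is rounded up instead, because a bin contains its left end point. *)
  have [i i1 i2] : exists2 i : nat, i%:R < x + 1 & x <= i%:R.
    have /andP[i1 i2] : (Num.truncn x)%:R <= x < (Num.truncn x).+1%:R.
      by apply: truncn_itv; rewrite ltW// (lt_trans _ x1).
    have [xi|xi] := eqVneq x (Num.truncn x)%:R.
      by exists (Num.truncn x); rewrite -?xi ?ltrDl.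
    exists (Num.truncn x).+1; last exact: ltW.
    by rewrite -natr1 ltrD2r lt_neqAle eq_sym xi.
  have xE : x * mesh n = anchor n - u by rewrite /x meshE mulfK ?gt_eqF//; ring.
  have i1' : i%:R * mesh n < anchor n - u + mesh n.
    by rewrite -xE -[X in _ < _ + X]mul1r -mulrDl ltr_pM2r.
  have i2' : anchor n - u <= i%:R * mesh n by rewrite -xE ler_wpM2r// ltW.
  have i0 : (0 < i)%N.
    by rewrite lt0n; apply/eqP => E; move: i2 x1; rewrite E => ? ?; lra.
  exists i; last first.
    by rewrite /cell /= in_itv/= node0 mulN1r; apply/andP; split; lra.
  (* An index from [j n] on would force [u] below knot 2 minus one mesh, which is at most 0. *)
  rewrite i0 /= ltnNge; apply/negP => ji.
  have /andP[_ k1] := knot2_in t0_in (K_gt0 n).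
  have jj : (2 <= j n <= L n)%N by rewrite j2 ltnW.
  have LL : (2 <= 2 <= L n)%N by rewrite (nbins_ge2 t0_in (K_gt0 n)).
  have kE := knot_shift (K_gt0 n) LL jj.
  have : (j n)%:R * mesh n <= i%:R * mesh n.
    by rewrite ler_wpM2r ?(ltW (mesh0 n))// ler_nat.
  move: kE k1 i1'; rewrite -meshE -/(anchor n) => kE k1 i1'' h1.
  have : anchor n = knot t0 (K n) 2 + (j n)%:R * mesh n - 2 * mesh n by rewrite kE; ring.
  by move: (mesh n) (knot t0 (K n) 2) (anchor n) k1 i1'' h1 => *; lra.
- move=> u /andP[u1 u2]; rewrite mulN1r opprB.
  have /andP[? ?] := F0t0_in; have /andP[? _] := F0_01 u.
  have [_ hh] := F0_lt u.
  have {}hh : F0 u < F0 t0 by apply: hh; lra.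
  by apply/andP; split; lra.
Unshelve. all: by end_near. Qed.

End sides.

(** * The estimator as a function of the class counts *)

Section sum_split.
Context {V : nmodType}.

Lemma big_split_at (L j : nat) (f : nat -> V) : (1 <= j <= L)%N ->
  \sum_(1 <= k < L.+1 | k != j) f k = \sum_(1 <= k < j) f k + \sum_(j.+1 <= k < L.+1) f k.
Proof.
move=> /andP[j1 jL]; rewrite (@big_cat_nat _ _ _ j)//=; last exact: leqW.
congr (_ + _).
  rewrite big_nat_cond [RHS]big_nat_cond; apply: eq_bigl => k.
  by case: ltngtP => //; rewrite ?andbT ?andbF// => /ltnW; case: ltngtP.
rewrite big_ltn_cond ?ltnS// eqxx /= big_nat_cond [RHS]big_nat_cond; apply: eq_bigl => k.
by case: ltngtP => //; rewrite ?andbT ?andbF.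
Qed.

Lemma big_ord_split_at (L j : nat) (f : nat -> V) : (1 <= j <= L)%N -> f 0%N = 0 -> f j = 0 ->
  \sum_(k < L.+1) f k = \sum_(1 <= k < j) f k + \sum_(j.+1 <= k < L.+1) f k.
Proof.
move=> jL f0 fj; rewrite -(big_split_at _ jL) -(big_mkord xpredT) big_ltn// f0 add0r.
rewrite big_mkcond [RHS]big_mkcond; apply: eq_bigr => k _.
by case: eqP => [->|].
Qed.

Lemma big_around (L j : nat) (f : nat -> V) : (1 <= j <= L)%N -> f 0%N = 0 -> f j = 0 ->
  \sum_(k < L.+1) f k =
  \sum_(1 <= i < j) f (j - i)%N + \sum_(1 <= i < L.+1 - j) f (j + i)%N.
Proof.
move=> jL f0 fj; rewrite (big_ord_split_at jL f0 fj); congr (_ + _).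
  by rewrite big_nat_rev; apply: eq_bigr => i _; rewrite add1n.
rewrite -[j.+1]add1n big_addn; apply: eq_bigr => i _.
by rewrite addnC.
Qed.

End sum_split.

Section coding.
Context {R : realType}.
Variables (t0 : R) (K j : nat) (gd : nat -> bool).
Local Notation L := (nbins t0 K).
Local Notation I := (bin t0 K).
Hypothesis t0_in : 0 < t0 < 1.
Hypothesis K_gt0 : (0 < K)%N.
Hypothesis j_in : (2 <= j < L)%N.
Hypothesis gd_in : forall k, gd k -> (1 <= k <= L)%N && (k != j).

Definition inA k (z : R * R) : bool := if (j < k)%N then z.1 \in I k else z.2 \in I k.
Definition inC k (z : R * R) : bool :=
  if (j < k)%N then (z.1 \in I j) && (z.2 \in I k) else (z.1 \in I k) && (z.2 \in I j).
(** The inequality of the two times holds almost surely; it is built in because the disjointness of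
    the classes rests on it. *)
Definition inside (d : bool * 'I_(L.+1)) (z : R * R) : bool :=
  (if d.1 then inA d.2 z else inC d.2 z) && (z.1 < z.2).
Definition cls (z : R * R) : option (bool * 'I_(L.+1)) :=
  [pick d : bool * 'I_(L.+1) | gd d.2 && inside d z].
(** To the left of the anchor the success of a marginal class is [X <= U], the complement of
    [Delta3]: the term 1 - M' / M is then itself a success ratio. *)
Definition outcome (d : option (bool * 'I_(L.+1))) (z : R * R) (x : R) : bool :=
  match d with
  | None => false
  | Some (true, k) => if (j < k)%N then x <= z.1 else x <= z.2
  | Some (false, _) => z.1 < x <= z.2
  end.

Let j_in' : (1 <= j <= L)%N.
Proof. by move/andP: j_in => [j2 jL]; rewrite (ltnW j2) ltnW. Qed.

(** Marginal classes on opposite sides exclude each other because T < U. In all other combinations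
    of distinct classes some coordinate would lie in two different bins. Thus every observation has
    at most one class, and the counts come from a multinomial scheme. *)
Lemma inside_inj (d d' : bool * 'I_(L.+1)) z : gd d.2 -> gd d'.2 -> inside d z -> inside d' z -> d = d'.
Proof.
case: d d' => [b [k kL]] [b' [l lL]]; rewrite /inside /=.
move=> /gd_in/andP[kin kj] /gd_in/andP[lin lj] /andP[hk tu] /andP[hl _].
have inj p q s : (1 <= p <= L)%N -> (1 <= q <= L)%N -> s \in I p -> s \in I q -> p = q.
  exact: bin_inj.
have nolt p q : (1 <= p)%N -> (p < q)%N -> (q <= L)%N -> z.2 \in I p -> z.1 \in I q -> False.
  by move=> p1 pq qL h2 h1; have := lt_trans tu (bin_lt_lt t0_in K_gt0 p1 pq qL h2 h1); rewrite ltxx.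
suff [E1 E2] : b = b' /\ k = l.
  by subst b' l; congr (_, _); apply: val_inj.
move: hk hl; have /andP[k1 k2] := kin; have /andP[l1 l2] := lin.
move/eqP in kj; move/eqP in lj.
case: b; case: b'; rewrite /inA /inC.
- case: ltnP => jk; case: ltnP => jl hk hl; split => //.
  + exact: (inj _ _ _ kin lin hk hl).
  + by exfalso; apply: (nolt l k l1 _ k2 hl hk); apply: leq_ltn_trans jk.
  + by exfalso; apply: (nolt k l k1 _ l2 hk hl); apply: leq_ltn_trans jl.
  + exact: (inj _ _ _ kin lin hk hl).
- case: ltnP => jk; case: ltnP => jl hk /andP[h1 h2]; exfalso.
  + by apply: kj; exact: (inj _ _ _ kin j_in' hk h1).
  + by have E := inj _ _ _ kin lin hk h1; subst l; move: jl; rewrite leqNgt jk.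
  + by have E := inj _ _ _ kin lin hk h2; subst l; move: jk; rewrite leqNgt jl.
  + by apply: kj; exact: (inj _ _ _ kin j_in' hk h2).
- case: ltnP => jk; case: ltnP => jl /andP[h1 h2] hl; exfalso.
  + by apply: lj; exact: (inj _ _ _ lin j_in' hl h1).
  + by have E := inj _ _ _ kin lin h2 hl; subst l; move: jl; rewrite leqNgt jk.
  + by have E := inj _ _ _ kin lin h1 hl; subst l; move: jk; rewrite leqNgt jl.
  + by apply: lj; exact: (inj _ _ _ lin j_in' hl h2).
- case: ltnP => jk; case: ltnP => jl /andP[h1 h2] /andP[h3 h4]; split => //.
  + exact: (inj _ _ _ kin lin h2 h4).
  + by exfalso; apply: lj; exact: (inj _ _ _ lin j_in' h3 h1).
  + by exfalso; apply: kj; exact: (inj _ _ _ kin j_in' h1 h3).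
  + exact: (inj _ _ _ kin lin h1 h3).
Qed.

Lemma cls_eq (d : bool * 'I_(L.+1)) z : (cls z == Some d) = gd d.2 && inside d z.
Proof.
rewrite /cls; case: pickP => [d' /andP[g' i']|none]; last by rewrite none.
apply/eqP/idP => [[<-]|/andP[g i]]; first by rewrite g'.
by congr Some; exact: (inside_inj g' g i' i).
Qed.

Definition gap k : nat := if (j < k)%N then (k - j + 1)%N else (j - k + 1)%N.
Definition blam_ (k : 'I_(L.+1)) : R := if gd k then (gap k)%:R^-1 else 0.
Definition bsg_ (k : 'I_(L.+1)) : R := if (j < k)%N then 1 else -1.

Section sample.
Variables (n : nat) (x : nat -> R) (tu : nat -> R * R).
Let c : {ffun 'I_n -> option (bool * 'I_(L.+1))} := [ffun i : 'I_n => cls (tu i)].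
Let o : {ffun 'I_n -> bool} := [ffun i : 'I_n => outcome (cls (tu i)) (tu i) (x i)].
Hypothesis tu_lt : forall i, (i < n)%N -> (tu i).1 < (tu i).2.
Hypothesis tu_bad : forall k, (1 <= k <= L)%N -> k != j -> ~~ gd k ->
  (forall i, (i < n)%N -> ~~ inA k (tu i)) \/ (forall i, (i < n)%N -> ~~ inC k (tu i)).

Let rt_ k : R := if (j < k)%N then rootNQ t0 K n tu j k else rootMQ t0 K n tu j k.

Let clsA (k : 'I_(L.+1)) (i : 'I_n) : gd k -> (c i == mA k) = inA k (tu i).
Proof. by move=> gk; rewrite ffunE cls_eq gk /inside /= tu_lt// andbT. Qed.
Let clsC (k : 'I_(L.+1)) (i : 'I_n) : gd k -> (c i == mC k) = inC k (tu i).
Proof. by move=> gk; rewrite ffunE cls_eq gk /inside /= tu_lt// andbT. Qed.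

Let rtE k : rt_ k = Num.sqrt (minn (\sum_(i < n | inA k (tu i)) 1)
  (K * \sum_(i < n | inC k (tu i)) 1))%:R.
Proof. by rewrite /rt_ /rootNQ /rootMQ /inA /inC; case: ltnP. Qed.

(** One of the two counts is zero, and the minimum under the root removes the weight of the index;
    restricting the sums to [gd] therefore changes nothing. *)
Let rt_bad k : (1 <= k <= L)%N -> k != j -> ~~ gd k -> rt_ k = 0.
Proof.
move=> kin kj gk; rewrite rtE; have [h|h] := tu_bad kin kj gk.
  rewrite (big1 _ (fun i : 'I_n => inA k (tu i))) ?min0n ?sqrtr0//.
  by move=> i; rewrite (negbTE (h i (ltn_ord i))).
rewrite (big1 _ (fun i : 'I_n => inC k (tu i))) ?muln0 ?minn0 ?sqrtr0//.
by move=> i; rewrite (negbTE (h i (ltn_ord i))).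
Qed.

Local Notation rootc k := (Num.sqrt (minn (cnt c (mA k)) (K * cnt c (mC k)))%:R : R).
Let rootE (k : 'I_(L.+1)) : gd k -> rootc k = rt_ k.
Proof.
move=> gk; rewrite rtE /cnt.
by congr (Num.sqrt (minn _ (K * _))%:R); apply: eq_bigl => i; rewrite ?clsA ?clsC.
Qed.

Let term (k : nat) : R := rt_ k / (gap k)%:R.

Let WE : totalW t0 K n tu j = \sum_(1 <= k < j) term k + \sum_(j.+1 <= k < L.+1) term k.
Proof.
rewrite /totalW; congr (_ + _); apply: eq_big_nat => k /andP[k1 k2].
  by rewrite /term /rt_ /gap ltnNge ltnW.
by rewrite /term /rt_ /gap k1.
Qed.

Let gd0 : gd 0 = false. Proof. by apply/negP => /gd_in. Qed.
Let gdj : gd j = false. Proof. by apply/negP => /gd_in; rewrite eqxx andbF. Qed.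

Let side_eq (f g : nat -> R) : (forall k, (1 <= k <= L)%N -> k != j -> f k = g k) ->
  \sum_(1 <= k < j) f k + \sum_(j.+1 <= k < L.+1) f k =
  \sum_(1 <= k < j) g k + \sum_(j.+1 <= k < L.+1) g k.
Proof.
move=> fg; rewrite -!(big_split_at _ j_in') big_nat_cond [RHS]big_nat_cond.
by apply: eq_bigr => k /andP[kin kj]; exact: fg.
Qed.

Let sucA (k : 'I_(L.+1)) : gd k -> suc c o (mA k) =
  \sum_(i < n | inA k (tu i)) (outcome (mA k) (tu i) (x i))%:R :> R.
Proof.
move=> gk; rewrite /suc; apply: eq_big => [i|i /eqP ci]; first exact: clsA.
by rewrite ffunE; move: ci; rewrite ffunE => ->.
Qed.
Let sucC (k : 'I_(L.+1)) : gd k -> suc c o (mC k) =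
  \sum_(i < n | inC k (tu i)) (outcome (mC k) (tu i) (x i))%:R :> R.
Proof.
move=> gk; rewrite /suc; apply: eq_big => [i|i /eqP ci]; first exact: clsC.
by rewrite ffunE; move: ci; rewrite ffunE => ->.
Qed.
Let cntA (k : 'I_(L.+1)) : gd k -> cnt c (mA k) = (\sum_(i < n | inA k (tu i)) 1)%N.
Proof. by move=> gk; apply: eq_bigl => i; exact: clsA. Qed.
Let cntC (k : 'I_(L.+1)) : gd k -> cnt c (mC k) = (\sum_(i < n | inC k (tu i)) 1)%N.
Proof. by move=> gk; apply: eq_bigl => i; exact: clsC. Qed.

Let Delta3E i : (i < n)%N -> Delta3 x tu i = 1 - (x i <= (tu i).2)%R%:R.
Proof.
move=> ni; rewrite /Delta3 /Delta1 /Delta2; have := tu_lt ni.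
have [xt|tx] := leP (x i) (tu i).1 => /= tlu.
  by rewrite (le_trans xt (ltW tlu)) subr0.
by rewrite subr0.
Qed.

Let fitE (k : 'I_(L.+1)) : gd k ->
  term k * (suc c o (mA k) / (cnt c (mA k))%:R - bsg_ k * (suc c o (mC k) / (cnt c (mC k))%:R)) =
  term k * Fhat t0 K n x tu j k.
Proof.
move=> gk; rewrite sucA// sucC// cntA// cntC// /Fhat /bsg_ /inA /inC /outcome /mA /mC /=.
have [jk|kj] := ltnP j k; first by rewrite mul1r.
have -> : \sum_(i < n | (tu i).2 \in I k) (x i <= (tu i).2)%R%:R =
    (countM t0 K n tu k)%:R - sumM' t0 K n x tu k :> R.
  rewrite /countM /sumM' natr_sum -sumrB; apply: eq_bigr => i _.
  by rewrite Delta3E ?subKr.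
rewrite -/(countM t0 K n tu k).
(* When no U falls into the bin, the pilot estimate begins with 1 - 0 while the success ratio is 0
   by convention; both sides agree only because the weight vanishes. *)
have [M0|M0] := eqVneq (countM t0 K n tu k) 0%N.
  suff -> : term k = 0 by rewrite !mul0r.
  by rewrite /term /rt_ ltnNge kj /= /rootMQ M0 min0n sqrtr0 mul0r.
congr (_ * _); rewrite mulrBl divff ?pnatr_eq0// mulN1r opprK; congr (_ + _ / _%:R).
Qed.

(** The outer sum of the estimator reduces to [j], as the knot lies in no other bin. The
    normalisation by W becomes the common denominator of [est], and indices outside [gd] drop out of
    both sums. *)
Lemma birge_est : birge t0 K n x tu (knot t0 K j) = est K blam_ bsg_ c o.
Proof.
rewrite /birge big_mkcond (bigD1_seq j) ?iota_uniq ?mem_index_iota//=.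
rewrite (knot_in_bin K_gt0 j_in) [X in _ + X]big_seq_cond [X in _ + X]big1 ?addr0; last first.
  move=> i /andP[]; rewrite mem_index_iota => iin ij; case: ifP => // ib.
  by move/eqP: ij; case; exact: (bin_inj t0_in K_gt0 iin j_in' ib (knot_in_bin K_gt0 j_in)).
pose fden (k : nat) := if gd k then term k else 0.
pose fnum (k : nat) := if gd k then term k * Fhat t0 K n x tu j k else 0.
have num : \sum_k blam_ k * rootc k *
     (suc c o (mA k) / (cnt c (mA k))%:R - bsg_ k * (suc c o (mC k) / (cnt c (mC k))%:R)) =
     \sum_(k < L.+1) fnum k.
  apply: eq_bigr => k _; rewrite /fnum /blam_; case: ifPn => gk; last by rewrite !mul0r.
  by rewrite -fitE// rootE// /term [_^-1 * _]mulrC.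
have den : \sum_k blam_ k * rootc k = \sum_(k < L.+1) fden k.
  apply: eq_bigr => k _; rewrite /fden /blam_; case: ifPn => gk; last by rewrite !mul0r.
  by rewrite rootE// /term mulrC.
have denW : \sum_(k < L.+1) fden k = totalW t0 K n tu j.
  rewrite (big_ord_split_at j_in') /fden ?gd0 ?gdj// WE; apply: side_eq => k kin kj.
  by case: ifPn => // gk; rewrite /term rt_bad// mul0r.
transitivity ((\sum_(k < L.+1) fnum k) / (\sum_(k < L.+1) fden k)); last first.
  by rewrite -num -den.
rewrite denW (big_ord_split_at j_in') /fnum ?gd0 ?gdj//.
rewrite (@side_eq _ (fun k => term k * Fhat t0 K n x tu j k)); last first.
  by move=> k kin kj; case: ifPn => // gk; rewrite /term rt_bad// !mul0r.
rewrite -(big_split_at _ j_in') mulr_suml; apply: eq_bigr => k kj.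
rewrite mulrAC; congr (_ * _); rewrite /weight /term /rt_ /gap.
by case: ifP => _; rewrite invfM mulrA.
Qed.

End sample.
End coding.

(** * Measurability of the estimator *)

Section measurable_estimator.
Context {R : realType} {d : measure_display} {Omega : measurableType d}
  (P : probability Omega R).
Variables (X : nat -> {RV P >-> R}) (TU : nat -> {RV P >-> (R * R)%type}).

Lemma measurable_bool_code (J : finType) (f : J -> Omega -> bool) (v : {ffun J -> bool}) :
  (forall i, measurable [set w | f i w]) ->
  measurable ((fun w => [ffun i => f i w]) @^-1` [set v]).
Proof.
move=> mf; have -> : (fun w => [ffun i => f i w]) @^-1` [set v] =
    \bigcap_(i in [set: J]) [set w | f i w = v i].
  apply/seteqP; split => [w <- i _ /=|w h]; first by rewrite ffunE.
  by apply/ffunP => i; rewrite ffunE; exact: h.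
apply: fin_bigcap_measurable; first exact: finite_finset.
move=> i _; case: (v i); first exact: mf.
have -> : [set w | f i w = false] = ~` [set w | f i w].
  by apply/seteqP; split => w /=; [move=> ->|move/negP/negbTE].
exact: measurableC (mf i).
Qed.

Let mT i : measurable_fun setT (fun w => (TU i w).1).
Proof. by apply: measurableT_comp => //; exact: measurable_fst. Qed.
Let mU i : measurable_fun setT (fun w => (TU i w).2).
Proof. by apply: measurableT_comp => //; exact: measurable_snd. Qed.
Let mX i : measurable_fun setT (fun w => X i w).
Proof. exact: measurable_funPT. Qed.

Let m_le (f g : Omega -> R) : measurable_fun setT f -> measurable_fun setT g ->
  measurable [set w | f w <= g w].
Proof. by move=> mf mg; rewrite -[X in measurable X]setTI; exact: measurable_fun_le. Qed.

Let m_bin (f : Omega -> R) t0 K k : measurable_fun setT f -> measurable [set w | f w \in bin t0 K k].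
Proof.
move=> mf; rewrite -[X in measurable X]setTI.
exact: (mf measurableT _ (measurable_bin t0 K k)).
Qed.

(** The estimator depends on the sample only through finitely many truth values: bin memberships and
    comparisons of X with the two times. Each of them is a measurable event. *)
Lemma measurable_birge t0 K n s : measurable_fun setT
  (fun w => birge t0 K n (fun i => X i w) (fun i => TU i w) s).
Proof.
pose L := nbins t0 K.
pose J : finType := ('I_n * ('I_(L.+1) + 'I_(L.+1) + bool))%type.
pose f (a : J) (w : Omega) : bool := match a.2 with
  | inl (inl k) => (TU a.1 w).1 \in bin t0 K k
  | inl (inr k) => (TU a.1 w).2 \in bin t0 K k
  | inr true => X a.1 w <= (TU a.1 w).1
  | inr false => (TU a.1 w).1 < X a.1 w <= (TU a.1 w).2
  end.
apply: (@measurable_fun_code _ _ _ _ (fun w => [ffun a => f a w])).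
  move=> v; apply: measurable_bool_code => -[i [[k|k]|[]]]; rewrite /f /=.
  - exact: m_bin.
  - exact: m_bin.
  - exact: m_le.
  - have -> : [set w | (TU i w).1 < X i w <= (TU i w).2] =
        [set w | X i w <= (TU i w).2] `\` [set w | X i w <= (TU i w).1].
      apply/seteqP; split => [w /= /andP[h1 h2]|w /= [h1 /negP]].
        by split => //; apply/negP; rewrite -ltNge.
      by rewrite -ltNge => ->.
    by apply: measurableD; exact: m_le.
move=> w w' ww'.
have E i a : f (i, a) w = f (i, a) w' by have /ffunP/(_ (i, a)) := ww'; rewrite !ffunE.
have ET (i : 'I_n) k : (k <= L)%N -> ((TU i w).1 \in bin t0 K k) = ((TU i w').1 \in bin t0 K k).
  by move=> kL; exact: (E i (inl (inl (Ordinal (kL : k < L.+1)%N)))).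
have EU (i : 'I_n) k : (k <= L)%N -> ((TU i w).2 \in bin t0 K k) = ((TU i w').2 \in bin t0 K k).
  by move=> kL; exact: (E i (inl (inr (Ordinal (kL : k < L.+1)%N)))).
have E1 (i : 'I_n) : (X i w <= (TU i w).1) = (X i w' <= (TU i w').1) by exact: (E i (inr true)).
have E2 (i : 'I_n) : ((TU i w).1 < X i w <= (TU i w).2) = ((TU i w').1 < X i w' <= (TU i w').2).
  exact: (E i (inr false)).
pose x w i : R := X i w; pose tu w i : R * R := TU i w.
have D3 (i : 'I_n) : Delta3 (x w) (tu w) i = Delta3 (x w') (tu w') i.
  by rewrite /Delta3 /Delta1 /Delta2 /x /tu E1 E2.
have cN k : (k <= L)%N -> countN t0 K n (tu w) k = countN t0 K n (tu w') k.
  by move=> kL; apply: eq_bigl => i; exact: ET.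
have cM k : (k <= L)%N -> countM t0 K n (tu w) k = countM t0 K n (tu w') k.
  by move=> kL; apply: eq_bigl => i; exact: EU.
have cQ k l : (k <= L)%N -> (l <= L)%N -> countQ t0 K n (tu w) k l = countQ t0 K n (tu w') k l.
  by move=> kL lL; apply: eq_bigl => i; rewrite /tu ET// EU.
have sN k : (k <= L)%N -> sumN' t0 K n (x w) (tu w) k = sumN' t0 K n (x w') (tu w') k.
  by move=> kL; apply: eq_big => i; [exact: ET|rewrite /Delta1 /x /tu E1].
have sM k : (k <= L)%N -> sumM' t0 K n (x w) (tu w) k = sumM' t0 K n (x w') (tu w') k.
  by move=> kL; apply: eq_big => i; [exact: EU|rewrite D3].
have sQ k l : (k <= L)%N -> (l <= L)%N ->
    sumQ' t0 K n (x w) (tu w) k l = sumQ' t0 K n (x w') (tu w') k l.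
  by move=> kL lL; apply: eq_big => i; [rewrite /tu ET// EU|rewrite /Delta2 /x /tu E2].
have rN k l : (k <= L)%N -> (l <= L)%N ->
    rootNQ t0 K n (tu w) k l = rootNQ t0 K n (tu w') k l.
  by move=> kL lL; rewrite /rootNQ cN// cQ.
have rM k l : (k <= L)%N -> (l <= L)%N ->
    rootMQ t0 K n (tu w) k l = rootMQ t0 K n (tu w') k l.
  by move=> kL lL; rewrite /rootMQ cM// cQ.
have tW k : (k <= L)%N -> totalW t0 K n (tu w) k = totalW t0 K n (tu w') k.
  move=> kL; congr (_ + _); apply: eq_big_nat => l /andP[l1 l2].
    by rewrite rM// (leq_trans _ kL)// ltnW.
  by rewrite rN.
rewrite -/(x w) -/(x w') -/(tu w) -/(tu w') /birge big_nat_cond [RHS]big_nat_cond.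
apply: eq_bigr => k /andP[/andP[_ kL] _]; rewrite big_nat_cond [RHS]big_nat_cond.
apply: eq_bigr => l /andP[/andP[_ lL] _].
by rewrite /weight /Fhat tW// rN// rM// sN// cN// sQ// cQ// sM// cM// [sumQ' _ _ _ (x w) _ l k]sQ//
  [countQ _ _ _ (tu w) l k]cQ.
Qed.

Lemma ae_prob_eq (A B : set Omega) : measurable A -> measurable B ->
  {ae P, forall w, A w <-> B w} -> P A = P B.
Proof.
move=> mA mB [N [mN N0 sub]].
have key (C : set Omega) : measurable C -> P C = P (C `\` N).
  move=> mC; rewrite measureD//; last by rewrite ltey_eq fin_num_measure.
  suff E0 : P (C `&` N) = 0%E by rewrite -[LHS]sube0; congr (_ - _)%E; rewrite -[LHS]E0.
  by apply: (subset_measure0 _ mN _ N0); [exact: measurableI|exact: subIsetr].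
rewrite key// [RHS]key//; congr (P _); apply/seteqP; split => w [Cw Nw]; split => //.
  have [|nb] := pselect (A w <-> B w); first by move=> [h _]; exact: h.
  by exfalso; apply: Nw; exact: sub.
have [|nb] := pselect (A w <-> B w); first by move=> [_ h]; exact: h.
by exfalso; apply: Nw; exact: sub.
Qed.

End measurable_estimator.

(** * Law of the class codes *)

Section coding_law.
Context {R : realType} {d : measure_display} {Omega : measurableType d}
  (P : probability Omega R).
Variables (X : nat -> {RV P >-> R}) (TU : nat -> {RV P >-> (R * R)%type})
  (F0 : R -> R) (h : R * R -> R) (eps : R).
Hypothesis X_law : forall i x, cdf (X i) x = (F0 x)%:E.
Hypothesis TU_law : forall i, has_joint_density P (TU i) h.
Hypothesis X_indep : mutually_independent P X.
Hypothesis TU_indep : mutually_independent P TU.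
Hypothesis X_TU_indep : independent_sequences P X TU.
Hypothesis h_supp : forall z, h z != 0 -> sep_triangle eps z.
Hypothesis eps_gt0 : 0 < eps.

Variables (t0 : R) (K j : nat) (gd : nat -> bool).
Local Notation L := (nbins t0 K).
Local Notation D := (option (bool * 'I_(L.+1))).
Hypothesis t0_in : 0 < t0 < 1.
Hypothesis K_gt0 : (0 < K)%N.
Hypothesis j_in : (2 <= j < L)%N.
Hypothesis gd_in : forall k, gd k -> (1 <= k <= L)%N && (k != j).

Local Notation leb2 := (@lebesgue_measure R \x @lebesgue_measure R)%E.
Local Notation mR := (measurableTypeR R).
Local Notation clsz := (cls t0 K j gd).

Let mh : measurable_fun setT h. Proof. by case: (TU_law 0). Qed.
Let h_ge0 z : 0 <= h z. Proof. by case: (TU_law 0). Qed.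
Let mF0 : measurable_fun setT F0. Proof. exact: (measurable_F0 X_law). Qed.
Let F0b y : 0 <= F0 y <= 1. Proof. exact: (F0_01 X_law). Qed.

Lemma density_total : (\int[leb2]_z (h z)%:E = 1)%E.
Proof.
have := prob_TU TU_law 0 (measurableT : measurable (setT : set (R * R))).
by rewrite preimage_setT probability_setT => /esym.
Qed.

Let ih : leb2.-integrable setT (EFin \o h).
Proof.
apply/integrableP; split; first exact/measurable_EFinP.
under eq_integral do rewrite /= ger0_norm//.
by rewrite density_total ltry.
Qed.
Let ihS (S : set (mR * mR)) : measurable S -> leb2.-integrable S (EFin \o h).
Proof. by move=> mS; apply: integrableS ih. Qed.

Let mfst : measurable_fun setT (fun z : R * R => z.1). Proof. exact: measurable_fst. Qed.
Let msnd : measurable_fun setT (fun z : R * R => z.2). Proof. exact: measurable_snd. Qed.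

Let iFh (S : set (mR * mR)) (phi : R * R -> R) : measurable S -> measurable_fun setT phi ->
  leb2.-integrable S (EFin \o (fun z => F0 (phi z) * h z)).
Proof.
move=> mS mphi; apply: (@integrable_bounded_mul _ _ _ _ _ _ _ 1) => //; first exact: ihS.
  by apply: measurable_funTS; exact: (measurableT_comp mF0 mphi).
by move=> z _; have /andP[? ?] := F0b (phi z); rewrite ger0_norm.
Qed.

Lemma prob_TU_fine i (S : set (mR * mR)) : measurable S ->
  P (TU i @^-1` S) = (\int[leb2]_(z in S) h z)%:E.
Proof.
move=> mS; rewrite (prob_TU TU_law)// /Rintegral fineK//.
by apply: integrable_fin_num => //; exact: ihS.
Qed.

Lemma prob_le_fine i (S : set (mR * mR)) (phi : R * R -> R) : measurable S ->
  measurable_fun setT phi ->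
  P [set w | S (TU i w) /\ X i w <= phi (TU i w)] = (\int[leb2]_(z in S) (F0 (phi z) * h z))%:E.
Proof.
move=> mS mphi; rewrite (prob_le X_law TU_law X_TU_indep i mS mphi) /Rintegral fineK//.
by apply: integrable_fin_num => //; exact: iFh.
Qed.

Let m_le2 (f g : R * R -> R) : measurable_fun setT f -> measurable_fun setT g ->
  measurable [set z | f z <= g z].
Proof. by move=> mf mg; rewrite -[X in measurable X]setTI; exact: measurable_fun_le. Qed.

Let m_fstbin k : measurable [set z : R * R | z.1 \in bin t0 K k].
Proof. by rewrite -[X in measurable X]setTI; exact: (mfst measurableT (measurable_bin t0 K k)). Qed.
Let m_sndbin k : measurable [set z : R * R | z.2 \in bin t0 K k].
Proof. by rewrite -[X in measurable X]setTI; exact: (msnd measurableT (measurable_bin t0 K k)). Qed.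

Lemma measurable_inA k : measurable [set z | inA t0 K j k z].
Proof. by rewrite /inA; case: ltnP. Qed.

Lemma measurable_inC k : measurable [set z | inC t0 K j k z].
Proof.
have H a b : measurable [set z : R * R | (z.1 \in bin t0 K a) && (z.2 \in bin t0 K b)].
  have -> : [set z : R * R | (z.1 \in bin t0 K a) && (z.2 \in bin t0 K b)] =
      [set z | z.1 \in bin t0 K a] `&` [set z | z.2 \in bin t0 K b].
    by apply/seteqP; split => z /= => [/andP[]|[-> ->]].
  exact: measurableI.
by rewrite /inC; case: ltnP.
Qed.

Lemma measurable_lt12 : measurable [set z : R * R | z.1 < z.2].
Proof.
have -> : [set z : R * R | z.1 < z.2] = ~` [set z | z.2 <= z.1].
  by apply/seteqP; split => z /=; [rewrite ltNge => /negP|move/negP; rewrite -ltNge].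
by apply: measurableC; exact: m_le2.
Qed.

Definition clset (v : D) : set (mR * mR) := [set z | clsz z = v].

Lemma clsetE (k : 'I_(L.+1)) b : gd k ->
  clset (Some (b, k)) = [set z | (if b then inA t0 K j k z else inC t0 K j k z) /\ z.1 < z.2].
Proof.
move=> gk; apply/seteqP; split => z; rewrite /clset /=.
  by move=> /eqP; rewrite (cls_eq t0_in K_gt0 j_in gd_in) => /andP[_ /andP[]].
move=> [h1 h2]; apply/eqP; rewrite (cls_eq t0_in K_gt0 j_in gd_in) gk /=.
by rewrite /inside /= h1 h2.
Qed.

Lemma clset_bad (k : 'I_(L.+1)) b : ~~ gd k -> clset (Some (b, k)) = set0.
Proof.
move=> gk; apply/seteqP; split => // z /eqP.
by rewrite (cls_eq t0_in K_gt0 j_in gd_in) /= (negbTE gk).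
Qed.

Let mclset_some (dd : bool * 'I_(L.+1)) : measurable (clset (Some dd)).
Proof.
case: dd => b k; have [gk|gk] := boolP (gd k); last by rewrite clset_bad.
rewrite clsetE//; apply: measurableI; last exact: measurable_lt12.
by case: b; [exact: measurable_inA|exact: measurable_inC].
Qed.

Lemma measurable_clset v : measurable (clset v).
Proof.
case: v => [dd|]; first exact: mclset_some.
have -> : clset None = ~` (\big[setU/set0]_(dd : bool * 'I_(L.+1)) clset (Some dd)).
  rewrite -bigcup_seq; apply/seteqP; split => z; rewrite /clset /=.
    by move=> E [dd _]; rewrite /= E.
  move=> nz; case E: (clsz z) => [dd|//]; exfalso; apply: nz.
  by exists dd => //=; rewrite mem_index_enum.
by apply: measurableC; apply: bigsetU_measurable => dd _; exact: mclset_some.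
Qed.

Lemma clset_lt (dd : bool * 'I_(L.+1)) z : clset (Some dd) z -> z.1 < z.2.
Proof.
case: dd => b k; have [gk|gk] := boolP (gd k); last by rewrite clset_bad.
by rewrite clsetE// => -[].
Qed.

(** Success probability of an observation of class [v] given its two times. Accordingly [qv] is the
    probability of the class, [sv] that of the class with a success, and [pv] the conditional
    probability of a success. *)
Definition wv (v : D) (z : R * R) : R := match v with
  | None => 0
  | Some (true, k) => if (j < k)%N then F0 z.1 else F0 z.2
  | Some (false, _) => F0 z.2 - F0 z.1
  end.
Definition qv (v : D) : R := \int[leb2]_(z in clset v) h z.
Definition sv (v : D) : R := \int[leb2]_(z in clset v) (wv v z * h z).
Definition pv (v : D) : R := sv v / qv v.

Let mset_le i (S : set (mR * mR)) (phi : R * R -> R) : measurable S -> measurable_fun setT phi ->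
  measurable [set w | S (TU i w) /\ X i w <= phi (TU i w)].
Proof.
move=> mS mphi; apply: (@measurableI _ _ (TU i @^-1` S) [set w | X i w <= phi (TU i w)]).
  by rewrite -[X in measurable X]setTI; exact: (measurable_funPT (TU i)).
rewrite -[X in measurable X]setTI; apply: measurable_fun_le => //.
exact: measurableT_comp.
Qed.

Lemma law_true i v :
  P [set w | clset v (TU i w) /\ outcome j v (TU i w) (X i w)] = (sv v)%:E.
Proof.
have mc := measurable_clset v.
case: v mc => [[[] k]|] mc; rewrite /sv /wv /=.
- case: ltnP => _; [have := prob_le_fine i mc mfst|have := prob_le_fine i mc msnd]; exact.
- have -> : [set w | clset (Some (false, k)) (TU i w) /\ (TU i w).1 < X i w <= (TU i w).2] =
      [set w | clset (Some (false, k)) (TU i w) /\ X i w <= (TU i w).2] `\`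
      [set w | clset (Some (false, k)) (TU i w) /\ X i w <= (TU i w).1].
    apply/seteqP; split => w /=.
      move=> [h1 /andP[h2 h3]]; split => // -[_]; by rewrite leNgt h2.
    move=> [[h1 h2] h3]; split => //; rewrite h2 andbT ltNge; apply/negP => h4.
    exact: h3.
  rewrite measureD; [|exact: mset_le|exact: mset_le|]; last first.
    by rewrite ltey_eq fin_num_measure//; exact: mset_le.
  have -> : [set w | clset (Some (false, k)) (TU i w) /\ X i w <= (TU i w).2] `&`
      [set w | clset (Some (false, k)) (TU i w) /\ X i w <= (TU i w).1] =
      [set w | clset (Some (false, k)) (TU i w) /\ X i w <= (TU i w).1].
    apply: setIidr => w /= [h1 h2]; split => //; rewrite (le_trans h2)// ltW//.
    exact: clset_lt h1.
  have E1 := prob_le_fine i mc msnd; have E2 := prob_le_fine i mc mfst.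
  transitivity ((\int[leb2]_(z in clset (Some (false, k))) (F0 z.2 * h z))%:E -
    (\int[leb2]_(z in clset (Some (false, k))) (F0 z.1 * h z))%:E)%E.
    by congr (_ - _)%E; [exact: E1|exact: E2].
  rewrite -EFinB; congr (_%:E); rewrite -RintegralB//; [|exact: iFh|exact: iFh].
  by apply: eq_Rintegral => z _; rewrite mulrBl.
- have -> : [set w | clset None (TU i w) /\ false] = set0 by apply/seteqP; split => w // [].
  rewrite measure0; congr (_%:E); rewrite /Rintegral integral0_eq// => z _.
  by rewrite mul0r.
Qed.

Let mO i v : measurable [set w | clset v (TU i w) /\ outcome j v (TU i w) (X i w)].
Proof.
have mc := measurable_clset v.
case: v mc => [[[] k]|] mc; rewrite /outcome.
- by case: ltnP => _; exact: mset_le.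
- have -> : [set w | clset (Some (false, k)) (TU i w) /\ (TU i w).1 < X i w <= (TU i w).2] =
      [set w | clset (Some (false, k)) (TU i w) /\ X i w <= (TU i w).2] `\`
      [set w | clset (Some (false, k)) (TU i w) /\ X i w <= (TU i w).1].
    apply/seteqP; split => w /=.
      move=> [h1 /andP[h2 h3]]; split => // -[_]; by rewrite leNgt h2.
    move=> [[h1 h2] h3]; split => //; rewrite h2 andbT ltNge; apply/negP => h4.
    exact: h3.
  by apply: measurableD; exact: mset_le.
- by have -> : [set w | clset None (TU i w) /\ false] = set0 by apply/seteqP; split => w // [].
Qed.

Let mTUc i v : measurable (TU i @^-1` clset v).
Proof.
by rewrite -[X in measurable X]setTI; apply: (measurable_funPT (TU i)) => //; exact: measurable_clset.
Qed.

Lemma sv_bounds v : 0 <= sv v <= qv v.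
Proof.
rewrite -!lee_fin -(law_true 0) -(prob_TU_fine 0 (measurable_clset v)) measure_ge0/=.
by apply: le_measure; [rewrite inE; exact: mO|rewrite inE; exact: mTUc|move=> w []].
Qed.

Lemma qv_ge0 v : 0 <= qv v.
Proof. by have /andP[h1 h2] := sv_bounds v; exact: le_trans h2. Qed.

Lemma pv_bounds v : 0 <= pv v <= 1.
Proof.
have /andP[h1 h2] := sv_bounds v; rewrite /pv divr_ge0 ?qv_ge0//=.
have [->|q0] := eqVneq (qv v) 0; first by rewrite invr0 mulr0.
by rewrite ler_pdivrMr ?mul1r// lt_neqAle eq_sym q0 qv_ge0.
Qed.

(** For a class of probability zero [sv] is squeezed to 0, which agrees with the value 0 of the
    quotient. *)
Lemma qv_pv v : qv v * pv v = sv v.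
Proof.
rewrite /pv; have [q0|q0] := eqVneq (qv v) 0; last by rewrite mulrCA divff// mulr1.
have := sv_bounds v; rewrite q0 mul0r => /andP[h1 h2].
by apply/eqP; rewrite eq_le h1.
Qed.

Lemma sum_qv : \sum_v qv v = 1.
Proof.
have := @measure_bigsetU_fin _ _ _ P D xpredT (fun v => TU 0 @^-1` clset v) (mTUc 0).
rewrite (_ : \big[setU/set0]_(v : D) (TU 0 @^-1` clset v) = setT); last first.
  rewrite -bigcup_seq; apply/seteqP; split => // w _ /=.
  by exists (clsz (TU 0 w)) => //=; rewrite mem_index_enum.
move=> H; apply: EFin_inj; rewrite -sumEFin.
transitivity (P [set: Omega]); last exact: probability_setT.
apply: esym; refine (eq_trans (H _) _).
  by apply/trivIsetP => v v' _ _ vv'; apply/seteqP; split => // w [E1 E2]; move/eqP: vv'; case; rewrite -E1 -E2.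
by apply: eq_bigr => v _; exact: (prob_TU_fine 0 (measurable_clset v)).
Qed.

Definition obs_cls (e : (mR * mR) * mR) : D := clsz e.1.
Definition obs_bit (e : (mR * mR) * mR) : bool := outcome j (clsz e.1) e.1 e.2.

Lemma measurable_code v b : measurable [set e | obs_cls e = v /\ obs_bit e = b].
Proof.
have mle (phi : R * R -> R) : measurable_fun setT phi ->
    measurable [set e : (mR * mR) * mR | e.2 <= phi e.1].
  move=> mphi; rewrite -[X in measurable X]setTI; apply: measurable_fun_le => //.
  exact: (measurableT_comp mphi measurable_fst).
have mout : measurable [set e : (mR * mR) * mR | outcome j v e.1 e.2].
  case: v => [[[] k]|]; rewrite /outcome.
  - by case: ltnP => _; [exact: mle mfst|exact: mle msnd].
  - have -> : [set e : (mR * mR) * mR | e.1.1 < e.2 <= e.1.2] =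
        [set e | e.2 <= e.1.2] `\` [set e | e.2 <= e.1.1].
      apply/seteqP; split => e /=.
        by move=> /andP[h1 h2]; split => //; apply/negP; rewrite -ltNge.
      by move=> [h1 /negP]; rewrite -ltNge => ->.
    by apply: measurableD; [exact: mle msnd|exact: mle mfst].
  - have -> : [set e : (mR * mR) * mR | false] = set0 by apply/seteqP; split.
    exact: measurable0.
have mcl : measurable [set e : (mR * mR) * mR | clset v e.1].
  rewrite -[X in measurable X]setTI.
  have mf : measurable_fun setT (fun e : (mR * mR) * mR => e.1) by exact: measurable_fst.
  exact: (mf measurableT _ (measurable_clset v)).
have -> : [set e | obs_cls e = v /\ obs_bit e = b] = [set e | clset v e.1] `&`
    (if b then [set e | outcome j v e.1 e.2] else ~` [set e | outcome j v e.1 e.2]).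
  apply/seteqP; split => e; rewrite /obs_cls /obs_bit /clset /=.
    by move=> [<- <-]; split => //; case E: (outcome _ _ _ _) => /=; rewrite E.
  by move=> [<-]; case: b => /= [->//|/negP/negbTE].
by apply: measurableI => //; case: b => //; exact: measurableC.
Qed.

Lemma code_law i v b :
  P (obs X TU i @^-1` [set e | obs_cls e = v /\ obs_bit e = b]) = (qv v * bern (pv v) b)%:E.
Proof.
case: b; rewrite /bern.
  rewrite qv_pv -(law_true i); congr (P _); apply/seteqP; split => w; rewrite /obs_bit /obs_cls /=.
    by move=> [<- ->].
  by move=> [<- ->].
rewrite mulrBr mulr1 qv_pv EFinB -(law_true i) -(prob_TU_fine i (measurable_clset v)).
have -> : obs X TU i @^-1` [set e | obs_cls e = v /\ obs_bit e = false] =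
    (TU i @^-1` clset v) `\` [set w | clset v (TU i w) /\ outcome j v (TU i w) (X i w)].
  apply/seteqP; split => w; rewrite /obs_bit /obs_cls /=.
    by move=> [<- E]; split => // -[_]; rewrite E.
  move=> [<- nw]; split => //; apply/negbTE/negP => E; exact: nw.
rewrite measureD; [|exact: mTUc|exact: mO|]; last by rewrite ltey_eq fin_num_measure//; exact: mTUc.
by congr (_ - P _)%E; apply: setIidr => w [].
Qed.

Hypothesis bad_null : forall k, (1 <= k <= L)%N -> k != j -> ~~ gd k ->
  \int[leb2]_(z in [set z | inA t0 K j k z]) h z = 0 \/
  \int[leb2]_(z in [set z | inC t0 K j k z]) h z = 0.

Let ae_out i (S : set (mR * mR)) : measurable S -> \int[leb2]_(z in S) h z = 0 ->
  {ae P, forall w, ~ S (TU i w)}.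
Proof.
move=> mS S0; exists (TU i @^-1` S); split.
- by rewrite -[X in measurable X]setTI; exact: (measurable_funPT (TU i)).
- by rewrite prob_TU_fine// S0.
- by move=> w /= /contrapT.
Qed.

Let null_off : \int[leb2]_(z in [set z : mR * mR | ~ z.1 < z.2]) h z = 0.
Proof.
rewrite /Rintegral integral0_eq// => z /= zz.
have [->//|/h_supp[_ h1 _]] := eqVneq (h z) 0.
by exfalso; apply: zz; rewrite (lt_le_trans _ h1)// ltrDl.
Qed.

(** The identity [birge_est] holds off a null event: almost surely all pairs satisfy T < U, and
    every index outside [gd] has an empty marginal bin or an empty cell. The distribution is then a
    sum over finite codes. *)
Theorem birge_law n theta sn y :
  P [set w | sn * (birge t0 K n (fun i => X i w) (fun i => TU i w) (knot t0 K j) - theta) <= y] =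
  (EE qv pv (fun (c : {ffun 'I_n -> D}) o =>
    (zst K (blam_ j gd) (bsg_ j) theta sn c o <= y)%R%:R))%:E.
Proof.
have [mQ <-] := prob_code measurable_code code_law
  (obs_indep X_indep TU_indep X_TU_indep)
  (fun (c : {ffun 'I_n -> D}) o => (zst K (blam_ j gd) (bsg_ j) theta sn c o <= y)%R).
apply: ae_prob_eq => //.
  have mZ : measurable_fun setT (fun w => sn *
      (birge t0 K n (fun i => X i w) (fun i => TU i w) (knot t0 K j) - theta)).
    apply: measurable_funM => //; apply: measurable_funB => //.
    exact: measurable_birge.
  by rewrite -[X in measurable X]setTI; exact: measurable_fun_le.
have ok1 : {ae P, forall w, forall i : 'I_n, (TU i w).1 < (TU i w).2}.
  apply: filter_forall => i.
  have := @ae_out i [set z : mR * mR | ~ z.1 < z.2] _ null_off.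
  by move=> /(_ (measurableC measurable_lt12)); apply: filterS => w /= /contrapT.
have ok2 : {ae P, forall w, forall k : 'I_(L.+1), (1 <= k <= L)%N -> k != j :> nat -> ~~ gd k ->
    (forall i : 'I_n, ~~ inA t0 K j k (TU i w)) \/ (forall i : 'I_n, ~~ inC t0 K j k (TU i w))}.
  apply: filter_forall => k.
  have [kin|] := boolP (1 <= k <= L)%N; last by move=> nk; apply: aeW => w.
  have [kj|nkj] := eqVneq (k : nat) j; first by apply: aeW => w.
  have [gk|gk] := boolP (gd k); first by apply: aeW => w.
  have [b0|b0] := bad_null kin nkj gk.
    have : {ae P, forall w, forall i : 'I_n, ~ inA t0 K j k (TU i w)}.
      by apply: filter_forall => i; exact: (ae_out i (measurable_inA k) b0).
    by apply: filterS => w hw _ _ _; left => i; apply/negP; exact: hw.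
  have : {ae P, forall w, forall i : 'I_n, ~ inC t0 K j k (TU i w)}.
    by apply: filter_forall => i; exact: (ae_out i (measurable_inC k) b0).
  by apply: filterS => w hw _ _ _; right => i; apply/negP; exact: hw.
apply: filterS2 ok1 ok2 => w h1 h2 /=.
rewrite /zst (@birge_est _ _ _ _ gd t0_in K_gt0 j_in gd_in n (fun i => X i w) (fun i => TU i w)) //.
- by move=> i ni; exact: (h1 (Ordinal ni)).
- move=> k /andP[k1 k2] kj gk.
  have := h2 (Ordinal (k2 : (k < L.+1)%N)) _ kj gk; rewrite /= k1 k2 => /(_ isT) [H|H].
    by left => i ni; exact: (H (Ordinal ni)).
  by right => i ni; exact: (H (Ordinal ni)).
Qed.

End coding_law.

(** * Identification of the cell parameters *)

Section identification.
Context {R : realType}.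
Local Notation leb := (@lebesgue_measure R).
Local Notation leb2 := (@lebesgue_measure R \x @lebesgue_measure R)%E.
Local Notation mR := (measurableTypeR R).
Variables (F0 : R -> R) (h : R * R -> R) (eps t0 : R) (K j : nat -> nat) (n : nat).
Hypothesis mh : measurable_fun setT h.
Hypothesis h_ge0 : forall z, 0 <= h z.
Hypothesis h_supp : forall z, h z != 0 -> sep_triangle eps z.
Hypothesis h_int1 : (\int[leb2]_z (h z)%:E = 1)%E.
Hypothesis eps_gt0 : 0 < eps.
Hypothesis t0_in : 0 < t0 < 1.
Hypothesis mF0 : measurable_fun setT F0.
Hypothesis F0_nd : {homo F0 : x y / x <= y}.
Hypothesis F0b : forall y, 0 <= F0 y <= 1.
Hypothesis K_gt0 : forall n, (0 < K n)%N.
Local Notation L := (nbins t0 (K n)).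
Hypothesis j_in : (2 <= j n < L)%N.
Hypothesis mesh_lt : @mesh R K n < eps.

Local Notation a := (anchor t0 K j).
Local Notation I := (bin t0 (K n)).
Local Notation kn := (knot t0 (K n)).
Local Notation mesh := (@mesh R K n).

Definition gdR i := good 1 a K (G1 h) h n i.
Definition gdL i := good (-1) a K (G2 h) (hswap h) n i.
(** Translates the index of a bin in the partition into its distance from the anchor bin, the index
    used for the two sides. *)
Definition gd_at k : bool :=
  if (j n < k)%N then (k <= L)%N && gdR (k - j n) else (0 < k < j n)%N && gdL (j n - k).

Let Kn0 := K_gt0 n.
Let mesh0 : 0 < mesh. Proof. exact: mesh_gt0. Qed.
Let jle : (2 <= j n <= L)%N. Proof. by have /andP[-> /ltnW] := j_in. Qed.
Let hE z : h z != 0 -> [/\ 0 <= z.1, z.1 + eps <= z.2 & z.2 <= 1].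
Proof. exact: h_supp. Qed.
Let h_lt z : h z != 0 -> z.1 < z.2.
Proof. by move=> /hE[_ h1 _]; rewrite (lt_le_trans _ h1)// ltrDl. Qed.

Let G1s := G1_supp h_supp eps_gt0.
Let G2s := G2_supp h_supp eps_gt0.

Let nodeR k : (j n < k <= L)%N -> node 1 a K n (k - j n) = kn k.
Proof.
move=> /andP[jk kL]; have kin : (2 <= k <= L)%N.
  by rewrite kL andbT (leq_trans _ (ltnW jk))//; have /andP[] := jle.
by rewrite (knot_shift Kn0 jle kin) /node mul1r natrB// ltnW.
Qed.

Let nodeL k : (2 <= k < j n)%N -> node (-1) a K n (j n - k) = kn k.
Proof.
move=> /andP[k2 kj]; have kin : (2 <= k <= L)%N.
  by rewrite k2 (leq_trans (ltnW kj))//; have /andP[] := jle.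
rewrite (knot_shift Kn0 jle kin) /node natrB ?(ltnW kj)// mulN1r -mulNr opprB.
by [].
Qed.

Let knotL_gt : 1 - eps < kn L.
Proof.
have /andP[h1 _] := knotL_in t0_in Kn0; apply: lt_le_trans h1.
by rewrite -[_^-1]/mesh ltrD2l ltrN2.
Qed.

Let knot2_lt : kn 2 < eps.
Proof. by have /andP[_ h1] := knot2_in t0_in Kn0; exact: le_lt_trans mesh_lt. Qed.

(** A good bin is never an end bin: the last one starts beyond [1 - eps], where [G1] vanishes, and
    the first one ends before [eps], where [G2] vanishes. Hence all good bins have full length. *)
Lemma gd_range k : gd_at k -> (2 <= k < L)%N && (k != j n).
Proof.
rewrite /gd_at; case: ltnP => [jk /andP[kL]|kj /andP[/andP[k0 kj']]].
  move=> /andP[/Rintegral_neq0[y] + /G1s y1 _].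
  rewrite nodeR ?jk// /cell /= in_itv/= => /andP[h1 _].
  rewrite (gtn_eqF jk) andbT (leq_trans _ (ltnW jk)) ?(andP jle).1//=.
  rewrite ltn_neqAle kL andbT; apply/eqP => kE.
  by have := le_lt_trans (le_trans h1 y1) knotL_gt; rewrite kE ltxx.
move=> /andP[/Rintegral_neq0[y] + /G2s y1 _].
rewrite /cell /= in_itv/= => /andP[_ h2].
rewrite (ltn_eqF kj') andbT (leq_ltn_trans _ (andP j_in).2) ?(ltnW kj')// andbT.
rewrite ltn_neqAle k0 andbT; apply/eqP => kE.
move: h2; rewrite -kE.
have LL : (2 <= 2 <= L)%N by rewrite (nbins_ge2 t0_in Kn0).
have k2E := knot_shift Kn0 jle LL.
rewrite /node natrB ?(ltnW (andP j_in).1)// mulN1r => h2.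
(* The cell attached to [k = 1] has full length and ends at [kn 2], like the first bin, but may
   start below 0. *)
have E : kn 2 = a n - ((j n)%:R - 1) * mesh + mesh by rewrite k2E -[_^-1]/mesh /anchor; ring.
by have := lt_trans (le_lt_trans y1 h2); rewrite -E => /(_ _ knot2_lt); rewrite ltxx.
Qed.

Lemma gd_in k : gd_at k -> (1 <= k <= L)%N && (k != j n).
Proof. by move=> /gd_range/andP[/andP[k2 kL] ->]; rewrite andbT (ltnW k2) ltnW. Qed.

Let cellP k s : (2 <= k < L)%N -> s \in I k <-> cell (kn k) mesh s.
Proof.
move=> /andP[k2 kL]; by rewrite /bin ltn_eqF// knot_step ?k2// /cell /= in_itv.
Qed.

Lemma Rint_supp (A B : set (mR * mR)) (f : R * R -> R) :
  (forall z, h z != 0 -> A z <-> B z) ->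
  \int[leb2]_(z in A) (f z * h z) = \int[leb2]_(z in B) (f z * h z).
Proof.
move=> AB; rewrite /Rintegral integral_mkcond [in RHS]integral_mkcond; congr fine.
apply: eq_integral => z _; rewrite !patchE.
have [h0|h0] := eqVneq (h z) 0; first by rewrite h0 mulr0 !if_same.
have -> // : (z \in A) = (z \in B).
by apply/idP/idP; rewrite !inE => /(AB z h0).
Qed.

Let one_mul (A : set (mR * mR)) : \int[leb2]_(z in A) h z = \int[leb2]_(z in A) (1 * h z).
Proof. by apply: eq_Rintegral => z _; rewrite mul1r. Qed.

Let qvE b (k : 'I_(L.+1)) : gd_at k -> qv h (j n) gd_at (Some (b, k)) =
  \int[leb2]_(z in [set z | if b then inA t0 (K n) (j n) k z else inC t0 (K n) (j n) k z]) h z.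
Proof.
move=> gk; rewrite /qv one_mul [RHS]one_mul; apply: Rint_supp => z h0.
by rewrite (clsetE t0_in Kn0 j_in gd_in b gk) /=; split => [[]//|hz]; split => //; exact: h_lt.
Qed.

Let svE b (k : 'I_(L.+1)) : gd_at k -> sv F0 h (j n) gd_at (Some (b, k)) =
  \int[leb2]_(z in [set z | if b then inA t0 (K n) (j n) k z else inC t0 (K n) (j n) k z])
    (wv F0 (j n) (Some (b, k)) z * h z).
Proof.
move=> gk; rewrite /sv; apply: Rint_supp => z h0.
by rewrite (clsetE t0_in Kn0 j_in gd_in b gk) /=; split => [[]//|hz]; split => //; exact: h_lt.
Qed.

Let margR k (phi : R -> R) : (j n < k < L)%N -> measurable_fun setT phi ->
  (forall y, 0 <= phi y <= 1) ->
  \int[leb2]_(z in [set z | inA t0 (K n) (j n) k z]) (phi z.1 * h z) =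
  \int[leb]_(y in cell (node 1 a K n (k - j n)) mesh) (phi y * G1 h y).
Proof.
move=> /andP[jk kL] mphi phi01; rewrite (nodeR (k := k)); last by rewrite jk ltnW.
have kin : (2 <= k < L)%N by rewrite kL (leq_trans (andP j_in).1)// ltnW.
have -> : [set z | inA t0 (K n) (j n) k z] = cell (kn k) mesh `*` setT.
  apply/seteqP; split => z; rewrite /inA jk /=; first by move=> /(cellP _ kin).
  by move=> [/(cellP _ kin)].
by congr fine; exact: (marginal1 mh h_ge0 h_supp (ltW eps_gt0) h_int1 (measurable_cell _ _) mphi phi01).
Qed.

Let margL k (phi : R -> R) : (2 <= k < j n)%N -> measurable_fun setT phi ->
  (forall y, 0 <= phi y <= 1) ->
  \int[leb2]_(z in [set z | inA t0 (K n) (j n) k z]) (phi z.2 * h z) =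
  \int[leb]_(y in cell (node (-1) a K n (j n - k)) mesh) (phi y * G2 h y).
Proof.
move=> /andP[k2 kj] mphi phi01; rewrite (nodeL (k := k)); last by rewrite k2.
have kin : (2 <= k < L)%N by rewrite k2 (ltn_trans kj)//; have /andP[] := j_in.
have -> : [set z | inA t0 (K n) (j n) k z] = setT `*` cell (kn k) mesh.
  apply/seteqP; split => z; rewrite /inA ltnNge (ltnW kj) /=; first by move=> /(cellP _ kin).
  by move=> [_ /(cellP _ kin)].
by congr fine; exact: (marginal2 mh h_ge0 h_supp (ltW eps_gt0) h_int1 (measurable_cell _ _) mphi phi01).
Qed.

Let one01 (y : R) : 0 <= (1 : R) <= 1. Proof. by rewrite ler01 lexx. Qed.

Let massR k : (j n < k < L)%N -> \int[leb2]_(z in [set z | inA t0 (K n) (j n) k z]) h z =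
  massA 1 a K (G1 h) n (k - j n).
Proof.
move=> kin; rewrite one_mul (margR (phi := fun _ => 1) kin (measurable_cst _) one01).
by apply: eq_Rintegral => y _; rewrite mul1r.
Qed.

Let massL k : (2 <= k < j n)%N -> \int[leb2]_(z in [set z | inA t0 (K n) (j n) k z]) h z =
  massA (-1) a K (G2 h) n (j n - k).
Proof.
move=> kin; rewrite one_mul (margL (phi := fun _ => 1) kin (measurable_cst _) one01).
by apply: eq_Rintegral => y _; rewrite mul1r.
Qed.

Let setCR k : (j n < k < L)%N -> [set z | inC t0 (K n) (j n) k z] =
  cell (a n) mesh `*` cell (node 1 a K n (k - j n)) mesh.
Proof.
move=> /andP[jk kL]; rewrite (nodeR (k := k)); last by rewrite jk ltnW.
have kin : (2 <= k < L)%N by rewrite kL (leq_trans (andP j_in).1)// ltnW.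
apply/seteqP; split => z; rewrite /inC jk /=.
  by move=> /andP[/(cellP _ j_in) h1 /(cellP _ kin) h2].
by move=> [/(cellP _ j_in) h1 /(cellP _ kin) h2]; apply/andP.
Qed.

Let setCL k : (2 <= k < j n)%N -> [set z | inC t0 (K n) (j n) k z] =
  cell (node (-1) a K n (j n - k)) mesh `*` cell (a n) mesh.
Proof.
move=> /andP[k2 kj]; rewrite (nodeL (k := k)); last by rewrite k2.
have kin : (2 <= k < L)%N by rewrite k2 (ltn_trans kj)//; have /andP[] := j_in.
apply/seteqP; split => z; rewrite /inC ltnNge (ltnW kj) /=.
  by move=> /andP[/(cellP _ kin) h1 /(cellP _ j_in) h2].
by move=> [/(cellP _ kin) h1 /(cellP _ j_in) h2]; apply/andP.
Qed.

Let massCL k : (2 <= k < j n)%N -> \int[leb2]_(z in [set z | inC t0 (K n) (j n) k z]) h z =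
  massC (-1) a K (hswap h) n (j n - k).
Proof.
move=> kin; rewrite (setCL kin); congr fine.
apply: (@leb2_swap R (fun z => (h z)%:E)); [exact: measurable_cell|exact: measurable_cell|exact/measurable_EFinP|].
by move=> z; rewrite lee_fin.
Qed.

Let ihs := integrable_hswap mh h_ge0 h_int1.

(** The reflection exchanges the two times, and the increment of [F0] changes sign with them. *)
Let avCL k : (2 <= k < j n)%N ->
  \int[leb2]_(z in [set z | inC t0 (K n) (j n) k z]) ((F0 z.2 - F0 z.1) * h z) =
  - \int[leb2]_(z in cell (a n) mesh `*` cell (node (-1) a K n (j n - k)) mesh)
      ((F0 z.2 - F0 z.1) * hswap h z).
Proof.
move=> kin; rewrite (setCL kin).
have mdF : measurable_fun setT (fun z : R * R => F0 z.2 - F0 z.1).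
  apply: measurable_funB; first exact: (measurableT_comp mF0 measurable_snd).
  exact: (measurableT_comp mF0 measurable_fst).
(* Tonelli's theorem applies because [F0] is nondecreasing and the first time is the smaller one
   wherever [h] is nonzero. *)
have f0 (z : R * R) : (0 <= ((F0 z.2 - F0 z.1) * h z)%:E)%E.
  rewrite lee_fin; have [->|hz] := eqVneq (h z) 0; first by rewrite mulr0.
  by rewrite mulr_ge0// subr_ge0 F0_nd// ltW// h_lt.
have mf : measurable_fun setT (fun z : R * R => ((F0 z.2 - F0 z.1) * h z)%:E).
  by apply/measurable_EFinP; exact: measurable_funM.
transitivity (\int[leb2]_(z in cell (a n) mesh `*` cell (node (-1) a K n (j n - k)) mesh)
    (-1 * ((F0 z.2 - F0 z.1) * hswap h z))).
  rewrite /Rintegral (leb2_swap (measurable_cell _ _) (measurable_cell _ _) mf f0).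
  by congr fine; apply: eq_integral => z _ /=; congr (_%:E); rewrite /hswap; ring.
have mc := measurable_cell2 (a n) (node (-1) a K n (j n - k)) mesh.
rewrite RintegralZl; [exact: mulN1r|exact: mc|].
apply: (@integrable_bounded_mul _ _ _ _ _ _ _ 1); first exact: mc.
- exact: (integrableS measurableT mc (@subsetT _ _) ihs).
- exact: measurable_funTS.
- move=> z _; have /andP[? ?] := F0b z.2; have /andP[? ?] := F0b z.1.
  by rewrite ler_norml; apply/andP; split; lra.
Qed.

Lemma identR (k : 'I_(L.+1)) : gd_at k -> (j n < k)%N ->
  [/\ qv h (j n) gd_at (mA k) = massA 1 a K (G1 h) n (k - j n),
      qv h (j n) gd_at (mC k) = massC 1 a K h n (k - j n),
      pv F0 h (j n) gd_at (mA k) = avA 1 a K (G1 h) F0 n (k - j n),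
      pv F0 h (j n) gd_at (mC k) = avC 1 a K F0 h n (k - j n) &
      gdR (k - j n)].
Proof.
move=> gk jk; have /andP[/andP[k2 kL] _] := gd_range gk.
have kin : (j n < k < L)%N by rewrite jk.
have qA : qv h (j n) gd_at (mA k) = massA 1 a K (G1 h) n (k - j n).
  by rewrite (qvE true gk) (massR kin).
have qC : qv h (j n) gd_at (mC k) = massC 1 a K h n (k - j n).
  by rewrite (qvE false gk) (setCR kin).
split => //.
- rewrite /pv qA (svE true gk) /wv jk (margR kin mF0 F0b).
  by rewrite mulrC.
- by rewrite /pv qC (svE false gk) (setCR kin) mulrC.
- by move: gk; rewrite /gd_at jk => /andP[].
Qed.

Lemma identL (k : 'I_(L.+1)) : gd_at k -> (k < j n)%N ->
  [/\ qv h (j n) gd_at (mA k) = massA (-1) a K (G2 h) n (j n - k),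
      qv h (j n) gd_at (mC k) = massC (-1) a K (hswap h) n (j n - k),
      pv F0 h (j n) gd_at (mA k) = avA (-1) a K (G2 h) F0 n (j n - k),
      pv F0 h (j n) gd_at (mC k) = - avC (-1) a K F0 (hswap h) n (j n - k) &
      gdL (j n - k)].
Proof.
move=> gk kj; have /andP[/andP[k2 kL] _] := gd_range gk.
have kin : (2 <= k < j n)%N by rewrite k2.
have jk : (j n < k)%N = false by rewrite ltnNge ltnW.
have qA : qv h (j n) gd_at (mA k) = massA (-1) a K (G2 h) n (j n - k).
  by rewrite (qvE true gk) (massL kin).
have qC : qv h (j n) gd_at (mC k) = massC (-1) a K (hswap h) n (j n - k).
  by rewrite (qvE false gk) (massCL kin).
split => //.
- rewrite /pv qA (svE true gk) /wv jk (margL kin mF0 F0b).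
  by rewrite mulrC.
- by rewrite /pv qC (svE false gk) (avCL kin) mulNr mulrC.
- by move: gk; rewrite /gd_at jk => /andP[].
Qed.

Let h_out (A : set (mR * mR)) : (forall z, h z != 0 -> ~ A z) -> \int[leb2]_(z in A) h z = 0.
Proof.
move=> hA; rewrite /Rintegral integral0_eq// => z Az.
by have [->//|hz] := eqVneq (h z) 0; exfalso; exact: (hA z).
Qed.

(** An end bin has no marginal mass, by the gap [eps] of the support. For the other bins, failing to
    be good is exactly the vanishing of one of the two masses. *)
Lemma bad_null_at k : (1 <= k <= L)%N -> k != j n -> ~~ gd_at k ->
  \int[leb2]_(z in [set z | inA t0 (K n) (j n) k z]) h z = 0 \/
  \int[leb2]_(z in [set z | inC t0 (K n) (j n) k z]) h z = 0.
Proof.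
move=> /andP[k1 kL] kj gk; move: gk; rewrite /gd_at.
have [jk|kj'] := ltnP (j n) k.
  rewrite kL /= => gk; have [kE|kN] := eqVneq k L.
    left; apply: h_out => z /hE[_ h1 h2]; rewrite /= /inA jk => /bin_ge; rewrite kE => h3.
    by have := lt_le_trans knotL_gt h3; rewrite ltNge => /negP; apply; lra.
  have kin : (j n < k < L)%N by rewrite jk ltn_neqAle kN.
  move: gk; rewrite /gdR /good negb_and !negbK => /orP[/eqP E|/eqP E].
    by left; rewrite (massR kin).
  by right; rewrite (setCR kin).
have kj2 : (k < j n)%N by rewrite ltn_neqAle kj.
rewrite k1 kj2 /= => gk; have [kE|kN] := eqVneq k 1%N.
  left; apply: h_out => z /hE[h1 h2 _]; rewrite /= /inA ltnNge kj' /= kE => h3.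
  have := lt_trans (bin_lt (nbins_ge2 t0_in Kn0) h3) knot2_lt.
  by rewrite ltNge => /negP; apply; lra.
have kin : (2 <= k < j n)%N by rewrite kj2 ltn_neqAle eq_sym kN k1.
move: gk; rewrite /gdL /good negb_and !negbK => /orP[/eqP E|/eqP E].
  by left; rewrite (massL kin).
by right; rewrite (massCL kin).
Qed.

Lemma sum_sides (T : 'I_(L.+1) -> R) (fl fr : nat -> R) :
  (forall k : 'I_(L.+1), gd_at k -> (j n < k)%N -> T k = fr (k - j n)%N) ->
  (forall k : 'I_(L.+1), gd_at k -> (k < j n)%N -> T k = fl (j n - k)%N) ->
  (forall k : 'I_(L.+1), ~~ gd_at k -> T k = 0) ->
  (forall i, ~~ gdR i -> fr i = 0) -> (forall i, ~~ gdL i -> fl i = 0) ->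
  \sum_k T k = \sum_(1 <= i < j n) fl i + \sum_(1 <= i < L.+1 - j n) fr i.
Proof.
move=> Tr Tl T0 fr0 fl0.
pose f k := if (j n < k)%N then fr (k - j n)%N else if (0 < k < j n)%N then fl (j n - k)%N else 0.
have j1 : (1 <= j n <= L)%N by have /andP[/ltnW -> ->] := jle.
transitivity (\sum_(k < L.+1) f k).
  apply: eq_bigr => k _; have [gk|gk] := boolP (gd_at k).
    have /andP[/andP[k1 _] kj] := gd_in gk; rewrite /f k1 /=.
    have [jk|kj'|E] := ltngtP (j n) k; [exact: Tr|exact: Tl|by rewrite E eqxx in kj].
  rewrite T0// /f; move: gk; rewrite /gd_at.
  have kL : (k <= L)%N by rewrite -ltnS.
  case: ltnP => _; first by rewrite kL /= => /fr0 ->.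
  by case: ifP => //= _ /fl0 ->.
rewrite (big_around j1); [|by rewrite /f|by rewrite /f !ltnn andbF].
congr (_ + _); apply: eq_big_nat => i /andP[i1 i2].
  rewrite /f ltnNge leq_subr /= subn_gt0 i2 /= ltn_subrL i1 (leq_trans _ i2)//=.
  by rewrite subKn// ltnW.
by rewrite /f -{1}[j n]addn0 ltn_add2l i1 addKn.
Qed.

End identification.

(** * Convergence of the estimator *)

Lemma measurable_invr {R : realType} : measurable_fun setT (@GRing.inv R).
Proof.
have -> : @GRing.inv R = (fun x => x * (x ^+ 2) `^ (-1)).
  apply/funext => x; rewrite powR_inv1 ?sqr_ge0//; have [->|x0] := eqVneq x 0.
    by rewrite invr0 mul0r.
  by rewrite expr2 invfM mulrA mulfV// mul1r.
apply: measurable_funM; first exact: measurable_id.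
by apply: (measurableT_comp (measurable_powR _)); exact: exprn_measurable.
Qed.

Lemma le_triple m l : (0 < m)%N -> (l <= m.+1)%N -> (l < 3 * m)%N.
Proof. lia. Qed.

Section assembly.
Context {R : realType} {d : measure_display} {Omega : measurableType d}
  {P : probability Omega R}.
Local Notation leb := (@lebesgue_measure R).
Variables (X : nat -> {RV P >-> R}) (TU : nat -> {RV P >-> (R * R)%type}).
Variables (F0 f0 : R -> R) (h : R * R -> R) (eps t0 b c : R) (K j : nat -> nat).
Hypothesis X_law : forall i x, cdf (X i) x = (F0 x)%:E.
Hypothesis TU_law : forall i, has_joint_density P (TU i) h.
Hypothesis X_indep : mutually_independent P X.
Hypothesis TU_indep : mutually_independent P TU.
Hypothesis X_TU_indep : independent_sequences P X TU.
Hypothesis eps_gt0 : 0 < eps.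
Hypothesis h_supp : forall z, h z != 0 -> sep_triangle eps z.
Hypothesis b_gt0 : 0 < b.
Hypothesis h_lb : forall z, sep_triangle eps z -> b <= h z.
Hypothesis t0_in : 0 < t0 < 1.
Hypothesis h_contl : forall t, eps <= t <= t0 - eps ->
  h z @[z --> within (sep_triangle eps) (nbhs (t, t0))] --> h (t, t0).
Hypothesis h_contr : forall u, t0 + eps <= u <= 1 - eps ->
  h z @[z --> within (sep_triangle eps) (nbhs (t0, u))] --> h (t0, u).
Hypothesis F0_deriv : forall x : R, 0 < x < 1 -> is_derive x 1 F0 (f0 x).
Hypothesis f0_cont : forall x : R, 0 < x < 1 -> {for x, continuous f0}.
Hypothesis f0_gt0 : 0 < f0 t0.
Hypothesis W_neq0 : Wtilde h eps t0 != 0%E.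
Hypothesis c_gt0 : 0 < c.
Hypothesis K_gt0 : forall n, (0 < K n)%N.
Hypothesis K_asymp : (K n)%:R / (n%:R `^ 3^-1 / c) @[n --> \oo] --> (1 : R).
Hypothesis j_in : forall n, (1 <= j n <= nbins t0 (K n))%N.
Hypothesis j_cvg : knot t0 (K n) (j n) @[n --> \oo] --> t0.

Local Notation a := (anchor t0 K j).
Local Notation L n := (nbins t0 (K n)).
Local Notation gd n := (gd_at h t0 K j n).

Let mh : measurable_fun setT h. Proof. by have [] := TU_law 0. Qed.
Let h_ge0 z : 0 <= h z. Proof. by have [_ + _] := TU_law 0; exact. Qed.
Let h_int1 := density_total TU_law.
Let mF0 := measurable_F0 X_law.
Let F0b := F0_01 X_law.
Let F0_nd : {homo F0 : x y / x <= y}. Proof. exact: F0_nondecreasing X_law. Qed.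
Let mF0' : measurable_fun setT F0. Proof. exact: mF0. Qed.

Let mmin1 : measurable_fun setT (min_g1h h t0).
Proof.
apply: (measurableT_comp (fine_measurable measurableT)).
apply: measurable_mine; first exact: g1_measurable mh h_ge0 h_supp (ltW eps_gt0).
by apply/measurable_EFinP; exact: section_measurable1.
Qed.

Let mmin2 : measurable_fun setT (min_g2h h t0).
Proof.
apply: (measurableT_comp (fine_measurable measurableT)).
apply: measurable_mine; first exact: g2_measurable mh h_ge0 h_supp (ltW eps_gt0).
by apply/measurable_EFinP; exact: section_measurable2.
Qed.

Let min_ae1 : {ae leb, forall u, min_g1h h t0 u = Num.min (G1 h u) (h (t0, u))}.
Proof.
have FA := ae_filter_ringOfSetsType leb.
have H := g1_fin_ae mh h_ge0 h_supp h_int1 eps_gt0.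
apply: (@filterS _ _ FA _ _ _ H) => u fu.
by rewrite /min_g1h /G1 -{1}(fineK fu) -EFin_min.
Qed.

Let min_ae2 : {ae leb, forall u, min_g2h h t0 u = Num.min (G2 h u) (hswap h (t0, u))}.
Proof.
have FA := ae_filter_ringOfSetsType leb.
have H := g2_fin_ae mh h_ge0 h_supp h_int1 eps_gt0.
apply: (@filterS _ _ FA _ _ _ H) => u fu.
by rewrite /min_g2h /G2 -{1}(fineK fu) -EFin_min.
Qed.

Lemma integral_closed_open (f g : R -> R) (lo hi : R) :
  measurable_fun setT f -> measurable_fun `]lo, hi[ g ->
  {ae leb, forall u, f u = g u} ->
  (\int[leb]_(u in `[lo, hi]) (f u)%:E = \int[leb]_(u in `]lo, hi[) (g u)%:E)%E.
Proof.
move=> mf mg fg.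
have mf' : measurable_fun `]lo, hi[ f by exact: measurable_funS mf.
rewrite integral_itv_bndoo; last exact/measurable_EFinP.
apply: (@ae_eq_integral _ _ _ leb _ (EFin \o g) (EFin \o f)); [exact: measurable_itv|exact/measurable_EFinP|exact/measurable_EFinP|].
have FA := ae_filter_ringOfSetsType leb.
by apply: (@filterS _ _ FA _ _ _ fg) => u /= -> _.
Qed.

Let mX (k : R) : measurable_fun setT (fun u : R => u - k).
Proof. by apply: measurable_funB; [exact: measurable_id|exact: measurable_cst]. Qed.
Let mX' (k : R) : measurable_fun setT (fun u : R => k - u).
Proof. by apply: measurable_funB; [exact: measurable_cst|exact: measurable_id]. Qed.
Let mdiv (f g : R -> R) : measurable_fun setT f -> measurable_fun setT g ->
  measurable_fun setT (fun u => f u / g u).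
Proof. by move=> mf mg; apply: measurable_funM => //; exact: (measurableT_comp measurable_invr). Qed.
Let mF (k : R) : measurable_fun setT (fun u => F0 u - k).
Proof. by apply: measurable_funB; [exact: mF0'|exact: measurable_cst]. Qed.
Let mF' (k : R) : measurable_fun setT (fun u => k - F0 u).
Proof. by apply: measurable_funB; [exact: measurable_cst|exact: mF0']. Qed.
Let m1 (f : R -> R) : measurable_fun setT f -> measurable_fun setT (fun u => 1 - f u).
Proof. by move=> mf; apply: measurable_funB; [exact: measurable_cst|]. Qed.
Let mX2 (f : R -> R) : measurable_fun setT f -> measurable_fun setT (fun u => f u ^+ 2).
Proof. by move=> mf; exact: measurable_funX. Qed.

Let oR := (`]t0 + eps, 1 - eps[%classic : set R).
Let oL := (`]eps, t0 - eps[%classic : set R).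
Definition rootR : R := \int[leb]_(u in oR) phi_root 1 (G1 h) h t0 u.
Definition rootL : R := \int[leb]_(u in oL) phi_root (-1) (G2 h) (hswap h) t0 u.
Definition varR : R := \int[leb]_(u in oR) phi_var 1 (G1 h) F0 h t0 u.
Definition varL : R := \int[leb]_(u in oL) phi_var (-1) (G2 h) F0 (hswap h) t0 u.

Let cbrtE n : n%:R `^ 3^-1 = @cbrt R n. Proof. by []. Qed.

Lemma bins_rate : (K n)%:R / cbrt n @[n --> \oo] --> c^-1.
Proof.
have -> : (fun n => (K n)%:R / cbrt n) = (fun n => (K n)%:R / (n%:R `^ 3^-1 / c) * c^-1).
  by apply/funext => n; rewrite invfM invrK mulrA -[RHS]mulrA mulfV ?gt_eqF// mulr1.
by rewrite -[X in _ --> X]mul1r; apply: cvgM => //; exact: cvg_cst.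
Qed.

Lemma mesh_cvg : mesh K n @[n --> \oo] --> (0 : R).
Proof.
apply: (@near_eq_cvg_to _ _ _ (fun n => ((K n)%:R / (n%:R `^ 3^-1 / c))^-1 * (c * (cbrt n)^-1))).
  near=> n; have n0 : (0 < n)%N by near: n; exists 1.
  have cb : cbrt n != 0 :> R by rewrite gt_eqF// cbrt_gt0.
  have K0 : (K n)%:R != 0 :> R by rewrite pnatr_eq0 -lt0n.
  by rewrite cbrtE /mesh; field; rewrite K0 cb gt_eqF.
rewrite -[X in _ --> X](mulr0 (1^-1)); apply: cvgM.
  by apply: cvgV => //; exact: oner_neq0.
by rewrite -[X in _ --> X](mulr0 c); apply: cvgM; [exact: cvg_cst|exact: cvg_cbrtV].
Unshelve. all: by end_near.
Qed.

Let a_cvg : a n @[n --> \oo] --> t0. Proof. exact: j_cvg. Qed.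
Let bins_at := near_anchor eps_gt0 t0_in K_gt0 j_in mesh_cvg a_cvg.

(** The centring is [F0] at the anchor, and the bias is what remains of the mean of the pilot
    estimate; at contributing indices it is [dev] of the corresponding side. *)
Definition bin_model n : bmodel R :=
  let p := pv F0 h (j n) (gd n) in
  @BModel R (K n) (L n).+1 (qv h (j n) (gd n)) p (@blam_ R t0 (K n) (j n) (gd n))
    (fun k => p (mA k) - @bsg_ R t0 (K n) (j n) k * p (mC k) - F0 (a n))
    (@bsg_ R t0 (K n) (j n)) (F0 (a n)).

Local Notation q_ n := (bq (bin_model n)).
Local Notation wL := (wgt (-1) a K (G2 h) (hswap h)).
Local Notation wR := (wgt 1 a K (G1 h) h).
Local Notation rL := (rmin (-1) a K (G2 h) (hswap h)).
Local Notation rR := (rmin 1 a K (G1 h) h).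
Local Notation cL n i := ((K n)%:R ^+ 2 * massC (-1) a K (hswap h) n i).
Local Notation cR n i := ((K n)%:R ^+ 2 * massC 1 a K h n i).
Local Notation dL := (dev (-1) a K (G2 h) F0 (hswap h)).
Local Notation dR := (dev 1 a K (G1 h) F0 h).
Local Notation aL n i := (-1 * avC (-1) a K F0 (hswap h) n i).
Local Notation aR n i := (1 * avC 1 a K F0 h n i).

Lemma bin_modelR n (k : 'I_(L n).+1) : (2 <= j n < L n)%N -> mesh K n < eps ->
  gd n k -> (j n < k)%N ->
  [/\ blam (bin_model n) k = wR n (k - j n), rbar (K n) (q_ n) k = rR n (k - j n),
      cbar (K n) (q_ n) k = cR n (k - j n), bbeta (bin_model n) k = dR n (k - j n) &
      pq (bp (bin_model n)) k = aR n (k - j n)%N * (1 - aR n (k - j n)%N)] /\ gdR h t0 K j n (k - j n).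
Proof.
move=> jn ml gk jk.
have [h1 h2 h3 h4 h5] := identR mh h_ge0 h_supp h_int1 eps_gt0 t0_in mF0 F0b K_gt0 jn ml gk jk.
split => //; split.
- by rewrite /= /blam_ gk /gap jk addn1 /wgt -/(gdR h t0 K j n _) h5.
- by rewrite /rbar /abar /cbar /= h1 h2.
- by rewrite /cbar /= h2.
- by rewrite /= /bsg_ jk mul1r h3 h4.
- by rewrite /pq /= h4 mul1r.
Qed.

Lemma bin_modelL n (k : 'I_(L n).+1) : (2 <= j n < L n)%N -> mesh K n < eps ->
  gd n k -> (k < j n)%N ->
  [/\ blam (bin_model n) k = wL n (j n - k), rbar (K n) (q_ n) k = rL n (j n - k),
      cbar (K n) (q_ n) k = cL n (j n - k), bbeta (bin_model n) k = dL n (j n - k) &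
      pq (bp (bin_model n)) k = aL n (j n - k)%N * (1 - aL n (j n - k)%N)] /\ gdL h t0 K j n (j n - k).
Proof.
move=> jn ml gk jk.
have [h1 h2 h3 h4 h5] := identL mh h_ge0 h_supp h_int1 eps_gt0 t0_in mF0 F0_nd F0b K_gt0 jn ml gk jk.
split => //; split.
- by rewrite /= /blam_ gk /gap ltnNge (ltnW jk) /= addn1 /wgt -/(gdL h t0 K j n _) h5.
- by rewrite /rbar /abar /cbar /= h1 h2.
- by rewrite /cbar /= h2.
- by rewrite /= /bsg_ ltnNge (ltnW jk) /= h3 h4 mulrNN mul1r.
- by rewrite /pq /= h4 mulN1r.
Qed.

(** One statement for the four functionals of the discrete limit theorem, with [F] as the summand.
    That [F] vanishes at weight 0 removes the indices that are not good. *)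
Lemma sum_model n (F : R -> R -> R -> R -> R -> R) : (2 <= j n < L n)%N -> mesh K n < eps ->
  (forall r cc bt v, F 0 r cc bt v = 0) ->
  \sum_k F (blam (bin_model n) k) (rbar (K n) (q_ n) k) (cbar (K n) (q_ n) k)
    (bbeta (bin_model n) k) (pq (bp (bin_model n)) k) =
  \sum_(1 <= i < j n) F (wL n i) (rL n i) (cL n i) (dL n i) (aL n i * (1 - aL n i)) +
  \sum_(1 <= i < (L n).+1 - j n) F (wR n i) (rR n i) (cR n i) (dR n i) (aR n i * (1 - aR n i)).
Proof.
move=> jn ml F00; apply: (sum_sides h_supp eps_gt0 t0_in K_gt0 jn ml
  (fl := fun i => F (wL n i) (rL n i) (cL n i) (dL n i) (aL n i * (1 - aL n i)))
  (fr := fun i => F (wR n i) (rR n i) (cR n i) (dR n i) (aR n i * (1 - aR n i)))).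
- by move=> k gk jk; have [[-> -> -> -> ->] _] := bin_modelR jn ml gk jk.
- by move=> k gk jk; have [[-> -> -> -> ->] _] := bin_modelL jn ml gk jk.
- by move=> k gk; rewrite /= /blam_ (negbTE gk) F00.
- by move=> i; rewrite /gdR /wgt => /negbTE ->; rewrite F00.
- by move=> i; rewrite /gdL /wgt => /negbTE ->; rewrite F00.
Qed.

Lemma sum_model_cvg (F : nat -> R -> R -> R -> R -> R -> R) (lL lR : R) :
  (forall n r cc bt v, F n 0 r cc bt v = 0) ->
  (\sum_(1 <= i < j n) F n (wL n i) (rL n i) (cL n i) (dL n i) (aL n i * (1 - aL n i)))
    @[n --> \oo] --> lL ->
  (\sum_(1 <= i < (L n).+1 - j n)
    F n (wR n i) (rR n i) (cR n i) (dR n i) (aR n i * (1 - aR n i))) @[n --> \oo] --> lR ->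
  (\sum_k F n (blam (bin_model n) k) (rbar (K n) (q_ n) k) (cbar (K n) (q_ n) k)
    (bbeta (bin_model n) k) (pq (bp (bin_model n)) k)) @[n --> \oo] --> lL + lR.
Proof.
move=> F00 hL hR; apply: near_eq_cvg_to (cvgD hL hR).
near=> n; have [jn ml] : (2 <= j n < L n)%N /\ mesh K n < eps by near: n; exact: bins_at.
by rewrite (sum_model jn ml (F00 n)).
Unshelve. all: by end_near.
Qed.

Lemma bin_model_ok (kL CL eL kR CR eR : R) :
  [/\ 0 <= kL, 0 <= CL & 0 <= eL] -> [/\ 0 <= kR, 0 <= CR & 0 <= eR] ->
  (\forall n \near \oo, forall i, 0 <= (K n)%:R * wL n i <= kL) ->
  (\forall n \near \oo, forall i, gdL h t0 K j n i -> cL n i <= CL) ->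
  (\forall n \near \oo, forall i, gdL h t0 K j n i -> (K n)%:R * `|dL n i| <= eL) ->
  (\forall n \near \oo, forall i, 0 <= (K n)%:R * wR n i <= kR) ->
  (\forall n \near \oo, forall i, gdR h t0 K j n i -> cR n i <= CR) ->
  (\forall n \near \oo, forall i, gdR h t0 K j n i -> (K n)%:R * `|dR n i| <= eR) ->
  \forall n \near \oo, bmodel_ok (kL + CL + eL + kR + CR + eR) (bin_model n).
Proof.
move=> [k0 C0 e0] [k0' C0' e0'] HkL HCL HeL HkR HCR HeR; near=> n.
have [jn ml] : (2 <= j n < L n)%N /\ mesh K n < eps by near: n; exact: bins_at.
have gin := gd_in h_supp eps_gt0 t0_in K_gt0 jn ml.
have Kr : 0 < (K n)%:R :> R by rewrite ltr0n.
have kLn : forall i, 0 <= (K n)%:R * wL n i <= kL by near: n.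
have CLn : forall i, gdL h t0 K j n i -> cL n i <= CL by near: n.
have eLn : forall i, gdL h t0 K j n i -> (K n)%:R * `|dL n i| <= eL by near: n.
have kRn : forall i, 0 <= (K n)%:R * wR n i <= kR by near: n.
have CRn : forall i, gdR h t0 K j n i -> cR n i <= CR by near: n.
have eRn : forall i, gdR h t0 K j n i -> (K n)%:R * `|dR n i| <= eR by near: n.
(* The discrete model has a single constant; the sum of the six nonnegative bounds dominates each of
   them. *)
set C := kL + CL + eL + kR + CR + eR.
have H (k : 'I_(L n).+1) : [/\ 0 <= (K n)%:R * blam (bin_model n) k <= C,
    cbar (K n) (q_ n) k <= C &
    gd n k -> (K n)%:R * `|bbeta (bin_model n) k| <= C].
  have [gk|gk] := boolP (gd n k); last first.
    split => //; first by rewrite /= /blam_ (negbTE gk) mulr0 lexx /C; lra.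
    rewrite /cbar /= /qv (clset_bad t0_in (K_gt0 n) jn gin _ gk) Rintegral_set0 mulr0 /C.
    lra.
  have [jk|jk|E] := ltngtP (j n) k.
  - have [[-> _ -> -> _] gg] := bin_modelR jn ml gk jk.
    have := kRn (k - j n)%N; have := CRn _ gg; have := eRn _ gg; rewrite /C => h1 h2 /andP[h3 h4].
    by split; [rewrite h3 /=; lra|lra|move=> _; lra].
  - have [[-> _ -> -> _] gg] := bin_modelL jn ml gk jk.
    have := kLn (j n - k)%N; have := CLn _ gg; have := eLn _ gg; rewrite /C => h1 h2 /andP[h3 h4].
    by split; [rewrite h3 /=; lra|lra|move=> _; lra].
  - by have := gin k gk; rewrite E eqxx andbF.
have lam0 k : 0 <= blam (bin_model n) k.
  by have [/andP[h1 _] _ _] := H k; rewrite -(pmulr_rge0 _ Kr).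
split.
- split; [exact: K_gt0| | | |].
  + by have /andP[_ h1] := nbins_le t0 (K n); exact: (le_triple (K_gt0 n) h1).
  + exact: (qv_ge0 X_law TU_law X_TU_indep t0_in (K_gt0 n) jn gin).
  + exact: (sum_qv TU_law t0_in (K_gt0 n) jn gin).
  + exact: (pv_bounds X_law TU_law X_TU_indep t0_in (K_gt0 n) jn gin).
- by move=> k; rewrite /= /bsg_; case: ifP; rewrite ?sqrrN expr1n.
- by move=> k; have [/andP[_ h1] _ _] := H k; rewrite lam0 /= ler_pdivlMr// mulrC.
- by move=> k; have [] := H k.
split => // k; have [gk|gk] := boolP (gd n k).
  by have [_ _ /(_ gk) h1] := H k; rewrite ler_wpM2l.
by rewrite /= /blam_ (negbTE gk) !mul0r.
Unshelve. all: by end_near.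
Qed.

(** The minimum with the extended marginal density agrees almost everywhere with that of its real
    version, and closing the interval adds only a null set. *)
Lemma Wtilde_sides :
  leb.-integrable oL (EFin \o phi_root (-1) (G2 h) (hswap h) t0) ->
  leb.-integrable oR (EFin \o phi_root 1 (G1 h) h t0) ->
  Wtilde h eps t0 = (rootL + rootR)%:E.
Proof.
move=> iL iR; rewrite /Wtilde EFinD; congr (_ + _)%E.
  transitivity (\int[leb]_(u in oL) (phi_root (-1) (G2 h) (hswap h) t0 u)%:E)%E; last first.
    by rewrite /rootL /Rintegral fineK; last by apply: (integrable_fin_num _ iL); exact: measurable_itv.
  apply: integral_closed_open.
  - by apply: mdiv => //; exact: (measurableT_comp measurable_sqrt).
  - by move/measurable_int : iL => /measurable_EFinP.
  have FA := ae_filter_ringOfSetsType leb; apply: (@filterS _ _ FA _ _ _ min_ae2) => u ->.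
  by rewrite /phi_root mulN1r opprB.
transitivity (\int[leb]_(u in oR) (phi_root 1 (G1 h) h t0 u)%:E)%E; last first.
  by rewrite /rootR /Rintegral fineK; last by apply: (integrable_fin_num _ iR); exact: measurable_itv.
apply: integral_closed_open.
- by apply: mdiv => //; exact: (measurableT_comp measurable_sqrt).
- by move/measurable_int : iR => /measurable_EFinP.
have FA := ae_filter_ringOfSetsType leb; apply: (@filterS _ _ FA _ _ _ min_ae1) => u ->.
by rewrite /phi_root mul1r.
Qed.

Lemma limit_variance_sides : Wtilde h eps t0 = (rootL + rootR)%:E ->
  measurable_fun oL (phi_var (-1) (G2 h) F0 (hswap h) t0) ->
  measurable_fun oR (phi_var 1 (G1 h) F0 h t0) ->
  limit_variance h F0 eps t0 c = (varL + varR) / (c * (rootL + rootR) ^+ 2).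
Proof.
move=> WE mL mR; rewrite /limit_variance WE /= -mulrDr mulrC (addrC varL).
have FA := ae_filter_ringOfSetsType leb.
congr ((_ + _) * _); rewrite /varL /varR /Rintegral; congr fine; apply: integral_closed_open => //.
- apply: measurable_funM; last exact: m1.
  apply: measurable_funM => //; apply: mdiv => //; apply: measurable_funM; last exact: mX2.
  exact: section_measurable1.
- by apply: (@filterS _ _ FA _ _ _ min_ae1) => u ->; rewrite /phi_var !mul1r.
- apply: measurable_funM; last exact: m1.
  apply: measurable_funM => //; apply: mdiv => //; apply: measurable_funM; last exact: mX2.
  exact: section_measurable2.
- by apply: (@filterS _ _ FA _ _ _ min_ae2) => u ->; rewrite /phi_var !mulN1r !opprB.
Qed.

Lemma birge_clt (x : R) :
  P [set w | cbrt n * (birge t0 (K n) n (fun i => X i w) (fun i => TU i w)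
       (knot t0 (K n) (j n)) - F0 (knot t0 (K n) (j n))) <= x] @[n --> \oo] -->
  normal_prob (2^-1 * c * f0 t0) (Num.sqrt (limit_variance h F0 eps t0 c)) `]-oo, x].
Proof.
have [kR [CR [eR [rR' [kR0 CR0 eR0 _ [R1 R2 R3 R4 [R5 R6 R7 _ [R8 R9 R10 R11 [R12 R13]]]]]]]]] :=
  right_limits mh h_ge0 h_supp h_int1 eps_gt0 b_gt0 h_lb t0_in h_contr mF0' F0b F0_nd
    F0_deriv f0_cont f0_gt0 K_gt0 j_in mesh_cvg a_cvg.
have [kL [CL [eL [rL' [kL0 CL0 eL0 _ [L1 L2 L3 L4 [L5 L6 L7 _ [L8 L9 L10 L11 [L12 L13]]]]]]]]] :=
  left_limits mh h_ge0 h_supp h_int1 eps_gt0 b_gt0 h_lb t0_in h_contl mF0' F0b F0_nd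
    F0_deriv f0_cont f0_gt0 K_gt0 j_in mesh_cvg a_cvg.
have WE := Wtilde_sides L13 R13.
have VE := limit_variance_sides WE L11 R11.
have w0 : 0 < rootL + rootR.
  rewrite lt_neqAle addr_ge0// andbT eq_sym; apply: contra W_neq0 => /eqP E.
  by rewrite WE E.
(* If both variance integrals vanished, so would both root integrals by [phi_var_int_eq0],
   contradicting that W is nonzero. *)
have tau0 : 0 < varL + varR.
  rewrite lt_neqAle addr_ge0// andbT eq_sym; apply/negP; rewrite paddr_eq0//.
  by move=> /andP[/eqP/L12 E1 /eqP/R12 E2]; move: w0; rewrite /rootL /rootR E1 E2 addr0 ltxx.
have v0 : 0 < limit_variance h F0 eps t0 c.
  by rewrite VE divr_gt0// mulr_gt0// exprn_gt0.
have b20 : 0 < b / 2 by rewrite divr_gt0.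
have C0 : 0 <= kL + CL + eL + kR + CR + eR by rewrite !addr_ge0.
have s0 : 0 < Num.sqrt (limit_variance h F0 eps t0 c) by rewrite sqrtr_gt0.
have sE : Num.sqrt (limit_variance h F0 eps t0 c) ^+ 2 =
    (varL + varR) / (c * (rootL + rootR) ^+ 2) by rewrite sqr_sqrtr ?VE// -VE ltW.
have ok : \forall n \near \oo, bmodel_ok (kL + CL + eL + kR + CR + eR) (bin_model n).
  exact: bin_model_ok.
have S1 := @sum_model_cvg (fun _ l r _ _ _ => l * Num.sqrt r) _ _
  (fun _ _ _ _ _ => mul0r _) L1 R1.
have S2 := @sum_model_cvg (fun n l r _ bt _ => l * Num.sqrt r * ((K n)%:R * bt)) _ _
  (fun _ _ _ _ _ => etrans (congr1 (fun z => z * _) (mul0r _)) (mul0r _)) L2 R2.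
have F3 n r cc (bt v : R) : (K n)%:R * 0 ^+ 2 * (r / cc) * v = 0 :> R.
  by rewrite expr0n mulr0 !mul0r.
have F4 n (r cc bt v : R) : (K n)%:R * 0 ^+ 2 * (cc < b / 2)%R%:R = 0 :> R.
  by rewrite expr0n mulr0 mul0r.
have S3 := @sum_model_cvg (fun n l r cc _ v => (K n)%:R * l ^+ 2 * (r / cc) * v) _ _
  F3 L3 R3.
have S4 := @sum_model_cvg (fun n l _ cc _ _ => (K n)%:R * l ^+ 2 * (cc < b / 2)%R%:R) _ _
  F4 L4 R4.
rewrite addr0 in S4.
rewrite -mulrDl in S2.
(* The discrete theorem expects the bias in the form [w * (mu / c)], which identifies [mu] as
   [2^-1 * c * f0 t0]. *)
have muE : f0 t0 / 2 = 2^-1 * c * f0 t0 / c.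
  by field; rewrite gt_eqF.
rewrite muE in S2.
have clt := discrete_clt C0 b20 w0 c_gt0 s0 sE ok bins_rate S1 S2 S3 S4 (x := x).
have fn : normal_prob (2^-1 * c * f0 t0) (Num.sqrt (limit_variance h F0 eps t0 c))
    `]-oo, x] \is a fin_num by exact: fin_num_measure.
(* The discrete law represents the estimator only for large [n], once the anchor bin is interior and
   the mesh is below [eps]. *)
suff law : \forall n \near \oo, P [set w | cbrt n * (birge t0 (K n) n (fun i => X i w)
    (fun i => TU i w) (knot t0 (K n) (j n)) - F0 (knot t0 (K n) (j n))) <= x] =
    (EE (q_ n) (bp (bin_model n)) (fun (cl : {ffun 'I_n -> _}) o => (zst (bK (bin_model n))
      (blam (bin_model n)) (bsg (bin_model n)) (btheta (bin_model n)) (cbrt n) cl o <= x)%R%:R))%:E.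
  rewrite -(fineK fn); apply/fine_cvgP; split.
    by apply: filterS law => n ->.
  by apply: near_eq_cvg_to clt; apply: filterS law => n /= ->.
near=> n; have [jn ml] : (2 <= j n < L n)%N /\ mesh K n < eps by near: n; exact: bins_at.
exact: (birge_law X_law TU_law X_indep TU_indep X_TU_indep h_supp eps_gt0 t0_in (K_gt0 n) jn
  (gd_in h_supp eps_gt0 t0_in K_gt0 jn ml)
  (bad_null_at mh h_ge0 h_supp h_int1 eps_gt0 t0_in K_gt0 jn ml)).
Unshelve. all: by end_near.
Qed.

End assembly.

Theorem theorem4p1 (R : realType) (d : measure_display)
  (Omega : measurableType d) (P : probability Omega R)
  (X : nat -> {RV P >-> R}) (TU : nat -> {RV P >-> (R * R)%type})
  (F0 f0 : R -> R) (h : R * R -> R) (eps t0 c : R) (K j : nat -> nat)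
  (X_law : forall i x, cdf (X i) x = (F0 x)%:E)
  (TU_law : forall i, has_joint_density P (TU i) h)
  (X_indep : mutually_independent P X)
  (TU_indep : mutually_independent P TU)
  (X_TU_indep : independent_sequences P X TU)
  (F0_lt0 : forall x, x < 0 -> F0 x = 0)
  (F0_1 : F0 1 = 1)
  (g_lb : exists2 m : R, 0 < m &
     forall t, 0 <= t <= 1 -> (m%:E <= g1 h t + g2 h t)%E)
  (eps_gt0 : 0 < eps)
  (h_supp : closure [set z : R * R | h z != 0] = sep_triangle eps)
  (h_lb : exists2 b : R, 0 < b & forall z, sep_triangle eps z -> b <= h z)
  (t0_in : 0 < t0 < 1)
  (* h is the version of the density that is continuous at the points of its
     support where it is evaluated below *)
  (h_contl : forall t, eps <= t <= t0 - eps ->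
     h z @[z --> within (sep_triangle eps) (nbhs (t, t0))] --> h (t, t0))
  (h_contr : forall u, t0 + eps <= u <= 1 - eps ->
     h z @[z --> within (sep_triangle eps) (nbhs (t0, u))] --> h (t0, u))
  (F0_deriv : forall x : R, 0 < x < 1 -> is_derive x 1 F0 (f0 x))
  (f0_cont : forall x : R, 0 < x < 1 -> {for x, continuous f0})
  (f0_gt0 : 0 < f0 t0)
  (* W is finite, and nonzero since one divides by its square *)
  (W_fin : (Wtilde h eps t0 < +oo)%E)
  (W_neq0 : Wtilde h eps t0 != 0%E)
  (c_gt0 : 0 < c)
  (K_gt0 : forall n, (0 < K n)%N)
  (K_asymp : (K n)%:R / (n%:R `^ 3^-1 / c) @[n --> \oo] --> (1 : R))
  (j_in : forall n, (1 <= j n <= nbins t0 (K n))%N)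
  (j_cvg : knot t0 (K n) (j n) @[n --> \oo] --> t0) :
  cvg_in_distribution P
    (fun n omega =>
       n%:R `^ 3^-1 *
       (birge t0 (K n) n (fun i => X i omega) (fun i => TU i omega)
          (knot t0 (K n) (j n))
        - F0 (knot t0 (K n) (j n))))
    (normal_prob (2^-1 * c * f0 t0)
       (Num.sqrt (limit_variance h F0 eps t0 c))).
Proof.
have h_supp' z : h z != 0 -> sep_triangle eps z.
  by move=> hz; rewrite -h_supp; exact: subset_closure.
have [b b_gt0 h_b] := h_lb.
split=> [n|x _].
  apply: measurable_funM; first exact: measurable_cst.
  by apply: measurable_funB; [exact: measurable_birge|exact: measurable_cst].
have H := birge_clt X_law TU_law X_indep TU_indep X_TU_indep eps_gt0 h_supp' b_gt0 h_b t0_in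
  h_contl h_contr F0_deriv f0_cont f0_gt0 W_neq0 c_gt0 K_gt0 K_asymp j_in j_cvg (x := x).
apply: cvg_trans H; apply: near_eq_cvg; near=> n.
by congr (P _); apply/seteqP; split => w /=; rewrite in_itv.
Unshelve. all: by end_near.
Qed.
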